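(* For every $n\ge 1$, every finitely generated subgroup of $\mathrm{GL}_n(\mathbb{Q})$ embeds in a finitely presented simple group; that is, it satisfies the Boone--Higman conjecture.
   Context: A group is said to satisfy the Boone--Higman conjecture if it embeds in a finitely presented simple group. *)

(* Defs.v *)
From mathcomp Require Import all_boot all_algebra.
Set Implicit Arguments. Unset Strict Implicit. Unset Printing Implicit Defensive.
Import GRing.Theory.
Local Open Scope ring_scope.

Definition is_group (G : Type) (mul : G -> G -> G) (inv : G -> G) (one : G) : Prop :=
  [/\ (forall x y z, mul x (mul y z) = mul (mul x y) z),
      (forall x, mul one x = x),
      (forall x, mul x one = x),
      (forall x, mul (inv x) x = one) &
      (forall x, mul x (inv x) = one)].

Definition is_normal_subgroup (G : Type) (mul : G -> G -> G) (inv : G -> G) (one : G)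
  (N : G -> Prop) : Prop :=
  [/\ N one,
      (forall x y, N x -> N y -> N (mul x y)),
      (forall x, N x -> N (inv x)) &
      (forall g x, N x -> N (mul (mul g x) (inv g)))].

Definition is_simple_group (G : Type) (mul : G -> G -> G) (inv : G -> G) (one : G) : Prop :=
  (exists g, g <> one) /\
  forall N, is_normal_subgroup mul inv one N ->
    (forall x, N x -> x = one) \/ (forall x, N x).

(* A word on k generators: letters (i, b), b = true meaning the inverse x_i^-1. *)
Definition letter (k : nat) := ('I_k * bool)%type.
Definition word (k : nat) := seq (letter k).
Definition letter_inv (k : nat) (a : letter k) : letter k := (a.1, ~~ a.2).

Inductive pres_eq (k : nat) (R : seq (word k)) : word k -> word k -> Prop :=
  | pres_refl w : pres_eq R w w
  | pres_sym u v : pres_eq R u v -> pres_eq R v u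
  | pres_trans u v w : pres_eq R u v -> pres_eq R v w -> pres_eq R u w
  | pres_cancel u v (a : letter k) : pres_eq R (u ++ a :: letter_inv a :: v) (u ++ v)
  | pres_rel u v r : r \in R -> pres_eq R (u ++ r ++ v) (u ++ v).

Definition eval_word (G : Type) (mul : G -> G -> G) (inv : G -> G) (one : G)
  (k : nat) (gens : 'I_k -> G) (w : word k) : G :=
  foldr (fun a acc => mul (if a.2 then inv (gens a.1) else gens a.1) acc) one w.

(* G is finitely presented: there are finitely many generators g_1..g_k of G and
   finitely many relators R such that the evaluation map from words onto G has
   kernel exactly the normal closure of R (i.e. G = < x_1..x_k | R >). *)
Definition finitely_presented (G : Type) (mul : G -> G -> G) (inv : G -> G) (one : G) : Prop :=
  exists (k : nat) (gens : 'I_k -> G) (R : seq (word k)),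
    (forall g, exists w, eval_word mul inv one gens w = g) /\
    (forall w, eval_word mul inv one gens w = one <-> pres_eq R w [::]).

Inductive gen_subgroup (n : nat) (S : seq 'M[rat]_n) : 'M[rat]_n -> Prop :=
  | gs_one : gen_subgroup S 1%:M
  | gs_gen A : A \in S -> gen_subgroup S A
  | gs_mul A B : gen_subgroup S A -> gen_subgroup S B -> gen_subgroup S (A *m B)
  | gs_inv A : gen_subgroup S A -> gen_subgroup S (invmx A).

Definition embeds_in_fp_simple (n : nat) (H : 'M[rat]_n -> Prop) : Prop :=
  exists (G : Type) (mul : G -> G -> G) (inv : G -> G) (one : G),
    [/\ is_group mul inv one,
        finitely_presented mul inv one,
        is_simple_group mul inv one &
        exists f : 'M[rat]_n -> G,
          (forall A B, H A -> H B -> f (A *m B) = mul (f A) (f B)) /\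
          (forall A B, H A -> H B -> f A = f B -> A = B)].

(* Main.v *)
(* After adding a 2x2 identity block, the subgroup lies in GL_N(Z[1/m]) for some
   m and some N >= 3. Fix a prime p not dividing m. The affine group A of the maps
   v -> a v + b, with a in GL_N(Z[1/m]) and b in Z[1/m]^N, acts on streams of
   base-p digit vectors, with carries, and the section of (a, b) at a digit
   vector is again of the form (a, b'). It still acts faithfully on the streams
   over an alphabet with a second copy of the digit vectors, which (a, b) fixes
   with section the inverse transpose of a. Thus A, which is finitely presented,
   is self-similar.

   The Roever-Nekrashevych group of A consists of the bijections of the stream
   space that on each cone of a finite partition change the prefix and act by
   an element of A on the rest. It contains A (acting inside one cone), and it
   is finitely presented because A is: its relations are instances of
   finitely many schemes in disjoint addresses, and each address can be
   conjugated to a short one.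

   It is simple: a nontrivial normal subgroup N contains the commutators of
   elements supported in a common cone; hence, the alphabet being even, the
   exchanges of two cones; hence it contains the copy in a cone of g in A as soon
   as it contains the product of the copies of the sections of g. Translations
   and elementary matrices are commutators in A. For a symmetric matrix a, the
   sections are a, up to translations, at half of the letters and a^-1 at the
   others, so that their product is trivial modulo commutators. Diagonal and
   permutation matrices being symmetric, this exhausts A, by the Smith normal
   form. *)
Require Import Defs.
From HB Require Import structures.
From mathcomp Require Import all_boot all_order all_algebra.
From mathcomp Require Import fingroup perm boolp.
From mathcomp Require Import ring zify.
Set Implicit Arguments. Unset Strict Implicit. Unset Printing Implicit Defensive.
Import monoid.

(** * Presentations by words and short relations *)

(** The second copy of the letters is there for simplicity. On digits alone every section of a
    linear map [a] has linear part [a], and there are [p^N] of them, so that modulo commutators one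
    would only learn that [a] to the power [p^N - 1] is trivial, which leaves the determinant alive.
    Letters whose section is the inverse transpose cancel these contributions, and they also make
    the alphabet even. The size [N >= 3] provides the third index that turns an elementary matrix
    into a commutator. Finite presentability is handled as a universal property: a map to an
    arbitrary group [Q] that respects short relations kills every relator. For GL_n(Z) and for the
    Roever-Nekrashevych group it is proved by one device. The generators, paired with their images
    in [Q], satisfy the same relations in the product group, and any group with such generators is
    shown to act faithfully through its first component. Both faithfulness proofs are confluence
    arguments: of Euclid's algorithm on row vectors in one case, of the subdivision of cones in the
    other. For GL_n(Z[1/m]) this role is played by greedy factorisations. *)

Section Products.
Local Open Scope group_scope.
Variables (A : Type) (Q : groupType).
Implicit Type f : A -> Q.

Definition pr f (w : seq A) : Q := foldr (fun a q => f a * q) 1 w.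

Lemma pr_cons f a w : pr f (a :: w) = f a * pr f w. Proof. by []. Qed.

Lemma pr1 f a : pr f [:: a] = f a. Proof. exact: mulg1. Qed.

Lemma pr_cat f u v : pr f (u ++ v) = pr f u * pr f v.
Proof. by elim: u => [|a u IH] /=; rewrite ?mul1g // IH mulgA. Qed.

Lemma pr_rcons f u a : pr f (rcons u a) = pr f u * f a.
Proof. by rewrite -cats1 pr_cat pr1. Qed.

Lemma eq_pr f f' w : f =1 f' -> pr f w = pr f' w.
Proof. by move=> e; elim: w => //= a w ->; rewrite e. Qed.

End Products.

Lemma pr_map (A B : Type) (Q : groupType) (f : B -> Q) (h : A -> B) w :
  pr f (map h w) = pr (f \o h) w.
Proof. by elim: w => //= a w ->. Qed.

Section Relations.
Local Open Scope group_scope.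
Variable G : groupType.
Implicit Types (B : seq G) (H : G -> Prop) (w : seq G).

Local Notation inw B w := (all (mem B) w).

(** As [B] is finite, a bound on the length encodes a finite set of relators without listing them,
    and several finite demands are merged by taking the larger bound. Only the values of [f] on [B]
    matter. *)
Definition rels (Q : groupType) (f : G -> Q) B n :=
  forall w w', inw B w -> inw B w' -> (size w <= n)%N -> (size w' <= n)%N ->
    pr id w = pr id w' -> pr f w = pr f w'.

(* [H] is presented by the generators [B] and all relations between words of
   length at most [n], stated as a universal property. *)
Definition fpres_by H B n :=
  [/\ (forall b, b \in B -> b^-1 \in B),
      (forall a, H a <-> exists2 w, inw B w & pr id w = a) &
      forall (Q : groupType) (f : G -> Q), rels f B n ->
        forall w, inw B w -> pr id w = 1 -> pr f w = 1].

Definition fpres H := exists B n, fpres_by H B n.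

(* A property of maps that follows from finitely many of the relations
   that hold in [G] between the elements of [B]. *)
Definition ev B (P : forall Q : groupType, (G -> Q) -> Prop) :=
  exists n, forall Q f, rels f B n -> P Q f.

Lemma rels_sub (Q : groupType) (f : G -> Q) B B' n n' :
  {subset B' <= B} -> (n' <= n)%N -> rels f B n -> rels f B' n'.
Proof.
move=> sB le r w w' Bw Bw' sw sw'; apply: r; rewrite ?(leq_trans _ le) //.
  by apply: sub_all Bw.
by apply: sub_all Bw'.
Qed.

Lemma ev_mono B (P P' : forall Q : groupType, (G -> Q) -> Prop) :
  (forall Q f, P Q f -> P' Q f) -> ev B P -> ev B P'.
Proof. by move=> PP' [n h]; exists n => Q f /h/PP'. Qed.

Lemma ev_and B (P P' : forall Q : groupType, (G -> Q) -> Prop) :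
  ev B P -> ev B P' -> ev B (fun Q f => P Q f /\ P' Q f).
Proof.
move=> [n h] [n' h']; exists (maxn n n') => Q f r; split.
  by apply/h/rels_sub/r; rewrite // leq_maxl.
by apply/h'/rels_sub/r; rewrite // leq_maxr.
Qed.

Lemma ev_all B (T : eqType) (s : seq T)
    (P : T -> forall Q : groupType, (G -> Q) -> Prop) :
  (forall t, t \in s -> ev B (P t)) ->
  ev B (fun Q f => forall t, t \in s -> P t Q f).
Proof.
elim: s => [|t s IH] h; first by exists 0%N.
have [||n hn] := @ev_and B (P t) (fun Q f => forall t, t \in s -> P t Q f).
- by apply: h; rewrite mem_head.
- by apply: IH => u us; apply: h; rewrite inE us orbT.
exists n => Q f /hn [h1 h2] u; rewrite inE => /orP [/eqP-> //|]; exact: h2.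
Qed.

Lemma ev_fin B (T : finType) (P : T -> forall Q : groupType, (G -> Q) -> Prop) :
  (forall t, ev B (P t)) -> ev B (fun Q f => forall t, P t Q f).
Proof.
move=> h; have [n hn] := @ev_all B T (enum T) P (fun t _ => h t).
by exists n => Q f /hn hf t; apply: hf; rewrite mem_enum.
Qed.

Lemma ev_imp B (A : Prop) (P : forall Q : groupType, (G -> Q) -> Prop) :
  (A -> ev B P) -> ev B (fun Q f => A -> P Q f).
Proof.
case: (pselect A) => a h; first by case: (h a) => n hn; exists n => Q f /hn.
by exists 0%N.
Qed.

Lemma ev_rel B w w' : inw B w -> inw B w' -> pr id w = pr id w' ->
  ev B (fun Q f => pr f w = pr f w').
Proof.
move=> Bw Bw' e; exists (maxn (size w) (size w')) => Q f; apply=> //.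
  exact: leq_maxl.
exact: leq_maxr.
Qed.

(** Words have no formal inverses, so the compatibility of [f] with inversion is itself one of the
    relations. *)
Lemma ev_V B : (forall b, b \in B -> b^-1 \in B) ->
  ev B (fun Q f => forall b, b \in B -> f b^-1 = (f b)^-1).
Proof.
move=> VB; apply: ev_all => b Bb.
have [||| n hn] := @ev_rel B [:: b; b^-1] [::] => //=; rewrite ?Bb ?VB //.
  by rewrite !mulg1 mulgV.
exists n => Q f /hn /= h; apply/esym/mulg1_eq.
by move: h; rewrite mulg1.
Qed.

(** The universal property only speaks of words of value 1. Two words of equal value are compared by
    appending to both the inverse word of the second, which avoids knowing that [f] respects
    inverses. The homomorphism is read off from chosen words. *)
Lemma fpres_hom H B n : fpres_by H B n ->
  forall (Q : groupType) (f : G -> Q), rels f B n ->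
  exists phi : G -> Q, (forall a b, H a -> H b -> phi (a * b) = phi a * phi b)
    /\ (forall w, inw B w -> phi (pr id w) = pr f w).
Proof.
move=> [VB HB triv] Q f r.
have tr w w' : inw B w -> inw B w' -> pr id w = pr id w' -> pr f w = pr f w'.
  move=> Bw Bw' e.
  pose iw := rev (map (@inv G) w').
  have Biw : inw B iw.
    by rewrite all_rev all_map; apply: sub_all Bw' => b /VB.
  have E : pr id iw = (pr id w')^-1.
    rewrite /iw; elim: (w') => [|a v IH] /=; first by rewrite invg1.
    by rewrite rev_cons pr_rcons IH invgM.
  have E1 : pr f (w ++ iw) = 1.
    by apply: triv; rewrite ?all_cat ?Bw //= pr_cat E e mulgV.
  have E2 : pr f (w' ++ iw) = 1.
    by apply: triv; rewrite ?all_cat ?Bw' //= pr_cat E mulgV.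
  by apply: (mulIg (pr f iw)); rewrite -!pr_cat E1 E2.
have /choice [W hW] : forall a, exists w, H a -> inw B w /\ pr id w = a.
  move=> a; case: (pselect (H a)) => [/HB [w Bw e]|nH]; first by exists w.
  by exists [::].
have HH w : inw B w -> H (pr id w) by move=> Bw; apply/HB; exists w.
exists (pr f \o W); split=> [a b Ha Hb|w Bw] /=; last first.
  by have [Bw' e] := hW _ (HH _ Bw); apply: tr.
have [Ba ea] := hW a Ha; have [Bb eb] := hW b Hb.
have Hab : H (a * b).
  by rewrite -ea -eb -pr_cat; apply: HH; rewrite all_cat Ba.
have [Bab eab] := hW _ Hab.
by rewrite -pr_cat; apply: tr; rewrite ?all_cat ?Ba // pr_cat ea eb eab.
Qed.

Lemma ev_hom H B n B' : fpres_by H B n -> {subset B <= B'} ->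
  ev B' (fun Q f => exists phi : G -> Q,
    (forall a b, H a -> H b -> phi (a * b) = phi a * phi b)
    /\ (forall w, inw B w -> phi (pr id w) = pr f w)).
Proof.
move=> fB sB; exists n => Q f r; apply: fpres_hom fB _ _ _.
exact: rels_sub sB (leqnn n) r.
Qed.

Section Gen.
Variables (H : G -> Prop) (B : seq G) (n : nat).
Hypothesis fB : fpres_by H B n.

Lemma fpres_word a : H a -> exists2 w, inw B w & pr id w = a.
Proof. by case: fB => _ h _ /h. Qed.

Lemma fpres_pr w : inw B w -> H (pr id w).
Proof. by case: fB => _ h _ Bw; apply/h; exists w. Qed.

Lemma fpres_gen b : b \in B -> H b.
Proof. by move=> Bb; rewrite -(pr1 id b); apply: fpres_pr; rewrite /= Bb. Qed.

Lemma fpres_1 : H 1. Proof. exact: (@fpres_pr [::]). Qed.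

Lemma fpres_M a b : H a -> H b -> H (a * b).
Proof.
move=> /fpres_word [u Bu <-] /fpres_word [v Bv <-]; rewrite -pr_cat.
by apply: fpres_pr; rewrite all_cat Bu.
Qed.

Lemma fpres_V a : H a -> H a^-1.
Proof.
move=> /fpres_word [u Bu <-]; elim: u Bu => [|b u IH] /=.
  by rewrite invg1 => _; exact: fpres_1.
case/andP=> Bb Bu; rewrite invgM; apply: fpres_M (IH Bu) _.
by apply: fpres_gen; case: fB => + _ _; apply.
Qed.

End Gen.

End Relations.

Notation inw B w := (all (mem B) w).

Section Transfer.
Local Open Scope group_scope.
Variables (G G' : groupType) (h : G -> G').

Lemma pr_hom (H : G -> Prop) (A : Type) (f : A -> G) w : H 1 ->
    (forall a b, H a -> H b -> H (a * b)) ->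
    (forall a b, H a -> H b -> h (a * b) = h a * h b) -> (forall i, H (f i)) ->
  h (pr f w) = pr (h \o f) w.
Proof.
move=> H1 HM hM Hf; have Hp : H (pr f w) by elim: w => //= a w; apply: HM.
elim: w Hp => /= [_|a w IH Hp]; first by apply: (mulgI (h 1)); rewrite -hM // !mulg1.
rewrite hM ?IH //; elim: {Hp IH}w => //= b w; exact: HM.
Qed.

Lemma fpres_inj (H : G -> Prop) :
    (forall a b, H a -> H b -> h (a * b) = h a * h b) ->
    (forall a b, H a -> H b -> h a = h b -> a = b) ->
  fpres H -> fpres (fun a' => exists2 a, H a & h a = a').
Proof.
move=> hM hI [B [n fB]]; have H1 := fpres_1 fB.
have h1 : h 1 = 1 by apply: (mulgI (h 1)); rewrite -hM // !mulg1.
have hV a : H a -> h a^-1 = (h a)^-1.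
  by move=> Ha; apply/esym/mulg1_eq; rewrite -hM ?mulgV //; apply: (fpres_V fB).
have lift w : inw (map h B) w -> exists2 v, inw B v & w = map h v.
  elim: w => [|b w IH] /=; first by exists [::].
  case/andP=> /mapP [c Bc ->] /IH [v Bv ->].
  by exists (c :: v); rewrite //= Bc.
have img v : inw B v -> inw (map h B) (map h v).
  by elim: v => //= b v IH /andP [Bb /IH ->]; rewrite map_f.
have pri v : inw B v -> pr id (map h v) = h (pr id v).
  elim: v => //= b v IH /andP [Bb Bv]; rewrite IH // hM //; first exact: (fpres_gen fB).
  exact: (fpres_pr fB).
exists (map h B), n; split.
- move=> _ /mapP [b Bb ->]; rewrite -hV; last exact: (fpres_gen fB).
  apply: map_f.
  by case: fB => + _ _; apply.
- move=> a; split=> [[a' /(fpres_word fB) [w Bw <-] <-]|[w /lift [v Bv ->] <-]].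
    by exists (map h w); [apply: img | rewrite pri].
  by exists (pr id v); rewrite ?pri //; apply: (fpres_pr fB).
move=> Q f r w /lift [v Bv ->]; rewrite pri // pr_map => e.
case: (fB) => _ _ triv; apply: triv (Bv) _.
  move=> u u' Bu Bu' su su' e'; rewrite -(pr_map f h u) -(pr_map f h u').
  by apply: r; rewrite ?size_map ?pri ?e' //; apply: img.
by apply: hI; rewrite ?e ?h1 //; apply: (fpres_pr fB Bv).
Qed.

End Transfer.

(** * The group defined by generators and relators *)

Section Presentation.
Local Open Scope group_scope.
Variables (k : nat) (R : seq (Defs.word k)).

Let e : rel (Defs.word k) := fun u v => `[< pres_eq R u v >].
Let e_refl : reflexive e. Proof. by move=> u; apply/asboolP; apply: pres_refl. Qed.
Let e_sym : symmetric e.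
Proof. by move=> u v; apply/asboolP/asboolP; apply: pres_sym. Qed.
Let e_trans : transitive e.
Proof. by move=> v u w /asboolP uv /asboolP vw; apply/asboolP/(pres_trans uv). Qed.

Canonical pres_equiv := EquivRel e e_refl e_sym e_trans.

Local Open Scope quotient_scope.
Definition presented := {eq_quot pres_equiv}.
HB.instance Definition _ := Choice.on presented.
HB.instance Definition _ := Quotient.on presented.

Definition pcl (u : Defs.word k) : presented := \pi_presented u.

Lemma pclP u v : pcl u = pcl v <-> pres_eq R u v.
Proof. by split=> [/eqmodP/asboolP|h]; last by apply/eqmodP/asboolP. Qed.

Lemma pcl_repr (x : presented) : pcl (generic_quotient.repr x) = x.
Proof. exact: reprK. Qed.

Lemma pres_eq_catl t u v : pres_eq R u v -> pres_eq R (t ++ u) (t ++ v).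
Proof.
elim=> {u v} [w|u v _ IH|u v w _ IH _ IH'|u v a|u v r Rr].
- exact: pres_refl.
- exact/pres_sym.
- exact: pres_trans IH IH'.
- by rewrite !catA; apply: pres_cancel.
- by rewrite (catA t u (r ++ v)) (catA t u v); apply: pres_rel.
Qed.

Lemma pres_eq_catr t u v : pres_eq R u v -> pres_eq R (u ++ t) (v ++ t).
Proof.
elim=> {u v} [w|u v _ IH|u v w _ IH _ IH'|u v a|u v r Rr].
- exact: pres_refl.
- exact/pres_sym.
- exact: pres_trans IH IH'.
- by rewrite -!catA /=; apply: pres_cancel.
- by rewrite -!catA; apply: pres_rel.
Qed.

Lemma pres_eq_cat u u' v v' :
  pres_eq R u u' -> pres_eq R v v' -> pres_eq R (u ++ v) (u' ++ v').
Proof.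
by move=> /(pres_eq_catr v) h /(pres_eq_catl u') h'; apply: pres_trans h h'.
Qed.

Definition winv (u : Defs.word k) := rev (map (@letter_inv k) u).

Lemma letter_invK : involutive (@letter_inv k).
Proof. by case=> i b; rewrite /letter_inv /= negbK. Qed.

Lemma winvK : involutive winv.
Proof. by move=> u; rewrite /winv map_rev revK mapK //; apply: letter_invK. Qed.

Lemma pres_winvr u : pres_eq R (u ++ winv u) [::].
Proof.
elim: u => [|a u IH]; first exact: pres_refl.
rewrite /winv /= rev_cons -cats1.
have := pres_eq_cat (pres_refl R [:: a]) (pres_eq_cat IH (pres_refl R [:: letter_inv a])).
rewrite -catA /= => h; apply: pres_trans h _.
exact: (@pres_cancel _ _ [::] [::]).
Qed.

Lemma pres_winvl u : pres_eq R (winv u ++ u) [::].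
Proof. by rewrite -{2}(winvK u); apply: pres_winvr. Qed.

Lemma pres_winv u v : pres_eq R u v -> pres_eq R (winv u) (winv v).
Proof.
move=> h; apply: (@pres_trans _ _ _ (winv u ++ v ++ winv v)).
  rewrite -{1}(cats0 (winv u)).
  by apply/(pres_eq_cat (pres_refl _ _))/pres_sym/pres_winvr.
rewrite catA -{2}(cat0s (winv v)).
apply: (pres_eq_cat _ (pres_refl _ _)).
apply: pres_trans (pres_eq_cat (pres_refl _ _) (pres_sym h)) _.
exact: pres_winvl.
Qed.

Definition pmul (x y : presented) := pcl (generic_quotient.repr x ++ generic_quotient.repr y).
Definition pinv (x : presented) := pcl (winv (generic_quotient.repr x)).

Lemma pmulE u v : pmul (pcl u) (pcl v) = pcl (u ++ v).
Proof. by apply/pclP/pres_eq_cat; apply/pclP; rewrite pcl_repr. Qed.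

Lemma pinvE u : pinv (pcl u) = pcl (winv u).
Proof. by apply/pclP/pres_winv/pclP; rewrite pcl_repr. Qed.

Lemma pmulA : associative pmul.
Proof.
move=> x y z; rewrite -(pcl_repr x) -(pcl_repr y) -(pcl_repr z) !pmulE.
by rewrite catA.
Qed.
Lemma pmul1 : left_id (pcl [::]) pmul.
Proof. by move=> x; rewrite -(pcl_repr x) pmulE. Qed.
Lemma pmulr1 : right_id (pcl [::]) pmul.
Proof. by move=> x; rewrite -(pcl_repr x) pmulE cats0. Qed.
Lemma pmulV : left_inverse (pcl [::]) pinv pmul.
Proof.
by move=> x; rewrite -(pcl_repr x) pinvE pmulE; apply/pclP/pres_winvl.
Qed.
Lemma pmulVr : right_inverse (pcl [::]) pinv pmul.
Proof.
by move=> x; rewrite -(pcl_repr x) pinvE pmulE; apply/pclP/pres_winvr.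
Qed.

HB.instance Definition _ :=
  isGroup.Build presented pmulA pmul1 pmulr1 pmulV pmulVr.

End Presentation.

(** * Subgroups presented by short relations are finitely presented groups *)

Section Abstract.
Local Open Scope group_scope.
Variables (G : groupType) (H : G -> Prop).
Hypothesis fH : fpres H.

Let sub1 : H 1. Proof. by case: fH => B [n fB]; exact: (fpres_1 fB). Qed.
Let subM a b : H a -> H b -> H (a * b).
Proof. by case: fH => B [n fB]; exact: (fpres_M fB). Qed.
Let subV a : H a -> H a^-1.
Proof. by case: fH => B [n fB]; exact: (fpres_V fB). Qed.

Definition sub_carrier := {a | H a}.
Definition sub_mul (x y : sub_carrier) : sub_carrier :=
  exist H (sval x * sval y) (subM (svalP x) (svalP y)).
Definition sub_inv (x : sub_carrier) : sub_carrier :=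
  exist H (sval x)^-1 (subV (svalP x)).
Definition sub_one : sub_carrier := exist H 1 sub1.

Lemma sub_inj (x y : sub_carrier) : sval x = sval y -> x = y.
Proof.
case: x y => a Ha [b Hb] /= e; subst b.
by rewrite (Prop_irrelevance Ha Hb).
Qed.

Lemma sub_is_group : is_group sub_mul sub_inv sub_one.
Proof.
split=> *; apply: sub_inj => /=;
  by rewrite ?mulgA ?mul1g ?mulg1 ?mulVg ?mulgV.
Qed.

(** The universal property is applied to the group presented by all relators that identify two short
    positive words of equal value, and to the map sending a generator to its letter. A word of value
    1 becomes trivial there, which is what a finite presentation demands. *)
Lemma sub_finitely_presented : finitely_presented sub_mul sub_inv sub_one.
Proof.
have [B [n [VB HB triv0]]] := fH.
(* The bound is made positive so that two letters standing for the same element, if [B] has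
   repetitions, are identified by a relator. *)
have fB : fpres_by H B n.+1.
  by split=> // Q f r; apply: triv0; apply: rels_sub r.
have {}triv0 := I; have [_ _ triv] := fB.
pose k := size B; pose b (i : 'I_k) := nth 1 B i.
have bB i : b i \in B by apply: mem_nth.
pose gens (i : 'I_k) : sub_carrier := exist H (b i) (fpres_gen fB (bB i)).
pose val_letter (a : letter k) : G := if a.2 then (b a.1)^-1 else b a.1.
have evalE w : sval (eval_word sub_mul sub_inv sub_one gens w) = pr val_letter w.
  by elim: w => //= -[i c] w <-; case: c.
pose pos (u : seq 'I_k) : Defs.word k := map (fun i => (i, false)) u.
pose words := flatten [seq [seq (tval t : seq 'I_k) | t <- enum {: m.-tuple 'I_k}]
  | m <- iota 0 n.+2].
have wordsP u : (size u <= n.+1)%N -> u \in words.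
  move=> su; apply/flattenP; exists [seq (tval t : seq 'I_k)
     | t <- enum {: (size u).-tuple 'I_k}].
    by apply/mapP; exists (size u); rewrite // mem_iota.
  by apply/mapP; exists (in_tuple u); rewrite // mem_enum.
pose R := [seq pos p.1 ++ winv (pos p.2) | p <- [seq (u, v) | u <- words, v <- words]
   & pr b p.1 == pr b p.2].
exists k, gens, R; split=> [g|w].
  have [w Bw e] := fpres_word fB (svalP g).
  exists (pos (pmap insub [seq index a B | a <- w])).
  apply: sub_inj; rewrite evalE -{}e {g}.
  elim: w Bw => //= a w IH /andP [Ba Bw].
  rewrite insubT ?index_mem //= => lt; rewrite IH // /val_letter /= /b /=.
  by rewrite nth_index.
have val_winv u : pr val_letter (winv u) = (pr val_letter u)^-1.
  rewrite /winv; elim: u => [|[i c] u IH] /=; first by rewrite invg1.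
  rewrite rev_cons pr_rcons IH invgM; congr (_ * _).
  by rewrite /val_letter /=; case: c; rewrite ?invgK.
have val_pos u : pr val_letter (pos u) = pr b u by rewrite pr_map.
split=> [/(congr1 sval)|h]; last first.
  apply: sub_inj; rewrite evalE /=.
  suff E u v : pres_eq R u v -> pr val_letter u = pr val_letter v by exact: E h.
  elim=> {w h u v} [//|u v _ -> //|u v w _ -> _ -> //|u v [i c]|u v r].
    rewrite !pr_cat /=; congr (_ * _); rewrite /val_letter /=.
    by case: c; rewrite /= mulgA ?mulgV ?mulVg mul1g.
  case/mapP=> p; rewrite mem_filter => /andP [/eqP e _] ->.
  by rewrite !pr_cat val_winv !val_pos e mulgV mul1g.
rewrite evalE /= => e.
pose f (a : G) : presented R :=
  if insub (index a B) is Some i then pcl R [:: (i, false)] else 1.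
have fE u : inw B u -> exists2 v : seq 'I_k, size v = size u &
    pr b v = pr id u /\ pr f u = pcl R (pos v).
  elim: u => [|a u IH] /=; first by exists [::].
  case/andP=> Ba /IH [v sv [ev fv]].
  have lt : (index a B < k)%N by rewrite index_mem.
  exists (Ordinal lt :: v); rewrite /= ?sv // /b /= nth_index // ev; split=> //.
  by rewrite fv /f insubT /= [LHS]pmulE.
have rf : rels f B n.+1.
  move=> u u' Bu Bu' su su' eu.
  have [v sv [ev ->]] := fE u Bu; have [v' sv' [ev' ->]] := fE u' Bu'.
  apply: (mulIg (pcl R (winv (pos v')))).
  transitivity (1 : presented R); last first.
    by apply/esym; rewrite [LHS]pmulE; apply/pclP/pres_winvr.
  rewrite [LHS]pmulE; apply/pclP.
  rewrite -[_ ++ _]cat0s -{1}[_ ++ _]cats0; apply: (@pres_rel _ _ [::] [::]).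
  apply/mapP; exists (v, v'); rewrite // mem_filter /= ev eu ev' eqxx /=.
  by apply: allpairs_f; apply: wordsP; rewrite ?sv ?sv'.
have f1 i : f (b i) = pcl R [:: (i, false)].
  have [] := fE [:: b i]; first by rewrite /= bB.
  case=> [|j []] //= _ []; rewrite !mulg1 => ej ->; apply/pclP.
  have -> : [:: (j, false)] = pos [:: j] by [].
  have -> : [:: (i, false)] = pos [:: i] by [].
  apply: (@pres_trans _ _ _ (pos [:: j] ++ winv (pos [:: i]) ++ pos [:: i])).
    by apply/pres_sym/(pres_eq_catl (pos [:: j]))/pres_winvl.
  rewrite catA; apply: (@pres_rel k R [::] (pos [:: i]) (pos [:: j] ++ winv (pos [:: i]))).
  apply/mapP; exists ([:: j], [:: i]); rewrite // mem_filter /= !mulg1 ej eqxx /=.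
  by apply: allpairs_f; apply: wordsP.
have lift v : exists2 u, inw B u & pr id u = pr val_letter v /\ pr f u = pcl R v.
  elim: v => [|[i c] v [u Bu [eu fu]]]; first by exists [::].
  exists (val_letter (i, c) :: u).
    by rewrite /= Bu andbT /val_letter /=; case: c; rewrite ?VB ?bB.
  rewrite /= eu fu; split=> //; rewrite -[RHS](pmulE R [:: (i, c)] v).
  congr (_ * _); rewrite /val_letter; case: c => //=.
  (* The inverse of [b i] is itself in [B] and has a letter of its own; the universal property
     identifies that letter with the formal inverse of the letter of [b i]. *)
  have := triv _ f rf [:: (b i)^-1; b i]; rewrite /= VB bB //= mulg1 mulVg => /(_ isT erefl).
  rewrite mulg1 f1 => h; apply: (mulIg (pcl R [:: (i, false)])); rewrite h.
  by apply/esym; rewrite [LHS]pmulE; apply/pclP/(@pres_cancel _ _ [::] [::] (i, true)).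
have [u Bu [eu fu]] := lift w.
by apply/(@pclP k R); rewrite -fu triv // eu e.
Qed.

End Abstract.

(** * Groups of units and of bijections *)

Section UnitGroup.
Local Open Scope ring_scope.
Import GRing.Theory.
Variable R : unitRingType.

Record ugroup := UGroup { uval : R; uvalP : uval \is a GRing.unit }.

HB.instance Definition _ := [isSub for uval].
HB.instance Definition _ := [Choice of ugroup by <:].

Definition umul u v := UGroup (etrans (unitrMr _ (uvalP u)) (uvalP v)).
Definition uinv u := UGroup (etrans (unitrV _) (uvalP u)).
Definition uone := UGroup (unitr1 R).

Lemma umulA : associative umul.
Proof. by move=> u v w; apply: val_inj; apply: mulrA. Qed.
Lemma umul1 : left_id uone umul.
Proof. by move=> u; apply: val_inj; apply: mul1r. Qed.
Lemma umulr1 : right_id uone umul.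
Proof. by move=> u; apply: val_inj; apply: mulr1. Qed.
Lemma umulV : left_inverse uone uinv umul.
Proof. by move=> u; apply: val_inj; apply: mulVr; apply: uvalP. Qed.
Lemma umulrV : right_inverse uone uinv umul.
Proof. by move=> u; apply: val_inj; apply: mulrV; apply: uvalP. Qed.

HB.instance Definition _ := isGroup.Build ugroup umulA umul1 umulr1 umulV umulrV.

Lemma uvalM (u v : ugroup) : uval (u * v)%g = uval u * uval v. Proof. by []. Qed.
Lemma uvalV (u : ugroup) : uval u^-1%g = (uval u)^-1. Proof. by []. Qed.
End UnitGroup.

Section Bijections.
Variable X : Type.

Record bij := Bij { fw : X -> X; bw : X -> X; fwK : cancel fw bw; bwK : cancel bw fw }.

HB.instance Definition _ := gen_eqMixin bij.
HB.instance Definition _ := gen_choiceMixin bij.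

Lemma bijP f g : fw f =1 fw g -> f = g.
Proof.
case: f g => f f' fK f'K [g g' gK g'K] /= /funext e; subst g.
have e' : f' = g' by apply: funext => x; rewrite -{2}(f'K x) gK.
by subst g'; rewrite (Prop_irrelevance fK gK) (Prop_irrelevance f'K g'K).
Qed.

Definition bmul f g := Bij (can_comp (fwK f) (fwK g)) (can_comp (bwK g) (bwK f)).
Definition binv f := Bij (bwK f) (fwK f).
Definition bone := @Bij id id (fun=> erefl) (fun=> erefl).

Lemma bmulA : associative bmul. Proof. by move=> f g h; apply: bijP. Qed.
Lemma bmul1 : left_id bone bmul. Proof. by move=> f; apply: bijP. Qed.
Lemma bmulr1 : right_id bone bmul. Proof. by move=> f; apply: bijP. Qed.
Lemma bmulV : left_inverse bone binv bmul.
Proof. by move=> f; apply: bijP => x; apply: fwK. Qed.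
Lemma bmulrV : right_inverse bone binv bmul.
Proof. by move=> f; apply: bijP => x; apply: bwK. Qed.

HB.instance Definition _ := isGroup.Build bij bmulA bmul1 bmulr1 bmulV bmulrV.

Lemma fwM (f g : bij) x : fw (f * g)%g x = fw f (fw g x). Proof. by []. Qed.
Lemma fw1 x : fw 1%g x = x. Proof. by []. Qed.
Lemma fwI (f : bij) : injective (fw f). Proof. exact: can_inj (fwK f). Qed.

Lemma exists_bij (f g : X -> X) : cancel f g -> cancel g f ->
  exists h : bij, fw h =1 f.
Proof. by move=> fK gK; exists (Bij fK gK). Qed.

End Bijections.

(** * Presentation of GL_n(Z) *)

Section ElementaryMatrices.
Import GRing.Theory Num.Theory.
Local Open Scope ring_scope.
Variable n : nat.
Local Notation I := 'I_n.+1.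
Local Notation M := 'M[int]_n.+1.
Implicit Types (i j k l m : I) (v : 'rV[int]_n.+1).

(** The value 1 at [i = j] makes the family total and keeps it inside the units. *)
Definition trv_mx i j : M := if i == j then 1 else 1 + delta_mx j i.
Definition trvi_mx i j : M := if i == j then 1 else 1 - delta_mx j i.
Definition flip_mx i : M := diag_mx (\row_m (if m == i then -1 else 1)).

Lemma mul_trv v i j m : i != j ->
  (v *m trv_mx i j) 0 m = v 0 m + (if m == i then v 0 j else 0).
Proof.
move=> /negPf ne; rewrite /trv_mx ne mulmxDr mulmx1 !mxE; congr (_ + _).
rewrite (bigD1 j) //= big1 ?addr0 => [|r /negPf nr]; rewrite mxE ?eqxx /= ?nr.
  by case: (m == i); rewrite ?mulr1 ?mulr0.
by rewrite mulr0.
Qed.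

Lemma mul_trvi v i j m : i != j ->
  (v *m trvi_mx i j) 0 m = v 0 m - (if m == i then v 0 j else 0).
Proof.
move=> /negPf ne; rewrite /trvi_mx ne mulmxBr mulmx1 !mxE; congr (_ - _).
rewrite (bigD1 j) //= big1 ?addr0 => [|r /negPf nr]; rewrite mxE ?eqxx /= ?nr.
  by case: (m == i); rewrite ?mulr1 ?mulr0.
by rewrite mulr0.
Qed.

Lemma mul_flip v i m : (v *m flip_mx i) 0 m = if m == i then - v 0 m else v 0 m.
Proof. by rewrite mul_mx_diag !mxE; case: ifP; rewrite ?mulrN1 ?mulr1. Qed.

Lemma mul_swap v i j m : (v *m tperm_mx i j) 0 m = v 0 (tperm i j m).
Proof. by rewrite -xcolE mxE. Qed.

Lemma eq_row_mul (A B : M) : (forall v, v *m A = v *m B) -> A = B.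
Proof. by move=> e; apply/row_matrixP => i; rewrite !rowE e. Qed.

Lemma trv_unit i j : trv_mx i j \is a GRing.unit.
Proof.
apply/unitrP; exists (trvi_mx i j); case: (eqVneq i j) => [->|ne].
  by rewrite /trv_mx /trvi_mx eqxx !mulr1.
have ji : (j == i) = false by rewrite eq_sym (negPf ne).
split; apply: eq_row_mul => v; apply/rowP => m; rewrite mulmxA mulmx1.
  by rewrite mul_trv // !mul_trvi // ji; case: ifP; rewrite ?subr0 ?addr0 ?subrK.
by rewrite mul_trvi // !mul_trv // ji; case: ifP; rewrite ?subr0 ?addr0 ?addrK.
Qed.

Lemma flip_unit i : flip_mx i \is a GRing.unit.
Proof.
have E : flip_mx i * flip_mx i = 1.
  apply: eq_row_mul => v; apply/rowP => m; rewrite mulmxA mulmx1 !mul_flip.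
  by case: (m == i); rewrite ?opprK.
by apply/unitrP; exists (flip_mx i); rewrite E.
Qed.

Lemma swap_unit i j : (tperm_mx i j : M) \is a GRing.unit.
Proof. exact: unitmx_perm. Qed.

Definition trv i j := UGroup (trv_unit i j).
Definition flip i := UGroup (flip_unit i).
Definition exch i j := UGroup (swap_unit i j).

Lemma trvV i j : uval (trv i j)^-1%g = trvi_mx i j.
Proof.
apply: (mulrI (trv_unit i j)); rewrite mulrV ?trv_unit //.
case: (eqVneq i j) => [->|ne]; first by rewrite /trv_mx /trvi_mx eqxx mulr1.
have ji : (j == i) = false by rewrite eq_sym (negPf ne).
apply: eq_row_mul => v; apply/rowP => m; rewrite mulmxA mulmx1.
by rewrite mul_trvi // !mul_trv // ji; case: ifP; rewrite ?subr0 ?addr0 ?addrK.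
Qed.

Definition coords := (mul_trv, mul_trvi, mul_flip, mul_swap).

End ElementaryMatrices.

(* The relations between the elementary generators of [GL_n(Z)]. Matrices act
   on row vectors from the right: [x i j] adds coordinate [j] to coordinate
   [i], [f i] negates coordinate [i], [s i j] exchanges [i] and [j]. *)
Section ElementaryRelations.
Local Open Scope group_scope.
Variable n : nat.
Local Notation I := 'I_n.+1.
Implicit Types (i j k l : I).

Record elem_rels (P : groupType) (x : I -> I -> P) (f : I -> P)
    (s : I -> I -> P) : Prop := ElemRels {
  er_comm : forall i j k l, i != j -> k != l -> i != l -> j != k ->
    x i j * x k l = x k l * x i j;
  er_steinberg : forall i j l, i != j -> j != l -> i != l ->
    x j l * x i j = x i j * x j l * x i l;
  er_ss : forall i j, s i j * s i j = 1;
  er_sC : forall i j, s i j = s j i;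
  er_s1 : forall i, s i i = 1;
  er_sx : forall a b i j, i != j ->
    s a b * x i j = x (tperm a b i) (tperm a b j) * s a b;
  er_sf : forall a b i, s a b * f i = f (tperm a b i) * s a b;
  er_sJ : forall a b i j,
    s a b * s i j = s (tperm a b i) (tperm a b j) * s a b;
  er_ff : forall i, f i * f i = 1;
  er_fC : forall i j, f i * f j = f j * f i;
  er_fx : forall k i j, i != j -> k != i -> k != j -> f k * x i j = x i j * f k;
  er_fxi : forall i j, i != j -> f i * x i j = (x i j)^-1 * f i;
  er_fxj : forall i j, i != j -> f j * x i j = (x i j)^-1 * f j;
  er_xV : forall i j, i != j ->
    (x i j)^-1 = (x j i)^-1 * s i j * x j i * f i;
  er_xs : forall i j, i != j ->
    x j i * s i j * (x j i)^-1 = x i j * f j }.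

End ElementaryRelations.

Section ElementaryHold.
Import GRing.Theory.
Local Open Scope ring_scope.
Variable n : nat.
Local Notation I := 'I_n.+1.

Lemma elem_rels_matrix : elem_rels (@trv n) (@flip n) (@exch n).
Proof.
have key (a b : ugroup 'M[int]_n.+1) :
    (forall (v : 'rV_n.+1) m, (v *m uval a) 0 m = (v *m uval b) 0 m) -> a = b.
  by move=> e; apply: val_inj; apply: eq_row_mul => v; apply/rowP.
have neq2 (i j : I) : i != j -> ((i == j) = false) * ((j == i) = false).
  by move=> h; rewrite [j == i]eq_sym (negPf h).
split.
- move=> i j k l /neq2 ij /neq2 kl /neq2 il /neq2 jk; apply: key => v m.
  rewrite !uvalM /= !mulmxA !coords ?ij ?kl // il jk /=.
  by case: (m == i); case: (m == k); ring.
- move=> i j l /neq2 ij /neq2 jl /neq2 il; apply: key => v m.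
  rewrite !uvalM /= !mulmxA !coords ?ij ?jl ?il // !eqxx.
  by case: (m == j); case: (m == i); ring.
- by move=> i j; apply: key => v m; rewrite !uvalM /= !mulmxA !coords tpermK mulmx1.
- by move=> i j; apply: val_inj; rewrite /= /tperm_mx tpermC.
- by move=> i; apply: key => v m; rewrite /= !coords tperm1 perm1 mulmx1.
- move=> a b i j ij; apply: key => v m.
  by rewrite !uvalM /= !mulmxA !coords ?(inj_eq perm_inj).
- move=> a b i; apply: key => v m.
  by rewrite !uvalM /= !mulmxA !coords (inj_eq perm_inj).
- move=> a b i j; apply: key => v m.
  rewrite !uvalM /= !mulmxA !coords; congr (v 0 _).
  by rewrite (inj_tperm _ _ _ (@perm_inj _ (tperm a b))).
- move=> i; apply: key => v m; rewrite !uvalM /= !mulmxA !coords mulmx1.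
  by case: (m == i); rewrite ?opprK.
- move=> i j; apply: key => v m; rewrite !uvalM /= !mulmxA !coords.
  by case: (m == i); case: (m == j).
- move=> k i j /neq2 ij /neq2 ki /neq2 kj; apply: key => v m.
  rewrite !uvalM /= !mulmxA !coords ?ij // [j == k]kj.
  by case: (eqVneq m k) => [->|_]; rewrite ?ki ?oppr0 ?addr0.
- move=> i j /neq2 ij; apply: key => v m.
  rewrite !uvalM trvV /= !mulmxA !coords ?ij //.
  by case: (m == i); ring.
- move=> i j /neq2 ij; apply: key => v m.
  rewrite !uvalM trvV /= !mulmxA !coords ?ij // eqxx.
  by case: (eqVneq m j) => [->|_]; rewrite ?ij; case: (m == i); ring.
- move=> i j ij; have := neq2 _ _ ij => ij2; apply: key => v m.
  rewrite !uvalM !trvV /= !mulmxA !coords ?ij2 // ?eqxx ?ij2 ?tpermL ?tpermR.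
  by case: tpermP => [->|->|/eqP/negPf-> /eqP/negPf->]; rewrite ?eqxx ?ij2; ring.
- move=> i j ij; have := neq2 _ _ ij => ij2; apply: key => v m.
  rewrite !uvalM !trvV /= !mulmxA !coords ?ij2 // ?eqxx ?ij2 ?tpermL ?tpermR.
  by case: tpermP => [->|->|/eqP/negPf-> /eqP/negPf->]; rewrite ?eqxx ?ij2; ring.
Qed.
End ElementaryHold.

Section Generated.
Local Open Scope group_scope.
Variable P : groupType.
Implicit Type S : P -> Prop.

Inductive sgen S : P -> Prop :=
| sgen1 : sgen S 1
| sgenM a b : S a -> sgen S b -> sgen S (a * b)
| sgenV a b : S a -> sgen S b -> sgen S (a^-1 * b).

Lemma sgen_in S a : S a -> sgen S a.
Proof. by move=> Sa; rewrite -[a]mulg1; apply: sgenM (sgen1 S). Qed.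

Lemma sgen_M S a b : sgen S a -> sgen S b -> sgen S (a * b).
Proof.
by elim=> [|c d Sc _ IH|c d Sc _ IH] /= gb; rewrite ?mul1g -?mulgA //;
  [apply: sgenM | apply: sgenV] => //; apply: IH.
Qed.

Lemma sgen_V S a : sgen S a -> sgen S a^-1.
Proof.
elim=> [|c d Sc _ IH|c d Sc _ IH]; rewrite ?invg1 ?invgM ?invgK.
- exact: sgen1.
- by apply: sgen_M IH _; rewrite -[_^-1]mulg1; apply: sgenV (sgen1 S).
- by apply: sgen_M IH _; apply: sgen_in.
Qed.

Lemma sgen_sub S S' a : (forall b, S b -> sgen S' b) -> sgen S a -> sgen S' a.
Proof.
move=> sS; elim=> [|c d /sS Sc _ IH|c d /sS Sc _ IH]; first exact: sgen1.
  exact: sgen_M.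
by apply: sgen_M IH; apply: sgen_V.
Qed.

End Generated.

(** * Faithfulness of a group that satisfies the elementary relations *)

Section Descent.
Import GRing.Theory Num.Theory Order.TTheory.
Variable n : nat.
Local Notation I := 'I_n.+1.
Local Notation GL := (ugroup 'M[int]_n.+1).
Variables (P : groupType) (act : P -> GL).
Variables (x : I -> I -> P) (f : I -> P) (s : I -> I -> P).
Hypothesis actM : {morph act : a b / (a * b)%g}.
Hypothesis rel : elem_rels x f s.
Hypotheses (act_x : forall i j, act (x i j) = trv i j)
  (act_f : forall i, act (f i) = flip i)
  (act_s : forall i j, act (s i j) = exch i j).
Implicit Types (i j k l m : I) (a b c d p q : P).

Lemma act1 : act 1%g = 1%g.
Proof. by apply: (mulgI (act 1%g)); rewrite -actM !mulg1. Qed.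

Lemma actV a : act a^-1%g = (act a)^-1%g.
Proof. by apply/esym/mulg1_eq; rewrite -actM mulgV act1. Qed.

Inductive elem (k : nat) : P -> Prop :=
| elem_x i j : i != j -> (i < k)%N -> (j < k)%N -> elem k (x i j)
| elem_f i : (i < k)%N -> elem k (f i)
| elem_s i j : (i < k)%N -> (j < k)%N -> elem k (s i j).

Lemma elem_le (k k' : nat) a : (k <= k')%N -> elem k a -> elem k' a.
Proof.
move=> le [i j ne ik jk|i ik|i j ik jk].
- by apply: elem_x; rewrite ?(leq_trans _ le).
- by apply: elem_f; rewrite ?(leq_trans _ le).
- by apply: elem_s; rewrite ?(leq_trans _ le).
Qed.

Section Level.
Variable o : I.

(* Generators fixing the basis vector [e_o]. *)
Inductive stab_gen : P -> Prop :=
| stab_elem a : elem o a -> stab_gen a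
| stab_x j : (j < o)%N -> stab_gen (x o j).

Definition stab := sgen stab_gen.

(** The image of the basis row vector [e_o]. Elements are followed through it modulo left
    multiplication by the stabiliser of [e_o]. *)
Definition v p m : int := uval (act p) o m.
Definition normv p : int := (\sum_m v p m)%R.

Local Open Scope ring_scope.

Lemma v_mul p q m : v (p * q)%g m = (row o (uval (act p)) *m uval (act q)) 0 m.
Proof. by rewrite /v actM uvalM -row_mul [RHS]mxE. Qed.

Lemma v_row p m : row o (uval (act p)) 0 m = v p m.
Proof. by rewrite mxE. Qed.

Lemma v_x p i j m : i != j ->
  v (p * x i j)%g m = v p m + (if m == i then v p j else 0).
Proof. by move=> ij; rewrite v_mul act_x mul_trv // !v_row. Qed.

Lemma v_xV p i j m : i != j ->
  v (p * (x i j)^-1)%g m = v p m - (if m == i then v p j else 0).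
Proof. by move=> ij; rewrite v_mul actV act_x trvV mul_trvi // !v_row. Qed.

Lemma v_f p i m : v (p * f i)%g m = if m == i then - v p m else v p m.
Proof. by rewrite v_mul act_f mul_flip !v_row. Qed.

Lemma v_s p i j m : v (p * s i j)%g m = v p (tperm i j m).
Proof. by rewrite v_mul act_s mul_swap !v_row. Qed.

Lemma v_1 m : v 1%g m = (m == o)%:R.
Proof. by rewrite /v act1 mxE eq_sym. Qed.

Lemma v_eqM p q r : v p =1 v q -> v (p * r)%g =1 v (q * r)%g.
Proof.
move=> e m; rewrite !v_mul; congr ((_ *m _) _ _).
by apply/rowP => i; rewrite !v_row.
Qed.

Lemma ltn_neq i : (i < o)%N -> (i == o) = false.
Proof. by move=> lt; apply/eqP => e; rewrite e ltnn in lt. Qed.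

Lemma v_stab c : stab c -> v c =1 v 1%g.
Proof.
have key a : stab_gen a -> v a =1 v 1%g.
  case=> {}a; last first.
    move=> jo m; rewrite -[x _ _]mul1g v_x; last by rewrite eq_sym (ltn_neq jo).
    by rewrite !v_1 (ltn_neq jo); case: ifP; rewrite addr0.
  case=> [i j ij io jo|i io|i j io jo] m; rewrite -[LHS]/(v _ m).
  - rewrite -[x _ _]mul1g v_x // !v_1 (ltn_neq jo).
    by case: ifP; rewrite addr0.
  - rewrite -[f _]mul1g v_f !v_1; case: eqP => // ->.
    by rewrite (ltn_neq io) ?oppr0.
  - rewrite -[s _ _]mul1g v_s !v_1; congr (_ %:R); congr nat_of_bool.
    by case: tpermP => [->|->|]; rewrite ?(ltn_neq io) ?(ltn_neq jo).
elim=> // a b Sa _ IH m; last first.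
  have e : v a^-1%g =1 v 1%g.
    by move=> r; have := v_eqM a^-1%g (key a Sa) r; rewrite mulgV mul1g.
  by rewrite -IH -[b in RHS]mul1g; apply: v_eqM.
by rewrite -IH -[b in RHS]mul1g; apply: v_eqM; apply: key.
Qed.

Lemma v_stabM c p : stab c -> v (c * p)%g =1 v p.
Proof. by move=> /v_stab/v_eqM e m; rewrite e mul1g. Qed.

(* Elements obtained by steps that increase the nonnegative vector [e_o p]. *)
Inductive desc : P -> Prop :=
| desc_base c i : stab c -> (i <= o)%N -> desc (c * s o i)%g
| desc_step p i j : desc p -> i != j -> (i <= o)%N -> (j <= o)%N -> 0 < v p j ->
    desc (p * x i j)%g.

Lemma desc1 : desc 1%g.
Proof. by rewrite -(er_s1 rel o) -[s _ _]mul1g; apply: desc_base (sgen1 _) _. Qed.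

Lemma v_base c i m : stab c -> v (c * s o i)%g m = (m == i)%:R.
Proof.
move=> Sc; rewrite v_stabM // -[s _ _]mul1g v_s v_1.
by rewrite -(inj_eq (@perm_inj _ (tperm o i))) tpermK tpermL.
Qed.

Lemma desc_ge0 p m : desc p -> 0 <= v p m.
Proof.
elim=> [c i Sc _|q i j _ IH ij _ _ vj]; first by rewrite v_base.
by rewrite v_x // addr_ge0 //; case: ifP => // _; apply: ltW.
Qed.

Lemma desc_supp p m : desc p -> (o < m)%N -> v p m = 0.
Proof.
move=> Dp om; elim: Dp => [c i Sc io|q i j _ IH ij io _ vj].
  by rewrite v_base //; case: eqP => // e; rewrite e ltnNge io in om.
by rewrite v_x // IH add0r; case: eqP => // e; rewrite e ltnNge io in om.
Qed.

Lemma desc_stabM c p : stab c -> desc p -> desc (c * p)%g.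
Proof.
move=> Sc; elim=> [d i Sd io|q i j _ IH ij io jo vj].
  by rewrite mulgA; apply: desc_base => //; apply: sgen_M.
by rewrite mulgA; apply: desc_step => //; rewrite v_stabM.
Qed.

Lemma tperm_le i j m : (i <= o)%N -> (j <= o)%N -> (m <= o)%N ->
  (tperm i j m <= o)%N.
Proof. by move=> io jo mo; case: tpermP. Qed.

Lemma lt_le_neq i : (i <= o)%N -> i != o -> (i < o)%N.
Proof. by move=> le ne; rewrite ltn_neqAle le andbT. Qed.

Lemma stab_s i j : (i <= o)%N -> (j <= o)%N -> i != o -> j != o -> stab (s i j).
Proof.
by move=> io jo ni nj; apply/sgen_in/stab_elem/elem_s; apply: lt_le_neq.
Qed.

Lemma stab_xg i j : i != j -> (i <= o)%N -> (j <= o)%N -> j != o -> stab (x i j).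
Proof.
move=> ij io jo nj; apply: sgen_in; case: (eqVneq i o) => [->|ni].
  by apply: stab_x; apply: lt_le_neq.
by apply/stab_elem/elem_x => //; apply: lt_le_neq.
Qed.

Lemma stab_f i : (i <= o)%N -> i != o -> stab (f i).
Proof. by move=> io ni; apply/sgen_in/stab_elem/elem_f/lt_le_neq. Qed.

(** Conjugation by an exchange permutes the indices of the steps, so only the starting elements
    [s o i] matter. There the additional exchange is absorbed into another starting element, up to
    an exchange fixing [o]. *)
Lemma desc_s p i j : desc p -> (i <= o)%N -> (j <= o)%N -> desc (p * s i j)%g.
Proof.
move=> Dp io jo; elim: Dp => [c i0 Sc i0o|q k l _ IH kl ko lo vl]; last first.
  rewrite -mulgA -[(x _ _ * _)%g]invgK invgM.
  have -> : (s i j)^-1%g = s i j by apply: mulg1_eq (er_ss rel i j).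
  have -> : (s i j * (x k l)^-1 = (x (tperm i j k) (tperm i j l))^-1 * s i j)%g.
    apply: (mulIg (x k l)); rewrite -!mulgA (er_sx rel) // mulKg.
    by rewrite mulVg mulg1.
  rewrite invgM invgK.
  have -> : (s i j)^-1%g = s i j by apply: mulg1_eq (er_ss rel i j).
  rewrite mulgA; apply: desc_step; rewrite ?(inj_eq perm_inj) ?tperm_le //.
  by rewrite v_s tpermK.
wlog ij : i j io jo / i != j => [W|].
  by case: (eqVneq i j) => [->|]; rewrite ?(er_s1 rel) ?mulg1;
    [apply: desc_base | apply: W].
case: (eqVneq i0 i) => [ei|ni]; last case: (eqVneq i0 j) => [ej|nj].
- case: (eqVneq i0 o) => [eo|no].
    by rewrite -ei eo (er_s1 rel) mulg1; apply: desc_base.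
  case: (eqVneq j o) => [ejo|njo].
    rewrite ejo -ei (er_sC rel i0) -mulgA (er_ss rel) mulg1.
    by rewrite -[c]mulg1 -(er_s1 rel o); apply: desc_base.
  have -> : (c * s o i0 * s i j = c * s i j * s o j)%g.
    rewrite -!mulgA; congr (_ * _)%g; subst i0.
    rewrite -[LHS]mul1g -(er_ss rel i j) -mulgA; congr (_ * _)%g.
    by rewrite mulgA (er_sJ rel) tpermL tpermD // -mulgA (er_ss rel) mulg1.
  by apply: desc_base => //; apply: sgen_M => //; apply: stab_s; rewrite // -ei.
- case: (eqVneq i0 o) => [eo|no].
    by rewrite -ej eo (er_s1 rel) mulg1 (er_sC rel); apply: desc_base.
  case: (eqVneq i o) => [eio|nio].
    rewrite eio -ej -mulgA (er_ss rel) mulg1.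
    by rewrite -[c]mulg1 -(er_s1 rel o); apply: desc_base.
  have -> : (c * s o i0 * s i j = c * s i j * s o i)%g.
    rewrite -!mulgA; congr (_ * _)%g; subst i0.
    rewrite -[LHS]mul1g -(er_ss rel i j) -mulgA; congr (_ * _)%g.
    by rewrite mulgA (er_sJ rel) tpermR tpermD // -mulgA (er_ss rel) mulg1.
  by apply: desc_base => //; apply: sgen_M => //; apply: stab_s; rewrite // -ej.
rewrite -mulgA (er_sJ rel) mulgA; apply: desc_base => //; apply: sgen_M => //.
have nt m : i0 != m -> tperm o i0 m != o.
  by move=> ne; rewrite -(inj_eq (@perm_inj _ (tperm o i0))) tpermK tpermL eq_sym.
by apply: stab_s; rewrite ?tperm_le ?nt.
Qed.

Lemma normv_x p i j : i != j -> normv (p * x i j)%g = normv p + v p j.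
Proof.
move=> ij; rewrite /normv (eq_bigr (fun m => v p m + (if m == i then v p j else 0))).
  by rewrite big_split /= -big_mkcond big_pred1_eq.
by move=> m _; rewrite v_x.
Qed.

Lemma normv_xV p i j : i != j -> normv (p * (x i j)^-1)%g = normv p - v p j.
Proof.
move=> ij; have := normv_x (p * (x i j)^-1)%g ij.
by rewrite mulgVK v_xV // eq_sym (negPf ij) subr0 => ->; rewrite addrK.
Qed.

Lemma eq_normv p q : v p =1 v q -> normv p = normv q.
Proof. by move=> e; apply: eq_bigr => m _; apply: e. Qed.

Lemma normv_ge0 p : (forall m, 0 <= v p m) -> 0 <= normv p.
Proof. by move=> ge; apply: sumr_ge0. Qed.

(** Adding or negating a coordinate equal to 0 leaves the vector of [p] unchanged, so these
    conjugates ought to fix [e_o]. That they lie in [stab] is derived from the relations, by moving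
    them backwards through the steps that built [p]. *)
Lemma desc_zero p j : desc p -> v p j = 0 -> (j <= o)%N ->
  (forall i, i != j -> (i <= o)%N -> stab (p * x i j * p^-1)%g)
  /\ stab (p * f j * p^-1)%g.
Proof.
move=> Dp; elim: Dp => [c i0 Sc i0o|q k l Dq IH kl ko lo vl].
  rewrite v_base //; case: (eqVneq j i0) => // nj _ jo.
  have SsV : (s o i0)^-1%g = s o i0 by apply: mulg1_eq (er_ss rel _ _).
  have nt : tperm o i0 j != o.
    by rewrite -(inj_eq (@perm_inj _ (tperm o i0))) tpermK tpermL.
  split=> [i ij io|]; rewrite invgM SsV !mulgA; apply: sgen_M (sgen_V Sc).
    rewrite -!mulgA; apply: sgen_M => //.
    rewrite mulgA (er_sx rel) // -mulgA (er_ss rel) mulg1.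
    by apply: stab_xg; rewrite ?(inj_eq perm_inj) ?tperm_le.
  rewrite -!mulgA; apply: sgen_M => //.
  rewrite mulgA (er_sf rel) // -mulgA (er_ss rel) mulg1.
  by apply: stab_f; rewrite ?tperm_le.
have vk : 0 < v (q * x k l)%g k.
  by rewrite v_x // eqxx ltr_wpDl // desc_ge0.
move=> vj jo; have jk : j != k by apply/eqP => e; move: vj; rewrite e => z; rewrite z ltxx in vk.
have vqj : v q j = 0 by move: vj; rewrite v_x // (negPf jk) addr0.
have jl : j != l by apply/eqP => e; rewrite -e vqj ltxx in vl.
have [IHx IHf] := IH vqj jo.
split=> [i ij io|]; rewrite invgM mulgA.
  case: (eqVneq i l) => [il|nil].
    subst i.
    have -> : (q * x k l * x l j * (x k l)^-1 * q^-1 =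
      (q * x l j * q^-1) * (q * x k j * q^-1)^-1)%g.
      rewrite !invgM invgK !mulgA mulgVK; congr (_ * _)%g; rewrite -!mulgA.
      congr (_ * _)%g; apply: (mulIg (x k l)); rewrite -!mulgA mulVg mulg1.
      have jk' : k != j by rewrite eq_sym.
      have -> : ((x k j)^-1 * x k l = x k l * (x k j)^-1)%g.
        apply: (mulgI (x k j)); rewrite mulVKg !mulgA (er_comm rel) ?mulgK //.
      apply: (mulIg (x k j)); rewrite !mulgA mulgVK.
      by rewrite -(er_steinberg rel) // eq_sym.
    apply: sgen_M; first exact: IHx.
    by apply/sgen_V/IHx; rewrite // eq_sym.
  have -> : (q * x k l * x i j * (x k l)^-1 = q * x i j)%g.
    rewrite -[(q * _ * _)%g]mulgA (er_comm rel) // ?mulgA ?mulgK //; by rewrite eq_sym.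
  exact: IHx.
have -> : (q * x k l * f j * (x k l)^-1 = q * f j)%g.
  by rewrite -[(q * _ * _)%g]mulgA -(er_fx rel) // ?mulgA ?mulgK.
exact: IHf.
Qed.

(** The row belongs to an invertible integer matrix, so its only non-zero entry is a unit. *)
Lemma unit_coord p i : (forall m, m != i -> v p m = 0) -> 0 <= v p i -> v p i = 1.
Proof.
move=> z ge; have e : v (p * p^-1)%g o = v p i * uval (act p^-1%g) i o.
  rewrite v_mul mxE (bigD1 i) //= big1 ?addr0 ?v_row // => m /z.
  by rewrite v_row => ->; rewrite mul0r.
move: e ge; rewrite mulgV v_1 eqxx /= mulr1n.
move: (v p i) (uval (act p^-1%g) i o) => a b e ge.
have [b0|b1] : b <= 0 \/ 1 <= b by lia.
  nia.
nia.
Qed.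

(** Euclid's algorithm: while two coordinates are positive the smaller is subtracted from the
    larger, and a single remaining one is 1 by [unit_coord]. Undoing the subtractions gives the
    steps of [c]. *)
Lemma exists_desc_vec p : (forall m, 0 <= v p m) ->
  (forall m : I, (o < m)%N -> v p m = 0) -> exists2 c, desc c & v c =1 v p.
Proof.
have [N] := ubnP `|normv p|%N; elim: N p => // N IH p lt ge supp.
have le i : v p i != 0 -> (i <= o)%N.
  by apply: contraNT; rewrite -ltnNge => /supp->.
have [/existsP [i /existsP [j /and4P [ij vi vj vji]]]|no] :=
    boolP [exists i, exists j, [&& i != j, 0 < v p i, 0 < v p j & v p j <= v p i]].
  have io := le i (lt0r_neq0 vi); have jo := le j (lt0r_neq0 vj).
  have ji : (j == i) = false by rewrite eq_sym (negPf ij).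
  have [|||c Dc vc] := IH (p * (x i j)^-1)%g.
  - rewrite -ltnS; apply: leq_trans lt; rewrite ltnS -ltz_nat !gez0_abs.
    + by rewrite normv_xV // ltrBlDr ltrDl.
    + exact: normv_ge0.
    apply: normv_ge0 => m; rewrite v_xV //.
    by case: eqP => [->|_]; rewrite ?subr0 ?subr_ge0.
  - move=> m; rewrite v_xV //.
    by case: eqP => [->|_]; rewrite ?subr0 ?subr_ge0.
  - move=> m om; rewrite v_xV // supp //; case: eqP => // e.
    by rewrite e ltnNge io in om.
  exists (c * x i j)%g.
    by apply: desc_step; rewrite // vc v_xV // ji subr0.
  by move=> m; rewrite (v_eqM _ vc) mulgVK.
have one i j : i != j -> 0 < v p i -> 0 < v p j -> False.
  move=> ij vi vj; move: no; rewrite negb_exists => /forallP.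
  case/orP: (le_total (v p i) (v p j)) => h.
    move/(_ j); rewrite negb_exists => /forallP/(_ i).
    by rewrite eq_sym ij vi vj h.
  move/(_ i); rewrite negb_exists => /forallP/(_ j).
  by rewrite ij vi vj h.
have pos m : v p m != 0 -> 0 < v p m by move=> h; rewrite lt0r h ge.
have [i vi] : exists i, v p i != 0.
  apply/existsP; apply: contraT; rewrite negb_exists => /forallP z.
  have : v p o = 1 by apply: unit_coord => // m _; apply/eqP/negPn/z.
  by move/eqP: (negPn (z o)) => /= ->.
have z m : m != i -> v p m = 0.
  move=> mi; apply/eqP; apply: contraT => /pos vm; exfalso.
  by apply: (one m i) => //; apply: pos.
exists (s o i); first by rewrite -[s _ _]mul1g; apply: desc_base (sgen1 _) (le i vi).
move=> m; rewrite -[s _ _]mul1g v_base //; last exact: sgen1.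
by case: eqP => [->|/eqP/z->//]; rewrite unit_coord.
Qed.

Local Notation "p ~ q" := (stab (p * q^-1)%g) (at level 70).

Lemma eqv_sym p q : p ~ q -> q ~ p.
Proof. by move=> /sgen_V; rewrite invgM invgK. Qed.

Lemma eqv_trans p q r : p ~ q -> q ~ r -> p ~ r.
Proof. by move=> pq qr; have := sgen_M pq qr; rewrite mulgA mulgVK. Qed.

Lemma eqv_mulr p q r : p ~ q -> (p * r)%g ~ (q * r)%g.
Proof. by rewrite invgM !mulgA mulgK. Qed.

Section Confluence.
Variable N : nat.
Hypothesis IH : forall p q, (`|normv p| < N)%N -> desc p -> desc q ->
  v p =1 v q -> p ~ q.

(** Independent steps: undoing both gives a common predecessor [c] of [p] and [q], and the two steps
    commute. *)
Lemma conf_comm p q i j k l : desc p -> desc q -> i != j -> k != l ->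
    (i <= o)%N -> (j <= o)%N -> (k <= o)%N -> (l <= o)%N -> 0 < v p j -> 0 < v q l ->
    (`|normv (p * x i j)%g| <= N)%N -> v (p * x i j)%g =1 v (q * x k l)%g ->
    i != l -> j != k -> i != k -> (p * x i j)%g ~ (q * x k l)%g.
Proof.
move=> Dp Dq ij kl io jo ko lo pj ql leN e il jk ik.
have li : (l == i) = false by rewrite eq_sym (negPf il).
have ki : (k == i) = false by rewrite eq_sym (negPf ik).
have ji : (j == i) = false by rewrite eq_sym (negPf ij).
have lk : (l == k) = false by rewrite eq_sym (negPf kl).
have vl : v p l = v q l.
  by have := e l; rewrite !v_x // li lk !addr0.
have vj : v q j = v p j.
  by have := e j; rewrite !v_x // (negPf jk) ji !addr0.
have vk : v p k = v q k + v q l.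
  by have := e k; rewrite !v_x // ki eqxx !addr0.
have vi : v q i = v p i + v p j.
  by have := e i; rewrite !v_x // (negPf ik) eqxx !addr0.
have vpk m : v (p * (x k l)^-1)%g m = v p m - (if m == k then v p l else 0).
  exact: v_xV.
have [m|m om|c Dc vc] := @exists_desc_vec (p * (x k l)^-1)%g.
- rewrite vpk; case: eqP => [->|_]; last by rewrite subr0 desc_ge0.
  by rewrite vk vl addrK desc_ge0.
- rewrite vpk (desc_supp Dp om); case: eqP => [ek|_]; last by rewrite subr0.
  by rewrite ek ltnNge ko in om.
have nlt : (`|normv p| < `|normv (p * x i j)%g|)%N.
  rewrite -ltz_nat !gez0_abs ?normv_x ?ltrDl //.
    by apply: addr_ge0; [apply: normv_ge0 => m; apply: desc_ge0|apply: ltW].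
  by apply: normv_ge0 => m; apply: desc_ge0.
have pc : p ~ (c * x k l)%g.
  apply: IH => //; first exact: leq_trans nlt leN.
    by apply: desc_step; rewrite // vc vpk lk subr0 vl.
  by move=> m; rewrite (v_eqM _ vc) mulgVK.
have cq : (c * x i j)%g ~ q.
  have vcq : v (c * x i j)%g =1 v q.
    move=> m; rewrite (v_eqM _ vc) v_x // !vpk (negPf jk) subr0.
    have := e m; rewrite !v_x //.
    case: (eqVneq m k) => [->|_]; first by rewrite ki !addr0 vl => ->; rewrite addrK.
    by rewrite subr0 addr0.
  apply: eqv_sym; apply: IH => //.
  - rewrite (leq_trans _ leN) // -ltz_nat !gez0_abs.
    + by rewrite (eq_normv e) normv_x // ltrDl.
    + by rewrite (eq_normv e); apply: normv_ge0 => m; rewrite v_x // addr_ge0 ?desc_ge0 //; case: ifP => // _; apply: ltW.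
    by apply: normv_ge0 => m; apply: desc_ge0.
  by apply: desc_step; rewrite // vc vpk (negPf jk) subr0.
apply: eqv_trans (eqv_mulr (x i j) pc) _.
apply: eqv_trans (eqv_mulr (x k l) cq).
have -> : (c * x k l * x i j = c * x i j * x k l)%g.
  by rewrite -!mulgA (er_comm rel ij kl).
by rewrite mulgV; apply: sgen1.
Qed.

(** The steps overlap in [j]. Undoing [x j l] below [p] gives [c], from which [q] is reached by
    adding coordinate [l] and then coordinate [j] to coordinate [i]; the Steinberg relation closes
    the diagram. *)
Lemma conf_chain p q i j l : desc p -> desc q -> i != j -> j != l ->
    (i <= o)%N -> (j <= o)%N -> (l <= o)%N -> 0 < v p j -> 0 < v q l ->
    (`|normv (p * x i j)%g| <= N)%N -> v (p * x i j)%g =1 v (q * x j l)%g ->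
    i != l -> (p * x i j)%g ~ (q * x j l)%g.
Proof.
move=> Dp Dq ij jl io jo lo pj ql leN e il.
have li : (l == i) = false by rewrite eq_sym (negPf il).
have ji : (j == i) = false by rewrite eq_sym (negPf ij).
have lj : (l == j) = false by rewrite eq_sym (negPf jl).
have vl : v p l = v q l.
  by have := e l; rewrite !v_x // li lj !addr0.
have vj : v p j = v q j + v q l.
  by have := e j; rewrite !v_x // ji eqxx !addr0.
have vi : v q i = v p i + v p j.
  by have := e i; rewrite !v_x // (negPf ij) eqxx !addr0.
have vpk m : v (p * (x j l)^-1)%g m = v p m - (if m == j then v p l else 0).
  exact: v_xV.
have [m|m om|c Dc vc] := @exists_desc_vec (p * (x j l)^-1)%g.
- rewrite vpk; case: eqP => [->|_]; last by rewrite subr0 desc_ge0.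
  by rewrite vj vl addrK desc_ge0.
- rewrite vpk (desc_supp Dp om); case: eqP => [ek|_]; last by rewrite subr0.
  by rewrite ek ltnNge jo in om.
have nlt : (`|normv p| < `|normv (p * x i j)%g|)%N.
  rewrite -ltz_nat !gez0_abs ?normv_x ?ltrDl //.
    by apply: addr_ge0; [apply: normv_ge0 => m; apply: desc_ge0|apply: ltW].
  by apply: normv_ge0 => m; apply: desc_ge0.
have vcl : v c l = v q l by rewrite vc vpk lj subr0.
have vcj : v c j = v q j by rewrite vc vpk eqxx vj vl addrK.
have pc : p ~ (c * x j l)%g.
  apply: IH => //; first exact: leq_trans nlt leN.
    by apply: desc_step; rewrite // vcl.
  by move=> m; rewrite (v_eqM _ vc) mulgVK.
have Dcl : desc (c * x i l)%g by apply: desc_step; rewrite // vcl.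
have vclj : v (c * x i l)%g j = v q j by rewrite v_x // ji addr0.
have vcq : v (c * x i l * x i j)%g =1 v q.
  move=> m; rewrite v_x // vclj v_x // vcl vc vpk.
  have := e m; rewrite !v_x //.
  case: (eqVneq m i) => [->|_].
    rewrite (negPf ij) addr0 subr0 => <-; rewrite vj -addrA; congr (_ + _).
    by rewrite addrC.
  by rewrite !addr0; case: eqP => _ ->; rewrite ?addr0 ?subr0 // vl addrK.
have qN : (`|normv q| < N)%N.
  rewrite (leq_trans _ leN) // -ltz_nat !gez0_abs.
  - by rewrite (eq_normv e) normv_x // ltrDl.
  - by rewrite (eq_normv e); apply: normv_ge0 => m; rewrite v_x // addr_ge0 ?desc_ge0 //; case: ifP => // _; apply: ltW.
  by apply: normv_ge0 => m; apply: desc_ge0.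
have cq : (c * x i l * x i j)%g ~ q.
  (* [x i j] is a legitimate step only if coordinate [j] is positive; otherwise it stays in the
     coset of the stabiliser by [desc_zero]. *)
  have [q0|qj] : v q j = 0 \/ 0 < v q j.
    by have := desc_ge0 j Dq; rewrite le_eqVlt => /orP [/eqP<-|]; [left|right].
    have vc0 : v (c * x i l)%g j = 0 by rewrite vclj.
    have [Sx _] := desc_zero Dcl vc0 jo.
    apply: (@eqv_trans _ (c * x i l)%g).
      by apply: Sx.
    apply: eqv_sym; apply: IH => // m; rewrite -vcq v_x // vc0.
    by case: ifP; rewrite addr0.
  apply: eqv_sym; apply: IH => //.
  by apply: desc_step; rewrite // vclj.
apply: eqv_trans (eqv_mulr (x i j) pc) _.
apply: eqv_trans (eqv_mulr (x j l) cq).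
have -> : (c * x j l * x i j = c * x i l * x i j * x j l)%g.
  rewrite -!mulgA; congr (_ * _)%g.
  rewrite (er_steinberg rel) // -mulgA (er_comm rel jl il) 1?eq_sym //.
  by rewrite !mulgA (er_comm rel ij il) // eq_sym.
  by rewrite eq_sym.
by rewrite mulgV; apply: sgen1.
Qed.

(** Opposite steps with equal results force [v p i = 0] and [v q j = 0], so the two vectors differ
    by the exchange of [i] and [j], and [er_xs] compares the two steps. *)
Lemma conf_opp p q i j : desc p -> desc q -> i != j ->
    (i <= o)%N -> (j <= o)%N -> 0 < v p j -> 0 < v q i ->
    (`|normv (p * x i j)%g| <= N)%N -> v (p * x i j)%g =1 v (q * x j i)%g ->
    (p * x i j)%g ~ (q * x j i)%g.
Proof.
move=> Dp Dq ij io jo pj qi leN e.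
have ji : (j == i) = false by rewrite eq_sym (negPf ij).
have ji' : j != i by rewrite eq_sym.
have ei : v p i + v p j = v q i by have := e i; rewrite !v_x // eqxx (negPf ij) addr0.
have ej : v p j = v q j + v q i by have := e j; rewrite !v_x // eqxx ji addr0.
have pi0 : v p i = 0 /\ v q j = 0.
  have := desc_ge0 i Dp; have := desc_ge0 j Dq; lia.
have [pi qj] := pi0.
have nlt : (`|normv p| < `|normv (p * x i j)%g|)%N.
  rewrite -ltz_nat !gez0_abs ?normv_x ?ltrDl //.
    by apply: addr_ge0; [apply: normv_ge0 => m; apply: desc_ge0|apply: ltW].
  by apply: normv_ge0 => m; apply: desc_ge0.
have pq : p ~ (q * s i j)%g.
  apply: IH; rewrite ?(leq_trans nlt leN) //; first exact: desc_s.
  move=> m; rewrite v_s; have := e m; rewrite !v_x //.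
  case: tpermP => [->|->|/eqP/negPf-> /eqP/negPf->]; last by rewrite !addr0.
    by rewrite pi qj.
  by rewrite ji eqxx addr0 => ->; rewrite qj add0r.
have [Sx Sf] := desc_zero Dq qj jo.
apply: eqv_trans (eqv_mulr (x i j) pq) _.
rewrite -(mulgA q) (er_sx rel) // tpermL tpermR.
have -> : (q * (x j i * s i j) * (q * x j i)^-1 =
    (q * x i j * q^-1) * (q * f j * q^-1))%g.
  rewrite invgM !mulgA mulgVK; congr (_ * _)%g; rewrite -!mulgA; congr (_ * _)%g.
  by rewrite mulgA (er_xs rel).
by apply: sgen_M; first exact: Sx.
Qed.

Lemma conf_step p q i j k l : desc p -> desc q -> i != j -> k != l ->
    (i <= o)%N -> (j <= o)%N -> (k <= o)%N -> (l <= o)%N -> 0 < v p j -> 0 < v q l ->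
    (`|normv (p * x i j)%g| <= N)%N -> v (p * x i j)%g =1 v (q * x k l)%g ->
    (p * x i j)%g ~ (q * x k l)%g.
Proof.
move=> Dp Dq ij kl io jo ko lo pj ql leN e.
have nlt : (`|normv p| < `|normv (p * x i j)%g|)%N.
  rewrite -ltz_nat !gez0_abs ?normv_x ?ltrDl //.
    by apply: addr_ge0; [apply: normv_ge0 => m; apply: desc_ge0|apply: ltW].
  by apply: normv_ge0 => m; apply: desc_ge0.
have e' : v (q * x k l)%g =1 v (p * x i j)%g by move=> m; rewrite e.
have leN' : (`|normv (q * x k l)%g| <= N)%N by rewrite (eq_normv e').
case: (eqVneq i l) => [il|il]; case: (eqVneq j k) => [jk|jk].
- by subst k l; apply: conf_opp.
- subst l; apply: eqv_sym; apply: conf_chain => //; by rewrite eq_sym.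
- by subst k; apply: conf_chain.
case: (eqVneq i k) => [ik|ik]; last exact: conf_comm.
subst k; case: (eqVneq j l) => [jl|jl].
  subst l; rewrite invgM mulgA mulgK; apply: IH => //; first exact: leq_trans nlt leN.
  by move=> m; have := v_eqM (x i j)^-1%g e m; rewrite !mulgK.
(* Two different coordinates [j] and [l] are added to the same [i]. A third way to reach the vector,
   ending with the step [x j l], exists when coordinate [l] is at most coordinate [j]; it forms a
   chain with the one and commutes with the other. *)
wlog le : p q j l Dp Dq ij kl jo lo pj ql leN e leN' e' nlt jl il jk /
    v (p * x i j)%g l <= v (p * x i j)%g j => [W|].
  case/orP: (le_total (v (p * x i j)%g l) (v (p * x i j)%g j)) => h.
    exact: W.
  apply: eqv_sym; apply: W => //; rewrite ?(eq_sym l) //; last by rewrite -!e.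
  rewrite -ltz_nat !gez0_abs ?normv_x ?ltrDl //.
    by apply: addr_ge0; [apply: normv_ge0 => m; apply: desc_ge0|apply: ltW].
  by apply: normv_ge0 => m; apply: desc_ge0.
have ji : (j == i) = false by rewrite eq_sym (negPf ij).
have li : (l == i) = false by rewrite eq_sym (negPf kl).
have lj : (l == j) = false by rewrite eq_sym (negPf jl).
have vl : v (p * x i j)%g l = v q l by rewrite e v_x // li addr0.
have Dpx : desc (p * x i j)%g by apply: desc_step.
have vpk m : v (p * x i j * (x j l)^-1)%g m =
    v (p * x i j)%g m - (if m == j then v q l else 0).
  by rewrite v_xV // vl.
have [m|m om|c Dc vc] := @exists_desc_vec (p * x i j * (x j l)^-1)%g.
- rewrite vpk; case: eqP => [->|_]; last by rewrite subr0 desc_ge0.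
  by rewrite subr_ge0 -vl.
- rewrite vpk (desc_supp Dpx om); case: eqP => [ek|_]; last by rewrite subr0.
  by rewrite ek ltnNge jo in om.
have vcl : 0 < v c l by rewrite vc vpk lj subr0 vl.
have ec : v (c * x j l)%g =1 v (p * x i j)%g.
  by move=> m; rewrite (v_eqM _ vc) mulgVK.
have jl' : j != l by [].
apply: (@eqv_trans _ (c * x j l)%g).
  by apply: conf_chain => // m; rewrite ec.
apply: conf_comm => //.
- by rewrite (eq_normv ec).
- by move=> m; rewrite ec.
by rewrite eq_sym.
Qed.

End Confluence.

(** Local confluence gives, by induction on the sum of the coordinates, that the vector determines
    the coset of the stabiliser, as it does for matrices. *)
Lemma desc_uniq p q : desc p -> desc q -> v p =1 v q -> p ~ q.
Proof.
have [N] := ubnP `|normv p|%N; elim: N p q => // N IH p q lt Dp Dq e.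
(* A step leaves two positive coordinates, so its result is never a basis vector. *)
have base_step c i r k l : stab c -> desc r -> k != l -> 0 < v r l ->
    v (c * s o i)%g =1 v (r * x k l)%g -> False.
  move=> Sc Dr kl rl h; have := h k; have := h l; rewrite !v_base // !v_x // eqxx.
  have lk : (l == k) = false by rewrite eq_sym (negPf kl).
  rewrite lk addr0; case: eqP => [<- _|_ e0]; last by rewrite -e0 ltxx in rl.
  rewrite (negPf kl); have := desc_ge0 k Dr; lia.
case: Dp lt e => [c i Sc io|p' i j Dp' ij io jo vj] lt e; case: Dq e => [d k Sd ko|q' k l Dq' kl ko lo vl] e.
- have := e i; rewrite !v_base // eqxx; case: eqP => // -> _.
  by rewrite invgM mulgA mulgK; apply: sgen_M (sgen_V Sd).
- by case: (base_step c i q' k l).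
- by case: (base_step d k p' i j) => // m; rewrite e.
by apply: (@conf_step N) => //; move=> p0 q0 lt0; apply: IH.
Qed.

Lemma fV i : (f i)^-1%g = f i. Proof. by apply: mulg1_eq (er_ff rel i). Qed.

Lemma sV i j : (s i j)^-1%g = s i j. Proof. by apply: mulg1_eq (er_ss rel i j). Qed.

Definition signs_lt (k : nat) := sgen (fun p => exists2 i : I, (i < k)%N & p = f i).
Definition signs := signs_lt o.+1.

Lemma f_x k i j : i != j ->
  ((f k * x i j = x i j * f k)%g /\ (f k * (x i j)^-1 = (x i j)^-1 * f k)%g) \/
  ((f k * x i j = (x i j)^-1 * f k)%g /\ (f k * (x i j)^-1 = x i j * f k)%g).
Proof.
move=> ij; have [e|e] : (f k * x i j = x i j * f k)%g \/
    (f k * x i j = (x i j)^-1 * f k)%g.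
- case: (eqVneq k i) => [->|ki]; first by right; apply: (er_fxi rel).
  case: (eqVneq k j) => [->|kj]; first by right; apply: (er_fxj rel).
  by left; apply: (er_fx rel).
- left; split=> //; apply: (mulIg (x i j)).
  by rewrite mulgVK -mulgA e mulKg.
right; split=> //; apply: (mulIg (x i j)).
by rewrite mulgVK -mulgA e mulVKg.
Qed.

Lemma signs_x (k : nat) nu i j : i != j -> signs_lt k nu ->
  ((nu * x i j = x i j * nu)%g /\ (nu * (x i j)^-1 = (x i j)^-1 * nu)%g) \/
  ((nu * x i j = (x i j)^-1 * nu)%g /\ (nu * (x i j)^-1 = x i j * nu)%g).
Proof.
move=> ij; elim=> [|a b [r _ ->] _ IH|a b [r _ ->] _ IH].
- by left; rewrite !mul1g !mulg1.
- rewrite -!mulgA; case: IH => -[-> ->]; rewrite !mulgA;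
    by case: (f_x r ij) => -[-> ->]; auto.
rewrite fV -!mulgA; case: IH => -[-> ->]; rewrite !mulgA;
  by case: (f_x r ij) => -[-> ->]; auto.
Qed.

Lemma signs_s nu i j : (i <= o)%N -> (j <= o)%N -> signs nu ->
  exists2 nu', signs nu' & (nu * s i j = s i j * nu')%g.
Proof.
move=> io jo.
have key (r : I) b : (r <= o)%N -> (exists2 nu', signs nu' & (b * s i j = s i j * nu')%g) ->
    exists2 nu', signs nu' & (f r * b * s i j = s i j * nu')%g.
  move=> ro [nu' snu e]; exists (f (tperm i j r) * nu')%g.
    by apply: sgenM => //; exists (tperm i j r) => //; apply: tperm_le.
  by rewrite -mulgA e !mulgA (er_sf rel) tpermK.
elim=> [|a b [r ro ->] _ IH|a b [r ro ->] _ IH].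
- by exists 1%g; [apply: sgen1 | rewrite mul1g mulg1].
- exact: key.
by rewrite fV; apply: key.
Qed.

(** Sign changes are collected on the right, so that [desc] itself only meets non-negative
    vectors. *)
Definition sdesc p := exists d nu, [/\ desc d, signs nu & p = (d * nu)%g].

Lemma desc_sdesc d : desc d -> sdesc d.
Proof. by move=> Dd; exists d, 1%g; rewrite mulg1; split=> //; apply: sgen1. Qed.

Lemma desc_x d i j : i != j -> (i <= o)%N -> (j <= o)%N -> desc d ->
  desc (d * x i j)%g.
Proof.
move=> ij io jo Dd; have := desc_ge0 j Dd; rewrite le_eqVlt => /orP [/eqP e|]; last first.
  exact: desc_step.
have [Sx _] := desc_zero Dd (esym e) jo.
have -> : (d * x i j = d * x i j * d^-1 * d)%g by rewrite mulgVK.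
by apply: desc_stabM => //; apply: Sx.
Qed.

(** By confluence, any step that the vector allows to undo may be taken as the last one. *)
Lemma desc_xV_le d i j : i != j -> (i <= o)%N -> (j <= o)%N -> desc d ->
  v d j <= v d i -> desc (d * (x i j)^-1)%g.
Proof.
move=> ij io jo Dd le; have := desc_ge0 j Dd; rewrite le_eqVlt => /orP [/eqP e|vj].
  have [Sx _] := desc_zero Dd (esym e) jo.
  have -> : (d * (x i j)^-1 = (d * x i j * d^-1)^-1 * d)%g.
    by rewrite !invgM invgK -!mulgA mulVg mulg1.
  by apply: desc_stabM => //; apply/sgen_V/Sx.
have [m|m om|c Dc vc] := @exists_desc_vec (d * (x i j)^-1)%g.
- by rewrite v_xV //; case: eqP => [->|_]; rewrite ?subr0 ?desc_ge0 ?subr_ge0.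
- rewrite v_xV // (desc_supp Dd om); case: eqP => [ek|_]; last by rewrite subr0.
  by rewrite ek ltnNge io in om.
have vcj : 0 < v c j by rewrite vc v_xV // eq_sym (negPf ij) subr0.
have cd : d ~ (c * x i j)%g.
  apply: desc_uniq => //; first exact: desc_step.
  by move=> m; rewrite (v_eqM _ vc) mulgVK.
have -> : (d * (x i j)^-1 = d * (c * x i j)^-1 * c)%g.
  by rewrite invgM -!mulgA mulVg mulg1.
exact: desc_stabM.
Qed.

(** When the difference would be negative the opposite subtraction is made instead, and [er_xV]
    recovers the wanted element at the price of one sign change. *)
Lemma sdesc_xV d i j : i != j -> (i <= o)%N -> (j <= o)%N -> desc d ->
  sdesc (d * (x i j)^-1)%g.
Proof.
move=> ij io jo Dd; have ji : j != i by rewrite eq_sym.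
have [le|lt] := lerP (v d j) (v d i); first exact/desc_sdesc/desc_xV_le.
exists (d * (x j i)^-1 * s i j * x j i)%g, (f i); split.
- by apply: desc_x => //; apply: desc_s => //; apply: desc_xV_le => //; apply: ltW.
- by apply: sgen_in; exists i.
by rewrite (er_xV rel) // !mulgA.
Qed.

Lemma sdesc_elem p g : sdesc p -> elem o.+1 g -> sdesc (p * g)%g /\ sdesc (p * g^-1)%g.
Proof.
move=> [d [nu [Dd snu ->]]] [i j ij io jo|i io|i j io jo].
- have D1 := desc_sdesc (desc_x ij io jo Dd); have D2 := sdesc_xV ij io jo Dd.
  have mulr q : sdesc q -> sdesc (q * nu)%g.
    move=> [d' [nu' [Dd' snu' ->]]]; exists d', (nu' * nu)%g; split=> //.
      exact: sgen_M.
    by rewrite mulgA.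
  rewrite -!mulgA; case: (signs_x ij snu) => -[-> ->]; rewrite !mulgA;
    by split; apply: mulr.
- rewrite fV; suff D : sdesc (d * nu * f i)%g by [].
  exists d, (nu * f i)%g; split; rewrite ?mulgA //; apply: sgen_M => //.
  by apply: sgen_in; exists i.
rewrite sV; suff D : sdesc (d * nu * s i j)%g by [].
have [nu' snu' e] := signs_s io jo snu.
exists (d * s i j)%g, nu'; split=> //; first exact: desc_s.
by rewrite -!mulgA e.
Qed.

Lemma sdesc_sgen p a : sgen (elem o.+1) a -> sdesc p -> sdesc (p * a)%g.
Proof.
move=> ga; elim: ga p => [|g b eg _ IH|g b eg _ IH] p sp; first by rewrite mulg1.
  by rewrite mulgA; apply: IH; case: (sdesc_elem sp eg).
by rewrite mulgA; apply: IH; case: (sdesc_elem sp eg).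
Qed.

Lemma signs_v nu p m : signs nu -> v (p * nu)%g m = v p m \/ v (p * nu)%g m = - v p m.
Proof.
move=> snu; elim: snu p => [|a b [r _ ->] _ IH|a b [r _ ->] _ IH] p.
- by rewrite mulg1; left.
- rewrite mulgA; case: (IH (p * f r)%g) => ->; rewrite v_f; case: eqP;
    by rewrite ?opprK; auto.
rewrite fV mulgA; case: (IH (p * f r)%g) => ->; rewrite v_f; case: eqP;
  by rewrite ?opprK; auto.
Qed.

Lemma signs_lt_stab nu : signs_lt o nu -> stab nu.
Proof.
by apply: sgen_sub => b [i io ->]; apply/sgen_in/stab_elem/elem_f.
Qed.

Lemma signs_split nu : signs nu ->
  exists2 nu', signs_lt o nu' & nu = nu' \/ nu = (nu' * f o)%g.
Proof.
have fo nu' : signs_lt o nu' -> (f o * nu' = nu' * f o)%g.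
  elim=> [|a b [r _ ->] _ IH|a b [r _ ->] _ IH]; first by rewrite mulg1 mul1g.
    by rewrite mulgA (er_fC rel) -!mulgA IH.
  by rewrite fV mulgA (er_fC rel) -!mulgA IH.
have key (r : I) b : (r < o.+1)%N ->
    (exists2 nu', signs_lt o nu' & b = nu' \/ b = (nu' * f o)%g) ->
    exists2 nu', signs_lt o nu' & (f r * b)%g = nu' \/ (f r * b)%g = (nu' * f o)%g.
  move=> ro [nu' snu' e]; case: (eqVneq r o) => [->|ne].
    exists nu' => //; case: e => ->; rewrite ?mulgA fo //; first by right.
    by left; rewrite -mulgA (er_ff rel) mulg1.
  exists (f r * nu')%g.
    by apply: sgenM => //; exists r => //; apply: lt_le_neq.
  by case: e => ->; rewrite ?mulgA; auto.
elim=> [|a b [r ro ->] _ IH|a b [r ro ->] _ IH].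
- by exists 1%g; [apply: sgen1|left].
- exact: key.
by rewrite fV; apply: key.
Qed.

(** An element of the block is a descent followed by signs. If it fixes [e_o], the descent has
    vector [e_o] and lies in the stabiliser by uniqueness, and no sign change at [o] can remain. *)
Lemma stab_of p : sgen (elem o.+1) p -> v p =1 v 1%g -> stab p.
Proof.
move=> gp e; have [] := sdesc_sgen gp (desc_sdesc desc1); rewrite mul1g.
move=> d [nu [Dd snu ep]].
have vd : v d =1 v 1%g.
  move=> m; have := e m; rewrite v_1 ep; have := desc_ge0 m Dd.
  by case: (signs_v d m snu) => -> //; case: eqP => _ ge h; lia.
have Sd : stab d by rewrite -[d]mulg1 -invg1; apply: desc_uniq => //; apply: desc1.
have [nu' /signs_lt_stab snu' [en|en]] := signs_split snu.
  by rewrite ep en; apply: sgen_M.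
exfalso; have := e o; rewrite ep en mulgA v_f eqxx v_1 eqxx.
by rewrite v_stabM // v_stab // v_1 eqxx.
Qed.

Lemma stab_sgen p : stab p -> sgen (elem o.+1) p.
Proof.
apply: sgen_sub => b [a ea|j jo]; apply: sgen_in; first exact: elem_le (leqnSn o) ea.
by apply: elem_x => //; [rewrite eq_sym ltn_neq | apply: ltnW].
Qed.

Lemma desc_sgen p : desc p -> sgen (elem o.+1) p.
Proof.
elim=> [c i Sc io|q i j _ IH ij io jo _].
  by apply: sgen_M (stab_sgen Sc) _; apply/sgen_in/elem_s.
by apply: sgen_M IH _; apply/sgen_in/elem_x.
Qed.

(* Translations: the kernel of the restriction of the stabiliser to its
   block of size [o]. *)
Definition trans := sgen (fun p => exists2 j : I, (j < o)%N & p = x o j).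

Lemma on j : (j < o)%N -> o != j.
Proof. by move=> jo; rewrite eq_sym ltn_neq. Qed.

Lemma trans_conj g t : elem o g -> trans t ->
  trans (g * t * g^-1)%g /\ trans (g^-1 * t * g)%g.
Proof.
move=> eg.
have hom h : (forall j : I, (j < o)%N -> trans (h * x o j * h^-1)%g) ->
    trans t -> trans (h * t * h^-1)%g.
  move=> H; elim=> [|a b [j jo ->] _ IH|a b [j jo ->] _ IH].
  - by rewrite mulg1 mulgV; apply: sgen1.
  - have -> : (h * (x o j * b) * h^-1 = (h * x o j * h^-1) * (h * b * h^-1))%g.
      by rewrite !mulgA mulgVK.
    by apply: sgen_M IH; apply: H.
  have -> : (h * ((x o j)^-1 * b) * h^-1 = (h * x o j * h^-1)^-1 * (h * b * h^-1))%g.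
    by rewrite !invgM invgK !mulgA mulgVK.
  by apply: sgen_M IH; apply/sgen_V/H.
have tx j : (j < o)%N -> trans (x o j) by move=> jo; apply: sgen_in; exists j.
suff [H1 H2] : (forall j : I, (j < o)%N -> trans (g * x o j * g^-1)%g) /\
    (forall j : I, (j < o)%N -> trans (g^-1 * x o j * g)%g).
  by move=> tt; split; first exact: hom; rewrite -{2}[g]invgK; apply: hom;
    rewrite ?invgK.
case: eg => [i k ik io ko|i io|i k io ko].
- have oi := on io; have ok := on ko.
  have cxk : (x o i * x o k = x o k * x o i)%g.
    by rewrite (er_comm rel) // 1?eq_sym.
  have st : (x i k * x o i = x o i * x i k * x o k)%g by rewrite (er_steinberg rel).
  have ck : (x i k * x o k = x o k * x i k)%g.
    by rewrite (er_comm rel) // 1?eq_sym.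
  split=> j jo; have oj := on jo; case: (eqVneq i j) => [<-|ij].
  + have -> : (x i k * x o i * (x i k)^-1 = x o i * x o k)%g.
      by rewrite st -!mulgA; congr (_ * _)%g; rewrite mulgA ck mulgK.
    by apply: sgen_M; apply: tx.
  + by rewrite (er_comm rel ik oj ij) 1?eq_sym // mulgK; apply: tx.
  + have -> : ((x i k)^-1 * x o i * x i k = x o i * (x o k)^-1)%g.
      apply: (mulIg (x o k)); rewrite mulgVK; apply: (mulgI (x i k)).
      by rewrite !mulgA mulgV mul1g st.
    by apply: sgen_M; [apply: tx | apply/sgen_V/tx].
  by rewrite -mulgA -(er_comm rel ik oj ij) 1?eq_sym // mulKg; apply: tx.
- split=> j jo; rewrite fV; case: (f_x i (on jo)) => -[-> _];
    rewrite -!mulgA (er_ff rel) mulg1; [|apply: sgen_V| |apply: sgen_V]; exact: tx.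
have io' := on io; have ko' := on ko.
have H j : (j < o)%N -> trans (s i k * x o j * s i k)%g.
  move=> jo; rewrite (er_sx rel) ?on // -mulgA (er_ss rel) mulg1.
  rewrite [tperm _ _ o]tpermD 1?eq_sym //.
  by apply: tx; case: tpermP.
by split=> j jo; rewrite sV; apply: H.
Qed.

(** The smaller block normalises the translations ([trans_conj]), so translations can be collected
    on the left. *)
Lemma stab_split p : stab p ->
  exists t h, [/\ trans t, sgen (elem o) h & p = (t * h)%g].
Proof.
elim=> [|g b Sg _ [t [h [tt eh ->]]]|g b Sg _ [t [h [tt eh ->]]]].
- by exists 1%g, 1%g; split; rewrite ?mulg1 //; apply: sgen1.
- case: Sg => [{}g eg|j jo].
    exists (g * t * g^-1)%g, (g * h)%g; split.
    + by case: (trans_conj eg tt).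
    + exact: sgenM.
    by rewrite !mulgA mulgVK.
  exists (x o j * t)%g, h; split=> //; last by rewrite mulgA.
  by apply: sgenM => //; exists j.
case: Sg => [{}g eg|j jo].
  exists (g^-1 * t * g)%g, (g^-1 * h)%g; split.
  + by case: (trans_conj eg tt).
  + exact: sgenV.
  by rewrite !mulgA mulgK.
exists ((x o j)^-1 * t)%g, h; split=> //; last by rewrite mulgA.
by apply: sgenV => //; exists j.
Qed.

Lemma trv_mulE i (B : 'M[int]_n.+1) r m : o != i ->
  (trv_mx o i *m B) r m = B r m + (if r == i then B o m else 0).
Proof.
move=> ne; rewrite /trv_mx (negPf ne) mulmxDl mul1mx !mxE; congr (_ + _).
rewrite (bigD1 o) //= big1 ?addr0 => [|c /negPf nc]; rewrite mxE ?nc ?andbF ?mul0r //.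
by rewrite eqxx andbT; case: eqP; rewrite ?mul1r ?mul0r.
Qed.

Lemma trvi_mulE i (B : 'M[int]_n.+1) r m : o != i ->
  (trvi_mx o i *m B) r m = B r m - (if r == i then B o m else 0).
Proof.
move=> ne; rewrite /trvi_mx (negPf ne) mulmxBl mul1mx !mxE; congr (_ - _).
rewrite (bigD1 o) //= big1 ?addr0 => [|c /negPf nc]; rewrite mxE ?nc ?andbF ?mul0r //.
by rewrite eqxx andbT; case: eqP; rewrite ?mul1r ?mul0r.
Qed.

(** With natural exponents and a fixed order of the indices; a general translation is a quotient of
    two such products. *)
Definition tprod (a : I -> nat) : P :=
  pr (fun j => x o j ^+ a j)%g [seq j : I <- enum I | (j < o)%N].

Lemma tprodM (a b : I -> nat) :
  (tprod a * tprod b)%g = tprod (fun j => (a j + b j)%N).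
Proof.
have : all (fun j : I => (j < o)%N) [seq j : I <- enum I | (j < o)%N].
  exact: filter_all.
rewrite /tprod; elim: [seq _ <- _ | _] => [|j l IH] /=; first by rewrite mulg1.
case/andP=> jo al; rewrite -IH // expgnDr -!mulgA; congr (_ * _)%g.
rewrite !mulgA; congr (_ * _)%g; move: al; elim: l {IH} => [|k l IH] /=.
  by rewrite mulg1 mul1g.
case/andP=> ko al; rewrite -mulgA IH // !mulgA; congr (_ * _)%g.
apply: commuteX2; case: (eqVneq j k) => [->|_]; first by [].
by rewrite /commute (er_comm rel) ?on // eq_sym on.
Qed.

Lemma eq_tprod (a b : I -> nat) :
  (forall j : I, (j < o)%N -> a j = b j) -> tprod a = tprod b.
Proof.
move=> e; have : all (fun j : I => (j < o)%N) [seq j : I <- enum I | (j < o)%N].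
  exact: filter_all.
rewrite /tprod; elim: [seq _ <- _ | _] => //= j l IH /andP [jo /IH ->].
by rewrite e.
Qed.

Lemma tprod1 (i : I) : (i < o)%N -> tprod (fun j => (j == i)) = x o i.
Proof.
move=> io; have : i \in [seq j : I <- enum I | (j < o)%N].
  by rewrite mem_filter io mem_enum.
have : uniq [seq j : I <- enum I | (j < o)%N] by rewrite filter_uniq // enum_uniq.
rewrite /tprod; elim: [seq _ <- _ | _] => //= j l IH /andP [jl ul].
rewrite inE; case: (eqVneq i j) => [ij|ij] /=; last first.
  by rewrite mul1g; apply: IH.
subst j; rewrite ?eqxx expg1 => _; rewrite -[RHS]mulg1; congr (_ * _)%g.
elim: l {IH ul} jl => //= k l IH; rewrite inE negb_or => /andP [ik /IH ->].
by rewrite eq_sym (negPf ik) mul1g.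
Qed.

Lemma trans_stab t : trans t -> stab t.
Proof. by apply: sgen_sub => b [j jo ->]; apply/sgen_in/stab_x. Qed.

Lemma trans_tprod t : trans t -> exists a c : I -> nat,
  t = (tprod a * (tprod c)^-1)%g /\
  (forall j : I, (j < o)%N -> uval (act t) j o = (a j)%:Z - (c j)%:Z).
Proof.
have too b : trans b -> uval (act b) o o = 1.
  by move=> /trans_stab /v_stab /(_ o); rewrite v_1 eqxx.
have T0 : tprod (fun=> 0%N) = 1%g.
  by rewrite /tprod; elim: [seq _ <- _ | _] => //= j l ->; rewrite mulg1.
elim=> [|b d [i io ->] td [a [c [e ej]]]|b d [i io ->] td [a [c [e ej]]]].
- exists (fun=> 0%N), (fun=> 0%N); rewrite T0 mulgV; split=> // j jo.
  by rewrite act1 mxE ltn_neq.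
- exists (fun j => ((j == i) + a j)%N), c; split.
    by rewrite e mulgA -(tprod1 io) tprodM.
  move=> j jo; rewrite actM uvalM act_x [LHS]trv_mulE ?on // ej // too //.
  by case: (j == i); lia.
exists a, (fun j => ((j == i) + c j)%N); split.
  have cx (b' : I -> nat) : commute (x o i) (tprod b').
    rewrite /commute -(tprod1 io) !tprodM; apply: eq_tprod => j _; exact: addnC.
  rewrite -tprodM invgM e (tprod1 io) [RHS]mulgA.
  apply: (commute_sym (commuteV _)); apply: commute_sym; apply: commuteM (cx _) _.
  exact/commuteV/cx.
move=> j jo; rewrite actM uvalM actV act_x trvV [LHS]trvi_mulE ?on // ej // too //.
by case: (j == i); lia.
Qed.

Lemma trans_triv t : trans t ->
  (forall j : I, (j < o)%N -> uval (act t) j o = 0) -> t = 1%g.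
Proof.
move=> /trans_tprod [a [c [-> ej]]] z.
rewrite (@eq_tprod a c) ?mulgV // => j jo.
by have := z j jo; rewrite ej //; lia.
Qed.

Lemma elem_col h : sgen (elem o) h ->
  uval (act h) *m delta_mx o (0 : 'I_1) = delta_mx o 0.
Proof.
have cE b : elem o b -> uval (act b) *m delta_mx o (0 : 'I_1) = delta_mx o 0.
  case=> [i j ij io jo|i io|i j io jo].
  - rewrite act_x /= /trv_mx (negPf ij) mulmxDl mul1mx mul_delta_mx_0 ?addr0 //.
    by rewrite ltn_neq.
  - rewrite act_f; apply/matrixP => r m.
    rewrite -[uval _]/(flip_mx i) /flip_mx mul_diag_mx !mxE.
    by case: (eqVneq r i) => [->|_]; rewrite ?mul1r // ltn_neq // mulr0.
  rewrite act_s -[LHS]xrowE; apply/matrixP => r m; rewrite !mxE.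
  by case: tpermP => [->|->|_ _]; rewrite ?(ltn_neq io) ?(ltn_neq jo).
elim=> [|b d /cE eb _ IH|b d /cE eb _ IH]; first by rewrite act1 mul1mx.
  by rewrite actM uvalM -mulmxA IH.
rewrite actM uvalM -mulmxA IH actV uvalV -{1}eb mulmxA.
by rewrite -[(_^-1 *m _)]/(_^-1 * _) mulVr ?mul1mx // uvalP.
Qed.

(** Column [o] of the matrix of a translation shows its exponents, while the smaller block leaves
    the column [e_o] fixed. Hence the translation part of an element acting trivially is 1. *)
Lemma stab_faithful p : (forall h, sgen (elem o) h -> act h = 1%g -> h = 1%g) ->
  stab p -> act p = 1%g -> p = 1%g.
Proof.
move=> IH /stab_split [t [h [tt eh ->]]] e.
have t1 : t = 1%g.
  apply: trans_triv => // j jo.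
  have et : act t = act (h^-1)%g.
    by rewrite actV; apply: (mulIg (act h)); rewrite -actM e mulVg.
  have := elem_col (sgen_V eh); rewrite -et => /matrixP /(_ j 0).
  rewrite -colE !mxE eqxx andbT => ->.
  by rewrite ltn_neq.
by move: e; rewrite t1 mul1g; apply: IH.
Qed.

End Level.

(* Norm-decreasing steps carry an element of the block into the stabiliser of
   the last basis vector; by confluence two reductions of the same vector differ
   by the stabiliser, which is an extension of the smaller block. *)
Lemma elem_faithful (k : nat) : (k <= n.+1)%N ->
  forall p, sgen (elem k) p -> act p = 1%g -> p = 1%g.
Proof.
elim: k => [|k IH] kn p.
  elim=> // a b [] //.
move=> gp e; pose o : I := Ordinal kn.
apply: (@stab_faithful o) => //; first by apply: IH; apply: ltnW.
by apply: (@stab_of o) => // m; rewrite /v e act1.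
Qed.

End Descent.

(** * Generation and presentation of GL_n(Z) *)

Section GLZ.
Import GRing.Theory Num.Theory Order.TTheory.
Variable n : nat.
Local Notation I := 'I_n.+1.
Local Notation GL := (ugroup 'M[int]_n.+1).
Local Notation x := (@trv n).
Local Notation f := (@flip n).
Local Notation s := (@exch n).
Local Notation el := (elem x f s).
Local Open Scope ring_scope.

Let idM : {morph (@id GL) : a b / (a * b)%g}. Proof. by []. Qed.
Let rel := elem_rels_matrix n.
Let ax (i j : I) : id (x i j) = trv i j. Proof. by []. Qed.
Let af (i : I) : id (f i) = flip i. Proof. by []. Qed.
Let as_ (i j : I) : id (s i j) = exch i j. Proof. by []. Qed.

Definition blk k (g : GL) := forall i j : I, (k <= i)%N || (k <= j)%N ->
  uval g i j = (i == j)%:R.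

Lemma sum_delta (F : I -> int) i : \sum_r (i == r)%:R * F r = F i.
Proof.
rewrite (bigD1 i) //= eqxx mul1r big1 ?addr0 // => r /negPf.
by rewrite eq_sym => ->; rewrite mul0r.
Qed.

Lemma sum_deltar (F : I -> int) i : \sum_r F r * (r == i)%:R = F i.
Proof.
by rewrite -[RHS]sum_delta; apply: eq_bigr => r _; rewrite mulrC eq_sym.
Qed.

Lemma blkM k g h : blk k g -> blk k h -> blk k (g * h)%g.
Proof.
move=> bg bh i j ij; rewrite uvalM mxE.
have [ki|ik] := leqP k i.
  rewrite -(bh i j ij) -(sum_delta (fun r => uval h r j)); apply: eq_bigr => r _.
  by rewrite bg ?ki.
have kj : (k <= j)%N by move: ij; rewrite leqNgt ik.
rewrite -(bg i j ij) -(sum_deltar (fun r => uval g i r)); apply: eq_bigr => r _.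
by rewrite bh ?kj ?orbT.
Qed.

Lemma blkV k g : blk k g -> blk k g^-1%g.
Proof.
move=> bg i j ij; have [ki|ik] := leqP k i.
  have /(congr1 (fun h : GL => uval h i j)) := mulgV g.
  rewrite uvalM !mxE /= => <-; rewrite -[LHS](sum_delta (fun r => uval g^-1%g r j)); apply: eq_bigr => r _.
  by rewrite bg ?ki.
have kj : (k <= j)%N by move: ij; rewrite leqNgt ik.
have /(congr1 (fun h : GL => uval h i j)) := mulVg g.
rewrite uvalM !mxE /= => <-; rewrite -[LHS](sum_deltar (fun r => uval g^-1%g i r)); apply: eq_bigr => r _.
by rewrite bg ?kj ?orbT.
Qed.

Lemma blk_elem (k : nat) g : el k g -> blk k g.
Proof.
have ne (i r : I) : (i < k)%N -> (k <= r)%N -> (r == i) = false.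
  by move=> ik kr; apply/eqP => e; rewrite e leqNgt ik in kr.
case=> [i j ij ik jk|i ik|i j ik jk] r m; rewrite /= ?/trv_mx ?(negPf ij) !mxE.
- by case/orP=> h; rewrite ?(ne _ _ ik h) ?(ne _ _ jk h) ?andbF ?addr0.
- case: (eqVneq r i) => [->|_] //; case/orP=> h; first by rewrite leqNgt ik in h.
  by rewrite [i == m]eq_sym (ne _ _ ik h) mulr0n.
case/orP=> h; first by rewrite tpermD 1?eq_sym ?(ne _ _ ik h) ?(ne _ _ jk h).
suff -> : (tperm i j r == m) = (r == m) by [].
rewrite -(inj_eq (@perm_inj _ (tperm i j))) tpermK.
by rewrite [tperm i j m]tpermD 1?eq_sym ?(ne _ _ ik h) ?(ne _ _ jk h).
Qed.

Lemma blk_sgen (k : nat) g : sgen (el k) g -> blk k g.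
Proof.
elim=> [|a b /blk_elem ba _ IH|a b /blk_elem ba _ IH].
- by move=> i j _; rewrite mxE.
- exact: blkM.
by apply: blkM IH; apply: blkV.
Qed.

Section Level.
Variable o : I.
Local Notation v := (v (@id GL) o).

Lemma nonneg_signs g : (forall m : I, (o < m)%N -> v g m = 0) ->
  exists2 nu, signs f o nu & forall m, 0 <= v (g * nu)%g m.
Proof.
move=> supp.
suff [nu [snu h1 h2]] : exists nu, [/\ signs f o nu,
    forall m, v (g * nu)%g m = v g m \/ v (g * nu)%g m = - v g m
    & forall m, m \in enum I -> 0 <= v (g * nu)%g m].
  by exists nu => // m; apply: h2; rewrite mem_enum.
elim: (enum I) => [|i l [nu [snu h1 h2]]].
  by exists 1%g; split=> // [|m]; [apply: sgen1 | rewrite mulg1; left].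
have [ge|lt] := lerP 0 (v (g * nu)%g i).
  exists nu; split=> // m; rewrite inE => /orP [/eqP->//|]; exact: h2.
have io : (i <= o)%N.
  rewrite leqNgt; apply/negP => /supp z.
  by case: (h1 i) lt => ->; rewrite z ?oppr0 ltxx.
exists (nu * f i)%g; rewrite mulgA; split=> [|m|m].
- by apply: sgen_M => //; apply: sgen_in; exists i.
- rewrite (v_f idM af); case: eqP => _ //; case: (h1 m) => ->; rewrite ?opprK; auto.
rewrite (v_f idM af) inE; case: eqP => [->|_] /=; last exact: h2.
by rewrite oppr_ge0 ltW.
Qed.

Lemma trans_add (i : I) (b : int) (g : GL) : (i < o)%N ->
    (forall m, uval g o m = (o == m)%:R) ->
  exists2 t, sgen (el o.+1) t & forall r m, uval (t * g)%g r m =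
    uval g r m + (if (r == i) && (m == o) then b else 0).
Proof.
move=> io go; have oi : o != i by rewrite eq_sym (ltn_neq io).
have ex : el o.+1 (x o i) by apply: elem_x => //; apply: ltnW.
have oo (r m : I) : (if r == i then (o == m)%:R else 0 : int) =
    (if (r == i) && (m == o) then 1 else 0).
  by rewrite [o == m]eq_sym; case: (r == i); case: (m == o).
have row (t : GL) c : (forall r m, uval (t * g)%g r m =
    uval g r m + (if (r == i) && (m == o) then c else 0)) ->
    forall m, uval (t * g)%g o m = (o == m)%:R.
  by move=> h m; rewrite h (negPf oi) addr0.
case: b => b.
  elim: b => [|b [t gt ht]].
    exists 1%g => [|r m]; first exact: sgen1.
    by rewrite mul1g; case: ifP; rewrite addr0.
  exists (x o i * t)%g => [|r m]; first exact: sgenM.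
  rewrite -mulgA uvalM [LHS]trv_mulE // ht (row t b%:Z ht) oo.
  by case: andP => _; lia.
elim: b => [|b [t gt ht]].
  exists (x o i)^-1%g => [|r m]; first by apply/sgen_V/sgen_in.
  rewrite uvalM trvV [LHS]trvi_mulE // go oo NegzE.
  by case: andP => _; rewrite ?subr0 ?addr0.
exists ((x o i)^-1 * t)%g => [|r m]; first exact: sgenV.
rewrite -mulgA uvalM trvV [LHS]trvi_mulE // ht (row t (Negz b) ht) oo !NegzE.
by case: andP => _; lia.
Qed.

Lemma trans_clear (g : GL) : (forall m, uval g o m = (o == m)%:R) ->
  exists2 t, sgen (el o.+1) t & forall r m : I, uval (t * g)%g r m =
    if (r < o)%N && (m == o) then 0 else uval g r m.
Proof.
move=> go.
suff [t gt ht] : exists2 t, sgen (el o.+1) t & forall r m : I, uval (t * g)%g r m =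
    if [&& (r \in enum I), (r < o)%N & m == o] then 0 else uval g r m.
  by exists t => // r m; rewrite ht mem_enum.
elim: (enum I) => [|i l [t gt ht]].
  by exists 1%g => [|r m]; [apply: sgen1 | rewrite mul1g].
have [io|oi] := ltnP i o; last first.
  exists t => // r m; rewrite ht inE; case: (eqVneq r i) => // -> /=.
  by rewrite ltnNge oi /= andbF.
have tgo m : uval (t * g)%g o m = (o == m)%:R by rewrite ht ltnn andbF go.
have [t' gt' ht'] := trans_add (- uval (t * g)%g i o) io tgo.
exists (t' * t)%g => [|r m]; first exact: sgen_M.
rewrite -mulgA ht' inE; case: (eqVneq r i) => [->|ri] /=; last by rewrite ht addr0.
rewrite io; case: (eqVneq m o) => [->|mo] /=; first by rewrite addrN.
by rewrite addr0 ht (negPf mo) !andbF.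
Qed.

End Level.

(** Row [o] is made non-negative by signs and brought to [e_o] by Euclid's algorithm, and
    translations clear column [o]; what remains lies in the smaller block. *)
Lemma blk_gen (k : nat) : (k <= n.+1)%N -> forall g, blk k g -> sgen (el k) g.
Proof.
elim: k => [|k IH] kn g bg.
  suff -> : g = 1%g by apply: sgen1.
  by apply: val_inj; apply/matrixP => i j; rewrite bg // mxE.
pose o : I := Ordinal kn.
have supp (m : I) : (o < m)%N -> v (@id GL) o g m = 0.
  move=> om; rewrite /v bg ?om ?orbT //; case: eqP => // e.
  by rewrite -e ltnn in om.
have [nu snu ge] := nonneg_signs supp.
have gnu : sgen (el o.+1) nu.
  by apply: sgen_sub snu => b [i io ->]; apply/sgen_in/elem_f.
have bgn : blk o.+1 (g * nu)%g by apply: blkM => //; apply: blk_sgen.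
have supp' (m : I) : (o < m)%N -> v (@id GL) o (g * nu)%g m = 0.
  move=> om; rewrite /v bgn ?om ?orbT //; case: eqP => // e.
  by rewrite -e ltnn in om.
have [c Dc vc] := exists_desc_vec idM ax af as_ ge supp'.
have gc : sgen (el o.+1) c by apply: desc_sgen Dc.
have go m : uval (g * nu * c^-1)%g o m = (o == m)%:R.
  have := v_eqM idM c^-1%g vc m; rewrite mulgV /v => <-.
  by rewrite mxE.
have [t gt ht] := trans_clear go.
have bt : blk k (t * (g * nu * c^-1))%g.
  move=> i j ij; rewrite ht.
  have bg1 : blk o.+1 (g * nu * c^-1)%g.
    by apply: blkM => //; apply/blkV/blk_sgen.
  have [io|oi] := ltnP i o.
    have [jo|jo] := eqVneq j o; first by case: eqP => // e; rewrite e jo ltnn in io.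
    apply: bg1; move: ij; rewrite leqNgt io /= => kj.
    by rewrite (ltn_neqAle k j) kj andbT; apply/orP; right; rewrite eq_sym.
  case: (eqVneq i o) => [->|io]; first exact: go.
  by apply: bg1; rewrite (ltn_neqAle k i) oi andbT [k == i]eq_sym (_ : (i : nat) == k = false) //; apply/negbTE.
have -> : g = (t^-1 * (t * (g * nu * c^-1)) * c * nu^-1)%g.
  by rewrite mulKg mulgVK mulgK.
apply: sgen_M (sgen_V gnu); apply: sgen_M gc; apply: sgen_M (sgen_V gt) _.
apply: sgen_sub (IH (ltnW kn) _ bt) => b eb; apply: sgen_in.
exact: elem_le (leqnSn k) eb.
Qed.

Lemma gl_gen g : sgen (el n.+1) g.
Proof.
apply: blk_gen => // i j; case/orP=> h.
  by have := ltn_ord i; rewrite ltnNge h.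
by have := ltn_ord j; rewrite ltnNge h.
Qed.

Definition gl_base : seq GL :=
  flatten [seq [:: x p.1 p.2; (x p.1 p.2)^-1%g; s p.1 p.2] | p : I * I]
  ++ map f (enum I).

Lemma gl_base_x i j : x i j \in gl_base.
Proof.
rewrite mem_cat; apply/orP; left; apply/flattenP.
exists [:: x i j; (x i j)^-1%g; s i j]; last by rewrite !inE eqxx.
by apply/mapP; exists (i, j); rewrite ?mem_enum.
Qed.

Lemma gl_base_xV i j : (x i j)^-1%g \in gl_base.
Proof.
rewrite mem_cat; apply/orP; left; apply/flattenP.
exists [:: x i j; (x i j)^-1%g; s i j]; last by rewrite !inE eqxx orbT.
by apply/mapP; exists (i, j); rewrite ?mem_enum.
Qed.

Lemma gl_base_s i j : s i j \in gl_base.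
Proof.
rewrite mem_cat; apply/orP; left; apply/flattenP.
exists [:: x i j; (x i j)^-1%g; s i j]; last by rewrite !inE eqxx !orbT.
by apply/mapP; exists (i, j); rewrite ?mem_enum.
Qed.

Lemma gl_base_f i : f i \in gl_base.
Proof. by rewrite mem_cat map_f ?orbT // mem_enum. Qed.

Lemma gl_baseP b : b \in gl_base ->
  (exists i j, b = x i j \/ b = (x i j)^-1%g \/ b = s i j) \/ (exists i, b = f i).
Proof.
rewrite mem_cat => /orP [/flattenP [l /mapP [[i j] _ ->]]|/mapP [i _ ->]].
  by rewrite !inE => /or3P [] /eqP->; left; exists i, j; auto.
by right; exists i.
Qed.

Lemma gl_baseV b : b \in gl_base -> b^-1%g \in gl_base.
Proof.
case/gl_baseP=> [[i [j [->|[->|->]]]]|[i ->]].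
- exact: gl_base_xV.
- by rewrite invgK; apply: gl_base_x.
- by rewrite (sV rel) gl_base_s.
by rewrite (fV rel) gl_base_f.
Qed.

Lemma rels_elem (Q : groupType) (h : GL -> Q) : rels h gl_base 4 ->
  elem_rels (fun i j => h (x i j)) (fun i => h (f i)) (fun i j => h (s i j)).
Proof.
move=> r.
have E w w' : all (mem gl_base) w -> all (mem gl_base) w' ->
    (size w <= 4)%N && (size w' <= 4)%N -> pr id w = pr id w' -> pr h w = pr h w'.
  by move=> bw bw' /andP [sw sw']; apply: r.
have memE := (gl_base_x, gl_base_xV, gl_base_s, gl_base_f).
have hV i j : h (x i j)^-1%g = (h (x i j))^-1%g.
  have := E [:: x i j; (x i j)^-1%g] [::].
  by rewrite /= !memE !mulg1 => h1; apply/esym/mulg1_eq/h1; rewrite ?mulgV.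
split.
- move=> i j k l ij kl il jk; have := E [:: x i j; x k l] [:: x k l; x i j].
  by rewrite /= !memE !mulg1; apply=> //; apply: (er_comm rel).
- move=> i j l ij jl il; have := E [:: x j l; x i j] [:: x i j; x j l; x i l].
  by rewrite /= !memE !mulg1 !mulgA; apply=> //; apply: (er_steinberg rel).
- move=> i j; have := E [:: s i j; s i j] [::].
  by rewrite /= !memE !mulg1; apply=> //; apply: (er_ss rel).
- move=> i j; have := E [:: s i j] [:: s j i].
  by rewrite /= !memE !mulg1; apply=> //; apply: (er_sC rel).
- move=> i; have := E [:: s i i] [::].
  by rewrite /= !memE !mulg1; apply=> //; apply: (er_s1 rel).
- move=> a b i j ij.
  have := E [:: s a b; x i j] [:: x (tperm a b i) (tperm a b j); s a b].
  by rewrite /= !memE !mulg1; apply=> //; apply: (er_sx rel).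
- move=> a b i; have := E [:: s a b; f i] [:: f (tperm a b i); s a b].
  by rewrite /= !memE !mulg1; apply=> //; apply: (er_sf rel).
- move=> a b i j.
  have := E [:: s a b; s i j] [:: s (tperm a b i) (tperm a b j); s a b].
  by rewrite /= !memE !mulg1; apply=> //; apply: (er_sJ rel).
- move=> i; have := E [:: f i; f i] [::].
  by rewrite /= !memE !mulg1; apply=> //; apply: (er_ff rel).
- move=> i j; have := E [:: f i; f j] [:: f j; f i].
  by rewrite /= !memE !mulg1; apply=> //; apply: (er_fC rel).
- move=> k i j ij ki kj; have := E [:: f k; x i j] [:: x i j; f k].
  by rewrite /= !memE !mulg1; apply=> //; apply: (er_fx rel).
- move=> i j ij; have := E [:: f i; x i j] [:: (x i j)^-1%g; f i].
  by rewrite /= !memE !mulg1 hV; apply=> //; apply: (er_fxi rel).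
- move=> i j ij; have := E [:: f j; x i j] [:: (x i j)^-1%g; f j].
  by rewrite /= !memE !mulg1 hV; apply=> //; apply: (er_fxj rel).
- move=> i j ij.
  have := E [:: (x i j)^-1%g] [:: (x j i)^-1%g; s i j; x j i; f i].
  by rewrite /= !memE !mulg1 !mulgA !hV; apply=> //; apply: (er_xV rel).
move=> i j ij.
have := E [:: x j i; s i j; (x j i)^-1%g] [:: x i j; f j].
by rewrite /= !memE !mulg1 !mulgA !hV; apply=> //; apply: (er_xs rel).
Qed.

Lemma pair_elem_rels (P Q : groupType) (x1 : I -> I -> P) f1 s1
    (x2 : I -> I -> Q) f2 s2 : elem_rels x1 f1 s1 -> elem_rels x2 f2 s2 ->
  elem_rels (fun i j => (x1 i j, x2 i j) : (P * Q)%type)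
    (fun i => (f1 i, f2 i)) (fun i j => (s1 i j, s2 i j)).
Proof.
have E (a b c d : P) (a' b' c' d' : Q) :
  (a * b = c)%g -> (a' * b' = c')%g -> ((a, a') * (b, b') = (c, c') :> P * Q)%g.
  by move=> <- <-.
move=> r1 r2; split.
- by move=> i j k l ij kl il jk; congr (_, _); [apply: (er_comm r1)|apply: (er_comm r2)].
- by move=> i j l ij jl il; congr (_, _); [apply: (er_steinberg r1)|apply: (er_steinberg r2)].
- by move=> i j; congr (_, _); [apply: (er_ss r1)|apply: (er_ss r2)].
- by move=> i j; congr (_, _); [apply: (er_sC r1)|apply: (er_sC r2)].
- by move=> i; congr (_, _); [apply: (er_s1 r1)|apply: (er_s1 r2)].
- by move=> a b i j ij; congr (_, _); [apply: (er_sx r1)|apply: (er_sx r2)].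
- by move=> a b i; congr (_, _); [apply: (er_sf r1)|apply: (er_sf r2)].
- by move=> a b i j; congr (_, _); [apply: (er_sJ r1)|apply: (er_sJ r2)].
- by move=> i; congr (_, _); [apply: (er_ff r1)|apply: (er_ff r2)].
- by move=> i j; congr (_, _); [apply: (er_fC r1)|apply: (er_fC r2)].
- by move=> k i j ij ki kj; congr (_, _); [apply: (er_fx r1)|apply: (er_fx r2)].
- by move=> i j ij; congr (_, _); [apply: (er_fxi r1)|apply: (er_fxi r2)].
- by move=> i j ij; congr (_, _); [apply: (er_fxj r1)|apply: (er_fxj r2)].
- by move=> i j ij; congr (_, _); [apply: (er_xV r1)|apply: (er_xV r2)].
by move=> i j ij; congr (_, _); [apply: (er_xs r1)|apply: (er_xs r2)].
Qed.

(** The pairs of a generator and its image in [Q] satisfy the elementary relations. By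
    [elem_faithful] the group they generate embeds through its first component, so a word of value 1
    has image 1. *)
Lemma gl_int_fpres : fpres (fun _ : GL => True).
Proof.
(* Four is the number of letters on the longer side of [er_xV], the longest relation. *)
exists gl_base, 4; split; first exact: gl_baseV.
- move=> a; split=> // _; elim: (gl_gen a) => [|b c eb _ [w Bw <-]|b c eb _ [w Bw <-]].
  + by exists [::].
  + exists (b :: w); rewrite //= Bw andbT.
    by case: eb => *; rewrite ?gl_base_x ?gl_base_f ?gl_base_s.
  exists (b^-1%g :: w); rewrite //= Bw andbT; apply: gl_baseV.
  by case: eb => *; rewrite ?gl_base_x ?gl_base_f ?gl_base_s.
move=> Q h r w Bw e; have relQ := rels_elem r.
have relP := pair_elem_rels rel relQ.
pose PQ : groupType := (GL * Q)%type.
pose pg (a : GL) (q : Q) : PQ := (a, q).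
pose xP i j := pg (x i j) (h (x i j)).
pose fP i := pg (f i) (h (f i)).
pose sP i j := pg (s i j) (h (s i j)).
have faith := @elem_faithful n PQ fst xP fP sP _ relP _ _ _ n.+1 (leqnn _).
suff E : pg (pr id w) (pr h w) = 1%g by case: E.
apply: faith => //; elim: w Bw {e} => [|b w IH] /=; first by move=> _; apply: sgen1.
case/andP=> Bb Bw; rewrite -[pg _ _]/(pg b (h b) * pg (pr id w) (pr h w))%g.
apply: sgen_M (IH Bw).
(* [elem] leaves out the pairs [i = j], where the generator is 1; its image is 1 by a relation of
   length two. *)
have sx i j : sgen (elem xP fP sP n.+1) (xP i j).
  case: (eqVneq i j) => [->|ij]; last by apply/sgen_in/elem_x.
  have x1 : x j j = 1%g by apply: val_inj; rewrite /= /trv_mx eqxx.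
  have h1 : h 1%g = 1%g.
    have := r [:: x j j; x j j] [:: x j j]; rewrite /= !gl_base_x x1 !mulg1.
    by move/(_ isT isT isT isT erefl) => hh; apply: (mulgI (h 1%g)); rewrite hh mulg1.
  by rewrite /xP x1 h1; apply: sgen1.
case/gl_baseP: Bb => [[i [j [->|[->|->]]]]|[i ->]] //.
- exact: sx.
- have E : (xP i j)^-1%g = pg (x i j)^-1%g (h (x i j)^-1%g).
    congr (_, _); apply/mulg1_eq.
    have := r [:: x i j; (x i j)^-1%g] [::].
    by rewrite /= gl_base_x gl_base_xV !mulg1 mulgV; apply.
  exact: (eq_ind _ (sgen _) (sgen_V (sx i j)) _ E).
- exact: sgen_in (elem_s _ _ _ (ltn_ord i) (ltn_ord j)).
exact: sgen_in (elem_f _ _ _ (ltn_ord i)).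
Qed.

End GLZ.

(** * Presentation of GL_n(Z[1/m]) *)

(* Groups of fractions [M D^-1] of a monoid [M] with unit group [U] in which
   every element [c] has a greatest common left divisor with the central
   element [D]. Greedy factorisations lift from the divisors of [D] to [M]. *)
Section Fractions.
Local Open Scope group_scope.
Variables (G : groupType) (U M : G -> Prop) (B : seq G) (nB : nat).
Variables (len : G -> nat) (D : G) (reps : seq G).

Hypothesis fU : fpres_by U B nB.
Hypothesis UM : forall u, U u -> M u.
Hypothesis MM : forall a b, M a -> M b -> M (a * b).
Hypothesis lenM : forall a b, M a -> M b -> len (a * b) = (len a + len b)%N.
Hypothesis len0 : forall a, M a -> len a = 0%N <-> U a.
Hypothesis MD : M D.
Hypothesis DC : forall a, M a -> a * D = D * a.

Definition divD k := M k /\ M (k^-1 * D).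

Hypothesis gcdD : forall c, M c -> exists h, [/\ divD h, M (h^-1 * c),
  (0 < len c)%N -> (0 < len h)%N &
  forall e, divD e -> M (e^-1 * c) -> M (e^-1 * h)].
Hypothesis reps_div : forall r, r \in reps -> divD r.
Hypothesis repsP : forall k, divD k -> exists2 r, r \in reps & U (r^-1 * k).

Definition fracs a := exists s, M (a * D ^+ s).

Let B' := B ++ reps ++ map (@inv G) reps.

Let U1 : U 1. Proof. exact: (fpres_1 fU). Qed.
Let UMul a b : U a -> U b -> U (a * b). Proof. exact: (fpres_M fU). Qed.
Let UV a : U a -> U a^-1. Proof. exact: (fpres_V fU). Qed.
Let M1 : M 1. Proof. exact: UM. Qed.
Let MX s : M (D ^+ s).
Proof. by elim: s => [|s IH]; rewrite ?expgS //; apply: MM. Qed.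

Let VC k : M k -> k^-1 * D = D * k^-1.
Proof. by move=> Mk; apply: (mulgI k); rewrite mulVKg mulgA DC // mulgK. Qed.

Let XC s a : M a -> a * D ^+ s = D ^+ s * a.
Proof. by move=> Ma; apply: commuteX; apply: DC. Qed.

Lemma divD_unitl u k : U u -> divD k -> divD (u * k).
Proof.
move=> Uu [Mk Mk']; split; first exact: MM (UM Uu) Mk.
by rewrite invgM -mulgA (VC (UM Uu)) mulgA; apply: MM (UM (UV Uu)).
Qed.

Lemma divD_unitr u k : U u -> divD k -> divD (k * u).
Proof.
move=> Uu [Mk Mk']; split; first exact: MM Mk (UM Uu).
by rewrite invgM -mulgA; apply: MM (UM (UV Uu)) _.
Qed.

Lemma divD_D : divD D. Proof. by split; rewrite ?mulVg. Qed.

Lemma divD_compl k : divD k -> divD (k^-1 * D).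
Proof.
by move=> [Mk Mk']; split=> //; rewrite (VC Mk) invgM invgK -mulgA mulVg mulg1.
Qed.

Lemma divD_right e h : M e -> divD h -> M (e^-1 * h) -> divD (e^-1 * h).
Proof.
move=> Me [Mh Mh'] Meh; split=> //.
by rewrite invgM invgK -mulgA DC // mulgA; apply: MM.
Qed.

Section Lift.
Variables (Q : groupType) (f phi : G -> Q).
Hypothesis phiM : forall a b, U a -> U b -> phi (a * b) = phi a * phi b.
Hypothesis phiB : forall b, b \in B -> phi b = f b.
Hypothesis fB : forall b r r', b \in B -> r \in reps -> r' \in reps ->
  U (r'^-1 * (b * r)) -> f b * f r = f r' * phi (r'^-1 * (b * r)).
Hypothesis fR : forall r r' r'', r \in reps -> r' \in reps -> r'' \in reps ->
  U (r''^-1 * (r * r')) -> f r * f r' = f r'' * phi (r''^-1 * (r * r')).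
Hypothesis fr : forall r r', r \in reps -> r' \in reps -> U (r'^-1 * r) ->
  f r = f r' * phi (r'^-1 * r).
Hypothesis fu : forall r, r \in reps -> U r -> f r = phi r.
Hypothesis fV : forall r, r \in reps -> f r^-1 = (f r)^-1.

Let phi1 : phi 1 = 1.
Proof. by apply: (mulgI (phi 1)); rewrite -phiM // !mulg1. Qed.

(** A divisor of [D] is a representative times a unit, which prescribes its value; [fr] makes the
    value independent of the representative. *)
Lemma beta_ex : exists beta : G -> Q, forall r u, r \in reps -> U u ->
  beta (r * u) = f r * phi u.
Proof.
have /choice [rp hrp] : forall k, exists r, (exists2 r', r' \in reps & U (r'^-1 * k)) ->
    r \in reps /\ U (r^-1 * k).
  move=> k; case: (pselect (exists2 r', r' \in reps & U (r'^-1 * k))) => h.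
    by case: (h) => r rr Ur; exists r.
  by exists 1.
exists (fun k => f (rp k) * phi ((rp k)^-1 * k)) => r u rr Uu.
have [|r' Ur'] := hrp (r * u); first by exists r; rewrite ?mulKg.
have Urr : U ((rp (r * u))^-1 * r).
  have -> : (rp (r * u))^-1 * r = ((rp (r * u))^-1 * (r * u)) * u^-1.
    by rewrite !mulgA mulgK.
  by apply: UMul (UV Uu).
by rewrite (fr rr r' Urr) -[RHS]mulgA -phiM // !mulgA.
Qed.

Variable beta : G -> Q.
Hypothesis betaE : forall r u, r \in reps -> U u -> beta (r * u) = f r * phi u.

Lemma divP k : divD k -> exists r u, [/\ r \in reps, U u & k = r * u].
Proof.
by move=> /repsP [r rr Ur]; exists r, (r^-1 * k); rewrite mulVKg.
Qed.

Lemma betaR k u : divD k -> U u -> beta (k * u) = beta k * phi u.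
Proof.
move=> /divP [r [v [rr Uv ->]]] Uu; rewrite -mulgA !betaE //; last exact: UMul.
by rewrite phiM // mulgA.
Qed.

Lemma betaL u k : U u -> divD k -> beta (u * k) = phi u * beta k.
Proof.
move=> /(fpres_word fU) [w Bw <-]; elim: w Bw k => [|b w IH] /= Bw k Dk.
  by rewrite phi1 !mul1g.
case/andP: Bw => Bb Bw; have Uw := fpres_pr fU Bw; have Ub := fpres_gen fU Bb.
rewrite phiM // -!mulgA -IH //.
have /divP [r [v [rr Uv ->]]] := divD_unitl Uw Dk.
have [r' rr' Ur'] := repsP (divD_unitl Ub (reps_div rr)).
have -> : b * (r * v) = r' * ((r'^-1 * (b * r)) * v) by rewrite !mulgA mulgV mul1g.
rewrite !betaE //; last exact: UMul.
by rewrite phiM // [LHS]mulgA -fB // (phiB Bb) !mulgA.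
Qed.

Lemma betaU u : U u -> divD u -> beta u = phi u.
Proof.
move=> Uu /divP [r [v [rr Uv e]]].
have Ur : U r by rewrite -[r](mulgK v) -e; apply: UMul (UV Uv).
by rewrite e betaE // phiM // fu.
Qed.

(** The unit between the two representatives is moved into the right factor by [betaL]; the product
    of two representatives is then governed by [fR]. *)
Lemma betaM k k' : divD k -> divD k' -> divD (k * k') ->
  beta (k * k') = beta k * beta k'.
Proof.
move=> /divP [r [v [rr Uv ->]]] Dk' Dkk'.
have Dv := divD_unitl Uv Dk'; rewrite (betaE rr Uv) -!mulgA -(betaL Uv Dk').
have [r' [v' [rr' Uv' ev]]] := divP Dv.
rewrite -mulgA ev in Dkk'; rewrite ev betaE //.
have Drr : divD (r * r').
  have -> : r * r' = (r * (r' * v')) * v'^-1 by rewrite !mulgA mulgK.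
  exact: divD_unitr (UV Uv') Dkk'.
have [r'' rr'' Ur''] := repsP Drr.
have -> : r * (r' * v') = r'' * ((r''^-1 * (r * r')) * v').
  by rewrite !mulgA mulgV mul1g.
rewrite betaE //; last exact: UMul.
by rewrite phiM // [LHS]mulgA -fR // !mulgA.
Qed.

(** A relation and not a function: it gives one value for each factorisation into divisors of [D] of
    positive length and a final unit. Independence of the factorisation is [lift_fun]. *)
Inductive lift : G -> Q -> Prop :=
| lift_unit u : U u -> lift u (phi u)
| lift_step k p q : divD k -> (0 < len k)%N -> lift p q ->
    lift (k * p) (beta k * q).

Lemma lift_pos p q : lift p q -> M p.
Proof. by elim=> [u /UM //|k r s [Mk _] _ _ Mr]; apply: MM. Qed.

Lemma lift_unitl u p q : U u -> lift p q -> lift (u * p) (phi u * q).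
Proof.
move=> Uu; case=> [w Uw|k r s Dk lk lr].
  by rewrite -phiM //; apply/lift_unit/UMul.
rewrite mulgA mulgA -betaL //; apply: lift_step => //.
  exact: divD_unitl.
by have [Mk _] := Dk; rewrite (lenM (UM Uu) Mk) addn_gt0 lk orbT.
Qed.

Lemma lift_div k p q : divD k -> lift p q -> lift (k * p) (beta k * q).
Proof.
move=> Dk lp; have [Mk _] := Dk; case: (posnP (len k)) => [/(len0 Mk) Uk|lk].
  by rewrite betaU //; apply: lift_unitl.
exact: lift_step.
Qed.

Lemma lift_ex p : M p -> exists q, lift p q.
Proof.
have [N] := ubnP (len p); elim: N p => // N IH p lt Mp.
case: (posnP (len p)) => [/(len0 Mp) Up|lp].
  by exists (phi p); apply: lift_unit.
have [h [Dh Mhp hl _]] := gcdD Mp; have [Mh _] := Dh.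
have [|q lq] := IH (h^-1 * p) _ Mhp.
  have := lenM Mh Mhp; rewrite mulVKg => e; move: lt; rewrite e ltnS.
  by apply: leq_trans; rewrite -[X in (X < _)%N]add0n ltn_add2r hl.
by exists (beta h * q); rewrite -[p](mulVKg h); apply: lift_step; rewrite ?hl.
Qed.

Lemma lift_inv p q : lift p q -> (U p /\ q = phi p) \/
  exists k r t, [/\ divD k, (0 < len k)%N, lift r t, p = k * r & q = beta k * t].
Proof.
by case=> [u Uu|k r t Dk lk lr]; [left|right; exists k, r, t].
Qed.

Lemma lift_fun p q q' : lift p q -> lift p q' -> q = q'.
Proof.
have [N] := ubnP (len p); elim: N p q q' => // N IH p q q' lt lq lq'.
have Mp := lift_pos lq; have [h [Dh Mhp hl hmax]] := gcdD Mp.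
have [s ls] := lift_ex Mhp.
have unit_step u k r t : U u -> divD k -> (0 < len k)%N -> lift r t -> u = k * r -> False.
  move=> Uu [Mk _] lk /lift_pos Mr e.
  have /(len0 (UM Uu)) := Uu; rewrite e lenM // => /eqP.
  by rewrite addn_eq0 -leqn0 leqNgt lk.
have step k r t : divD k -> (0 < len k)%N -> lift r t -> p = k * r ->
    beta k * t = beta h * s.
  move=> Dk lk lr ep; have [Mk _] := Dk; have Mr := lift_pos lr.
  have Me : M (k^-1 * h) by apply: hmax => //; rewrite ep mulKg.
  have De : divD (k^-1 * h) by apply: divD_right.
  have er : r = (k^-1 * h) * (h^-1 * p) by rewrite ep !mulgA mulgK mulVg mul1g.
  have -> : t = beta (k^-1 * h) * s.
    apply: (IH r) => //; last by rewrite er; apply: lift_div.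
    by move: lt; rewrite ep lenM // ltnS; apply: leq_trans;
      rewrite -[X in (X < _)%N]add0n ltn_add2r.
  by rewrite mulgA -betaM // ?mulVKg.
case: (lift_inv lq) => [[Up ->]|[k [r [t [Dk lk lr ep ->]]]]];
  case: (lift_inv lq') => [[Up' ->]|[k' [r' [t' [Dk' lk' lr' ep' ->]]]]] //.
- by case: (unit_step p k' r' t').
- by case: (unit_step p k r t).
by rewrite (step k r t) // (step k' r' t').
Qed.

Lemma lift_M p q p' q' : lift p q -> lift p' q' -> lift (p * p') (q * q').
Proof.
move=> lp lp'; elim: lp => [u Uu|k r s Dk lk _ IH]; first exact: lift_unitl.
by rewrite -!mulgA; apply: lift_step.
Qed.

(** As [D] is central, [k] and its complement [k^-1 * D] have product [D] in either order. *)
Lemma betaC k : divD k -> beta k * beta D = beta D * beta k.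
Proof.
move=> Dk; have Dk' := divD_compl Dk; have [Mk _] := Dk.
have e1 : beta k * beta (k^-1 * D) = beta D.
  by rewrite -betaM // ?mulVKg //; apply: divD_D.
have e2 : beta (k^-1 * D) * beta k = beta D.
  have e : k^-1 * D * k = D by rewrite (VC Mk) mulgVK.
  by rewrite -betaM // e //; apply: divD_D.
by rewrite -{1}e2 -e1 mulgA.
Qed.

Lemma liftC p q : lift p q -> q * beta D = beta D * q.
Proof.
elim=> [u Uu|k r s Dk _ _ IH]; last by rewrite -mulgA IH mulgA betaC // mulgA.
rewrite -(betaR divD_D Uu) -(betaL Uu divD_D) DC //; exact: UM.
Qed.

Lemma lift_DX s : lift (D ^+ s) (beta D ^+ s).
Proof.
elim: s => [|s IH]; first by rewrite !expg0 -phi1; apply: lift_unit.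
by rewrite !expgS; apply: lift_div (divD_D) IH.
Qed.

(** Such fractions multiply because [D] and [beta D] commute with everything that is lifted
    ([liftC]). *)
Inductive frac : G -> Q -> Prop :=
  Frac p q s : lift p q -> frac (p * (D ^+ s)^-1) (q * (beta D ^+ s)^-1).

Lemma frac_M a q a' q' : frac a q -> frac a' q' -> frac (a * a') (q * q').
Proof.
case=> p r s lp [p' r' s' lp'].
have -> : p / D ^+ s * (p' / D ^+ s') = (p * p') * (D ^+ (s' + s))^-1.
  have c : commute p' (D ^+ s)^-1 by apply/commuteV/XC/lift_pos/lp'.
  by rewrite expgnDr invgM !mulgA -(mulgA p) -c !mulgA.
have -> : r / beta D ^+ s * (r' / beta D ^+ s') = (r * r') * (beta D ^+ (s' + s))^-1.
  have c : commute r' (beta D ^+ s)^-1 by apply/commuteV/commuteX/liftC/lp'.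
  by rewrite expgnDr invgM !mulgA -(mulgA r) -c !mulgA.
by apply: Frac; apply: lift_M.
Qed.

Lemma frac_lift p q : lift p q -> frac p q.
Proof. by move=> /(Frac 0); rewrite !expg0 !invg1 !mulg1. Qed.

Lemma frac_triv q : frac 1 q -> q = 1.
Proof.
move=> h; case: {-1}_ {-1}_ / h (erefl (1 : G)) (erefl q) => p r s lp /esym e _.
have ep : p = D ^+ s by rewrite -[p](mulgVK (D ^+ s)) e mul1g.
by rewrite ep in lp; rewrite (lift_fun lp (lift_DX s)) mulgV.
Qed.

Lemma frac_gen b : b \in B' -> frac b (f b).
Proof.
have Rr r : r \in reps -> beta r = f r.
  by move=> rr; rewrite -[r in LHS]mulg1 betaE // phi1 mulg1.
rewrite !mem_cat => /or3P [Bb|rr|/mapP [r rr ->]].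
- rewrite -phiB //; apply/frac_lift/lift_unit; exact: (fpres_gen fU Bb).
- have := lift_div (reps_div rr) (lift_unit U1).
  by rewrite mulg1 phi1 mulg1 Rr // => /frac_lift.
have Dr := reps_div rr; have Dr' := divD_compl Dr.
have lk := lift_div Dr' (lift_unit U1); rewrite mulg1 phi1 mulg1 in lk.
have := Frac 1 lk; rewrite !expg1 mulgK.
have -> // : beta (r^-1 * D) / beta D = f r^-1.
rewrite fV // -Rr //; apply/esym/mulg1_eq.
have e : beta r * beta (r^-1 * D) = beta D.
  by rewrite -betaM ?mulVKg //; apply: divD_D.
by rewrite mulgA e mulgV.
Qed.

Lemma frac_word w : inw B' w -> frac (pr id w) (pr f w).
Proof.
elim: w => [|b w IH] /=; last by case/andP=> /frac_gen Bb /IH; apply: frac_M.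
by move=> _; rewrite -[X in frac _ X]phi1; apply/frac_lift/lift_unit.
Qed.

End Lift.

Let VB' b : b \in B' -> b^-1 \in B'.
Proof.
rewrite !mem_cat => /or3P [Bb|rr|/mapP [r rr ->]].
- by case: fU => h _ _; rewrite h.
- by rewrite map_f ?orbT.
by rewrite invgK rr orbT.
Qed.

Lemma fracs_word a : fracs a <-> exists2 w, inw B' w & pr id w = a.
Proof.
have BB' w : inw B w -> inw B' w.
  by apply: sub_all => b; rewrite /= mem_cat => ->.
split=> [[s Ms]|[w Bw <-]]; last first.
  elim: w Bw => [|b w IH] /=; first by exists 0%N; rewrite expg0 mulg1.
  case/andP=> Bb /IH [s Ms].
  have [t Mt] : fracs b.
    move: Bb; rewrite !mem_cat => /or3P [Bb|rr|/mapP [r rr ->]].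
    - by exists 0%N; rewrite expg0 mulg1; apply/UM/(fpres_gen fU Bb).
    - by exists 0%N; rewrite expg0 mulg1; case: (reps_div rr).
    by exists 1%N; rewrite expg1; case: (reps_div rr).
  exists (t + s)%N; have := MM Mt Ms.
  have -> // : b * D ^+ t * (pr id w * D ^+ s) = b * pr id w * D ^+ (t + s).
  rewrite addnC expgnDr -!mulgA; congr (_ * _).
  have -> : pr id w = (pr id w * D ^+ s) * (D ^+ s)^-1 by rewrite mulgK.
  rewrite mulgVK -XC; last exact: Ms.
  by rewrite !mulgA mulgVK.
have wM p : M p -> exists2 w, inw B' w & pr id w = p.
  have [N] := ubnP (len p); elim: N p => // N IH p lt Mp.
  case: (posnP (len p)) => [/(len0 Mp) /(fpres_word fU) [w Bw <-]|lp].
    by exists w => //; apply: BB'.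
  have [h [Dh Mhp hl _]] := gcdD Mp; have [Mh _] := Dh.
  have [|w Bw e] := IH (h^-1 * p) _ Mhp.
    have := lenM Mh Mhp; rewrite mulVKg => e; move: lt; rewrite e ltnS.
    by apply: leq_trans; rewrite -[X in (X < _)%N]add0n ltn_add2r hl.
  have [r rr /(fpres_word fU) [v Bv ev]] := repsP Dh.
  exists (r :: v ++ w).
    by rewrite /= all_cat BB' // Bw !mem_cat rr orbT.
  by rewrite /= pr_cat ev e !mulgA mulgV mul1g mulgV mul1g.
have [w Bw ew] := wM _ Ms; have [v Bv ev] := wM _ (MX s).
exists (w ++ rev (map (@inv G) v)).
  rewrite all_cat Bw all_rev all_map /=.
  by apply: sub_all Bv => b /VB'.
rewrite pr_cat ew.
have -> : pr id (rev (map (@inv G) v)) = (D ^+ s)^-1.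
  rewrite -ev; elim: (v) => [|b u IH] /=; first by rewrite invg1.
  by rewrite rev_cons pr_rcons IH invgM.
exact: mulgK.
Qed.

(** Besides the relations of [U], only the products of generators of [U] and representatives with
    representatives, the comparison of representatives and their inverses are involved: finitely
    many relations, as [B] and [reps] are finite. *)
Lemma fracs_fpres : fpres fracs.
Proof.
have BB' w : inw B w -> inw B' w.
  by apply: sub_all => b; rewrite /= mem_cat => ->.
have RB' r : r \in reps -> r \in B' by move=> rr; rewrite !mem_cat rr orbT.
have sB : {subset B <= B'} by move=> b Bb; rewrite mem_cat Bb.
have /choice [W hW] : forall u, exists w, U u -> inw B w /\ pr id w = u.
  move=> u; case: (pselect (U u)) => [/(fpres_word fU) [w Bw e]|nU]; first by exists w.
  by exists [::].
have [n0 h0] := ev_hom fU sB.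
have [n1 h1] : ev B' (fun Q f => forall b, b \in B -> forall r, r \in reps ->
    forall r', r' \in reps -> U (r'^-1 * (b * r)) ->
    pr f [:: b; r] = pr f (r' :: W (r'^-1 * (b * r)))).
  apply: ev_all => b Bb; apply: ev_all => r rr; apply: ev_all => r' rr'.
  apply: ev_imp => Uu; have [Bw ew] := hW _ Uu.
  by apply: ev_rel; rewrite /= ?(sB b) ?RB' ?BB' // mulg1 ew mulVKg.
have [n2 h2] : ev B' (fun Q f => forall r, r \in reps -> forall r', r' \in reps ->
    forall r'', r'' \in reps -> U (r''^-1 * (r * r')) ->
    pr f [:: r; r'] = pr f (r'' :: W (r''^-1 * (r * r')))).
  apply: ev_all => r rr; apply: ev_all => r' rr'; apply: ev_all => r'' rr''.
  apply: ev_imp => Uu; have [Bw ew] := hW _ Uu.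
  by apply: ev_rel; rewrite /= ?(sB b) ?RB' ?BB' // mulg1 ew mulVKg.
have [n3 h3] : ev B' (fun Q f => forall r, r \in reps -> forall r', r' \in reps ->
    U (r'^-1 * r) -> pr f [:: r] = pr f (r' :: W (r'^-1 * r))).
  apply: ev_all => r rr; apply: ev_all => r' rr'.
  apply: ev_imp => Uu; have [Bw ew] := hW _ Uu.
  by apply: ev_rel; rewrite /= ?(sB b) ?RB' ?BB' // mulg1 ew mulVKg.
have [n4 h4] : ev B' (fun Q f => forall r, r \in reps -> U r ->
    pr f [:: r] = pr f (W r)).
  apply: ev_all => r rr; apply: ev_imp => Uu; have [Bw ew] := hW _ Uu.
  by apply: ev_rel; rewrite /= ?RB' ?BB' // mulg1.
have [n5 h5] := ev_V VB'.
exists B', (n0 + (n1 + (n2 + (n3 + (n4 + n5)))))%N; split; first exact: VB'.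
  exact: fracs_word.
move=> Q f r w Bw e.
have rl n : (n <= n0 + (n1 + (n2 + (n3 + (n4 + n5)))))%N -> rels f B' n.
  by move=> le; apply: rels_sub r.
have [phi [phiM phiW]] := h0 Q f (rl n0 ltac:(lia)).
have WE u : U u -> pr f (W u) = phi u.
  by move=> Uu; have [Bu eu] := hW u Uu; rewrite -phiW // eu.
have phiB b : b \in B -> phi b = f b.
  by move=> Bb; have := phiW [:: b]; rewrite /= Bb !mulg1; apply.
have fB b r0 r' : b \in B -> r0 \in reps -> r' \in reps ->
    U (r'^-1 * (b * r0)) -> f b * f r0 = f r' * phi (r'^-1 * (b * r0)).
  move=> Bb rr rr' Uu; have := h1 Q f (rl n1 ltac:(lia)) b Bb r0 rr r' rr' Uu.
  by rewrite /= mulg1 WE.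
have fR r0 r' r'' : r0 \in reps -> r' \in reps -> r'' \in reps ->
    U (r''^-1 * (r0 * r')) -> f r0 * f r' = f r'' * phi (r''^-1 * (r0 * r')).
  move=> rr rr' rr'' Uu; have := h2 Q f (rl n2 ltac:(lia)) r0 rr r' rr' r'' rr'' Uu.
  by rewrite /= mulg1 WE.
have fr r0 r' : r0 \in reps -> r' \in reps -> U (r'^-1 * r0) ->
    f r0 = f r' * phi (r'^-1 * r0).
  move=> rr rr' Uu; have := h3 Q f (rl n3 ltac:(lia)) r0 rr r' rr' Uu.
  by rewrite /= mulg1 WE.
have fu r0 : r0 \in reps -> U r0 -> f r0 = phi r0.
  move=> rr Uu; have := h4 Q f (rl n4 ltac:(lia)) r0 rr Uu.
  by rewrite /= mulg1 WE.
have fV r0 : r0 \in reps -> f r0^-1 = (f r0)^-1.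
  by move=> rr; apply: (h5 Q f (rl n5 ltac:(lia))); apply: RB'.
have [beta betaE] := beta_ex phiM fr.
by apply: (frac_triv phiM phiB fB fR fu betaE); rewrite -e; apply: frac_word.
Qed.

End Fractions.

(** * GL_n(Z[1/m]) as a group of fractions of integer matrices *)

Section IntegerMatrices.
Import GRing.Theory Num.Theory Order.TTheory.
Local Open Scope ring_scope.
Variable n : nat.
Local Notation GLZ := (ugroup 'M[int]_n.+1).
Local Notation GLQ := (ugroup 'M[rat]_n.+1).
Local Notation ZQ := (map_mx (intr : int -> rat)).

Definition iZ (A : 'M[rat]_n.+1) := exists B : 'M[int]_n.+1, A = ZQ B.

Lemma iZ_map B : iZ (ZQ B). Proof. by exists B. Qed.

Lemma ZQ_inj : injective (ZQ : 'M[int]_n.+1 -> 'M[rat]_n.+1).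
Proof.
by move=> A B /matrixP e; apply/matrixP=> i j; have := e i j; rewrite !mxE => /intr_inj.
Qed.

Lemma ZQM (A B : 'M[int]_n.+1) : ZQ (A * B) = ZQ A * ZQ B.
Proof. exact: map_mxM. Qed.

Lemma ZQ1 : ZQ (1 : 'M[int]_n.+1) = 1.
Proof. exact: map_mx1. Qed.

Lemma mx_unitE (R : comUnitRingType) (A : 'M[R]_n.+1) :
  (A \is a GRing.unit) = (\det A \is a GRing.unit).
Proof. exact: unitmxE. Qed.

Lemma iZM A B : iZ A -> iZ B -> iZ (A * B).
Proof. by move=> [A' ->] [B' ->]; exists (A' * B'); rewrite rmorphM. Qed.

Lemma iZD A B : iZ A -> iZ B -> iZ (A + B).
Proof. by move=> [A' ->] [B' ->]; exists (A' + B'); rewrite rmorphD. Qed.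

Lemma iZ1 : iZ 1. Proof. by exists 1; rewrite rmorph1. Qed.

Lemma iZZ (z : int) A : iZ A -> iZ (z%:~R *: A).
Proof. by move=> [A' ->]; exists (z *: A'); rewrite map_mxZ. Qed.

Lemma iZZn (k : nat) A : iZ A -> iZ (k%:R *: A).
Proof. exact: (iZZ k). Qed.

Lemma ZQ_unit (a : GLZ) : ZQ (uval a) \is a GRing.unit.
Proof. exact: rmorph_unit (uvalP a). Qed.

Definition toQ (a : GLZ) : GLQ := UGroup (ZQ_unit a).

Lemma toQM : {morph toQ : a b / (a * b)%g}.
Proof. by move=> a b; apply: val_inj; apply: rmorphM. Qed.

Lemma toQ_inj : injective toQ.
Proof.
move=> a b /(congr1 (@uval _)) /= e; apply: val_inj => /=.
exact: ZQ_inj e.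
Qed.

Definition GLZQ (a : GLQ) := exists2 b : GLZ, True & toQ b = a.

Lemma GLZQ_fpres : fpres GLZQ.
Proof.
apply: (fpres_inj (fun a b _ _ => toQM a b) _ (gl_int_fpres n)).
by move=> a b _ _; apply: toQ_inj.
Qed.

Lemma GLZQP (a : GLQ) : GLZQ a <-> iZ (uval a) /\ iZ (uval a^-1%g).
Proof.
split=> [[b _ <-]|[[A eA] [B eB]]].
  split; first exact: iZ_map.
  have -> : ((toQ b)^-1 = toQ b^-1)%g.
    apply: mulg1_eq; rewrite -toQM mulgV.
    by apply: val_inj; rewrite /= rmorph1.
  exact: iZ_map.
have AB : A * B = 1.
  apply: (ZQ_inj); rewrite ZQM ZQ1 -eA -eB.
  by rewrite -uvalM mulgV.
have BA : B * A = 1.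
  apply: (ZQ_inj); rewrite ZQM ZQ1 -eA -eB.
  by rewrite -uvalM mulVg.
have uA : A \is a GRing.unit by apply/unitrP; exists B.
by exists (UGroup uA) => //; apply: val_inj; rewrite /= -eA.
Qed.

Variable m : nat.
Hypothesis m0 : (0 < m)%N.

Let mQ : (m%:R : rat) != 0. Proof. by rewrite pnatr_eq0 -lt0n. Qed.

Lemma scal_unit : ((m%:R)%:M : 'M[rat]_n.+1) \is a GRing.unit.
Proof. by rewrite mx_unitE det_scalar unitfE expf_neq0. Qed.

Definition scal : GLQ := UGroup scal_unit.

Lemma uval_scalX s : uval (scal ^+ s)%g = (m%:R ^+ s)%:M.
Proof.
elim: s => [|s IH]; first by rewrite expr0.
by rewrite expgS uvalM IH exprS scalar_mxM.
Qed.

Lemma mul_scalX (a : GLQ) s : uval (a * scal ^+ s)%g = m%:R ^+ s *: uval a.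
Proof. by rewrite uvalM uval_scalX -[_ * _]/(_ *m _) mul_mx_scalar. Qed.

Lemma scalXC (a : GLQ) s : (a * scal ^+ s = scal ^+ s * a)%g.
Proof.
apply: val_inj; rewrite /= -!/(uval _) [LHS]mul_scalX.
by rewrite uval_scalX -[_ * _]/(_ *m _) mul_scalar_mx.
Qed.

(** The monoid to which the group of fractions is attached: its units are GL_n(Z), and the central
    element is the scalar matrix [m]. *)
Definition posm (a : GLQ) := iZ (uval a) /\ exists s, iZ (m%:R ^+ s *: uval a^-1%g).

Lemma iZX s A : iZ A -> iZ (m%:R ^+ s *: A).
Proof. by move=> iA; rewrite -natrX; apply: iZZn. Qed.

Lemma posm_M a b : posm a -> posm b -> posm (a * b)%g.
Proof.
move=> [ia [s is_]] [ib [t it]]; split; first exact: iZM.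
exists (t + s)%N; rewrite invgM uvalM exprD -scalerA.
by rewrite scalerAr scalerAl; apply: iZM.
Qed.

Lemma posm_unit a : GLZQ a -> posm a.
Proof. by move=> /GLZQP [ia ib]; split=> //; exists 0%N; rewrite scale1r. Qed.

Lemma posm_div a : divD posm scal a <-> iZ (uval a) /\ iZ (m%:R *: uval a^-1%g).
Proof.
have e b : uval (b * scal)%g = m%:R *: uval b.
  by have := mul_scalX b 1; rewrite expg1 expr1.
split=> [[[ia _] [ib _]]|[ia ib]]; first by rewrite e in ib.
split; first by split=> //; exists 1%N.
split; first by rewrite e.
exists 1%N; rewrite invgM invgK uvalM expr1 scalerAl.
have -> : m%:R *: uval scal^-1%g = 1.
  by rewrite -e mulVg.
by rewrite mul1r.
Qed.

(* The multiplicity of the primes dividing [m] in the determinant. *)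
Definition mlen (a : GLQ) : nat :=
  (\sum_(p <- primes m) logn p `|numq (\det (uval a))|)%N.

Lemma posm_det a : posm a -> exists2 z : int,
  \det (uval a) = z%:~R & (0 < `|z|)%N /\ exists s, (`|z| %| m ^ s)%N.
Proof.
move=> [[A eA] [s [B eB]]]; exists (\det A); first by rewrite eA det_map_mx.
have AB : A *m B = (m%:R ^+ s)%:M.
  apply: (ZQ_inj); rewrite map_mxM -eA -eB map_scalar_mx.
  rewrite -scalemxAr -[_ *m _]/(_ * _) -uvalM mulgV /= rmorphXn /= -scalemx1.
  by rewrite rmorph_nat.
have /(congr1 absz) := congr1 determinant AB.
rewrite det_mulmx det_scalar abszM !abszX natz absz_nat -expnM => e.
split; last by exists (s * n.+1)%N; rewrite -e dvdn_mulr.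
have : (0 < m ^ (s * n.+1))%N by rewrite expn_gt0 m0.
by rewrite -e muln_gt0 => /andP [].
Qed.

Lemma mlenE a z : \det (uval a) = z%:~R -> mlen a = (\sum_(p <- primes m) logn p `|z|)%N.
Proof. by rewrite /mlen => ->; rewrite numq_int. Qed.

Lemma mlen_M a b : posm a -> posm b -> mlen (a * b)%g = (mlen a + mlen b)%N.
Proof.
move=> /posm_det [y ey [y0 _]] /posm_det [z ez [z0 _]].
have eyz : \det (uval (a * b)%g) = (y * z)%:~R.
  by rewrite uvalM -[_ * _]/(_ *m _) det_mulmx ey ez intrM.
rewrite (mlenE ey) (mlenE ez) (mlenE eyz) -big_split /=.
by apply: eq_bigr => p _; rewrite abszM lognM.
Qed.

Lemma mlen_eq0 a z : \det (uval a) = z%:~R -> (0 < `|z|)%N ->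
  mlen a = 0%N <-> forall p, p \in primes m -> ~~ (p %| `|z|)%N.
Proof.
move=> e z0; rewrite (mlenE e); split=> [/eqP|h]; last first.
  rewrite big1_seq // => p /= pm; apply/eqP.
  by rewrite -leqn0 leqNgt logn_gt0 mem_primes z0 /= negb_and h // orbT.
rewrite sum_nat_seq_eq0 => /allP h p pm; have := h p pm.
rewrite /= -leqn0 leqNgt logn_gt0 mem_primes z0 /=.
by move: pm; rewrite mem_primes => /andP [-> _].
Qed.

(** The determinant divides a power of [m], so it is 1 or -1 as soon as no prime factor of [m]
    divides it. *)
Lemma mlen0 a : posm a -> mlen a = 0%N <-> GLZQ a.
Proof.
move=> pa; have [z ez [z0 [s zs]]] := posm_det pa; rewrite (mlen_eq0 ez z0).
split=> [h|/GLZQP [[A eA] [B eB]] p pm].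
  have z1 : `|z|%N = 1%N.
    apply/eqP; rewrite eqn_leq z0 andbT leqNgt; apply/negP => z1.
    have pp := pdiv_prime z1; have pz := pdiv_dvd `|z|%N.
    have pm : (pdiv `|z| %| m)%N.
      have := dvdn_trans pz zs; rewrite Euclid_dvdX //.
      by case/andP.
    by have := h (pdiv `|z|%N); rewrite mem_primes pp m0 pm pz => /(_ isT).
  have [[A eA] _] := pa; have uA : A \is a GRing.unit.
    rewrite mx_unitE.
    have -> : \det A = z.
      by apply: (@intr_inj rat); rewrite -ez eA det_map_mx.
    by have [->|->] : z = 1 \/ z = -1 by lia; rewrite ?unitrN1 ?unitr1.
  by exists (UGroup uA) => //; apply: val_inj; rewrite /= eA.
have e1 : \det A * \det B = 1.
  rewrite -det_mulmx; apply: (@intr_inj rat); rewrite -det_map_mx map_mxM -eA -eB.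
  by rewrite -[_ *m _]/(_ * _) -uvalM mulgV /= det1.
have zA : z = \det A by apply: (@intr_inj rat); rewrite -ez eA det_map_mx.
have : (`|z| %| 1)%N by rewrite zA -(absz1) -e1 abszM dvdn_mulr.
rewrite dvdn1 => /eqP ->; rewrite dvdn1; apply: contraTneq pm => ->.
by rewrite mem_primes.
Qed.

Lemma posm_scal : posm scal.
Proof.
split; first by exists (m%:Z)%:M; rewrite map_scalar_mx.
exists 1%N; have -> : m%:R ^+ 1 *: uval scal^-1%g = 1; last exact: iZ1.
by rewrite -mul_scalX expg1 mulVg.
Qed.

Let dg (f : 'I_n.+1 -> int) : 'M[rat]_n.+1 := diag_mx (\row_i (f i)%:~R).

Lemma iZ_dg f : iZ (dg f).
Proof.
exists (diag_mx (\row_i f i)); apply/matrixP=> i j; rewrite !mxE.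
by case: (i == j); rewrite ?mulr0n ?mulr1n.
Qed.

Lemma dgM f g : dg f * dg g = dg (fun i => f i * g i).
Proof.
rewrite /dg -[_ * _]/(_ *m _) mulmx_diag; congr diag_mx.
by apply/rowP=> i; rewrite !mxE intrM.
Qed.

Lemma dgD f g : dg f + dg g = dg (fun i => f i + g i).
Proof.
by apply/matrixP=> i j; rewrite !mxE intrD mulrnDl.
Qed.

Lemma dg_const (z : int) : dg (fun=> z) = z%:~R%:M.
Proof. by apply/matrixP=> i j; rewrite !mxE. Qed.

Lemma eq_dg f g : f =1 g -> dg f = dg g.
Proof. by move=> e; congr diag_mx; apply/rowP=> i; rewrite !mxE e. Qed.

Lemma det_dg f : \det (dg f) = (\prod_i f i)%:~R.
Proof.
by rewrite det_diag rmorph_prod /=; apply: eq_bigr => i _; rewrite mxE.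
Qed.

Lemma dg_unit f : (forall i, f i != 0) -> dg f \is a GRing.unit.
Proof.
move=> f0; rewrite mx_unitE unitfE det_dg intr_eq0.
by apply/prodf_neq0.
Qed.

Lemma posm_smith c : posm c -> exists L R d, [/\ GLZQ L, GLZQ R &
  uval c = uval L * dg d * uval R].
Proof.
move=> [[C eC] _]; have [L uL [R uR [d _ e]]] := int_Smith_normal_form C.
exists (toQ (@UGroup _ L uL)), (toQ (@UGroup _ R uR)), (fun i => d`_i).
split; [by exists (UGroup uL)|by exists (UGroup uR)|].
rewrite eC e /= !map_mxM; congr (_ *m _ *m _).
by apply/matrixP=> i j; rewrite !mxE; case: (i =P j) => [->|/eqP h];
  rewrite ?eqxx ?mulr1n // -[nat_of_ord i == _]/(i == j) (negPf h) !mulr0n.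
Qed.

Lemma GLZQ_det a : GLZQ a -> exists2 z : int, \det (uval a) = z%:~R & `|z|%N = 1%N.
Proof.
move=> [b _ <-]; exists (\det (uval b)); first by rewrite det_map_mx.
have := uvalP b; rewrite mx_unitE => /unitrP [y [h _]].
move/(congr1 absz): h; rewrite abszM => /eqP; rewrite muln_eq1.
by case/andP=> _ /eqP.
Qed.

(** If [L * dg d * R] is the Smith normal form of [c], the divisor is [L] times the diagonal matrix
    of the gcds of [d i] and [m]. Bezout coefficients write it as an integral right combination of
    [c] and the scalar [m], so every common left divisor divides it. *)
Lemma posm_gcd c : posm c -> exists h, [/\ divD posm scal h, posm (h^-1 * c)%g,
  (0 < mlen c)%N -> (0 < mlen h)%N &
  forall e, divD posm scal e -> posm (e^-1 * c)%g -> posm (e^-1 * h)%g].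
Proof.
move=> pc; have [L [R [d [GL_ GR ec]]]] := posm_smith pc.
have [iL iLV] := proj1 (GLZQP L) GL_; have [iR iRV] := proj1 (GLZQP R) GR.
pose u i := gcdz (d i) m.
have u0 i : u i != 0 by rewrite gcdz_eq0 negb_and orbC -lt0n m0.
have du : forall i, (d i = (d i %/ u i)%Z * u i)%R by move=> i; rewrite divzK ?dvdz_gcdl.
have mu : forall i, (m%:Z = (m%:Z %/ u i)%Z * u i)%R by move=> i; rewrite divzK ?dvdz_gcdr.
pose U : GLQ := UGroup (dg_unit u0).
pose h : GLQ := (L * U)%g.
have ih : iZ (uval h) by apply: iZM (iZ_dg u).
have eU (f : 'I_n.+1 -> int) : (forall i, f i = (f i %/ u i)%Z * u i) ->
    uval U^-1%g * dg f = dg (fun i => (f i %/ u i)%Z).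
  move=> ef; have -> : dg f = uval U * dg (fun i => (f i %/ u i)%Z).
    by rewrite dgM; apply: eq_dg => i; rewrite {1}ef mulrC.
  by rewrite mulrA -uvalM mulVg mul1r.
have ihV : iZ (m%:R *: uval h^-1%g).
  rewrite invgM uvalM scalerAl; apply: iZM iLV.
  rewrite -mul_mx_scalar -[m%:R]/((m%:Z)%:~R) -dg_const -[_ *m _]/(_ * _) eU //.
  exact: iZ_dg.
have dh : divD posm scal h by apply/posm_div.
have ehc : uval (h^-1 * c)%g = dg (fun i => (d i %/ u i)%Z) * uval R.
  rewrite invgM !uvalM ec -!mulrA [uval L^-1%g * _]mulrA -uvalM mulVg mul1r.
  by rewrite mulrA eU.
have phc : posm (h^-1 * c)%g.
  split; first by rewrite ehc; apply: iZM (iZ_dg _) iR.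
  have [_ [s is_]] := pc; exists s; rewrite invgM invgK uvalM scalerAl.
  exact: iZM.
exists h; split=> //.
- have [zL eL L1] := GLZQ_det GL_; have [zR eR R1] := GLZQ_det GR.
  have dc : \det (uval c) = (zL * (\prod_i d i) * zR)%:~R.
    by rewrite ec -![_ * _]/(_ *m _) !det_mulmx eL eR det_dg !intrM.
  have dth : \det (uval h) = (zL * \prod_i u i)%:~R.
    by rewrite uvalM -[_ * _]/(_ *m _) det_mulmx eL det_dg intrM.
  have pos a z : posm a -> \det (uval a) = z%:~R -> (0 < `|z|)%N.
    move=> /posm_det [z' -> [z0 _]] /(@intr_inj rat) <- //.
  move=> lc; rewrite lt0n; apply/eqP => /(mlen_eq0 dth (pos _ _ (proj1 dh) dth)) nd.
  move: lc; rewrite lt0n => /eqP []; apply/(mlen_eq0 dc (pos _ _ pc dc)) => p pm.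
  apply: contra (nd p pm); rewrite !abszM L1 R1 mul1n muln1.
  have pp : prime p by move: pm; rewrite mem_primes => /andP [].
  have prd (F : 'I_n.+1 -> int) : absz (\prod_i F i) = (\prod_i absz (F i))%N.
    exact: (big_morph absz abszM).
  rewrite mul1n !prd => pd.
  have [i pdi] : exists i, (p %| `|d i|)%N.
    have := @Euclid_dvd_prod _ (index_enum 'I_n.+1) xpredT (fun i => `|d i|%N) p pp.
    by rewrite pd big_has => /esym /hasP [i _ ?]; exists i.
  have pmm : (p %| m)%N by move: pm; rewrite mem_primes => /and3P [].
  rewrite (bigD1 i) //=; apply: dvdn_mulr.
  by rewrite dvdn_gcd pdi.
- move=> e [[ie [t ite]] [ieV _]] [iec _].
  split; last first.
    exists 1%N; rewrite expr1 invgM invgK uvalM scalerAl; exact: iZM.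
  have [a eab] : exists a : 'I_n.+1 -> int * int,
      forall i, u i = d i * (a i).1 + m%:Z * (a i).2.
    have /choice [a ea] : forall i, exists ab : int * int, u i = d i * ab.1 + m%:Z * ab.2.
      by move=> i; have [x [y e_]] := Bezoutz (d i) m; exists (x, y); rewrite /u -e_ /=; ring.
    by exists a.
  have -> : uval (e^-1 * h)%g = uval (e^-1 * c)%g * uval R^-1%g * dg (fun i => (a i).1)
     + uval (e^-1 * scal)%g * uval L * dg (fun i => (a i).2).
    rewrite !uvalM ec -!mulrA -mulrDr; congr (_ * _).
    have RK X : uval R * (uval R^-1%g * X) = X by rewrite mulrA -uvalM mulgV mul1r.
    rewrite RK dgM.
    rewrite /= -[_%:M * _]/(_ *m _) mul_scalar_mx scalerAr -mulrDr; congr (_ * _).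
    rewrite -mul_scalar_mx -[m%:R]/((m%:Z)%:~R) -dg_const -[_ *m _]/(_ * _) dgM dgD.
    by apply: eq_dg.
  apply: iZD; apply: iZM (iZ_dg _); first exact: iZM.
  exact: iZM.
Qed.

Let res (A : 'M[rat]_n.+1) : 'M['I_m]_n.+1 :=
  \matrix_(i, j) Ordinal (ltn_pmod `|(numq (A i j) %% m)%Z| m0).

Lemma res_eq A A' : iZ A -> iZ A' -> res A = res A' ->
  exists2 E, iZ E & A' = A + m%:R *: E.
Proof.
move=> [B ->] [B' ->] /matrixP e.
exists (ZQ (\matrix_(i, j) ((B' i j - B i j) %/ m)%Z)); first exact: iZ_map.
apply/matrixP=> i j; rewrite !mxE -[m%:R]/((m%:Z)%:~R) -intrM -intrD; congr (_%:~R).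
have mz : m%:Z != 0 by rewrite eqz_nat -lt0n.
have := congr1 (@nat_of_ord m) (e i j); rewrite !mxE !numq_int /=.
have lt z : (`|(z %% m)%Z| < m)%N.
  have := ltz_mod z mz; have := modz_ge0 z mz.
  by case: (z %% m)%Z => //= k _; rewrite ltz_nat.
rewrite !modn_small // => /(congr1 Posz); rewrite !gez0_abs ?modz_ge0 // => /esym /eqP.
by rewrite eqz_mod_dvd => /divzK; rewrite mulrC => ->; ring.
Qed.

(** Two divisors of [m] that agree modulo [m] differ by a unit: if [b] is [a + m E], then [a^-1 b]
    is [1 + (m a^-1) E], which is integral, and so is its inverse by symmetry. There are finitely
    many residues. *)
Lemma posm_reps : exists reps : seq GLQ,
  (forall r, r \in reps -> divD posm scal r) /\
  forall k, divD posm scal k -> exists2 r, r \in reps & GLZQ (r^-1 * k)%g.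
Proof.
have /choice [rep hrep] : forall r : 'M['I_m]_n.+1, exists k : GLQ,
    (exists2 k', divD posm scal k' & res (uval k') = r) ->
    divD posm scal k /\ res (uval k) = r.
  move=> r; case: (pselect (exists2 k', divD posm scal k' & res (uval k') = r)).
    by move=> [k dk ek]; exists k.
  by move=> h; exists 1%g.
(* Residues that come from no divisor are sent to [scal], which is a divisor. *)
exists (map (fun r => if `[< exists2 k', divD posm scal k' & res (uval k') = r >]
                      then rep r else scal) (enum {: 'M['I_m]_n.+1})); split=> [r|k dk].
  case/mapP=> q _ ->; case: asboolP => [/hrep [] //|_].
  apply/posm_div; split; first by exists (m%:Z)%:M; rewrite map_scalar_mx.
  have -> : m%:R *: uval scal^-1%g = 1; last exact: iZ1.
  have e : uval (scal^-1 * scal)%g = m%:R *: uval scal^-1%g.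
    by have := mul_scalX scal^-1%g 1; rewrite expg1 expr1.
  by rewrite -e mulVg.
have ex : exists2 k', divD posm scal k' & res (uval k') = res (uval k) by exists k.
have [/posm_div [ir irV] er] := hrep _ ex; have [ik ikV] := proj1 (posm_div k) dk.
exists (rep (res (uval k))).
  by apply/mapP; exists (res (uval k)); rewrite ?mem_enum //; case: asboolP.
set r := rep _ in ir irV er *.
have gen (a b : GLQ) : iZ (uval a) -> iZ (m%:R *: uval a^-1%g) -> iZ (uval b) ->
    res (uval a) = res (uval b) -> iZ (uval (a^-1 * b)%g).
  move=> ia iaV ib /(res_eq ia ib) [E iE e].
  rewrite uvalM e mulrDr -uvalM mulVg; apply: iZD; first exact: iZ1.
  by rewrite -scalerAr scalerAl; apply: iZM.
apply/GLZQP; split; first exact: gen.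
by rewrite invgM invgK; apply: gen.
Qed.

Definition GLm (a : GLQ) := exists s,
  iZ (m%:R ^+ s *: uval a) /\ iZ (m%:R ^+ s *: uval a^-1%g).

Lemma fracs_posm a : fracs posm scal a <-> GLm a.
Proof.
split=> [[s [ia [t iaV]]]|[s [ia iaV]]].
  rewrite mul_scalX in ia; exists (s + (s + t))%N; split.
    by rewrite addnC exprD -scalerA; apply: iZX.
  have -> : uval a^-1%g = uval (scal ^+ s * (a * scal ^+ s)^-1)%g.
    by rewrite invgM mulgA mulgV mul1g.
  rewrite uvalM uval_scalX -[_ * _]/(_ *m _) mul_scalar_mx.
  rewrite !exprD mulrCA -!scalerA; do 2 apply: iZX.
  by rewrite scalerA mulrC -scalerA; apply: iZX.
exists s; split; first by rewrite mul_scalX.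
exists (s + s)%N; rewrite invgM uvalM exprD -scalerA scalerAr.
have e : m%:R ^+ s *: uval (scal ^+ s)^-1%g = 1.
  by rewrite -mul_scalX mulVg.
by rewrite scalerAl e mul1r.
Qed.

Lemma GLm_fpres : fpres GLm.
Proof.
have [B [k fB]] := GLZQ_fpres; have [reps [rd rP]] := posm_reps.
have DC a : posm a -> (a * scal = scal * a)%g.
  by move=> _; have := scalXC a 1; rewrite !expg1.
have [B' [k' [h1 h2 h3]]] := fracs_fpres fB posm_unit posm_M mlen_M mlen0 posm_scal DC
  posm_gcd rd rP.
by exists B', k'; split=> // a; rewrite -fracs_posm.
Qed.

End IntegerMatrices.

(** * The affine group over Z[1/m] *)

Section IntegerPowers.
Import GRing.Theory.
Local Open Scope group_scope.
Variable Q : groupType.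
Implicit Type x : Q.

Definition zexp x (z : int) : Q := match z with Posz k => x ^+ k | Negz k => (x ^+ k.+1)^-1 end.

Lemma zexpS x z : zexp x (1 + z)%R = x * zexp x z.
Proof.
case: z => k; first by rewrite -PoszD add1n /= expgS.
case: k => [|k]; first by rewrite /= expg1 mulgV.
have -> : (1 + Negz k.+1 = Negz k)%R by rewrite !NegzE; lia.
by rewrite /= [in RHS]expgSr invgM mulgA mulgV mul1g.
Qed.

Lemma zexpD x (y z : int) : zexp x (y + z)%R = zexp x y * zexp x z.
Proof.
have pos (k : nat) u : zexp x (k%:Z + u)%R = x ^+ k * zexp x u.
  elim: k => [|k IH]; first by rewrite add0r mul1g.
  by rewrite -add1n PoszD -addrA zexpS IH expgS mulgA.
case: y => k; first exact: pos.
apply: (mulgI (x ^+ k.+1)); rewrite -pos mulgA mulgV mul1g; congr zexp.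
by rewrite NegzE; lia.
Qed.

Lemma zexp_comm x y z : commute x y -> commute x (zexp y z).
Proof. by case: z => k h; [apply: commuteX|apply/commuteV/commuteX]. Qed.

Lemma zexp_nseq x (z : int) :
  zexp x z = pr (fun b : bool => if b then x else x^-1) (nseq `|z|%N (0 <= z)%R).
Proof.
have h (b : bool) k : pr (fun b : bool => if b then x else x^-1) (nseq k b)
    = (if b then x else x^-1) ^+ k.
  by elim: k => [|k IH] //=; rewrite IH expgS.
by rewrite h; case: z => k //=; rewrite expVgn.
Qed.

End IntegerPowers.

Section IntegerVectors.
Import GRing.Theory.
Local Open Scope ring_scope.
Variable n : nat.

Lemma cV_ind (P : 'cV[int]_n -> Prop) :
  P 0 -> (forall u v, P u -> P v -> P (u + v)) -> (forall u, P u -> P (- u)) ->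
  (forall i, P (delta_mx i 0)) -> forall v, P v.
Proof.
move=> P0 PD PN Pe v; rewrite (matrix_sum_delta v).
apply: (big_ind P) => // i _; rewrite big_ord1.
have pos (k : nat) : P (k%:Z *: delta_mx i 0).
  elim: k => [|k IH]; first by rewrite scale0r.
  have -> : k.+1%:Z = k%:Z + 1 by lia.
  by rewrite scalerDl scale1r; apply: PD.
case: (v i 0) => k; first exact: pos.
by rewrite NegzE scaleNr; apply: PN.
Qed.

Section Torus.
Variables (Q : groupType) (t : 'I_n -> Q).
Hypothesis tC : forall i j, commute (t i) (t j).

(** The homomorphism from the free abelian group of integer vectors determined by the commuting
    elements [t i]. *)
Definition tor (v : 'cV[int]_n) : Q := (\prod_i zexp (t i) (v i 0))%g.

Lemma torD u v : tor (u + v) = (tor u * tor v)%g.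
Proof.
rewrite /tor -prodgM_commute; last first.
  move=> i j _ _; apply/zexp_comm/commute_sym/zexp_comm/tC.
by apply: eq_bigr => i _; rewrite mxE zexpD.
Qed.

Lemma tor0 : tor 0 = 1%g.
Proof. by rewrite /tor big1 // => i _; rewrite mxE. Qed.

Lemma torN u : tor (- u) = (tor u)^-1%g.
Proof. by apply/esym/mulg1_eq; rewrite -torD subrr tor0. Qed.

Lemma tor_delta i : tor (delta_mx i 0) = t i.
Proof.
rewrite /tor (big_only1 i) ?mxE ?eqxx ?expg1 // => j /negPf ji _.
by rewrite mxE ji.
Qed.

Lemma tor_act p (C : 'M[int]_n) :
  (forall i, p * t i = tor (C *m delta_mx i 0) * p)%g ->
  forall v, (p * tor v = tor (C *m v) * p)%g.
Proof.
move=> h v; move: v; apply: cV_ind => [|u v hu hv|u hu|i].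
- by rewrite mulmx0 tor0 mulg1 mul1g.
- by rewrite mulmxDr !torD mulgA hu -mulgA hv mulgA.
- rewrite mulmxN !torN; apply: (mulgI (tor (C *m u))); apply: (mulIg (tor u)).
  by rewrite -!mulgA mulVg mulg1 -hu !mulgA mulgV mul1g.
- by rewrite tor_delta h.
Qed.

End Torus.
End IntegerVectors.

Section AffineGroup.
Import GRing.Theory Num.Theory.
Local Open Scope ring_scope.
Variable n : nat.
Local Notation GLQ := (ugroup 'M[rat]_n.+1).
Local Notation V := 'cV[rat]_n.+1.

Record aff := Aff { lpart : GLQ; tpart : V }.

HB.instance Definition _ := gen_eqMixin aff.
HB.instance Definition _ := gen_choiceMixin aff.

Definition affM g h := Aff (lpart g * lpart h)%g (uval (lpart g) *m tpart h + tpart g).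
Definition affV g := Aff (lpart g)^-1%g (- (uval (lpart g)^-1%g *m tpart g)).

Lemma affMA : associative affM.
Proof.
by move=> g h k; rewrite /affM /= mulgA mulmxDr mulmxA addrA.
Qed.
Lemma aff1g : left_id (Aff 1%g 0) affM.
Proof. by case=> a b; rewrite /affM /= mul1g mul1mx addr0. Qed.
Lemma affg1 : right_id (Aff 1%g 0) affM.
Proof. by case=> a b; rewrite /affM /= mulg1 mulmx0 add0r. Qed.
Lemma affVg : left_inverse (Aff 1%g 0) affV affM.
Proof. by case=> a b; rewrite /affM /= mulVg subrr. Qed.
Lemma affgV : right_inverse (Aff 1%g 0) affV affM.
Proof.
case=> a b; rewrite /affM /= mulgV mulmxN mulmxA.
by rewrite [_ *m (_)^-1](mulrV (uvalP a)) mul1mx addNr.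
Qed.

HB.instance Definition _ := isGroup.Build aff affMA aff1g affg1 affVg affgV.

Definition lin (a : GLQ) : aff := Aff a 0.
Definition tr (b : V) : aff := Aff 1%g b.

Lemma linM : {morph lin : a b / (a * b)%g}.
Proof. by move=> a b; congr Aff; rewrite mulmx0 add0r. Qed.

Lemma linV a : lin a^-1%g = (lin a)^-1%g.
Proof. by apply/esym/mulg1_eq; rewrite -linM mulgV. Qed.

Lemma trD b c : tr (b + c) = (tr b * tr c)%g.
Proof. by congr Aff; rewrite ?mulg1 // mul1mx addrC. Qed.

Lemma lin_tr a b : (lin a * tr b = tr (uval a *m b) * lin a)%g.
Proof. by congr Aff; rewrite ?mulg1 ?mul1g //= addr0 mulmx0 add0r. Qed.

Lemma tr_lin a b : (tr b * lin a)%g = Aff a b.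
Proof. by congr Aff; rewrite /= ?mul1g // mulmx0 add0r. Qed.

Local Notation ZQ := (map_mx (intr : int -> rat)).
Definition tz (v : 'cV[int]_n.+1) : aff := tr (ZQ v).

Lemma tzD u v : tz (u + v) = (tz u * tz v)%g.
Proof. by rewrite -trD /tz map_mxD. Qed.

Lemma tz_tor v : tz v = tor (fun i => tz (delta_mx i 0)) v.
Proof.
have C i j : commute (tz (delta_mx i 0)) (tz (delta_mx j 0)).
  by rewrite /commute -!tzD addrC.
move: v; apply: cV_ind => [|u v hu hv|u hu|i].
- by rewrite tor0 /tz map_mx0.
- by rewrite torD // tzD hu hv.
- by rewrite torN // -hu; apply/esym/mulg1_eq; rewrite -tzD subrr /tz map_mx0.
- by rewrite tor_delta.
Qed.

Variable m : nat.
Hypothesis m0 : (0 < m)%N.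

Let mQ : (m%:R : rat) != 0. Proof. by rewrite pnatr_eq0 -lt0n. Qed.

Definition affm g := GLm m (lpart g) /\ exists s (v : 'cV[int]_n.+1),
  m%:R ^+ s *: tpart g = ZQ v.

Section Words.
Variables (B : seq GLQ) (nB : nat).
Hypothesis fB : fpres_by (GLm m) B nB.
Local Notation D := (scal n m0).

Let e i : 'cV[int]_n.+1 := delta_mx i 0.

Definition aff_base : seq aff := map lin B ++
  map (fun i => tz (e i)) (enum 'I_n.+1) ++ map (fun i => (tz (e i))^-1%g) (enum 'I_n.+1).

Lemma aff_base_lin b : b \in B -> lin b \in aff_base.
Proof. by move=> Bb; rewrite mem_cat map_f. Qed.

Lemma aff_base_tz i : tz (e i) \in aff_base.
Proof. by rewrite !mem_cat (map_f (fun i => tz (e i))) ?orbT // mem_enum. Qed.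

Lemma aff_base_tzV i : (tz (e i))^-1%g \in aff_base.
Proof. by rewrite !mem_cat (map_f (fun i => (tz (e i))^-1%g)) ?orbT // mem_enum. Qed.

Lemma aff_baseP g : g \in aff_base ->
  (exists2 b, b \in B & g = lin b) \/ (exists i, g = tz (e i) \/ g = (tz (e i))^-1%g).
Proof.
rewrite !mem_cat => /or3P [] /mapP [b Bb ->]; first by left; exists b.
  by right; exists b; left.
by right; exists b; right.
Qed.

Lemma aff_baseV g : g \in aff_base -> (g^-1)%g \in aff_base.
Proof.
move=> /aff_baseP [[b Bb ->]|[i [->|->]]].
- by rewrite -linV aff_base_lin //; case: fB => + _ _; apply.
- exact: aff_base_tzV.
- by rewrite invgK aff_base_tz.
Qed.

Definition tword (v : 'cV[int]_n.+1) : seq aff :=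
  flatten [seq map (fun b : bool => if b then tz (e i) else (tz (e i))^-1%g)
    (nseq `|v i ord0|%N (0 <= v i ord0)) | i <- enum 'I_n.+1].

Lemma tword_base v : inw aff_base (tword v).
Proof.
apply/allP=> x /flattenP [w /mapP [i _ ->]] /mapP [b _ ->]; case: b; [exact: aff_base_tz|exact: aff_base_tzV].
Qed.

Lemma pr_tword (Q : groupType) (f : aff -> Q) v :
  (forall i, f (tz (e i))^-1%g = (f (tz (e i)))^-1%g) ->
  pr f (tword v) = tor (fun i => f (tz (e i))) v.
Proof.
move=> fV; have -> : tor (fun i => f (tz (e i))) v =
    (\prod_(i <- enum 'I_n.+1) zexp (f (tz (e i))) (v i ord0))%g.
  by rewrite /tor [index_enum _]unlock -enumT.
rewrite /tword; elim: (enum _) => [|i r IH]; first by rewrite big_nil.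
rewrite big_cons /= pr_cat IH; congr (_ * _)%g; rewrite pr_map zexp_nseq.
by apply: eq_pr => b /=; case: b.
Qed.

Lemma lin_word w : pr id (map lin w) = lin (pr id w).
Proof. by rewrite pr_map; elim: w => //= a w ->; rewrite linM. Qed.

Lemma lin_base w : inw B w -> inw aff_base (map lin w).
Proof. by rewrite all_map => /sub_all; apply=> b; apply: aff_base_lin. Qed.

Lemma rels_lin (Q : groupType) (f : aff -> Q) k : rels f aff_base k -> rels (f \o lin) B k.
Proof.
move=> r w w' Bw Bw' sw sw' ew; rewrite -!(pr_map f lin); apply: r; rewrite ?size_map ?lin_base //.
by rewrite !lin_word ew.
Qed.

Lemma GLm_scal : GLm m D.
Proof. by apply/(fracs_posm m0); exists 0%N; rewrite mulg1; apply: posm_scal. Qed.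

Lemma GLm_clear b : GLm m b -> exists s (C : 'M[int]_n.+1),
  uval (D ^+ s * b)%g = map_mx intr C.
Proof.
by move=> [s [[C eC] _]]; exists s, C; rewrite -scalXC mul_scalX.
Qed.

(** A generator [b] may have denominators, and then it does not map integer translations to integer
    translations. The relations are therefore stated for [D ^+ s * b], integral for suitable [s],
    and for the scalar [D]; since [D] is central, they determine the action of [b]. *)
Definition aff_good (Q : groupType) (f : aff -> Q) :=
  [/\ (forall i, f (tz (e i))^-1%g = (f (tz (e i)))^-1%g),
   (forall i j, commute (f (tz (e i))) (f (tz (e j)))) &
   exists phi : GLQ -> Q, [/\
    (forall a b, GLm m a -> GLm m b -> phi (a * b)%g = (phi a * phi b)%g),
    (forall b, b \in B -> phi b = f (lin b)),
    (forall i, (phi D * f (tz (e i)) =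
       tor (fun i => f (tz (e i))) (m%:Z *: e i) * phi D)%g) &
    (forall b, b \in B -> exists s (C : 'M[int]_n.+1),
      uval (D ^+ s * b)%g = map_mx intr C /\
      forall i, (phi (D ^+ s * b) * f (tz (e i)) =
        tor (fun i => f (tz (e i))) (C *m e i) * phi (D ^+ s * b))%g)]].

Lemma ev_good : ev aff_base aff_good.
Proof.
have GM := fpres_M fB; have GD : forall s, GLm m (D ^+ s)%g.
  by elim=> [|s IH]; rewrite ?expgS; [exact: (fpres_1 fB)|apply: GM GLm_scal IH].
have /choice [sC hsC] : forall b, exists sC : nat * 'M[int]_n.+1, GLm m b ->
    uval (D ^+ sC.1 * b)%g = map_mx intr sC.2.
  move=> b; case: (pselect (GLm m b)) => [/GLm_clear [s [C eC]]|h]; first by exists (s, C).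
  by exists (0%N, 0).
have /choice [wd hwd] : forall b, exists w, GLm m b -> inw B w /\ pr id w = b.
  move=> b; case: (pselect (GLm m b)) => [/(fpres_word fB) [w Bw ew]|h]; first by exists w.
  by exists [::].
have GB b : b \in B -> GLm m b := @fpres_gen _ _ _ _ fB b.
have e1 := @ev_V _ aff_base aff_baseV.
have e2 : ev aff_base (fun Q f => forall i j, commute (f (tz (e i))) (f (tz (e j)))).
  apply: ev_fin => i; apply: ev_fin => j.
  have := @ev_rel _ aff_base [:: tz (e i); tz (e j)] [:: tz (e j); tz (e i)].
  rewrite /= !aff_base_tz !mulg1 => /(_ isT isT) h.
  have [|k hk] := h; first by rewrite -!tzD addrC.
  by exists k => Q f /hk; rewrite !mulg1.
have e3 : ev aff_base (fun Q f => forall b, b \in B -> forall i,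
    pr f (map lin (wd (D ^+ (sC b).1 * b)%g) ++ [:: tz (e i)]) =
    pr f (tword ((sC b).2 *m e i) ++ map lin (wd (D ^+ (sC b).1 * b)%g))).
  apply: ev_all => b /GB Gb; apply: ev_fin => i.
  have [Bw ew] := hwd _ (GM _ _ (GD (sC b).1) Gb).
  apply: ev_rel; rewrite ?all_cat ?tword_base ?lin_base ?andbT //=.
    by rewrite aff_base_tz.
  rewrite !pr_cat pr_tword // -tz_tor /= mulg1 lin_word ew lin_tr hsC //.
  by rewrite -map_mxM.
have e3' : ev aff_base (fun Q f => forall i,
    pr f (map lin (wd D) ++ [:: tz (e i)]) = pr f (tword (m%:Z *: e i) ++ map lin (wd D))).
  apply: ev_fin => i; have [Bw ew] := hwd _ GLm_scal.
  apply: ev_rel; rewrite ?all_cat ?tword_base ?lin_base ?andbT //=.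
    by rewrite aff_base_tz.
  rewrite !pr_cat pr_tword // -tz_tor /= mulg1 lin_word ew lin_tr; congr (tr _ * _)%g.
  by rewrite /= mul_scalar_mx map_mxZ.
have e4 : ev aff_base (fun Q f => exists phi : GLQ -> Q,
    (forall a b, GLm m a -> GLm m b -> phi (a * b)%g = (phi a * phi b)%g)
    /\ (forall w, inw B w -> phi (pr id w) = pr (f \o lin) w)).
  exists nB => Q f /rels_lin r; exact: fpres_hom fB _ _ r.
apply: ev_mono (ev_and (ev_and e1 e2) (ev_and (ev_and e3 e3') e4)) => Q f.
case=> -[fV fC] [[fR fD] [phi [phiM phiw]]].
have fV' i : f (tz (e i))^-1%g = (f (tz (e i)))^-1%g by apply/fV/aff_base_tz.
split=> //; exists phi; split=> // [b Bb|i|b Db].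
- by have := phiw [:: b]; rewrite /= Bb !mulg1; apply.
- have [Bw ew] := hwd _ GLm_scal; have := fD i.
  by rewrite !pr_cat pr_tword // pr1 pr_map -phiw // ew.
exists (sC b).1, (sC b).2; split; first exact/hsC/GB.
move=> i; have [Bw ew] := hwd _ (GM _ _ (GD (sC b).1) (GB _ Db)).
have := fR b Db i; rewrite !pr_cat pr_tword // pr1 pr_map -phiw //.
by rewrite ew.
Qed.

Section Lift.
Variables (Q : groupType) (f : aff -> Q).
Hypothesis gf : aff_good f.
Local Notation T := (tor (fun i => f (tz (e i)))).

(** The translation by [v / m^s] is represented by the word of the integer vector [v], conjugated by
    the image [d s] of the scalar [m^s]. The relation [rp] pairs an affine map with any such
    expression and is stable under left multiplication by generators; at the identity the vector is
    0. *)
Lemma aff_triv w : inw aff_base w -> pr id w = 1%g -> pr f w = 1%g.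
Proof.
have [fV fC [phi [phiM phiB phiD phiT]]] := gf.
have GM := fpres_M fB; have G1 := fpres_1 fB; have GV := fpres_V fB.
have GD : forall s, GLm m (D ^+ s)%g.
  by elim=> [|s IH]; rewrite ?expgS; [exact: G1|apply: GM GLm_scal IH].
have p1 : phi 1%g = 1%g by apply: (mulgI (phi 1%g)); rewrite -phiM // !mulg1.
pose d s := phi (D ^+ s)%g.
have dD s t : d (s + t)%N = (d s * d t)%g by rewrite /d expgnDr phiM.
have dC s a : GLm m a -> (phi a * d s = d s * phi a)%g.
  by move=> Ga; rewrite /d -!phiM // scalXC.
have dT s v : (d s * T v = T (m%:Z ^+ s *: v) * d s)%g.
  elim: s v => [|s IH] v; first by rewrite scale1r /d p1 mulg1 mul1g.
  rewrite -addn1 dD -mulgA /d expg1 (tor_act (C := m%:Z%:M) fC) -/(d s); last first.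
    by move=> i; rewrite mul_scalar_mx; apply: phiD.
  by rewrite mulgA IH mul_scalar_mx scalerA exprD mulgA.
pose rp g q := exists s v, [/\ GLm m (lpart g), m%:R ^+ s *: tpart g = ZQ v &
  q = ((d s)^-1 * T v * d s * phi (lpart g))%g].
have rp_lin b g q : b \in B -> rp g q -> rp (lin b * g)%g (f (lin b) * q)%g.
  move=> Bb [s [v [Gg ev ->]]]; have [t [C [eC hC]]] := phiT b Bb.
  have Gb := fpres_gen fB Bb; rewrite -phiB //.
  exists (s + t)%N, (C *m v); split; first exact: GM.
    rewrite map_mxM -eC -ev uvalM uval_scalX -[_ * _]/(_ *m _) mul_scalar_mx.
    by rewrite -scalemxAr -scalemxAl /= addr0 exprD -scalerA.
  apply: (mulgI (d (s + t)%N)); rewrite !mulgA mulgV mul1g [in RHS]phiM // addnC dD.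
  rewrite -[(d t * d s * _)%g]mulgA -dC // -!mulgA mulKVg (mulgA (d t)) -(phiM (D ^+ t)%g) //.
  rewrite (mulgA (phi _)) (tor_act fC hC) phiM // -!mulgA; congr (_ * (_ * _))%g.
  by rewrite !mulgA dC.
have rp_tz u g q : rp g q -> rp (tz u * g)%g (T u * q)%g.
  move=> [s [v [Gg ev ->]]]; exists s, (m%:Z ^+ s *: u + v); split.
  - by rewrite /= mul1g.
  - rewrite /= mul1mx scalerDr ev addrC map_mxD map_mxZ rmorphXn /=; congr (_ + _).
  - rewrite torD //= mul1g; apply: (mulgI (d s)); rewrite !mulgA mulgV mul1g dT.
    by rewrite mulgK.
have rpw : forall w, inw aff_base w -> rp (pr id w) (pr f w).
  elim=> [_|x w' IH /= /andP [/aff_baseP Bx /IH r]].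
    by exists 0%N, 0; split; rewrite ?scaler0 ?map_mx0 ?tor0 //= /d p1 !mulg1 invg1.
  case: Bx => [[b Bb ->]|[i ei]]; first exact: rp_lin.
  have [u [-> ->]] : exists u, x = tz u /\ f x = T u.
    case: ei => ->; first by exists (e i); rewrite tor_delta.
    exists (- e i); rewrite torN // tor_delta fV; split=> //.
    by apply: mulg1_eq; rewrite -tzD subrr /tz map_mx0.
  exact: rp_tz.
move=> Bw ew; have [s [v [_ /= ev ->]]] := rpw w Bw.
rewrite ew scaler0 /= in ev *; have -> : v = 0.
  by apply/colP=> i; move/colP/(_ i): ev; rewrite !mxE => /esym/eqP; rewrite intr_eq0 => /eqP.
by rewrite tor0 p1 !mulg1 mulVg.
Qed.

End Lift.
Lemma affm_fpres_by : fpres affm.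
Proof.
have [k hk] := ev_good; exists aff_base, k; split=> [g|g|Q f /hk gf w]; last exact: aff_triv.
  exact: aff_baseV.
have GM := fpres_M fB; have G1 := fpres_1 fB; have GV := fpres_V fB.
have GD : forall s, GLm m (D ^+ s)%g.
  by elim=> [|s IH]; rewrite ?expgS; [exact: G1|apply: GM GLm_scal IH].
split=> [[Gg [s [v ev]]]|[w Bw <-]]; last first.
  elim: w Bw => [_|x w IH /= /andP [/aff_baseP Bx /IH [Gg [s [v ev]]]]].
    by split=> //; exists 0%N, 0; rewrite scaler0 map_mx0.
  have tzc u : affm (tz u * pr id w)%g.
    split; first by rewrite /= mul1g.
    exists s, (m%:Z ^+ s *: u + v).
    by rewrite /= mul1mx scalerDr ev addrC map_mxD map_mxZ rmorphXn.
  case: Bx => [[b Bb ->]|[i [->|->]]] //.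
    split; first exact: GM (fpres_gen fB Bb) Gg.
    have [t [C eC]] := GLm_clear (fpres_gen fB Bb).
    exists (s + t)%N, (C *m v).
    rewrite map_mxM -eC -ev uvalM uval_scalX -[_ * _]/(_ *m _) mul_scalar_mx.
    by rewrite -scalemxAr -scalemxAl /= addr0 exprD -scalerA.
  have -> : ((tz (e i))^-1 = tz (- e i))%g; last exact: tzc.
  by apply: mulg1_eq; rewrite -tzD subrr /tz map_mx0.
have wlin a : GLm m a -> exists2 w, inw aff_base w & pr id w = lin a.
  by move=> /(fpres_word fB) [w Bw <-]; exists (map lin w); rewrite ?lin_base ?lin_word.
have [w1 B1 e1] := wlin _ (GV _ (GD s)); have [w2 B2 e2] := wlin _ (GD s).
have [w3 B3 e3] := wlin _ Gg.
exists (w1 ++ tword v ++ w2 ++ w3); first by rewrite !all_cat B1 B2 B3 tword_base.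
rewrite !pr_cat e1 e2 e3 pr_tword // -tz_tor mulgA lin_tr -mulgA [(lin _^-1 * _)%g]mulgA.
rewrite -linM mulVg mul1g tr_lin; case: (g) ev => a b /= ev; congr Aff.
rewrite -ev; apply: (@scalerI _ _ (m%:R ^+ s)); rewrite ?expf_neq0 //.
have eD : m%:R ^+ s *: uval (D ^+ s)^-1%g = 1 by rewrite -mul_scalX mulVg.
by rewrite scalemxAl [X in X *m _]eD mul1mx.
Qed.

End Words.

Lemma affm_fpres : fpres affm.
Proof. by have [B [k fB]] := GLm_fpres n m0; apply: affm_fpres_by fB. Qed.

End AffineGroup.

(** * Cones in the space of streams *)

Section Streams.
Local Open Scope group_scope.
Variables (T : finType) (z : T).
Local Notation X := (nat -> T).
Local Notation word := (seq T).
Implicit Types (u v w : word) (x y : X) (g h : bij X).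

Definition scons (i : T) x : X := fun n => if n is n'.+1 then x n' else i.
Definition app u x : X := foldr scons x u.
Definition sdrop k x : X := fun n => x (k + n)%N.
Definition pre u x := u == mkseq x (size u).
Definition dis u v := ~~ prefix u v && ~~ prefix v u.

Lemma app_cat u v x : app (u ++ v) x = app u (app v x).
Proof. by rewrite /app foldr_cat. Qed.

Lemma app_nth u x n : app u x n = if (n < size u)%N then nth z u n else x (n - size u)%N.
Proof. by elim: u n => [|i u IH] [|n] //=; rewrite IH. Qed.

Lemma pre_app u v x : pre u (app (u ++ v) x).
Proof.
apply/eqP/(@eq_from_nth _ z); first by rewrite size_mkseq.
move=> n nu; rewrite nth_mkseq // app_nth size_cat ltn_addr // nth_cat.
by rewrite nu.
Qed.

Lemma pre_app0 u x : pre u (app u x).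
Proof. by rewrite -{2}[u]cats0 pre_app. Qed.

Lemma preE u x : pre u x -> x = app u (sdrop (size u) x).
Proof.
move=> /eqP e; apply: funext => n; rewrite app_nth.
case: ltnP => nu; first by rewrite e nth_mkseq.
by rewrite /sdrop subnKC.
Qed.

Lemma sdrop_app u x : sdrop (size u) (app u x) = x.
Proof. by apply: funext => n; rewrite /sdrop app_nth ltnNge leq_addr /= addKn. Qed.

Lemma app_inj u : injective (app u).
Proof. by move=> x y e; rewrite -(sdrop_app u x) e sdrop_app. Qed.

Lemma pre_prefix u v x : pre u (app v x) -> (size u <= size v)%N -> prefix u v.
Proof.
move=> /preE e le; apply/prefixP; exists (drop (size u) v).
apply: (@eq_from_nth _ z); first by rewrite size_cat size_drop subnKC.
move=> n nv; rewrite nth_cat; case: ltnP => nu.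
  have := congr1 (fun f => f n) e; rewrite !app_nth nv nu => -> //.
by rewrite nth_drop subnKC.
Qed.

Lemma pre_dis u v x : dis u v -> pre u (app v x) = false.
Proof.
move=> /andP [uv vu]; apply/negP => h.
case: (leqP (size u) (size v)) => le; first by rewrite (pre_prefix h le) in uv.
case/negP: vu; have e := preE h; apply: (@pre_prefix v u (sdrop (size u) (app v x))).
  by rewrite -e pre_app0.
exact: ltnW.
Qed.

Lemma disP u v : reflect (forall x y, app u x <> app v y) (dis u v).
Proof.
apply: (iffP idP) => [uv x y e|h].
  by have := pre_dis y uv; rewrite -e pre_app0.
by apply/andP; split; apply/negP => /prefixP [w e];
  [apply: (h (app w (fun=> z)) (fun=> z))|apply: (h (fun=> z) (app w (fun=> z)))];
  rewrite e app_cat.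
Qed.

Lemma dis_sym u v : dis u v = dis v u.
Proof. by rewrite /dis andbC. Qed.

Lemma dis_catl u v w : dis u v -> dis (u ++ w) v.
Proof. by move/disP => h; apply/disP => x y; rewrite app_cat; apply: h. Qed.

Lemma dis_catr u v w : dis u v -> dis u (v ++ w).
Proof. by rewrite !(dis_sym u); apply: dis_catl. Qed.

Lemma dis_cat2l w u v : dis (w ++ u) (w ++ v) = dis u v.
Proof.
apply/disP/disP => h x y.
  by move=> e; apply: (h x y); rewrite !app_cat e.
by rewrite !app_cat => /app_inj; apply: h.
Qed.

Lemma dis_letter i j u v : i != j -> dis (i :: u) (j :: v).
Proof. by move=> /negPf ij; rewrite /dis !prefix_cons ij eq_sym ij. Qed.

Lemma dis_neq u v : dis u v -> u != v.
Proof. by apply: contraTneq => ->; rewrite /dis prefix_refl. Qed.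

Section Swap.
Variables a b : word.
Hypothesis ab : dis a b.

Definition swapf x := if pre a x then app b (sdrop (size a) x)
  else if pre b x then app a (sdrop (size b) x) else x.

Lemma swapf_l x : swapf (app a x) = app b x.
Proof. by rewrite /swapf pre_app0 sdrop_app. Qed.

Lemma swapf_r x : swapf (app b x) = app a x.
Proof. by rewrite /swapf pre_dis // pre_app0 sdrop_app. Qed.

Lemma swapfK : cancel swapf swapf.
Proof.
move=> x; case pa: (pre a x); first by rewrite (preE pa) swapf_l swapf_r.
case pb: (pre b x); first by rewrite (preE pb) swapf_r swapf_l.
by rewrite /swapf !(pa, pb).
Qed.

End Swap.

(** The value 1 on comparable words makes the exchange total. *)
Definition swap a b : bij X :=
  if pselect (dis a b) is left ab then Bij (swapfK ab) (swapfK ab) else 1.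

Lemma fw_swap a b x : dis a b -> fw (swap a b) x = swapf a b x.
Proof. by rewrite /swap; case: pselect. Qed.

Lemma swap_l a b x : dis a b -> fw (swap a b) (app a x) = app b x.
Proof. by move=> ab; rewrite fw_swap // swapf_l. Qed.

Lemma swap_r a b x : dis a b -> fw (swap a b) (app b x) = app a x.
Proof. by move=> ab; rewrite fw_swap // swapf_r. Qed.

Lemma swap_out a b x : dis a b -> ~~ pre a x -> ~~ pre b x -> fw (swap a b) x = x.
Proof. by move=> ab /negPf pa /negPf pb; rewrite fw_swap // /swapf pa pb. Qed.

Lemma swap_sym a b : swap a b = swap b a.
Proof.
case: (boolP (dis a b)) => ab; last first.
  rewrite /swap; case: pselect => h; first by rewrite h in ab.
  by case: pselect => // h'; rewrite dis_sym h' in ab.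
have ba : dis b a by rewrite dis_sym.
apply: bijP => x; case: (boolP (pre a x)) => [/preE ->|pa].
  by rewrite swap_l // swap_r.
case: (boolP (pre b x)) => [/preE ->|pb]; first by rewrite swap_r // swap_l.
by rewrite !swap_out.
Qed.

Lemma swap2 a b : swap a b * swap a b = 1.
Proof.
rewrite /swap; case: pselect => ab; last by rewrite mulg1.
by apply: bijP => x; apply: swapfK.
Qed.

Lemma swapV a b : (swap a b)^-1 = swap a b.
Proof. exact: mulg1_eq (swap2 a b). Qed.

Section Label.
Variables (a : word) (g : bij X).

Definition labf (f : X -> X) x := if pre a x then app a (f (sdrop (size a) x)) else x.

Lemma labf_in f x : labf f (app a x) = app a (f x).
Proof. by rewrite /labf pre_app0 sdrop_app. Qed.

Lemma labfK (f f' : X -> X) : cancel f f' -> cancel (labf f) (labf f').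
Proof.
move=> fK x; case pa: (pre a x); first by rewrite (preE pa) !labf_in fK.
by rewrite /labf !pa.
Qed.

Definition lab : bij X := Bij (labfK (fwK g)) (labfK (bwK g)).

Lemma lab_in x : fw lab (app a x) = app a (fw g x). Proof. exact: labf_in. Qed.

Lemma lab_out x : ~~ pre a x -> fw lab x = x.
Proof. by rewrite /= /labf => /negPf ->. Qed.

End Label.

Lemma labM a : {morph lab a : g h / g * h}.
Proof.
move=> g h; apply: bijP => x; case: (boolP (pre a x)) => [/preE ->|pa].
  by rewrite fwM !lab_in.
by rewrite fwM !lab_out.
Qed.

Lemma lab_inj a : injective (lab a).
Proof.
move=> g h e; apply: bijP => x; apply: (@app_inj a).
by rewrite -!lab_in e.
Qed.

Definition carries h u v := forall x, fw h (app u x) = app v x.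

Lemma carriesV h u v : carries h u v -> carries h^-1 v u.
Proof. by move=> hh x; rewrite -hh -[LHS]fwM mulVg. Qed.

Lemma carries_out h u v x : carries h u v -> pre v (fw h x) = pre u x.
Proof.
move=> hh; apply/idP/idP => [/preE|/preE ->]; last by rewrite hh pre_app0.
by rewrite -hh => /(@fwI _ h) ->; rewrite pre_app0.
Qed.

Lemma conj_swap h a b a' b' : dis a b -> dis a' b' -> carries h a a' -> carries h b b' ->
  h * swap a b * h^-1 = swap a' b'.
Proof.
move=> ab ab' ha hb; apply: (mulIg h); rewrite mulgKV.
apply: bijP => x; rewrite !fwM.
case: (boolP (pre a x)) => [/preE ->|pa]; first by rewrite swap_l // hb ha swap_l.
case: (boolP (pre b x)) => [/preE ->|pb]; first by rewrite swap_r // ha hb swap_r.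
by rewrite !swap_out ?(carries_out _ ha) ?(carries_out _ hb).
Qed.

Lemma conj_lab h a a' g : carries h a a' -> h * lab a g * h^-1 = lab a' g.
Proof.
move=> ha; apply: (mulIg h); rewrite mulgKV.
apply: bijP => x; rewrite !fwM.
case: (boolP (pre a x)) => [/preE ->|pa]; first by rewrite lab_in !ha lab_in.
by rewrite !lab_out ?(carries_out _ ha).
Qed.

Definition move_word a b u := if prefix a u then b ++ drop (size a) u
  else if prefix b u then a ++ drop (size b) u else u.

(** For disjoint [a] and [b] this excludes that [u] is a proper prefix of one of them, when the
    exchange need not act on the cone [u] by a change of prefix. *)
Definition movable a b u := [|| prefix a u, prefix b u | dis a u && dis b u].

Lemma mv_l a b w : move_word a b (a ++ w) = b ++ w.
Proof. by rewrite /move_word prefix_prefix drop_size_cat. Qed.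

Lemma mv_out a b u : dis a u -> dis b u -> move_word a b u = u.
Proof. by rewrite /move_word => /andP [/negPf -> _] /andP [/negPf -> _]. Qed.

Lemma mv_r a b w : dis a b -> move_word a b (b ++ w) = a ++ w.
Proof.
move=> ab; rewrite /move_word prefix_prefix (@drop_size_cat _ (size b)) //.
by have /andP [/negPf -> _] := dis_catr w ab.
Qed.

Lemma gpP a b u : movable a b u ->
  [\/ exists w, u = a ++ w, exists w, u = b ++ w | dis a u /\ dis b u].
Proof.
by case/or3P => [/prefixP|/prefixP|/andP []]; [constructor 1|constructor 2|constructor 3].
Qed.

Lemma swap_mv a b u : dis a b -> movable a b u -> carries (swap a b) u (move_word a b u).
Proof.
move=> ab /gpP [[w ->]|[w ->]|[au bu]] x.
- by rewrite mv_l !app_cat swap_l.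
- by rewrite mv_r // !app_cat swap_r.
- by rewrite mv_out // swap_out // pre_dis.
Qed.

Lemma gp_mv a b u : dis a b -> movable a b u -> movable a b (move_word a b u).
Proof.
move=> ab /gpP [[w ->]|[w ->]|[au bu]].
- by rewrite mv_l /movable prefix_prefix orbT.
- by rewrite mv_r // /movable prefix_prefix.
- by rewrite mv_out // /movable au bu !orbT.
Qed.

Lemma mvK a b u : dis a b -> movable a b u -> move_word a b (move_word a b u) = u.
Proof.
move=> ab /gpP [[w ->]|[w ->]|[au bu]].
- by rewrite mv_l mv_r.
- by rewrite mv_r // mv_l.
- by rewrite !mv_out.
Qed.

Lemma mv_sym a b u : dis a b -> movable a b u -> move_word a b u = move_word b a u.
Proof.
move=> ab; have ba : dis b a by rewrite dis_sym.
move=> /gpP [[w ->]|[w ->]|[au bu]].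
- by rewrite mv_l mv_r.
- by rewrite mv_r // mv_l.
- by rewrite !mv_out.
Qed.

Lemma gp_sym a b u : movable a b u = movable b a u.
Proof. by rewrite /movable orbCA andbC. Qed.

Lemma dis_carries h u v u' v' : carries h u u' -> carries h v v' -> dis u v -> dis u' v'.
Proof.
move=> hu hv /disP uv; apply/disP => x y; rewrite -hu -hv => /(@fwI _ h); exact: uv.
Qed.

Lemma dis_mv a b u v : dis a b -> movable a b u -> movable a b v -> dis u v ->
  dis (move_word a b u) (move_word a b v).
Proof. by move=> ab gu gv; apply: (@dis_carries (swap a b)); apply: swap_mv. Qed.

Lemma mv_cat a b u w : dis a b -> movable a b u -> move_word a b (u ++ w) = move_word a b u ++ w.
Proof.
move=> ab /gpP [[v ->]|[v ->]|[au bu]].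
- by rewrite -catA !mv_l catA.
- by rewrite -catA !mv_r // catA.
- by rewrite !mv_out ?dis_catr.
Qed.

Lemma gp_cat a b u w : movable a b u -> movable a b (u ++ w).
Proof.
move=> /gpP [[v ->]|[v ->]|[au bu]]; rewrite /movable -?catA ?prefix_prefix ?orbT //.
by rewrite !dis_catr ?orbT.
Qed.

Hypothesis T2 : (1 < #|T|)%N.

End Streams.

(** * Generators with long addresses as words in generators with short ones *)

Section Objects.
Local Open Scope group_scope.
Variables (T : finType) (z : T).
Local Notation X := (nat -> T).
Local Notation word := (seq T).
Local Notation swap := (@swap T z).
Local Notation lab := (@lab T z).
Hypothesis T8 : (8 <= #|T|)%N.
Variable B : seq (bij X).

Lemma fresh (l : seq T) : (size l < #|T|)%N -> exists c, c \notin l.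
Proof.
move=> sl; have /card_gt0P [c] : (0 < #|[predC l]|)%N.
  by rewrite -(ltn_add2l #|l|) addn0 cardC; apply: leq_ltn_trans (card_size l) sl.
by exists c.
Qed.

(* [(None, [:: a; b])] encodes the exchange of the cones [a] and [b], and
   [(Some h, [:: a])] the action of [h] inside the cone [a]. *)
Definition obj := (option (bij X) * seq word)%type.
Implicit Types (x : obj) (a b u v w g p q : word).

Definition obj_elt x : bij X := match x with
  | (None, [:: a; b]) => swap a b
  | (Some h, [:: a]) => lab a h
  | _ => 1 end.

Definition shape x := match x with
  | (None, [:: a; b]) => true
  | (Some h, [:: a]) => h \in B
  | _ => false end.

Definition admissible x := [&& shape x, all (fun u => u != [::]) x.2 & pairwise (@dis T) x.2].
Definition move_obj a b x : obj := (x.1, map (move_word a b) x.2).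
Definition obj_size x := sumn (map size x.2).
Definition short x := all (fun u : word => size u <= 2)%N x.2.
Definition short_word (u : word) := (0 < size u <= 2)%N.
Definition heads x := map (head z) x.2.

Lemma size_shape x : shape x -> (0 < size x.2 <= 2)%N.
Proof. by case: x => [[g|] [|a [|b [|]]]]. Qed.

Lemma shape_map x (F : word -> word) : shape (x.1, map F x.2) = shape x.
Proof. by case: x => [[g|] [|a [|b [|]]]]. Qed.

Lemma mv_nil a b u : a != [::] -> b != [::] -> u != [::] -> move_word a b u != [::].
Proof.
move=> a0 b0 u0; rewrite /move_word; case: ifP => _; first by case: (b) b0.
by case: ifP => _ //; case: (a) a0.
Qed.

Lemma sw0 u : short_word u -> u != [::]. Proof. by case: u. Qed.

Lemma adm_dis x u v : admissible x -> u \in x.2 -> v \in x.2 -> u != v -> dis u v.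
Proof.
case/and3P=> _ _; elim: x.2 => //= w s IH /andP [/allP aw pw].
rewrite !inE => /orP [/eqP ->|us] /orP [/eqP ->|vs] nuv; last exact: IH.
- by rewrite eqxx in nuv.
- exact: aw.
- by rewrite dis_sym; apply: aw.
Qed.

Lemma adm_nil x u : admissible x -> u \in x.2 -> u != [::].
Proof. by case/and3P=> _ /allP h _; apply: h. Qed.

Lemma pairwise_mv a b (s : seq word) : dis a b -> all (movable a b) s ->
  pairwise (@dis T) s -> pairwise (@dis T) (map (move_word a b) s).
Proof.
move=> ab; elim: s => // u s IH; rewrite [all _ _]/= [pairwise _ (u :: s)]/=.
case/andP=> gu gs /andP [/allP au ps]; rewrite /= IH // andbT.
by apply/allP=> _ /mapP [v vs ->]; apply: (dis_mv z ab gu (allP gs _ vs) (au _ vs)).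
Qed.

Lemma adm_mv a b x : a != [::] -> b != [::] -> dis a b -> all (movable a b) x.2 ->
  admissible x -> admissible (move_obj a b x).
Proof.
move=> a0 b0 ab /allP gx /and3P [sh /allP nx px]; apply/and3P; split.
- by rewrite shape_map.
- by apply/allP=> _ /mapP [u ux ->]; apply: mv_nil (nx _ ux).
- by apply: pairwise_mv px => //; apply/allP.
Qed.

Lemma el_conj a b x : dis a b -> all (movable a b) x.2 -> admissible x ->
  swap a b * obj_elt x * swap a b = obj_elt (move_obj a b x).
Proof.
move=> ab gx /and3P [sh _ px]; rewrite -{2}[swap a b](swapV z).
case: x sh gx px => [[g|] [|u [|v [|]]]] //= _.
  rewrite !andbT => gu _; apply: conj_lab; exact: swap_mv.
rewrite !andbT => /andP [gu gv] uv; apply: conj_swap => //; try exact: swap_mv.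
exact: (dis_mv z).
Qed.

Lemma sumn_lt (F G : word -> nat) s : (forall u, u \in s -> F u <= G u)%N ->
  (exists2 u, u \in s & F u < G u)%N -> (sumn (map F s) < sumn (map G s))%N.
Proof.
elim: s => [|u s IH] le [v] //; rewrite inE => /orP [/eqP ->|vs] lt /=.
  rewrite -addSn leq_add //.
  have {}le w : w \in s -> (F w <= G w)%N by move=> ws; apply: le; rewrite inE ws orbT.
  elim: s le {IH} => //= w s IH le; rewrite leq_add ?le ?mem_head //.
  by apply: IH => w' ws; apply: le; rewrite inE ws orbT.
rewrite -addnS leq_add ?le ?mem_head //; apply: IH; last by exists v.
by move=> w ws; apply: le; rewrite inE ws orbT.
Qed.

Lemma size_mv_le a b u : (size b <= size a)%N -> ~~ prefix b u ->
  (size (move_word a b u) <= size u)%N.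
Proof.
move=> ba /negPf bu; rewrite /move_word bu; case: ifP => // /prefixP [w ->].
by rewrite drop_size_cat // !size_cat leq_add2r.
Qed.

Lemma size_mv_eq a b u : size a = size b -> size (move_word a b u) = size u.
Proof.
move=> ab; rewrite /move_word; case: ifP => [/prefixP [w ->]|_].
  by rewrite drop_size_cat // !size_cat ab.
by case: ifP => // /prefixP [w ->]; rewrite drop_size_cat // !size_cat ab.
Qed.

Lemma sz_mv_eq a b x : size a = size b -> obj_size (move_obj a b x) = obj_size x.
Proof.
by move=> ab; rewrite /obj_size /= -map_comp; congr sumn; apply: eq_map => u /=; apply: size_mv_eq.
Qed.

(** As [c] begins no address of [x], the exchange of [g] with [[:: c]] acts on all the addresses,
    and it replaces two letters by one in an address beginning with [g]. *)
Definition reducible_by x (g : word) (c : T) :=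
  [/\ size g = 2, exists2 u, u \in x.2 & prefix g u & c \notin heads x].

Lemma notin_hds x u c : c \notin heads x -> u \in x.2 -> c != head z u.
Proof. by move=> cx ux; apply: contraNneq cx => ->; apply: map_f. Qed.

Lemma dis_hd (c : T) u : u != [::] -> c != head z u -> dis [:: c] u.
Proof. by case: u => //= i u _; apply: dis_letter. Qed.

Lemma redm_head x g c : admissible x -> reducible_by x g c -> dis g [:: c].
Proof.
move=> ax [g2 [u ux /prefixP [w e]] cx]; rewrite dis_sym; apply: dis_hd.
  by case: (g) g2.
have := notin_hds cx ux; rewrite e; by case: (g) g2.
Qed.

Lemma redm_gp x g c u : admissible x -> reducible_by x g c -> u \in x.2 ->
  (exists w, u = g ++ w) \/ (dis g u /\ dis [:: c] u).
Proof.
move=> ax [g2 [v vx gv] cx] ux; case: (boolP (prefix g u)) => [/prefixP|gu]; first by left.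
right; split; last exact: dis_hd (adm_nil ax ux) (notin_hds cx ux).
rewrite /dis gu /=; apply/negP => ug.
have uv : u != v by apply: contraNneq gu => ->.
have := adm_dis ax ux vx uv.
by rewrite /dis (prefix_trans ug gv).
Qed.

Lemma redm_all x g c : admissible x -> reducible_by x g c -> all (movable g [:: c]) x.2.
Proof.
move=> ax rx; apply/allP=> u /(redm_gp ax rx) [[w ->]|[gu cu]].
  by rewrite /movable prefix_prefix.
by rewrite /movable gu cu !orbT.
Qed.

Lemma redm_adm x g c : admissible x -> reducible_by x g c -> admissible (move_obj g [:: c] x).
Proof.
move=> ax rx; apply: (adm_mv _ _ (redm_head ax rx) (redm_all ax rx) ax) => //.
by case: (g) rx => [[]|].
Qed.

Lemma redm_not x g c u : admissible x -> reducible_by x g c -> u \in x.2 -> ~~ prefix [:: c] u.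
Proof.
move=> ax [_ _ cx] ux; have := dis_hd (adm_nil ax ux) (notin_hds cx ux).
by case/andP.
Qed.

Lemma redm_sz x g c : admissible x -> reducible_by x g c -> (obj_size (move_obj g [:: c] x) < obj_size x)%N.
Proof.
move=> ax rx; have [g2 [v vx gv] cx] := rx.
rewrite /obj_size /= -map_comp; apply: sumn_lt => [u ux|].
  by apply: size_mv_le; rewrite ?g2 // (redm_not ax rx).
exists v => //; case/prefixP: gv => w ->.
by rewrite /= mv_l !size_cat g2.
Qed.

Lemma redm_short x g c : admissible x -> reducible_by x g c -> short x -> short (move_obj g [:: c] x).
Proof.
move=> ax rx /allP sx; apply/allP=> _ /mapP [u ux ->].
apply: leq_trans (sx _ ux); apply: size_mv_le; first by case: rx => ->.
exact: redm_not rx ux.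
Qed.

(** An object has at most two addresses, so eight letters leave one that avoids their heads and five
    further letters. *)
Lemma fresh_redm x (l : seq T) : admissible x -> (size l <= 5)%N ->
  exists c, c \notin heads x /\ c \notin l.
Proof.
move=> /and3P [/size_shape sx _ _] sl; have [|c] := @fresh (heads x ++ l).
  by rewrite size_cat size_map; lia.
by rewrite mem_cat negb_or => /andP []; exists c.
Qed.

Lemma prefix_take2 u : prefix (take 2 u) u.
Proof. by apply/prefixP; exists (drop 2 u); rewrite cat_take_drop. Qed.

Lemma mvl a b : move_word a b a = b.
Proof. by rewrite -{2}[a]cats0 mv_l cats0. Qed.

Lemma mvr a b : dis a b -> move_word a b b = a.
Proof. by move=> ab; rewrite -{2}[b]cats0 (mv_r z) // cats0. Qed.

Lemma gp_l a b : movable a b a. Proof. by rewrite /movable prefix_refl. Qed.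
Lemma gp_r a b : movable a b b. Proof. by rewrite /movable prefix_refl orbT. Qed.
Lemma gp_out a b u : dis a u -> dis b u -> movable a b u.
Proof. by move=> au bu; rewrite /movable au bu !orbT. Qed.

Lemma red_ex : exists reduction : obj -> word * T, forall x, admissible x -> ~~ short x ->
  reducible_by x (reduction x).1 (reduction x).2.
Proof.
suff /choice [r hr] : forall x, exists r : word * T, admissible x -> ~~ short x -> reducible_by x r.1 r.2.
  by exists r.
move=> x; case: (boolP (admissible x)) => [ax|_]; last by exists ([::], z).
case: (boolP (short x)) => [_|]; first by exists ([::], z).
rewrite /short -has_predC => /hasP [u ux /=]; rewrite -ltnNge => u2.
have [c [cx _]] := @fresh_redm x [::] ax isT.
exists (take 2 u, c) => _ _; split=> //; first by rewrite size_take u2.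
by exists u => //; apply: prefix_take2.
Qed.

Definition reduction := sval (cid red_ex).

Lemma redP x : admissible x -> ~~ short x -> reducible_by x (reduction x).1 (reduction x).2.
Proof. exact: (svalP (cid red_ex)). Qed.

(* Exchanging a prefix of length two of an address with a letter that begins no
   address of the object shortens the object. *)
Fixpoint obj_word_rec n x : seq (bij X) := if short x then [:: obj_elt x] else
  if n is n'.+1 then
    let s := swap (reduction x).1 [:: (reduction x).2] in
    s :: rcons (obj_word_rec n' (move_obj (reduction x).1 [:: (reduction x).2] x)) s
  else [::].

Definition obj_word x := obj_word_rec (obj_size x) x.

Lemma sz_gt0 x : admissible x -> (0 < obj_size x)%N.
Proof.
case: x => [t [|u s]] /and3P; first by case: t => [?|] [].
by case=> _ /= /andP [u0 _] _; rewrite /obj_size /= addn_gt0; case: (u) u0.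
Qed.

Lemma Wn_eq n n' x : admissible x -> (obj_size x <= n)%N -> (obj_size x <= n')%N -> obj_word_rec n x = obj_word_rec n' x.
Proof.
elim: n n' x => [|n IH] [|n'] x ax sn sn'; try by have := sz_gt0 ax; lia.
rewrite /=; case: ifP => // /negbT lx; have rx := redP ax lx.
have lt := redm_sz ax rx; congr (_ :: rcons _ _).
by apply: IH; [exact: redm_adm rx|lia|lia].
Qed.

Lemma W_short x : short x -> obj_word x = [:: obj_elt x].
Proof. by rewrite /obj_word; case: (obj_size x) => [|k] /= ->. Qed.

Lemma W_long x (s := swap (reduction x).1 [:: (reduction x).2]) : admissible x -> ~~ short x ->
  obj_word x = s :: rcons (obj_word (move_obj (reduction x).1 [:: (reduction x).2] x)) s.
Proof.
move=> ax lx; have rx := redP ax lx; have lt := redm_sz ax rx.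
have := sz_gt0 ax; rewrite {1}/obj_word; case e: (obj_size x) => [|k] //= _.
rewrite (negPf lx); congr (_ :: rcons _ _); apply: Wn_eq => //; first exact: redm_adm rx.
by rewrite e in lt.
Qed.

Lemma pr_W x : admissible x -> pr id (obj_word x) = obj_elt x.
Proof.
have [n] := ubnP (obj_size x); elim: n x => // n IH x lt ax.
case: (boolP (short x)) => sx; first by rewrite W_short // pr1.
have rx := redP ax sx; rewrite W_long //= pr_rcons mulgA IH; last exact: redm_adm rx.
  have ax' := redm_adm ax rx; have hd := redm_head ax rx; have ga := redm_all ax rx.
  rewrite -(el_conj hd ga ax) !mulgA swap2 mul1g -mulgA swap2 mulg1 //.
by have := redm_sz ax rx; lia.
Qed.

Section Claim.
Variables (Q : groupType) (f : bij X -> Q).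

Local Notation S a b := (f (swap a b)).

(** Finitely many relations, as all words and objects in them are short; the behaviour of long
    addresses is derived from these. *)
Definition short_rels := (forall a b, short_word a -> short_word b -> dis a b -> S a b * S a b = 1) /\
  (forall x a b, admissible x -> short x -> short_word a -> short_word b -> dis a b -> all (movable a b) x.2 ->
    short (move_obj a b x) -> S a b * f (obj_elt x) * S a b = f (obj_elt (move_obj a b x))).

Hypothesis fok : short_rels.

Definition obj_val x : Q := pr f (obj_word x).

Lemma E_short x : short x -> obj_val x = f (obj_elt x).
Proof. by move=> sx; rewrite /obj_val W_short // pr1. Qed.

Lemma S_sym a b : S a b = S b a. Proof. by rewrite swap_sym. Qed.

Lemma S2 a b : short_word a -> short_word b -> dis a b -> S a b * S a b = 1.
Proof. by case: fok => h _; apply: h. Qed.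

Lemma S_conj a b p q : short_word a -> short_word b -> short_word p -> short_word q -> dis a b -> dis p q ->
  movable a b p -> movable a b q -> short_word (move_word a b p) -> short_word (move_word a b q) ->
  S a b * S p q * S a b = S (move_word a b p) (move_word a b q).
Proof.
move=> sa sb sp sq ab pq gap gaq smp smq; case: fok => _ h.
have := h (None, [:: p; q]) a b; rewrite /= /admissible /= /short /= !andbT.
move: sp sq smp smq; rewrite /short_word => /andP [p0 p2] /andP [q0 q2] /andP [_ ->] /andP [_ ->].
rewrite p2 q2 gap gaq pq -!size_eq0 -!lt0n p0 q0; exact.
Qed.

(** The sizes before and after are both bounded, because a move may lengthen the object and is also
    used backwards. *)
Definition moves_upto N := forall x a b, admissible x -> short_word a -> short_word b -> dis a b -> all (movable a b) x.2 ->
  (obj_size x <= N)%N -> (obj_size (move_obj a b x) <= N)%N -> S a b * obj_val x * S a b = obj_val (move_obj a b x).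

Lemma S_move a b (p q : Q) : short_word a -> short_word b -> dis a b -> S a b * p * S a b = q -> p = S a b * q * S a b.
Proof.
by move=> sa sb ab <-; rewrite !mulgA S2 // mul1g -mulgA S2 // mulg1.
Qed.

Lemma mv_comm a b p q u : dis a b -> dis p q -> dis a p -> dis a q -> dis b p -> dis b q ->
  movable a b u -> movable p q u -> movable p q (move_word a b u) /\ move_word p q (move_word a b u) = move_word a b (move_word p q u).
Proof.
move=> ab pq ap aq bp bq; have [pa qa pb qb] : [/\ dis p a, dis q a, dis p b & dis q b].
  by rewrite ![dis p _]dis_sym ![dis q _]dis_sym.
move=> /gpP [[w ->]|[w ->]|[au bu]] gpu.
- rewrite mv_l /movable !(dis_catr z _ pb, dis_catr z _ qb) !orbT; split=> //.
  rewrite (mv_out (a := p)) ?(dis_catr z) // (mv_out (a := p)) ?(dis_catr z) //.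
  by rewrite mv_l.
- rewrite (mv_r z) // /movable !(dis_catr z _ pa, dis_catr z _ qa) !orbT; split=> //.
  rewrite (mv_out (a := p)) ?(dis_catr z) // (mv_out (a := p)) ?(dis_catr z) //.
  by rewrite (mv_r z).
- rewrite mv_out //; split=> //; move: gpu => /gpP [[w ->]|[w ->]|[pu qu]].
  + by rewrite mv_l mv_out ?(dis_catr z).
  + by rewrite (mv_r z) // mv_out ?(dis_catr z).
  + by rewrite !mv_out.
Qed.

Lemma mvo_comp a b p q x (F : word -> word) :
  (forall u, u \in x.2 -> move_word a b (move_word p q u) = F u) ->
  move_obj a b (move_obj p q x) = (x.1, map F x.2).
Proof. by move=> h; rewrite /move_obj /= -map_comp; congr pair; apply/eq_in_map. Qed.

Section Step.
Variable N : nat.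
Hypothesis IH : moves_upto N.

Lemma sw_letter c : short_word [:: c]. Proof. by []. Qed.

Lemma redm_sw x g c : reducible_by x g c -> short_word g.
Proof. by case=> g2 _ _; rewrite /short_word g2. Qed.

Lemma dis_redm x g c g' c' : admissible x -> reducible_by x g c -> reducible_by x g' c' -> dis g [:: c'].
Proof.
move=> ax [g2 [u ux gu] _] [_ _ cx]; apply: (@redm_head x) => //.
by split=> //; exists u.
Qed.

Lemma dis_size2 (g g' : word) : size g = size g' -> g != g' -> dis g g'.
Proof.
have h (u v : word) : size u = size v -> u != v -> ~~ prefix u v.
  move=> e; apply: contraNN => /prefixP [[|i w] ev]; first by rewrite ev cats0.
  by move: e; rewrite ev size_cat /=; lia.
by move=> e n; rewrite /dis !h // eq_sym.
Qed.

(** Different prefixes of length two are disjoint, so the two reductions commute. The object reduced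
    both ways is smaller than [y], and the induction hypothesis compares both sides with it. *)
Lemma red_commute y g c g' c' : admissible y -> (obj_size y <= N.+1)%N -> reducible_by y g c -> reducible_by y g' c' ->
  g != g' -> c != c' ->
  S g [:: c] * obj_val (move_obj g [:: c] y) * S g [:: c] = S g' [:: c'] * obj_val (move_obj g' [:: c'] y) * S g' [:: c'].
Proof.
move=> ay sy r r' gg' cc'.
have sg := redm_sw r; have sg' := redm_sw r'.
have d := redm_head ay r; have d' := redm_head ay r'.
have dg : dis g g' by apply: dis_size2 gg'; case: r => ->; case: r'.
have d1 := dis_redm ay r r'; have d2 := dis_redm ay r' r.
have dc : dis [:: c] [:: c'] by apply: dis_letter.
have [dg' d1' d2' dc'] : [/\ dis g' g, dis [:: c'] g, dis [:: c] g' & dis [:: c'] [:: c]].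
  by split; rewrite dis_sym.
have CS : S g [:: c] * S g' [:: c'] = S g' [:: c'] * S g [:: c].
  have := S_conj sg (sw_letter c) sg' (sw_letter c') d d'.
  rewrite /movable dg d2' d1 dc !orbT (mv_out dg d2') (mv_out d1 dc) => /(_ isT isT sg' isT) e.
  by rewrite -[in RHS]e -!mulgA S2 // mulg1.
have cm u : u \in y.2 -> movable g' [:: c'] (move_word g [:: c] u) /\
    move_word g' [:: c'] (move_word g [:: c] u) = move_word g [:: c] (move_word g' [:: c'] u).
  move=> uy; apply: mv_comm => //; first exact: (allP (redm_all ay r)).
  exact: (allP (redm_all ay r')).
have cm' u : u \in y.2 -> movable g [:: c] (move_word g' [:: c'] u).
  move=> uy; apply: (proj1 (mv_comm _ _ _ _ _ _ _ _)) => //.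
    exact: (allP (redm_all ay r')).
  exact: (allP (redm_all ay r)).
have e2 : move_obj g' [:: c'] (move_obj g [:: c] y) = move_obj g [:: c] (move_obj g' [:: c'] y).
  by rewrite /move_obj /= -!map_comp; congr pair; apply/eq_in_map => u /cm [].
have lt := redm_sz ay r; have lt' := redm_sz ay r'.
have le u : u \in y.2 -> (size (move_word g' [:: c'] (move_word g [:: c] u)) <= size u)%N.
  move=> uy; have np : ~~ prefix [:: c'] (move_word g [:: c] u).
    have [[w ->]|[gu cu]] := redm_gp ay r uy; last by rewrite mv_out // (redm_not ay r').
    by rewrite mv_l; case/andP: (dis_catr z w dc').
  apply: leq_trans (size_mv_le _ np) (size_mv_le _ (redm_not ay r uy)); first by case: r' => ->.
  by case: r => ->.
have lt2 : (obj_size (move_obj g' [:: c'] (move_obj g [:: c] y)) < obj_size y)%N.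
  rewrite /obj_size /= -!map_comp; apply: sumn_lt => [u uy|]; first exact: le.
  have [g2 [v vy gv] _] := r; exists v => //=; case/prefixP: gv vy => w -> vy.
  by rewrite mv_l (mv_out (dis_catr z w d2) (dis_catr z w dc')) !size_cat g2.
have e3 : S g' [:: c'] * obj_val (move_obj g [:: c] y) * S g' [:: c'] = obj_val (move_obj g' [:: c'] (move_obj g [:: c] y)).
  have gy : all (movable g' [:: c']) (move_obj g [:: c] y).2.
    by apply/allP=> _ /mapP [u uy ->]; case: (cm _ uy).
  apply: (IH (redm_adm ay r) sg' (sw_letter c') d' gy); rewrite -ltnS.
    exact: leq_trans lt sy.
  exact: leq_trans lt2 sy.
have e4 : S g [:: c] * obj_val (move_obj g' [:: c'] y) * S g [:: c] = obj_val (move_obj g' [:: c'] (move_obj g [:: c] y)).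
  have gy : all (movable g [:: c]) (move_obj g' [:: c'] y).2.
    by apply/allP=> _ /mapP [u uy ->]; apply: cm'.
  rewrite e2; apply: (IH (redm_adm ay r') sg (sw_letter c) d gy); rewrite -ltnS.
    exact: leq_trans lt' sy.
  by rewrite -e2; apply: leq_trans lt2 sy.
rewrite (S_move sg' (sw_letter c') d' e3) (S_move sg (sw_letter c) d e4).
by rewrite !mulgA CS -!mulgA CS.
Qed.

(** The two reduced objects are related by the exchange of the letters [c] and [c'], to which the
    induction hypothesis applies; the three exchanges among [g], [c] and [c'] satisfy the relations
    of transpositions. *)
Lemma red_letter y g c c' : admissible y -> (obj_size y <= N.+1)%N -> reducible_by y g c -> reducible_by y g c' ->
  c != c' ->
  S g [:: c] * obj_val (move_obj g [:: c] y) * S g [:: c] = S g [:: c'] * obj_val (move_obj g [:: c'] y) * S g [:: c'].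
Proof.
move=> ay sy r r' cc'; have sg := redm_sw r.
have d := redm_head ay r; have d' := redm_head ay r'.
have dc : dis [:: c] [:: c'] by apply: dis_letter.
have lt := redm_sz ay r; have lt' := redm_sz ay r'.
have [dg dg' dc'] : [/\ dis [:: c] g, dis [:: c'] g & dis [:: c'] [:: c]].
  by rewrite ![dis _ g]dis_sym [dis [:: c'] _]dis_sym.
have eS : S g [:: c'] = S g [:: c] * S [:: c] [:: c'] * S g [:: c].
  rewrite (S_conj sg (sw_letter c) (sw_letter c) (sw_letter c') d dc) ?mvr ?(mv_out d' dc) //.
    exact: gp_r.
  exact: gp_out.
have eS2 : S [:: c] [:: c'] * S g [:: c] * S [:: c] [:: c'] = S g [:: c'].
  rewrite (S_conj (sw_letter c) (sw_letter c') sg (sw_letter c) dc d) ?mvl ?(mv_out dg dg') //.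
    exact: gp_out.
  exact: gp_l.
have cs u : u \in y.2 -> [/\ movable [:: c] [:: c'] (move_word g [:: c] u),
    move_word [:: c] [:: c'] (move_word g [:: c] u) = move_word g [:: c'] u,
    movable g [:: c'] (move_word g [:: c] u) & move_word g [:: c'] (move_word g [:: c] u) = move_word g [:: c] u].
  move=> uy; have [[w ->]|[gu cu]] := redm_gp ay r uy.
    rewrite !mv_l {1}/movable prefix_prefix; split=> //.
      by rewrite /movable !(dis_catr z) ?orbT.
    by rewrite mv_out ?(dis_catr z).
  have [[w e]|[_ cu']] := redm_gp ay r' uy.
    by move: gu; rewrite e /dis prefix_prefix.
  by rewrite !mv_out // /movable gu cu cu' !orbT.
have e1 : S [:: c] [:: c'] * obj_val (move_obj g [:: c] y) * S [:: c] [:: c'] = obj_val (move_obj g [:: c'] y).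
  have e : move_obj [:: c] [:: c'] (move_obj g [:: c] y) = move_obj g [:: c'] y.
    by apply: mvo_comp => u /cs [].
  rewrite -e; apply: IH; rewrite ?e //; [exact: redm_adm r| | |].
  - by apply/allP=> _ /mapP [u /cs [? _ _ _] ->].
  - by rewrite -ltnS; exact: leq_trans lt sy.
  - by rewrite -ltnS; exact: leq_trans lt' sy.
have e2 : S g [:: c'] * obj_val (move_obj g [:: c] y) * S g [:: c'] = obj_val (move_obj g [:: c] y).
  have e : move_obj g [:: c'] (move_obj g [:: c] y) = move_obj g [:: c] y.
    by apply: mvo_comp => u /cs [].
  rewrite -{2}e; apply: IH; rewrite ?e //; [exact: redm_adm r| | |].
  - by apply/allP=> _ /mapP [u /cs [_ _ ? _] ->].
  - by rewrite -ltnS; exact: leq_trans lt sy.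
  - by rewrite -ltnS; exact: leq_trans lt sy.
rewrite -e1 {1 2}eS -!mulgA; congr (_ * _); rewrite !mulgA eS2 -!mulgA.
rewrite (mulgA (S [:: c] _) (S g _) (_ * _)) (mulgA (_ * _) (S [:: c] _)) eS2.
by rewrite !mulgA e2.
Qed.

Lemma red_any y g c g' c' : admissible y -> (obj_size y <= N.+1)%N -> reducible_by y g c -> reducible_by y g' c' ->
  S g [:: c] * obj_val (move_obj g [:: c] y) * S g [:: c] = S g' [:: c'] * obj_val (move_obj g' [:: c'] y) * S g' [:: c'].
Proof.
move=> ay sy r r'; case: (eqVneq g g') => [e|gg'].
  by subst g'; case: (eqVneq c c') => [<- //|cc']; apply: red_letter.
(* [red_commute] needs distinct letters, so the letter is changed to a third one before the prefix
   is changed. *)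
have [c2 [cy]] := @fresh_redm y [:: c; c'] ay isT.
rewrite !inE negb_or => /andP [n1 n2].
have r2 : reducible_by y g c2 by case: r => ? ? _; split.
rewrite (red_letter ay sy r r2); last by rewrite eq_sym.
exact: red_commute.
Qed.

Lemma red_step y g c : admissible y -> (obj_size y <= N.+1)%N -> reducible_by y g c ->
  obj_val y = S g [:: c] * obj_val (move_obj g [:: c] y) * S g [:: c].
Proof.
move=> ay sy r; case: (boolP (short y)) => shy.
  rewrite !E_short //; last exact: redm_short r shy.
  apply: S_move; [exact: redm_sw r|by []|exact: redm_head r|].
  case: fok => _; apply=> //; [exact: redm_sw r|exact: redm_head r|exact: redm_all|].
  exact: redm_short r shy.
rewrite /obj_val W_long //= pr_rcons mulgA; apply: red_any => //; exact: redP.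
Qed.

(** Reducing [x] at its prefix [g] and the moved object at the moved [g], with the same fresh
    letter, leaves the claim for smaller objects. At most six letters have to be avoided: the heads
    of the addresses before and after the move, and those of [a] and [b]. *)
Lemma two_step x a b u : admissible x -> short_word a -> short_word b -> dis a b -> all (movable a b) x.2 ->
  (obj_size x <= N.+1)%N -> (obj_size (move_obj a b x) <= N.+1)%N -> u \in x.2 -> (2 <= size u)%N ->
  movable a b (take 2 u) -> size (move_word a b (take 2 u)) = 2 -> S a b * obj_val x * S a b = obj_val (move_obj a b x).
Proof.
move=> ax sa sb ab gx sx sx' ux u2 gu smu.
have a0 := sw0 sa; have b0 := sw0 sb.
have ax' : admissible (move_obj a b x) by apply: adm_mv.
have shx : (size x.2 <= 2)%N by case/and3P: ax => /size_shape /andP [].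
have [|c] := @fresh (heads x ++ heads (move_obj a b x) ++ [:: head z a; head z b]).
  rewrite !size_cat /heads !size_map /=; apply: leq_trans T8; rewrite addnA.
  by rewrite addn2 !ltnS (leq_trans (leq_add shx shx)).
rewrite mem_cat negb_or => /andP [cx]; rewrite mem_cat negb_or => /andP [cx'].
rewrite mem_seq2 negb_or => /andP [ca cb].
set g := take 2 u; have g2 : size g = 2 by rewrite size_takel.
have r : reducible_by x g c by split=> //; exists u => //; apply: prefix_take2.
have r' : reducible_by (move_obj a b x) (move_word a b g) c.
  split=> //; exists (move_word a b u); first exact: map_f.
  by rewrite -(cat_take_drop 2 u) (mv_cat z) // prefix_prefix.
have [dac dbc] : dis [:: c] a /\ dis [:: c] b by split; apply: dis_hd.
have [dca dcb] : dis a [:: c] /\ dis b [:: c] by rewrite ![dis _ [:: c]]dis_sym.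
have d := redm_head ax r; have d' := redm_head ax' r'.
have sg := redm_sw r; have sg' := redm_sw r'.
have eS : S a b * S g [:: c] * S a b = S (move_word a b g) [:: c].
  have := S_conj sa sb sg (sw_letter c) ab d gu.
  rewrite (mv_out dca dcb) => -> //; first by rewrite /movable dca dcb !orbT.
have cs v : v \in x.2 -> movable a b (move_word g [:: c] v) /\
    move_word a b (move_word g [:: c] v) = move_word (move_word a b g) [:: c] (move_word a b v).
  move=> vx; have gv := allP gx _ vx; have [[w e]|[gv' cv]] := redm_gp ax r vx.
    rewrite e mv_l [move_word a b (g ++ w)](mv_cat z) // mv_l mv_out ?(dis_catr z) //.
    by rewrite /movable !(dis_catr z) ?orbT.
  rewrite (mv_out gv' cv); split=> //; rewrite [RHS]mv_out //; first exact: (dis_mv z).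
  have := dis_mv z ab (_ : movable a b [:: c]) gv cv; rewrite (mv_out dca dcb); apply.
  by rewrite /movable dca dcb !orbT.
have e1 : move_obj a b (move_obj g [:: c] x) = move_obj (move_word a b g) [:: c] (move_obj a b x).
  by rewrite /move_obj /= -!map_comp; congr pair; apply/eq_in_map => v /cs [].
have e2 : S a b * obj_val (move_obj g [:: c] x) * S a b = obj_val (move_obj (move_word a b g) [:: c] (move_obj a b x)).
  have lt := redm_sz ax r; have lt' := redm_sz ax' r'.
  rewrite -e1; apply: IH; rewrite ?e1 //; [exact: redm_adm r| | |].
  - by apply/allP=> _ /mapP [v /cs [? _] ->].
  - by rewrite -ltnS; exact: leq_trans lt sx.
  - by rewrite -ltnS; exact: leq_trans lt' sx'.
rewrite (red_step ax sx r) (red_step ax' sx' r') -e2 -eS.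
by rewrite !mulgA -[_ * S a b * S a b]mulgA S2 // mulg1 -[_ * S a b * S a b]mulgA S2 // mulg1.
Qed.

Lemma gp_take2 a b u : short_word a -> short_word b -> movable a b u -> (2 < size u)%N -> movable a b (take 2 u).
Proof.
move=> /andP [_ a2] /andP [_ b2].
have pt c : (size c <= 2)%N -> prefix c u -> prefix c (take 2 u).
  move=> c2 /prefixP [w ->]; apply/prefixP; exists (take (2 - size c) w).
  by rewrite take_cat ltnNge c2.
have dt c : (size c <= 2)%N -> dis c u -> (2 < size u)%N -> dis c (take 2 u).
  move=> c2 /andP [cu uc] u2; apply/andP; split.
    by apply: contraNN cu => h; apply: prefix_trans h (prefix_take2 u).
  apply/negP => /prefixP [w e]; have := congr1 size e.
  rewrite size_cat size_takel ?(ltnW u2) // => sc.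
  have w0 : w = [::] by move: sc c2; case: (w) => //= i w' ->.
  by case/negP: cu; rewrite e w0 cats0 prefix_take2.
move=> g u2; apply/or3P; case/or3P: g => [h|h|/andP [h h']].
- by constructor 1; apply: pt.
- by constructor 2; apply: pt.
- by constructor 3; rewrite !dt.
Qed.

Lemma mvoK a b x : dis a b -> all (movable a b) x.2 -> move_obj a b (move_obj a b x) = x.
Proof.
move=> ab gx; rewrite (mvo_comp (F := id)) ?map_id; first by case: (x).
by move=> u ux; apply: (mvK z) => //; apply: (allP gx).
Qed.

Lemma mvo_sym a b x : dis a b -> all (movable a b) x.2 -> move_obj a b x = move_obj b a x.
Proof.
move=> ab gx; congr pair; apply/eq_in_map => u ux.
by apply: (mv_sym z) => //; apply: (allP gx).
Qed.

Lemma gp_mvo a b x : dis a b -> all (movable a b) x.2 -> all (movable a b) (move_obj a b x).2.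
Proof.
by move=> ab gx; apply/allP=> _ /mapP [u ux ->]; apply: (gp_mv z) => //; apply: (allP gx).
Qed.

Lemma step_base x a b : admissible x -> short_word a -> short_word b -> dis a b -> all (movable a b) x.2 ->
  short x -> short (move_obj a b x) -> S a b * obj_val x * S a b = obj_val (move_obj a b x).
Proof. by move=> ax sa sb ab gx s1 s2; rewrite !E_short //; case: fok => _; apply. Qed.

Lemma step_eq x a b : admissible x -> short_word a -> short_word b -> dis a b -> all (movable a b) x.2 ->
  (obj_size x <= N.+1)%N -> (obj_size (move_obj a b x) <= N.+1)%N -> size a = size b ->
  S a b * obj_val x * S a b = obj_val (move_obj a b x).
Proof.
move=> ax sa sb ab gx sx sx' eab.
have long y : admissible y -> all (movable a b) y.2 -> (obj_size y <= N.+1)%N -> (obj_size (move_obj a b y) <= N.+1)%N ->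
    ~~ short y -> S a b * obj_val y * S a b = obj_val (move_obj a b y).
  move=> ay gy sy sy'; rewrite /short -has_predC => /hasP [u uy /=]; rewrite -ltnNge => u2.
  apply: (@two_step y a b u) => //; first exact: ltnW.
    by apply: gp_take2 => //; apply: (allP gy).
  by rewrite size_mv_eq // size_takel // ltnW.
case: (boolP (short x)) => s1; last exact: long.
case: (boolP (short (move_obj a b x))) => s2; first exact: step_base.
apply/esym/S_move => //; rewrite -[in RHS](mvoK ab gx); apply: long => //.
- by apply: adm_mv => //; exact: sw0.
- exact: gp_mvo.
- by rewrite mvoK.
Qed.

(** If only [b] begins addresses of [x], the move is a reduction; if only [c] does, it is the
    inverse of one; if neither does, [x] is unchanged. If both do, the exchange is factored through
    a third letter. *)
Lemma step_12 x c b : admissible x -> size b = 2 -> dis [:: c] b -> all (movable [:: c] b) x.2 ->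
  (obj_size x <= N.+1)%N -> (obj_size (move_obj [:: c] b x) <= N.+1)%N ->
  S [:: c] b * obj_val x * S [:: c] b = obj_val (move_obj [:: c] b x).
Proof.
move=> ax b2 cb gx sx sx'.
have sb : short_word b by rewrite /short_word b2.
have b0 := sw0 sb.
have ax' : admissible (move_obj [:: c] b x) by apply: adm_mv.
have bc : dis b [:: c] by rewrite dis_sym.
have hd y : admissible y -> ~~ has (prefix [:: c]) y.2 -> c \notin heads y.
  move=> ay; apply: contraNN => /mapP [u uy ->]; apply/hasP; exists u => //.
  by have := adm_nil ay uy; case: (u) => //= i v _; rewrite eqxx prefix0s.
(* a reduction move in disguise *)
have one y : admissible y -> all (movable [:: c] b) y.2 -> (obj_size y <= N.+1)%N ->
    ~~ has (prefix [:: c]) y.2 -> has (prefix b) y.2 ->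
    S [:: c] b * obj_val y * S [:: c] b = obj_val (move_obj [:: c] b y).
  move=> ay gy sy hc /hasP [u uy bu].
  rewrite (red_step ay sy (g := b) (c := c)); last by split=> //; [exists u|apply: hd].
  rewrite (S_sym b) -(mvo_sym cb gy) !mulgA S2 // mul1g -mulgA S2 // mulg1 //.
have nb1 w : prefix [:: c] (b ++ w) = false.
  by have /andP [/negPf] := dis_catr z w cb.
have nb2 w : prefix b ([:: c] ++ w) = false.
  by have /andP [/negPf] := dis_catr z w bc.
have swp y : all (movable [:: c] b) y.2 ->
    has (prefix [:: c]) (move_obj [:: c] b y).2 = has (prefix b) y.2 /\
    has (prefix b) (move_obj [:: c] b y).2 = has (prefix [:: c]) y.2.
  move=> gy; rewrite /= !has_map; split; apply: eq_in_has => u /(allP gy) /gpP [[w ->]|[w ->]|[cu bu]] /=.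
  - by rewrite mv_l [LHS]nb1 [RHS]nb2.
  - by rewrite (mv_r z) // (prefix_prefix [:: c]) prefix_prefix.
  - by rewrite mv_out //; case/andP: cu => /negPf -> _; case/andP: bu => /negPf -> _.
  - by rewrite mv_l prefix_prefix [RHS](prefix_prefix [:: c] w).
  - by rewrite (mv_r z) // [LHS]nb2 [RHS]nb1.
  - by rewrite mv_out //; case/andP: cu => /negPf -> _; case/andP: bu => /negPf -> _.
case: (boolP (has (prefix [:: c]) x.2)) => hc; case: (boolP (has (prefix b) x.2)) => hb.
- have [c' [cx']] := @fresh_redm x [:: c; head z b] ax isT.
  rewrite !inE negb_or => /andP [ncc' ncb].
  have [dcc' dc'b] : dis [:: c] [:: c'] /\ dis [:: c'] b.
    by split; [apply: dis_letter; rewrite eq_sym|apply: dis_hd].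
  have dbc' : dis b [:: c'] by rewrite dis_sym.
  have dc'c : dis [:: c'] [:: c] by rewrite dis_sym.
  have r : reducible_by x b c' by split=> //; case/hasP: hb => u; exists u.
  have gx1 := redm_all ax r; have lt := redm_sz ax r; have ax1 := redm_adm ax r.
  set x1 := move_obj b [:: c'] x in gx1 lt ax1.
  have gc u : u \in x.2 -> [/\ movable [:: c] [:: c'] (move_word b [:: c'] u),
      movable b [:: c'] (move_word [:: c] b u), c' != head z (move_word [:: c] b u) &
      move_word [:: c] [:: c'] (move_word b [:: c'] u) = move_word b [:: c'] (move_word [:: c] b u)].
    move=> ux; have [[w ->]|[bu cu']] := redm_gp ax r ux.
      rewrite mv_l (mv_r z) // (mv_r z) // [in RHS]mv_out ?(dis_catr z) //.
      split=> //; first by rewrite gp_sym /movable prefix_prefix.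
      by apply: gp_out; apply: (dis_catr z).
    rewrite (mv_out bu cu'); have [[w e]|[w e]|[cu _]] := gpP (allP gx _ ux).
    + rewrite e !mv_l; split=> //; first by rewrite /movable prefix_prefix.
        by rewrite /movable prefix_prefix.
      by case: (b) b2 ncb => //= i ? _.
    + by move: bu; rewrite e /dis prefix_prefix.
    + rewrite (mv_out cu bu) (mv_out bu cu') (mv_out cu cu'); split=> //.
      - exact: gp_out.
      - exact: gp_out.
      - exact: notin_hds cx' ux.
  have e1 : move_obj [:: c] [:: c'] x1 = move_obj b [:: c'] (move_obj [:: c] b x).
    rewrite /move_obj /= -!map_comp; congr pair; apply/eq_in_map => v vx.
    by case: (gc v vx).
  have r' : reducible_by (move_obj [:: c] b x) b c'.
    split=> //.
      by case/hasP: hc => u ux /prefixP [w e]; exists (move_word [:: c] b u);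
        [apply: map_f|rewrite e mv_l prefix_prefix].
    by apply/negP => /mapP [_ /mapP [u ux ->] e]; case: (gc u ux) => _ _; rewrite -e eqxx.
  have e2 : S [:: c] [:: c'] * obj_val x1 * S [:: c] [:: c'] = obj_val (move_obj [:: c] [:: c'] x1).
    have s1 : (obj_size x1 <= N)%N by rewrite -ltnS; exact: leq_trans lt sx.
    apply: (IH ax1 (sw_letter c) (sw_letter c') dcc' _ s1); last by rewrite sz_mv_eq.
    by apply/allP=> _ /mapP [u /gc [? _ _ _] ->].
  have eS : S b [:: c'] * S [:: c] [:: c'] * S b [:: c'] = S [:: c] b.
    rewrite (S_conj sb (sw_letter c') (sw_letter c) (sw_letter c') dbc' dcc') ?mvr ?mv_out //.
      exact: gp_out.
    exact: gp_r.
  rewrite (red_step ax sx r) (red_step ax' sx' r') -e1 -e2 -eS -!mulgA.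
  have SK (q : Q) : S b [:: c'] * (S b [:: c'] * q) = q by rewrite mulgA S2 // mul1g.
  by rewrite !SK.
- apply/esym/S_move => //; have [h1 h2] := swp _ gx.
  rewrite -[in RHS](mvoK cb gx); apply: one => //; rewrite ?h1 ?h2 //; exact: gp_mvo.
- exact: one.
- have ex : move_obj [:: c] b x = x.
    rewrite /move_obj (_ : map _ _ = x.2); first by case: (x).
    apply: map_id_in => u ux; have /gpP [[w e]|[w e]|[cu bu]] := allP gx _ ux.
    + by case/hasP: hc; exists u => //; rewrite e (prefix_prefix [:: c]).
    + by case/hasP: hb; exists u => //; rewrite e prefix_prefix.
    + exact: mv_out.
  case: (boolP (short x)) => s1; first by apply: step_base; rewrite ?ex.
  move: (s1); rewrite /short -has_predC => /hasP [u ux /=]; rewrite -ltnNge => u2.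
  have gu := gp_take2 (sw_letter c) sb (allP gx _ ux) u2.
  apply: (@two_step x [:: c] b u) => //; first exact: ltnW.
  rewrite mv_out ?size_takel ?(ltnW u2) //.
    case/gpP: gu => [[w e]|[w e]|[] //].
      by case/hasP: hc; exists u => //; apply: prefix_trans (prefix_take2 u); rewrite e (prefix_prefix [:: c]).
    by case/hasP: hb; exists u => //; apply: prefix_trans (prefix_take2 u); rewrite e prefix_prefix.
  case/gpP: gu => [[w e]|[w e]|[] //].
    by case/hasP: hc; exists u => //; apply: prefix_trans (prefix_take2 u); rewrite e (prefix_prefix [:: c]).
  by case/hasP: hb; exists u => //; apply: prefix_trans (prefix_take2 u); rewrite e prefix_prefix.
Qed.

Lemma Cst_step : moves_upto N.+1.
Proof.
move=> x a b ax sa sb ab gx sx sx'.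
case: (eqVneq (size a) (size b)) => [|nab]; first exact: step_eq.
have ba : dis b a by rewrite dis_sym.
have sz12 c : short_word c -> size c = 1%N \/ size c = 2 by move=> /andP []; case: (c) => [|i [|j [|]]]; auto.
have [[a1|a2] [b1|b2]] := (sz12 _ sa, sz12 _ sb); try by rewrite ?a1 ?a2 ?b1 ?b2 in nab.
  by case: (a) a1 ab gx sx' {sa nab ba} => [|c [|]] // _ ab gx sx'; apply: step_12.
rewrite (mvo_sym ab gx) S_sym; rewrite (mvo_sym ab gx) in sx'.
have {}gx : all (movable b a) x.2 by apply: sub_all gx => u; rewrite gp_sym.
by case: (b) b1 ba gx sx' {sb ab nab} => [|c [|]] // _ ba gx sx'; apply: step_12.
Qed.

End Step.

Lemma swap_conj x a b : admissible x -> short_word a -> short_word b -> dis a b -> all (movable a b) x.2 ->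
  S a b * obj_val x * S a b = obj_val (move_obj a b x).
Proof.
move=> ax sa sb ab gx.
have CN N : moves_upto N.
  elim: N => [|N]; last exact: Cst_step.
  by move=> y ? ? ay _ _ _ _ sy; have := sz_gt0 ay; lia.
apply: (CN (maxn (obj_size x) (obj_size (move_obj a b x)))) => //; [exact: leq_maxl|exact: leq_maxr].
Qed.

End Claim.
End Objects.

(** * Relation schemes with variable addresses *)

Section Schemas.
Local Open Scope group_scope.
Variables (T : finType) (z : T).
Local Notation X := (nat -> T).
Local Notation word := (seq T).
Local Notation swap := (@swap T z).
Local Notation lab := (@lab T z).
Hypothesis T8 : (8 <= #|T|)%N.
Variable B : seq (bij X).
Hypothesis VB : forall b, b \in B -> b^-1 \in B.
Local Notation obj := (obj T).
Local Notation obj_elt := (@obj_elt T z).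
Local Notation admissible := (@admissible T B).
Local Notation obj_word := (@obj_word T z T8 B).
Local Notation obj_val f := (@obj_val T z T8 B _ f).
Local Notation short_rels f := (@short_rels T z B _ f).
Implicit Types (x : obj) (a b u v w g : word).

Definition short_words : seq word :=
  [seq [:: i] | i <- enum T] ++ [seq [:: i; j] | i <- enum T, j <- enum T].

Lemma words12P u : short_word u -> u \in short_words.
Proof.
rewrite mem_cat; case: u => [|i [|j [|k u]]] // _; apply/orP.
  by left; apply: map_f; rewrite mem_enum.
by right; apply/allpairsP; exists (i, j); rewrite !mem_enum.
Qed.

Lemma words12_sw u : u \in short_words -> short_word u.
Proof. by rewrite mem_cat => /orP [/mapP [i _ ->]|/allpairsP [[i j] [_ _ ->]]]. Qed.

Definition shortobjs : seq obj :=
  [seq (None, [:: u; v]) | u <- short_words, v <- short_words] ++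
  [seq (Some h, [:: u]) | h <- B, u <- short_words].

Definition base := map obj_elt (filter admissible shortobjs).

Lemma admP x : admissible x -> [/\ shape B x, all (fun u => u != [::]) x.2 & pairwise (@dis T) x.2].
Proof. by case/and3P. Qed.

Lemma shortobjsP x : admissible x -> short x -> x \in shortobjs.
Proof.
have sww u : (size u <= 2)%N -> u != [::] -> u \in short_words.
  by move=> u2 u0; apply: words12P; rewrite /short_word u2 andbT; case: (u) u0.
move=> /admP [sh nx _]; rewrite mem_cat; case: x sh nx => [[h|] [|u [|v [|]]]] //=.
  move=> hB; rewrite /short /= !andbT => u0 u2; apply/orP; right.
  by apply/allpairsP; exists (h, u); split=> //; apply: sww.
move=> _; rewrite /short /= !andbT => /andP [u0 v0] /andP [u2 v2]; apply/orP; left.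
by apply/allpairsP; exists (u, v); split=> //; apply: sww.
Qed.

Lemma base_el x : admissible x -> short x -> obj_elt x \in base.
Proof. by move=> ax sx; apply: map_f; rewrite mem_filter ax shortobjsP. Qed.

Lemma adm_swap a b : a != [::] -> b != [::] -> dis a b -> admissible (None, [:: a; b]).
Proof. by move=> a0 b0 ab; rewrite /admissible /= a0 b0 ab. Qed.

Lemma sw_short a b : short_word a -> short_word b -> short (None, [:: a; b]) .
Proof. by rewrite /short /= => /andP [_ ->] /andP [_ ->]. Qed.

Lemma base_swap a b : short_word a -> short_word b -> dis a b -> swap a b \in base.
Proof.
move=> sa sb ab; apply: (@base_el (None, [:: a; b])); last exact: sw_short.
by apply: adm_swap => //; apply: sw0.
Qed.

Lemma baseP h : h \in base -> exists x, [/\ admissible x, short x & h = obj_elt x].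
Proof.
case/mapP=> x; rewrite mem_filter => /andP [ax xs] ->; exists x; split=> //.
move: xs; rewrite mem_cat /short => /orP [] /allpairsP [[u v] [/= h1 h2 ->]] /=.
  by have [/andP [_ ->] /andP [_ ->]] := (words12_sw h1, words12_sw h2).
by have /andP [_ ->] := words12_sw h2.
Qed.

Lemma el_V x : admissible x -> exists2 x', admissible x' & (short x -> short x') /\ (obj_elt x)^-1 = obj_elt x'.
Proof.
move=> ax; have [sh nx _] := admP ax.
case: x sh nx ax => [[h|] [|u [|v [|]]]] //= hB nx ax; last first.
  by exists (None, [:: u; v]) => //; split=> //=; rewrite swapV.
exists (Some h^-1, [:: u]); first by rewrite /admissible /= VB //= nx.
have e : lab u 1 = 1.
  apply: bijP => y.
  by case: (boolP (pre u y)) => [/(preE z) ->|pu]; [rewrite lab_in|exact: lab_out].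
by split=> //=; apply: mulg1_eq; rewrite -labM mulgV.
Qed.

Lemma base_V h : h \in base -> h^-1 \in base.
Proof.
case/baseP=> x [ax sx ->]; have [x' ax' [sx' ->]] := el_V ax.
by apply: base_el => //; apply: sx'.
Qed.

Lemma W_base x : admissible x -> inw base (obj_word x).
Proof.
have [n] := ubnP (obj_size x); elim: n x => // n IH x lt ax.
case: (boolP (short x)) => sx; first by rewrite W_short //= base_el.
have rx := redP z T8 ax sx; rewrite W_long //= all_rcons.
have lt' := redm_sz ax rx.
rewrite (IH _ (leq_trans lt' lt)); last exact: (redm_adm ax rx).
have sg : short_word (reduction z T8 B x).1 by case: (rx) => g2 _ _; rewrite /short_word g2.
by have bs := base_swap sg (isT : short_word [:: (reduction z T8 B x).2]) (redm_head ax rx); rewrite andbT; apply/andP.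
Qed.

Lemma ev_okf : ev base (fun Q f => short_rels f).
Proof.
have sh a b : short_word a -> short_word b -> dis a b -> admissible (None, [:: a; b]).
  by move=> sa sb ab; apply: adm_swap => //; apply: sw0.
have e1 : ev base (fun Q f => forall a, a \in short_words -> forall b, b \in short_words ->
    dis a b -> f (swap a b) * f (swap a b) = 1).
  apply: ev_all => a /words12_sw sa; apply: ev_all => b /words12_sw sb.
  apply: ev_imp => ab; have := @ev_rel _ base [:: swap a b; swap a b] [::].
  rewrite /= !base_swap // !mulg1 swap2 => /(_ isT isT erefl) [n hn].
  by exists n => Q f /hn; rewrite !mulg1.
have e2 : ev base (fun Q f => forall x, x \in shortobjs -> forall a, a \in short_words ->
    forall b, b \in short_words ->
    [&& admissible x, short x, dis a b, all (movable a b) x.2 & short (move_obj a b x)] ->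
    f (swap a b) * f (obj_elt x) * f (swap a b) = f (obj_elt (move_obj a b x))).
  apply: ev_all => x _; apply: ev_all => a /words12_sw sa; apply: ev_all => b /words12_sw sb.
  apply: ev_imp => /and5P [ax sx ab gx smx].
  have ax' : admissible (move_obj a b x) by apply: (adm_mv z) => //; apply: sw0.
  have B1 : inw base [:: swap a b; obj_elt x; swap a b] by rewrite /= !base_swap ?base_el.
  have B2 : inw base [:: obj_elt (move_obj a b x)] by rewrite [inw _ _]andbT; apply: base_el.
  have [|n hn] := ev_rel B1 B2; first by rewrite /= !mulg1 mulgA (el_conj z ab gx ax).
  by exists n => Q f /hn /=; rewrite !mulg1 mulgA.
apply: ev_mono (ev_and e1 e2) => Q f [h1 h2]; split=> [a b /words12P sa /words12P sb|].
  exact: h1.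
move=> x a b ax sx /words12P sa /words12P sb ab gx smx.
by apply: h2 => //; [exact: shortobjsP|apply/and5P].
Qed.

(* A relation scheme: an object whose addresses are [us_i ++ w] for variable
   sites [us_i], represented by the pairs [(i, w)]. *)
Definition pattern := (option (bij X) * seq (nat * word))%type.
Implicit Types (us : seq word) (p : pattern).

Definition inst_pattern us p : obj := (p.1, [seq nth [::] us q.1 ++ q.2 | q <- p.2]).
Definition sites r us := [&& size us == r, all (fun u => u != [::]) us & pairwise (@dis T) us].

Lemma sites_dis r us u v : sites r us -> u \in us -> v \in us -> u != v -> dis u v.
Proof.
case/and3P=> _ _; elim: us => //= w s IH /andP [/allP aw pw].
rewrite !inE => /orP [/eqP ->|us] /orP [/eqP ->|vs] nuv; last exact: IH.
- by rewrite eqxx in nuv.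
- exact: aw.
- by rewrite dis_sym; apply: aw.
Qed.

Lemma sites_gp r us u c v : sites r us -> u \in us -> (2 <= size u)%N ->
  c \notin map (head z) us -> v \in us ->
  (exists w, v = take 2 u ++ w) \/ (dis (take 2 u) v /\ dis [:: c] v).
Proof.
move=> sus uus u2 cus vus; case: (boolP (prefix (take 2 u) v)) => [/prefixP|guv]; first by left.
right; split; last first.
  apply: (dis_hd (z := z)); first by case/and3P: sus => _ /allP h _; apply: h.
  by apply: contraNneq cus => ->; apply: map_f.
rewrite /dis guv /=; apply/negP => vg.
have uv : v != u by apply: contraNneq guv => ->; apply: prefix_take2.
have := sites_dis sus vus uus uv.
by rewrite /dis (prefix_trans vg (prefix_take2 u)).
Qed.

Lemma sites_map r us a b : dis a b -> a != [::] -> b != [::] -> all (movable a b) us ->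
  sites r us -> sites r (map (move_word a b) us).
Proof.
move=> ab a0 b0 gus /and3P [sr /allP nus pus]; apply/and3P; split.
- by rewrite size_map.
- by apply/allP=> _ /mapP [u uus ->]; apply: mv_nil => //; apply: nus.
- exact: (pairwise_mv z).
Qed.

Fixpoint short_sites r : seq (seq word) :=
  if r is r'.+1 then [seq u :: s | u <- short_words, s <- short_sites r'] else [:: [::]].

Lemma short_sitesP r us : sites r us -> all (fun u => size u <= 2)%N us -> us \in short_sites r.
Proof.
case/and3P=> /eqP <- nus _; elim: us nus => //= u us IH /andP [u0 nus] /andP [u2 sus].
apply/allpairsP; exists (u, us); split=> //=; last exact: IH.
by apply: words12P; rewrite /short_word u2 andbT; case: (u) u0.
Qed.

Section Schema.
Variables (r : nat) (P P' : seq pattern).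
Hypothesis r4 : (r <= 4)%N.
Hypothesis Pr : all (fun p => all (fun q => q.1 < r)%N p.2) (P ++ P').
Hypothesis Padm : forall us, sites r us -> all (fun p => admissible (inst_pattern us p)) (P ++ P').
Hypothesis Ptrue : forall us, sites r us ->
  pr (obj_elt \o inst_pattern us) P = pr (obj_elt \o inst_pattern us) P'.

(** Conjugation by the exchange of a two-letter prefix of a site with a letter that begins no site
    shortens the sites and turns an instance of the scheme into an equivalent one. The instances at
    sites of length at most two, finitely many, therefore imply all the others. *)
Lemma ev_schema : ev base (fun Q f => forall us, sites r us ->
  pr (obj_val f \o inst_pattern us) P = pr (obj_val f \o inst_pattern us) P').
Proof.
have prW (Q : groupType) (f : bij X -> Q) us R :
    pr (obj_val f \o inst_pattern us) R = pr f (flatten [seq obj_word (inst_pattern us p) | p <- R]).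
  by elim: R => //= p R ->; rewrite pr_cat.
have e1 : ev base (fun Q f => forall us, us \in short_sites r -> sites r us ->
    pr (obj_val f \o inst_pattern us) P = pr (obj_val f \o inst_pattern us) P').
  apply: ev_all => us _; apply: ev_imp => sus.
  have flat R : {subset R <= P ++ P'} -> inw base (flatten [seq obj_word (inst_pattern us p) | p <- R]) /\
      pr id (flatten [seq obj_word (inst_pattern us p) | p <- R]) = pr (obj_elt \o inst_pattern us) R.
    elim: R => //= p R IH sR; have pa : admissible (inst_pattern us p).
      by apply: (allP (Padm sus)); apply: sR; rewrite mem_head.
    have [|h1 h2] := IH; first by move=> q qR; apply: sR; rewrite inE qR orbT.
    by rewrite all_cat W_base // h1 pr_cat pr_W // h2.
  have [|b1 e1] := flat P; first by move=> p pP; rewrite mem_cat pP.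
  have [|b2 e2] := flat P'; first by move=> p pP; rewrite mem_cat pP orbT.
  have [|n hn] := ev_rel b1 b2; first by rewrite e1 e2 Ptrue.
  by exists n => Q f /hn; rewrite !prW.
apply: ev_mono (ev_and ev_okf e1) => Q f [ok h] us.
have [n] := ubnP (sumn (map size us)); elim: n us => // n IH us lt sus.
case: (boolP (all (fun u => size u <= 2)%N us)) => [s2|].
  by apply: h => //; apply: short_sitesP.
rewrite -has_predC => /hasP [u uus /=]; rewrite -ltnNge => u2.
have sr : size us = r by case/and3P: sus => /eqP.
have [|c cus] := @fresh T (map (head z) us).
  by rewrite size_map sr; apply: leq_ltn_trans r4 _; apply: leq_trans T8.
have gus v : v \in us -> _ := sites_gp sus uus (ltnW u2) cus.
have u0 : u != [::] by case: (u) u2.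
set g := take 2 u in gus.
have g2 : size g = 2 by rewrite size_takel // ltnW.
have g0 : g != [::] by case: (g) g2.
have sg : short_word g by rewrite /short_word g2.
have gc : dis g [:: c].
  rewrite dis_sym; apply: (dis_hd (z := z)) => //.
  have : c != head z u by apply: contraNneq cus => ->; apply: map_f.
  by rewrite /g; case: (u) u2.
have gp_us : all (movable g [:: c]) us.
  apply/allP=> v /gus [[w ->]|[gv cv]]; last exact: gp_out.
  by rewrite /movable prefix_prefix.
have S2 : f (swap g [:: c]) * f (swap g [:: c]) = 1 by case: ok => + _; apply.
have instE p : p \in P ++ P' -> obj_val f (inst_pattern (map (move_word g [:: c]) us) p) =
    f (swap g [:: c]) * obj_val f (inst_pattern us p) * f (swap g [:: c]).
  move=> pP; have pa := allP (Padm sus) _ pP; have pr_ := allP Pr _ pP.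
  have nus q : q \in p.2 -> nth [::] us q.1 \in us.
    by move=> qp; apply: mem_nth; rewrite sr; apply: (allP pr_).
  rewrite (swap_conj T8 ok) //; last first.
    apply/allP=> _ /mapP [q qp ->]; apply: (gp_cat z); apply: (allP gp_us); exact: nus.
  congr (obj_val f _); rewrite /inst_pattern /move_obj /= -map_comp; congr pair; apply/eq_in_map => q qp /=.
  rewrite (mv_cat z) //; last by apply: (allP gp_us); apply: nus.
  by rewrite (nth_map [::]) // sr; apply: (allP pr_).
have conj R : {subset R <= P ++ P'} -> pr (obj_val f \o inst_pattern (map (move_word g [:: c]) us)) R =
    f (swap g [:: c]) * pr (obj_val f \o inst_pattern us) R * f (swap g [:: c]).
  elim: R => [|p R IHR] sR /=; first by rewrite mulg1 S2.
  rewrite instE ?sR ?mem_head // IHR; last by move=> q qR; apply: sR; rewrite inE qR orbT.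
  by rewrite -!mulgA (mulgA (f _) (f _) (_ * _)) S2 mul1g.
have lt' : (sumn (map size (map (move_word g [:: c]) us)) < sumn (map size us))%N.
  rewrite -map_comp; apply: sumn_lt => [v vus|].
    have [[w ->]|[gv cv]] := gus v vus; last by rewrite /= mv_out.
    by rewrite /= mv_l !size_cat g2.
  by exists u => //=; rewrite -{2}(cat_take_drop 2 u) -{1}(cat_take_drop 2 u) mv_l !size_cat g2.
have := IH _ (leq_trans lt' lt) (sites_map gc g0 isT gp_us sus).
rewrite !conj; [|by move=> p pP; rewrite mem_cat pP orbT|by move=> p pP; rewrite mem_cat pP].
by move=> /mulIg /mulgI.
Qed.

End Schema.
End Schemas.

(** * The relations of the Roever-Nekrashevych group suffice *)

Section Faithful.
Local Open Scope group_scope.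
Variables (T : finType) (z : T).
Local Notation X := (nat -> T).
Local Notation word := (seq T).
Local Notation swap := (@swap T z).
Local Notation lab := (@lab T z).
Variables (G : bij X -> Prop) (P : groupType) (act : P -> bij X).
Variables (swp : word -> word -> P) (phi : word -> bij X -> P).
Implicit Types (a b c t u : word) (g h : bij X) (p q w : P) (S : seq word).

Let L := [seq r <- enum T | r != z].

Hypothesis G1 : G 1.
Hypothesis GM : forall g h, G g -> G h -> G (g * h).
Hypothesis GV : forall g, G g -> G g^-1.
Hypothesis actM : {morph act : p q / p * q}.
Hypothesis swpC : forall a b, swp a b = swp b a.
Hypothesis swp2 : forall a b, a != [::] -> b != [::] -> dis a b -> swp a b * swp a b = 1.
Hypothesis swp3 : forall a b c, a != [::] -> b != [::] -> c != [::] ->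
  dis a b -> dis a c -> dis b c -> swp a b * swp b c * swp a b = swp a c.
Hypothesis swp4 : forall a b c d, a != [::] -> b != [::] -> c != [::] -> d != [::] ->
  dis a b -> dis c d -> dis a c -> dis a d -> dis b c -> dis b d ->
  commute (swp a b) (swp c d).
Hypothesis phiM : forall a g h, a != [::] -> G g -> G h -> phi a (g * h) = phi a g * phi a h.
Hypothesis phi_swp : forall a b g, a != [::] -> b != [::] -> G g -> dis a b ->
  swp a b * phi a g * swp a b = phi b g.
Hypothesis phi_out : forall a b c g, a != [::] -> b != [::] -> c != [::] -> G g ->
  dis a b -> dis a c -> dis b c -> commute (swp a b) (phi c g).
Hypothesis phi_phi : forall a b g h, a != [::] -> b != [::] -> G g -> G h -> dis a b ->
  commute (phi a g) (phi b h).
Hypothesis act_swp : forall a b, a != [::] -> b != [::] -> dis a b -> act (swp a b) = swap a b.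
Hypothesis act_phi : forall a g, a != [::] -> G g -> act (phi a g) = lab a g.
Hypothesis phi_split : forall a g, a != [::] -> G g ->
  sgen (fun p => (exists i j, i != j /\ p = swp (rcons a i) (rcons a j)) \/
                 (exists i h, G h /\ p = phi (rcons a i) h)) (phi a g).
Hypothesis swp_split : forall c t, c != [::] -> t != [::] -> dis c t ->
  swp c (rcons t z) * swp c t * swp c (rcons t z) =
  pr (fun r => swp (rcons t r) (rcons (rcons t z) r)) L * swp c (rcons (rcons t z) z).

Lemma rep_act1 : act 1 = 1.
Proof. by apply: (mulgI (act 1)); rewrite -actM !mulg1. Qed.

Lemma rep_actV p : act p^-1 = (act p)^-1.
Proof. by apply/esym/mulg1_eq; rewrite -actM mulgV rep_act1. Qed.

Lemma cone1 a : a != [::] -> phi a 1 = 1.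
Proof. by move=> a0; apply: (mulgI (phi a 1)); rewrite -phiM // !mulg1. Qed.

Lemma coneV a g : a != [::] -> G g -> phi a g^-1 = (phi a g)^-1.
Proof.
move=> a0 Gg; apply/esym/mulg1_eq; rewrite -phiM //; last exact: GV.
by rewrite mulgV cone1.
Qed.

(** These elements generate the permutational wreath product of [G] over the cones in [S]. *)
Definition site_ops S p := (exists a b, [/\ a \in S, b \in S, a != b & p = swp a b]) \/
  (exists a g, [/\ a \in S, G g & p = phi a g]).

Definition good S := all (fun u => u != [::]) S && pairwise (@dis T) S.

Lemma good_dis S a b : good S -> a \in S -> b \in S -> a != b -> dis a b.
Proof.
case/andP=> nS pS aS bS; apply: (@sites_dis T (size S) S) aS bS.
by apply/and3P; split.
Qed.

Lemma good_nil S a : good S -> a \in S -> a != [::].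
Proof. by case/andP=> /allP h _; apply: h. Qed.

Lemma good_cons t S : good (t :: S) ->
  [/\ t != [::], good S & forall a, a \in S -> dis a t].
Proof.
case/andP=> /= /andP [t0 nS] /andP [/allP tS pS]; split=> //; first exact/andP.
by move=> a /tS; rewrite dis_sym.
Qed.

Lemma swpV a b : a != [::] -> b != [::] -> dis a b -> (swp a b)^-1 = swp a b.
Proof. by move=> a0 b0 ab; apply: mulg1_eq (swp2 a0 b0 ab). Qed.

Lemma wsV S p : good S -> site_ops S p -> site_ops S p^-1.
Proof.
move=> gS [[a [b [aS bS ab ->]]]|[a [g [aS Gg ->]]]].
  by left; exists a, b; rewrite swpV ?(good_nil gS) ?(good_dis gS).
by right; exists a, g^-1; rewrite coneV ?(good_nil gS) //; split=> //; apply: GV.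
Qed.

Lemma ws_ind S : good S -> forall R : P -> Prop, R 1 ->
  (forall x w, site_ops S x -> sgen (site_ops S) w -> R w -> R (x * w)) ->
  forall w, sgen (site_ops S) w -> R w.
Proof.
move=> gS R R1 RM w; elim=> [//|x v Sx Sv IH|x v Sx Sv IH]; apply: RM => //.
exact: wsV.
Qed.

Lemma ws_mono S S' p : {subset S <= S'} -> sgen (site_ops S) p -> sgen (site_ops S') p.
Proof.
move=> sS; apply: sgen_sub => x; case=> [[a [b [aS bS ab ->]]]|[a [g [aS Gg ->]]]]; apply: sgen_in.
  by left; exists a, b; rewrite !sS.
by right; exists a, g; rewrite sS.
Qed.

Lemma ws_out S t w : good (t :: S) -> sgen (site_ops S) w -> carries (act w) t t.
Proof.
move=> gS; have [t0 gS' dt] := good_cons gS.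
elim/(ws_ind gS') => [y|x v Sx Sv IH y]; first by rewrite rep_act1.
rewrite actM fwM IH; case: Sx => [[a [b [aS bS ab ->]]]|[a [g [aS Gg ->]]]].
  have a0 := good_nil gS' aS; have b0 := good_nil gS' bS; have dab := good_dis gS' aS bS ab.
  by rewrite act_swp // swap_out // (pre_dis z) // dt.
by rewrite act_phi ?(good_nil gS') // lab_out // (pre_dis z) // dt.
Qed.

Lemma ws_phiC S t w g : good (t :: S) -> G g -> sgen (site_ops S) w -> commute (phi t g) w.
Proof.
move=> gS Gg; have [t0 gS' dt] := good_cons gS.
elim/(ws_ind gS') => [|x v Sx Sv IH]; first exact: commute1.
apply: commuteM IH; case: Sx => [[a [b [aS bS ab ->]]]|[a [h [aS Gh ->]]]].
  have a0 := good_nil gS' aS; have b0 := good_nil gS' bS; have dab := good_dis gS' aS bS ab.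
  by apply/commute_sym/phi_out => //; apply: dt.
by apply/commute_sym/phi_phi => //; rewrite ?(good_nil gS') ?dt.
Qed.

(** Coset decomposition of the wreath product with respect to the stabiliser of [t]: at most one
    exchange involving [t] is needed, in front. *)
Lemma ws_dec S t w : good (t :: S) -> sgen (site_ops (t :: S)) w ->
  exists v g, [/\ sgen (site_ops S) v, G g &
    w = v * phi t g \/ exists2 a, a \in S & w = swp a t * (v * phi t g)].
Proof.
move=> gS; have [t0 gS' dt] := good_cons gS.
have nil a : a \in S -> a != [::] := good_nil gS'.
have tC a : a \in S -> dis t a by move=> aS; rewrite dis_sym; apply: dt.
have K a : a \in S -> forall w, swp a t * (swp a t * w) = w.
  by move=> aS w0; rewrite mulgA swp2 ?mul1g //; [apply: nil|apply: dt].
have K2 a b : a \in S -> b \in S -> dis a b -> forall w, swp a b * (swp a b * w) = w.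
  by move=> aS bS ab w0; rewrite mulgA swp2 ?mul1g //; apply: nil.
elim/(ws_ind gS) => [|x w' Sx _ [v [g [Sv Gg ew]]]].
  by exists 1, 1; split=> //; [exact: sgen1|left; rewrite cone1 ?mulg1].
have swpt a : a \in S -> exists v g, [/\ sgen (site_ops S) v, G g &
    swp a t * w' = v * phi t g \/ exists2 c, c \in S & swp a t * w' = swp c t * (v * phi t g)].
  move=> aS; case: ew => [->|[b bS ->]]; first by exists v, g; split=> //; right; exists a.
  case: (eqVneq a b) => [->|ab].
    by exists v, g; split=> //; left; rewrite K.
  have dab := good_dis gS' aS bS ab.
  exists (swp a b * v), g; split=> //; first by apply: sgenM => //; left; exists a, b.
  right; exists b => //; have := swp3 (nil _ bS) t0 (nil _ aS) (dt _ bS) _ (tC _ aS).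
  rewrite dis_sym => /(_ dab) e.
  by rewrite (swpC a b) -e (swpC t a) -!mulgA !K.
case: Sx => [[a [b [aS bS ab ->]]]|[a [h [aS Gh ->]]]].
  move: aS bS ab; rewrite !inE => /orP [/eqP ->|aS] /orP [/eqP ->|bS] ab.
  - by rewrite eqxx in ab.
  - by rewrite swpC; apply: swpt.
  - exact: swpt.
  have dab := good_dis gS' aS bS ab.
  have Sab : site_ops S (swp a b) by left; exists a, b.
  case: ew => [->|[c cS ->]].
    by exists (swp a b * v), g; split=> //; [apply: sgenM|left; rewrite mulgA].
  case: (eqVneq c a) => [->|ca].
    exists (swp a b * v), g; split=> //; first exact: sgenM.
    right; exists b => //; have := swp3 (nil _ bS) (nil _ aS) t0 _ (dt _ bS) (dt _ aS).
    rewrite dis_sym (swpC b a) => /(_ dab) <-.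
    by rewrite -!mulgA K2.
  case: (eqVneq c b) => [->|cb].
    exists (swp a b * v), g; split=> //; first exact: sgenM.
    right; exists a => //; have := swp3 (nil _ aS) (nil _ bS) t0 dab (dt _ aS) (dt _ bS).
    move=> <-.
    by rewrite -!mulgA K2.
  exists (swp a b * v), g; split=> //; first exact: sgenM.
  right; exists c => //; rewrite !mulgA; congr (_ * _ * _); apply: swp4 => //; rewrite ?nil ?dt //.
    by apply: (good_dis gS'); rewrite // eq_sym.
  by apply: (good_dis gS'); rewrite // eq_sym.
have vC k : G k -> phi t k * (v * phi t g) = v * phi t (k * g).
  by move=> Gk; rewrite phiM // !mulgA; congr (_ * _); apply: ws_phiC gS Gk Sv.
move: aS; rewrite inE => /orP [/eqP ->|aS].
  case: ew => [->|[c cS ->]].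
    by exists v, (h * g); split=> //; [exact: GM|left; rewrite vC].
  exists (phi c h * v), g; split=> //; first by apply: sgenM => //; right; exists c, h.
  right; exists c => //; have := phi_swp t0 (nil _ cS) Gh (tC _ cS); rewrite (swpC t c) => <-.
  by rewrite -!mulgA K.
have Sa : site_ops S (phi a h) by right; exists a, h.
case: ew => [->|[c cS ->]].
  by exists (phi a h * v), g; split=> //; [exact: sgenM|left; rewrite mulgA].
case: (eqVneq c a) => [->|ca].
  exists v, (h * g); split=> //; first exact: GM.
  right; exists a => //; rewrite -vC // -(phi_swp (nil _ aS) t0 Gh (dt _ aS)).
  by rewrite -!mulgA K.
exists (phi a h * v), g; split=> //; first exact: sgenM.
right; exists c => //; rewrite !mulgA; congr (_ * _ * _); apply: commute_sym.
exact: (phi_out (nil _ cS) t0 (nil _ aS) Gh (dt _ cS) (good_dis gS' cS aS ca) (tC _ aS)).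
Qed.

(** By induction on the cones: a trivial action on the cone [t] excludes the exchange and makes the
    label at [t] trivial in the decomposition, and what remains lives on the other cones. *)
Lemma ws_faithful S w : good S -> sgen (site_ops S) w -> act w = 1 -> w = 1.
Proof.
elim: S w => [|t S IH] w gS.
  by elim/(ws_ind gS) => // x v [[a [b []]]|[a [g []]]].
have [t0 gS' dt] := good_cons gS.
move=> /(ws_dec gS) [v [g [Sv Gg [->|[a aS ->]]]]] e.
  have e1 : lab t g = 1.
    apply: bijP => y; case: (boolP (pre t y)) => [/(preE z) ->|pt]; last exact: lab_out.
    have := congr1 (fun h => fw h (app t (sdrop (size t) y))) e.
    by rewrite actM fwM act_phi // lab_in (ws_out gS Sv).
  have g1 : g = 1.
    apply: (@lab_inj T z t); rewrite e1; apply: bijP => y.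
    by case: (boolP (pre t y)) => [/(preE z) ->|pt]; [rewrite lab_in|rewrite lab_out].
  by move: e; rewrite g1 cone1 // mulg1; apply: IH.
have a0 := good_nil gS' aS.
have := congr1 (fun h => fw h (app t (fun=> z))) e.
rewrite !actM !fwM act_phi // lab_in (ws_out gS Sv) act_swp ?dt // swap_r ?dt //.
by move=> h; have /(disP z) /(_ _ _ h) := dt _ aS.
Qed.

(* [comb k] is the partition of the stream space into the cones
   [z^j r], with [j <= k] and [r != z], and [z^(k+1)]. *)
Definition tip k : word := locked (nseq k.+1 z).
Fixpoint teeth k : seq word := if k is k'.+1 then [seq rcons (tip k') r | r <- L] ++ teeth k'
  else [seq [:: r] | r <- L].
Definition comb k := tip k :: teeth k.
Definition level k := sgen (site_ops (comb k)).

Lemma tlS k : tip k.+1 = rcons (tip k) z.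
Proof. by rewrite /tip -!lock; elim: k.+1 => //= n {1}->. Qed.

Lemma dis_rcons a i j : i != j -> dis (rcons a i) (rcons a j).
Proof. by move=> ij; rewrite -!cats1 (dis_cat2l z); apply: dis_letter. Qed.

Lemma dis_rconsr a b i : dis a b -> dis a (rcons b i).
Proof. by rewrite -cats1; apply: (dis_catr z). Qed.

Lemma rcons_nil a i : rcons a i != [::]. Proof. by case: a. Qed.

Lemma L_uniq : uniq L. Proof. exact: filter_uniq (enum_uniq T). Qed.
Lemma L_mem r : (r \in L) = (r != z). Proof. by rewrite mem_filter mem_enum andbT. Qed.

Lemma pairwise_L (F : T -> word) : (forall i j, i != j -> dis (F i) (F j)) ->
  pairwise (@dis T) (map F L).
Proof.
move=> h; elim: L L_uniq => //= i l IH /andP [il ul]; rewrite IH // andbT.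
by apply/allP=> _ /mapP [j jl ->]; apply: h; apply: contraNneq il => ->.
Qed.

Lemma tl0 : tip 0 = [:: z]. Proof. by rewrite /tip -lock. Qed.

Lemma comb_good k : good (comb k).
Proof.
elim: k => [|k IH].
  rewrite /good /comb tl0 /= all_map pairwise_L ?andbT; last by move=> i j; apply: dis_letter.
  rewrite (_ : all _ _) /=; last exact/allP.
  by apply/allP=> _ /mapP [j jL ->]; apply: dis_letter; rewrite L_mem eq_sym in jL.
have [t0 gS dt] := good_cons IH; have /andP [nS pS] := gS.
rewrite /good /comb tlS /= rcons_nil all_cat nS andbT; apply/andP; split.
  by apply/allP=> _ /mapP [j jL ->]; apply: rcons_nil.
rewrite pairwise_cat pS andbT all_cat; apply/and3P; split; last first.
- by apply: pairwise_L => i j; apply: dis_rcons.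
- apply/allrelP=> _ b /mapP [j jL ->] bS; rewrite dis_sym; apply: dis_rconsr.
  exact: dt.
apply/andP; split; apply/allP=> b; last by move=> bS; rewrite dis_sym; apply/dis_rconsr/dt.
by case/mapP=> j jL ->; apply: dis_rcons; rewrite L_mem eq_sym in jL.
Qed.

Lemma tl_nil k : tip k != [::]. Proof. by rewrite /tip -lock. Qed.
Lemma co_good k : good (teeth k). Proof. by have [] := good_cons (comb_good k). Qed.
Lemma co_dis k a : a \in teeth k -> dis a (tip k).
Proof. by have [_ _ h] := good_cons (comb_good k); apply: h. Qed.

Lemma co_sub k : {subset teeth k <= comb k.+1}.
Proof. by move=> a aS; rewrite inE mem_cat aS !orbT. Qed.

Lemma child_comb k r : rcons (tip k) r \in comb k.+1.
Proof.
rewrite inE tlS; case: (eqVneq r z) => [->|rz]; first by rewrite eqxx.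
by rewrite mem_cat map_f ?orbT // L_mem.
Qed.

Lemma W_phi k g : G g -> level k.+1 (phi (tip k) g).
Proof.
move=> Gg; apply: sgen_sub (phi_split (tl_nil k) Gg) => p [[i [j [ij ->]]]|[i [h [Gh ->]]]].
  apply: sgen_in; left; exists (rcons (tip k) i), (rcons (tip k) j).
  by rewrite !child_comb; split=> //; apply: contraNneq ij => /rcons_inj [->].
by apply: sgen_in; right; exists (rcons (tip k) i), h; rewrite child_comb.
Qed.

(** An element that preserves the tip up to a label passes to the next level by splitting that
    label; any other one does so after an exchange with the tip is taken out in front. *)
Lemma W_dec k w : level k w -> level k.+1 w \/ exists a v g, [/\ a \in teeth k, level k.+1 v,
  w = swp a (tip k) * v & forall y, fw (act v) (app (tip k) y) = app (tip k) (fw g y)].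
Proof.
move=> /(ws_dec (comb_good k)) [v [g [Sv Gg ew]]].
have Wv : level k.+1 (v * phi (tip k) g).
  by apply: sgen_M (W_phi k Gg); apply: ws_mono Sv; apply: co_sub.
case: ew => [->|[a aS ->]]; first by left.
right; exists a, (v * phi (tip k) g), g; split=> // y.
by rewrite actM fwM act_phi ?tl_nil // lab_in (ws_out (comb_good k) Sv).
Qed.

Lemma W_swp k a b : a \in comb k -> b \in comb k -> a != b -> level k (swp a b).
Proof. by move=> aC bC ab; apply: sgen_in; left; exists a, b. Qed.

Lemma co_tl k a : a \in teeth k -> a != tip k.
Proof. by move=> /co_dis; apply: dis_neq. Qed.

Lemma co_coS k a : a \in teeth k -> a \in teeth k.+1.
Proof. by move=> aS; rewrite mem_cat aS orbT. Qed.

Lemma W_swp_tl k a : a \in teeth k -> level k (swp a (tip k)).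
Proof.
by move=> aS; apply: W_swp; rewrite ?mem_head ?co_tl // inE aS orbT.
Qed.

(* Splitting [a] and the tail in either order gives the same subdivision. *)
Lemma W_diamond k a : a \in teeth k ->
  level k.+2 (swp a (tip k.+1) * swp a (tip k) * swp a (tip k.+1)).
Proof.
move=> aS; have a0 := good_nil (co_good k) aS.
rewrite tlS swp_split ?co_dis ?tl_nil //; apply: sgen_M; last first.
  by rewrite -!tlS; apply: W_swp_tl; apply/co_coS/co_coS.
have : forall r, r \in L -> level k.+2 (swp (rcons (tip k) r) (rcons (rcons (tip k) z) r)).
  move=> r rL; have rC : rcons (tip k) r \in teeth k.+1 by rewrite mem_cat map_f.
  rewrite -tlS; apply: W_swp; [exact: co_sub|exact: child_comb|].
  by apply: dis_neq; apply: dis_rconsr; apply: co_dis.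
elim: L => [_|r l IH h] /=; first exact: sgen1.
by apply: sgen_M; [apply: h; rewrite mem_head|apply: IH => s sl; apply: h; rewrite inE sl orbT].
Qed.

(* [refines k q k' q'] multiplies [q] by elements permuting and relabelling the
   cones of [comb k], [comb (k + 1)], and so on up to [comb k']. *)
Inductive refines : nat -> P -> nat -> P -> Prop :=
| ex0 k q w : level k w -> refines k q k (q * w)
| exS k q w k' q' : level k w -> refines k.+1 (q * w) k' q' -> refines k q k' q'.

Lemma ex_refl k q : refines k q k q.
Proof. by rewrite -{2}[q]mulg1; apply: ex0; apply: sgen1. Qed.

Lemma ex_inv k q k' q' : refines k q k' q' -> (k' = k /\ exists2 w, level k w & q' = q * w) \/
  exists2 w, level k w & refines k.+1 (q * w) k' q'.
Proof. by case=> [k0 q0 w W0|k0 q0 w k1 q1 W0 e]; [left; split=> //; exists w|right; exists w]. Qed.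

Lemma ex_src k q w k' q' : level k w -> refines k (q * w) k' q' -> refines k q k' q'.
Proof.
move=> Ww /ex_inv [[-> [w1 W1 ->]]|[w1 W1 e]].
  by rewrite -mulgA; apply: ex0; apply: sgen_M.
by apply: (@exS _ _ (w * w1)); [apply: sgen_M|rewrite mulgA].
Qed.

Lemma ex_srcV k q w k' q' : level k w -> refines k q k' q' -> refines k (q * w) k' q'.
Proof. by move=> Ww e; apply: (@ex_src _ _ w^-1); [exact: sgen_V|rewrite mulgK]. Qed.

Lemma ex_trans k q k1 q1 k2 q2 : refines k q k1 q1 -> refines k1 q1 k2 q2 -> refines k q k2 q2.
Proof.
elim=> [k0 q0 w0 W0|k0 q0 w0 k' q' W0 _ IH] e; first exact: ex_src e.
by apply: exS W0 (IH e).
Qed.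

Lemma ex_left p k q k' q' : refines k q k' q' -> refines k (p * q) k' (p * q').
Proof.
elim=> [k0 q0 w0 W0|k0 q0 w0 k1 q1 W0 _ IH]; first by rewrite mulgA; apply: ex0.
by apply: exS W0 _; rewrite -mulgA.
Qed.

(** Local confluence: if the refinement and [w] bring different cones to the tip, [W_diamond] allows
    both to be subdivided in either order. *)
Lemma ex_strip k q k1 q1 : refines k q k1 q1 -> forall w, level k w ->
  exists k3 q3, refines k.+1 (q * w) k3 q3 /\ refines k1 q1 k3 q3.
Proof.
elim=> [k0 q0 w0 W0 w Ww|k0 q0 w0 k' q' W0 _ IH w Ww].
  exists k0.+1, (q0 * w); split; first exact: ex_refl.
  apply: (@exS _ _ (w0^-1 * w)); first by apply: sgen_M Ww; apply: sgen_V.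
  by rewrite mulgA mulgK; apply: ex_refl.
have [a [b [e [Wa Wb We eab]]]] : exists a b e : P, [/\ level k0.+1 a, level k0.+1 b, level k0.+2 e &
    w0^-1 * w * b = a * e].
  have [Wv|[c [v [g [cS Wv ev _]]]]] := W_dec (sgen_M (sgen_V W0) Ww).
    by exists (w0^-1 * w), 1, 1; split=> //; rewrite ?mulg1 //; exact: sgen1.
  have Ws := W_swp_tl (co_coS cS).
  exists (swp c (tip k0.+1)), (v^-1 * swp c (tip k0.+1)),
    (swp c (tip k0.+1) * swp c (tip k0) * swp c (tip k0.+1)); split=> //.
  - by apply: sgen_M Ws; apply: sgen_V.
  - exact: W_diamond.
  rewrite ev !mulgA mulgK swp2 ?mul1g ?tl_nil //; first exact: good_nil (co_good k0) cS.
  by apply: co_dis; apply: co_coS.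
have [k3 [q3 [e1 e2]]] := IH a Wa; exists k3, q3; split=> //.
apply: (exS Wb); rewrite (_ : q0 * w * b = q0 * w0 * a * e); first exact: ex_srcV.
by rewrite -!mulgA -eab !mulgA mulgK.
Qed.

Lemma ex_confl k q k1 q1 : refines k q k1 q1 -> forall k2 q2, refines k q k2 q2 ->
  exists k3 q3, refines k1 q1 k3 q3 /\ refines k2 q2 k3 q3.
Proof.
elim=> [k0 q0 w0 W0|k0 q0 w0 k' q' W0 _ IH] k2 q2 e.
  by exists k2, q2; split; [apply: ex_srcV|apply: ex_refl].
have [k3 [q3 [e1 e2]]] := ex_strip e W0.
have [k4 [q4 [e3 e4]]] := IH _ _ e1.
by exists k4, q4; split=> //; apply: ex_trans e2 e4.
Qed.

(** The label [g] is left arbitrary, so that this depends only on the partition into the images of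
    the cones. *)
Definition on_cone k q u := exists c g, c \in comb k /\
  forall y, fw (act q) (app c y) = app u (fw g y).

Lemma W_perm k w c : level k w -> c \in comb k ->
  exists c' g, [/\ c' \in comb k, G g & forall y, fw (act w) (app c y) = app c' (fw g y)].
Proof.
move=> Ww cC; elim/(ws_ind (comb_good k)): w / Ww => [|x v Sx _ [c' [g [cC' Gg e]]]].
  by exists c, 1; split=> // y; rewrite rep_act1.
have c'0 := good_nil (comb_good k) cC'.
have neqd a : a \in comb k -> a != c' -> dis a c'.
  by move=> aS; apply: (good_dis (comb_good k)).
case: Sx => [[a [b [aS bS ab ->]]]|[a [h [aS Gh ->]]]].
  have a0 := good_nil (comb_good k) aS; have b0 := good_nil (comb_good k) bS.
  have dab := good_dis (comb_good k) aS bS ab.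
  case: (eqVneq a c') => [eac|ac].
    by exists b, g; split=> // y; rewrite actM fwM e act_swp // -eac swap_l.
  case: (eqVneq b c') => [ebc|bc].
    by exists a, g; split=> // y; rewrite actM fwM e act_swp // -ebc swap_r.
  by exists c', g; split=> // y; rewrite actM fwM e act_swp // swap_out // (pre_dis z) // neqd.
have a0 := good_nil (comb_good k) aS.
case: (eqVneq a c') => [eac|ac].
  by exists c', (h * g); split=> [||y] //; [exact: GM|rewrite actM fwM e act_phi // -eac lab_in].
by exists c', g; split=> // y; rewrite actM fwM e act_phi // lab_out // (pre_dis z) // neqd.
Qed.

Lemma fr_W k q w u : level k w -> on_cone k (q * w) u -> on_cone k q u.
Proof.
move=> Ww [c [g [cC e]]]; have [c2 [h2 [cC2 _ e2]]] := W_perm Ww cC.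
exists c2, (g * h2^-1); split=> // y.
have := e (fw h2^-1 y); rewrite actM fwM e2.
by rewrite -[fw h2 (fw h2^-1 y)]fwM mulgV.
Qed.

Lemma fr_WV k q w u : level k w -> on_cone k q u -> on_cone k (q * w) u.
Proof. by move=> Ww f; apply: (@fr_W _ _ w^-1); [exact: sgen_V|rewrite mulgK]. Qed.

Definition same k x y := exists c, [/\ c \in comb k, pre c x & pre c y].
Definition separated k q u := exists x y, [/\ pre u x, pre u y &
  ~ same k (fw (act q^-1) x) (fw (act q^-1) y)].

Lemma pre_cat u v x : pre (u ++ v) x -> pre u x.
Proof. by move=> /(preE z) ->; rewrite app_cat (pre_app0 z). Qed.

Lemma sameS k x y : same k.+1 x y -> same k x y.
Proof.
move=> [c [cC cx cy]]; have : (exists r, c = rcons (tip k) r) \/ c \in teeth k.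
  move: cC; rewrite inE tlS mem_cat => /or3P [/eqP ->|/mapP [r _ ->]|]; last by right.
    by left; exists z.
  by left; exists r.
case=> [[r ec]|cS]; last by exists c; split=> //; rewrite inE cS orbT.
exists (tip k); split; first exact: mem_head.
  by move: cx; rewrite ec -cats1; apply: pre_cat.
by move: cy; rewrite ec -cats1; apply: pre_cat.
Qed.

Lemma same_W k w x y : level k w -> same k x y -> same k (fw (act w) x) (fw (act w) y).
Proof.
move=> Ww [c [cC /(preE z) -> /(preE z) ->]].
have [c' [g [cC' _ e]]] := W_perm Ww cC.
by exists c'; rewrite !e; split=> //; apply: (pre_app0 z).
Qed.

Lemma sep_W k q w u : level k w -> separated k q u -> separated k (q * w) u.
Proof.
move=> Ww [x [y [ux uy n]]]; exists x, y; split=> // s; apply: n.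
have := same_W Ww s; rewrite -!fwM -!actM invgM mulgA mulgV mul1g //.
Qed.

Lemma sepS k q u : separated k q u -> separated k.+1 q u.
Proof. by move=> [x [y [ux uy n]]]; exists x, y; split=> // /sameS. Qed.

Lemma sep_ex k q k' q' u : refines k q k' q' -> separated k q u -> separated k' q' u.
Proof.
elim=> [k0 q0 w0 W0|k0 q0 w0 k1 q1 W0 _ IH] s; first exact: sep_W.
by apply/IH/sepS/sep_W.
Qed.

Lemma sep_fr k q u : separated k q u -> ~ on_cone k q u.
Proof.
move=> [x [y [/(preE z) ex_ /(preE z) ey n]]] [c [g [cC e]]]; apply: n; exists c.
have inc v : fw (act q^-1) (app u v) = app c (fw g^-1 v).
  rewrite -[v in LHS]/(fw 1 v) -(mulgV g) fwM -e -fwM -actM mulVg rep_act1 //.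
by rewrite ex_ ey !inc; split=> //; apply: (pre_app0 z).
Qed.

Lemma L_ex : (1 < #|T|)%N -> exists r, r != z.
Proof.
move=> T2; have /card_gt0P [r] : (0 < #|predC1 z|)%N.
  by have := cardC1 z; case: #|T| T2 => [|[|?]] //= _ ->.
by exists r.
Qed.

Hypothesis T2 : (1 < #|T|)%N.

Lemma sep_step k q u g : (forall y, fw (act q) (app (tip k) y) = app u (fw g y)) -> separated k.+1 q u.
Proof.
move=> e; have [r rz] := L_ex T2.
have inq y : fw (act q^-1) (app u (fw g y)) = app (tip k) y.
  by rewrite -e -fwM -actM mulVg rep_act1.
exists (app u (fw g (scons r (fun=> z)))), (app u (fw g (scons z (fun=> z)))).
rewrite !inq; split; try exact: (pre_app0 z).
move=> [c [cC p1 p2]].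
have ee i : app (tip k) (scons i (fun=> z)) = app (rcons (tip k) i) (fun=> z).
  by rewrite -cats1 app_cat.
have key i : pre c (app (tip k) (scons i (fun=> z))) -> c = rcons (tip k) i.
  rewrite ee; case: (eqVneq c (rcons (tip k) i)) => // n.
  by rewrite (pre_dis z) //; apply: good_dis (comb_good k.+1) cC (child_comb k i) n.
by move: rz; have := key _ p1; rewrite (key _ p2) => /rcons_inj [->]; rewrite eqxx.
Qed.

(** A cone [u] that is absent from the final partition has been subdivided at some stage.
    [W_diamond] moves its subdivision forward past the earlier ones, so that it may come at once. *)
Lemma ex_rearr k q k' q' : refines k q k' q' -> forall u w g, on_cone k q u -> ~ on_cone k' q' u -> level k w ->
  (forall y, fw (act (q * w)) (app (tip k) y) = app u (fw g y)) -> refines k.+1 (q * w) k' q'.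
Proof.
elim=> [k0 q0 w0 W0|k0 q0 w1 k1 q1 W1 e1 IH] u w g fu nfu Ww ew.
  by case: nfu; apply: fr_WV.
have [Wv|[a [v [h [aS Wv ev vt]]]]] := W_dec (sgen_M (sgen_V W1) Ww).
  by rewrite (_ : q0 * w = q0 * w1 * (w1^-1 * w)); [apply: ex_srcV|rewrite mulgA mulgK].
have ew' : w = w1 * (swp a (tip k0) * v) by rewrite -ev mulgA mulgV mul1g.
have a0 := good_nil (co_good k0) aS; have dat := co_dis aS.
have dat' := co_dis (co_coS aS).
have ua y : fw (act (q0 * w1)) (app a y) = app u (fw (g * h^-1) y).
  have := ew (fw h^-1 y); rewrite ew' !mulgA [act (_ * v)]actM [in LHS]fwM vt.
  rewrite -[fw h (fw _ y)]fwM mulgV fw1 [act (_ * swp _ _)]actM [in LHS]fwM.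
  by rewrite act_swp ?tl_nil // swap_r // => ->.
have Ws := W_swp_tl (co_coS aS).
have e2 : refines k0.+2 (q0 * w1 * swp a (tip k0.+1)) k1 q1.
  apply: (IH u _ (g * h^-1)) => //.
    by exists a, (g * h^-1); split=> //; apply: co_sub.
  by move=> y; rewrite actM fwM act_swp ?tl_nil // swap_r // ua.
apply: (@exS _ _ (v^-1 * swp a (tip k0.+1))); first by apply: sgen_M Ws; apply: sgen_V.
rewrite (_ : _ * _ = q0 * w1 * swp a (tip k0.+1) *
   (swp a (tip k0.+1) * swp a (tip k0) * swp a (tip k0.+1))).
  by apply: ex_srcV e2; apply: W_diamond.
by rewrite ew' !mulgA mulgK -[_ * swp a (tip k0.+1) * swp a (tip k0.+1)]mulgA swp2 ?tl_nil // mulg1.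
Qed.

Hypothesis Gss : forall g i, G g -> exists j h, G h /\
  forall y, fw g (scons i y) = scons j (fw h y).

Definition on_comb k q := forall c, c \in comb k -> exists u g, G g /\
  forall y, fw (act q) (app c y) = app u (fw g y).

Lemma frm_W k q w : level k w -> on_comb k q -> on_comb k (q * w).
Proof.
move=> Ww f c cC; have [c' [g [cC' Gg e]]] := W_perm Ww cC.
have [u [h [Gh e']]] := f c' cC'; exists u, (h * g); split; first exact: GM.
by move=> y; rewrite actM fwM e e'.
Qed.

Lemma frmS k q : on_comb k q -> on_comb k.+1 q.
Proof.
move=> f c cC; have : (exists r, c = rcons (tip k) r) \/ c \in teeth k.
  move: cC; rewrite inE tlS mem_cat => /or3P [/eqP ->|/mapP [r _ ->]|]; last by right.
    by left; exists z.
  by left; exists r.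
case=> [[r ec]|cS]; last by apply: f; rewrite inE cS orbT.
have [u [g [Gg e]]] := f _ (mem_head _ _); have [j [h [Gh eh]]] := Gss r Gg.
exists (rcons u j), h; split=> // y.
by rewrite ec -!cats1 !app_cat /= e eh.
Qed.

Lemma frm_tl k q w : on_comb k q -> level k w -> exists u g, on_cone k q u /\
  forall y, fw (act (q * w)) (app (tip k) y) = app u (fw g y).
Proof.
move=> f Ww; have [u [g [Gg e]]] := frm_W Ww f (mem_head _ _).
exists u, g; split=> //; apply: (fr_W Ww); exists (tip k), g; split=> //.
exact: mem_head.
Qed.

(** The cone that one refinement subdivides at the start is cut in its final partition, hence is
    absent from that of the other, which by [ex_rearr] may start with the same subdivision. *)
Lemma ex_unique k q k1 q1 : refines k q k1 q1 -> forall k2 q2, on_comb k q -> refines k q k2 q2 ->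
  (forall u, on_cone k1 q1 u <-> on_cone k2 q2 u) -> k1 = k2 /\ level k1 (q1^-1 * q2).
Proof.
elim=> [k0 q0 w0 W0|k0 q0 w k1' q1' Ww e1 IH] k2 q2 f e2 same_fr.
  case: (ex_inv e2) => [[-> [w2 W2 ->]]|[w Ww e]].
    split=> //; rewrite invgM -mulgA mulKg; apply: sgen_M W2; exact: sgen_V.
  have [u [g [fu eu]]] := frm_tl f Ww.
  case: (sep_fr (sep_ex e (sep_step eu))); apply/same_fr; exact: fr_WV.
have [u [g [fu eu]]] := frm_tl f Ww.
apply: IH => //; first by apply/frmS/frm_W.
apply: (ex_rearr e2 fu _ Ww eu) => /same_fr; apply: sep_fr.
exact: sep_ex e1 (sep_step eu).
Qed.

Lemma frm1 : on_comb 0 1.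
Proof. by move=> c _; exists c, 1; split=> // y; rewrite rep_act1. Qed.

(* The images of the cones of [comb k] under [q1] and [q2] are partitions
   identified by the action of [p]: the tree pair of Thompson's groups. *)
Definition represented p := exists k q1 q2, [/\ refines 0 1 k q1, refines 0 1 k q2 & p * q1 = q2].

Lemma rep_W k w : level k w -> represented w.
Proof.
move=> Ww; have e : refines 0 1 k 1.
  have h j : refines j 1 (j + 1) 1.
    rewrite addn1; apply: (@exS _ _ 1); first exact: sgen1.
    by rewrite mulg1; apply: ex_refl.
  elim: (k) => [|j IH]; first exact: ex_refl.
  by apply: ex_trans IH _; rewrite -addn1.
exists k, 1, w; split=> //; rewrite ?mulg1 //.
by apply: ex_trans e _; rewrite -[X in refines _ _ _ X]mul1g; apply: ex0.
Qed.

(** The target partition of [p'] and the source partition of [p] have a common refinement by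
    [ex_confl]. *)
Lemma rep_M p p' : represented p -> represented p' -> represented (p * p').
Proof.
move=> [k [q1 [q2 [e1 e2 e]]]] [k' [q1' [q2' [e1' e2' e']]]].
have [k3 [q3 [f1 f2]]] := ex_confl e1 e2'.
exists k3, (p'^-1 * q3), (p * q3); split; last by rewrite -mulgA mulKVg.
- apply: ex_trans e1' _; rewrite -(mulKg p' q1') e'; exact: ex_left.
- by apply: ex_trans e2 _; rewrite -e; apply: ex_left.
Qed.

(** If [p] acts trivially, the two partitions have the same cones, so [q1] and [q2] differ by an
    element of a single level, where the action is faithful. *)
Lemma rep_faithful p : represented p -> act p = 1 -> p = 1.
Proof.
move=> [k [q1 [q2 [e1 e2 e]]]] ap.
have eq : act q1 = act q2 by rewrite -e actM ap mul1g.
have [] := ex_unique e1 frm1 e2; first by move=> u; rewrite /on_cone eq.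
move=> _ Wk; have w1 : q1^-1 * q2 = 1.
  apply: (ws_faithful (comb_good k) Wk).
  by rewrite actM rep_actV eq mulVg.
by move: e; rewrite -[q2](mulKVg q1) w1 mulg1 => /(congr1 (fun x => x * q1^-1)); rewrite mulgK mulgV.
Qed.

End Faithful.

(** * Relations verified on finitely many addresses *)

Section ChildWords.
Local Open Scope group_scope.
Variables (T : finType) (z : T).
Local Notation X := (nat -> T).
Local Notation word := (seq T).
Local Notation swap := (@swap T z).
Local Notation lab := (@lab T z).
Implicit Types (a b c t u v : word) (g h : bij X) (x y : X).

Lemma pr_swap_perm a (ts : seq (T * T)) i y : all (fun t : T * T => t.1 != t.2) ts ->
  fw (pr (fun t : T * T => swap (rcons a t.1) (rcons a t.2)) ts) (app (rcons a i) y) =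
  app (rcons a (foldr (fun (t : T * T) j => tperm t.1 t.2 j) i ts)) y.
Proof.
elim: ts => [|[p q] ts IH] //= /andP [pq dts]; rewrite IH //.
set j := foldr _ _ _; have dpq := dis_rcons z a pq.
case: tpermP => [->|->|/eqP jp /eqP jq]; [exact: swap_l|exact: swap_r|].
by rewrite swap_out // (pre_dis z) // (dis_rcons z) // eq_sym.
Qed.

Lemma pr_swap_perm_out a (ts : seq (T * T)) x : all (fun t : T * T => t.1 != t.2) ts ->
  ~~ pre a x -> fw (pr (fun t : T * T => swap (rcons a t.1) (rcons a t.2)) ts) x = x.
Proof.
move=> dts ax; elim: ts dts => [|[p q] ts IH] //= /andP [pq dts]; rewrite IH //.
by apply: swap_out; [exact: dis_rcons| |]; apply: contraNN ax; rewrite -cats1; apply: (pre_cat z).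
Qed.

Lemma pr_lab_child a (F : T -> bij X) (l : seq T) i y : uniq l ->
  fw (pr (fun j => lab (rcons a j) (F j)) l) (app (rcons a i) y) =
  app (rcons a i) (if i \in l then fw (F i) y else y).
Proof.
elim: l => [//|j l IH]; rewrite [uniq _]/= => /andP [jl ul]; rewrite pr_cons fwM IH // inE.
case: (eqVneq i j) => [->|ij]; first by rewrite (negPf jl) lab_in.
by rewrite lab_out // (pre_dis z) // (dis_rcons z) // eq_sym.
Qed.

Lemma pr_lab_child_out a (F : T -> bij X) (l : seq T) x : ~~ pre a x ->
  fw (pr (fun j => lab (rcons a j) (F j)) l) x = x.
Proof.
move=> ax; elim: l => [//|j l IH]; rewrite pr_cons fwM IH lab_out //.
by apply: contraNN ax; rewrite -cats1; apply: (pre_cat z).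
Qed.

Lemma pr_lab a (w : seq (bij X)) : pr (lab a) w = lab a (pr id w).
Proof.
have l1 : lab a 1 = 1.
  apply: bijP => y.
  by case: (boolP (pre a y)) => [/(preE z) ->|pu]; [rewrite lab_in|exact: lab_out].
by elim: w => [|h w IH] /=; rewrite ?l1 // IH labM.
Qed.

Lemma perm_swaps (s : T -> T) : injective s -> exists2 ts : seq (T * T),
  all (fun t : T * T => t.1 != t.2) ts & forall i, s i = foldr (fun (t : T * T) j => tperm t.1 t.2 j) i ts.
Proof.
move=> sI; have [ts e dts] := prod_tpermP (perm sI).
exists (rev ts); first by rewrite all_rev.
move=> i; rewrite -[s i](permE sI) e -(foldl_rev (fun j (t : T * T) => tperm t.1 t.2 j)) revK.
elim: ts i {e dts} => [|t ts IH] i.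
  by rewrite big_nil perm1.
by rewrite big_cons permM IH.
Qed.

Variables (G : bij X -> Prop).
Hypothesis Gss : forall g i, G g -> exists j h, G h /\
  forall y, fw g (scons i y) = scons j (fw h y).

Lemma sections_inj g (s : T -> T) (F : T -> bij X) :
  (forall i y, fw g (scons i y) = scons (s i) (fw (F i) y)) -> injective s.
Proof.
move=> e i i' ei; have /(@fwI _ g) /(congr1 (fun f => f 0%N)) // :
    fw g (scons i (fw (F i)^-1 (fun=> z))) = fw g (scons i' (fw (F i')^-1 (fun=> z))).
by rewrite !e ei -!fwM !mulgV.
Qed.

(** The permutation of the letters is written once as a product of transpositions; at every address
    these become exchanges of children. *)
Lemma lab_sections g (s : T -> T) (F : T -> bij X) :
  (forall i y, fw g (scons i y) = scons (s i) (fw (F i) y)) ->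
  exists2 ts : seq (T * T), all (fun t : T * T => t.1 != t.2) ts &
   forall a, lab a g = pr (fun t : T * T => swap (rcons a t.1) (rcons a t.2)) ts *
     pr (fun j => lab (rcons a j) (F j)) (enum T).
Proof.
move=> e; have [ts dts es] := perm_swaps (sections_inj e).
exists ts => // a; apply: bijP => x; rewrite fwM.
case: (boolP (pre a x)) => [/(preE z) ->|ax]; last first.
  by rewrite lab_out // pr_lab_child_out // pr_swap_perm_out.
set y := sdrop _ _; have -> : y = scons (y 0%N) (fun k => y k.+1) by apply: funext => [[|k]].
have aE j (y' : X) : app a (scons j y') = app (rcons a j) y' by rewrite -cats1 app_cat.
by rewrite lab_in e !aE pr_lab_child ?enum_uniq // mem_enum pr_swap_perm // -es.
Qed.

Lemma self_similar g : G g -> exists (s : T -> T) (F : T -> bij X),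
  (forall i, G (F i)) /\ forall i y, fw g (scons i y) = scons (s i) (fw (F i) y).
Proof.
move=> Gg; have /choice [s hs] : forall i, exists j, exists h, G h /\
    forall y, fw g (scons i y) = scons j (fw h y) by move=> i; apply: Gss.
by have /choice [F hF] := hs; exists s, F; split=> i; case: (hF i).
Qed.

Lemma lab_split g : G g -> exists (ts : seq (T * T)) (F : T -> bij X),
  [/\ all (fun t : T * T => t.1 != t.2) ts, (forall i, G (F i)) &
   forall a, lab a g = pr (fun t : T * T => swap (rcons a t.1) (rcons a t.2)) ts *
     pr (fun j => lab (rcons a j) (F j)) (enum T)].
Proof.
by move=> /self_similar [s [F [GF /lab_sections [ts dts e]]]]; exists ts, F.
Qed.

Lemma pr_swap_in (u v : T -> word) (l : seq T) i y : uniq l ->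
  (forall i j, dis (u i) (v j)) -> (forall i j, i != j -> dis (u i) (u j)) ->
  (forall i j, i != j -> dis (v i) (v j)) ->
  fw (pr (fun r => swap (u r) (v r)) l) (app (u i) y) = app (if i \in l then v i else u i) y /\
  fw (pr (fun r => swap (u r) (v r)) l) (app (v i) y) = app (if i \in l then u i else v i) y.
Proof.
move=> ul duv du dv; have dvu j k : dis (v j) (u k) by rewrite dis_sym.
elim: l ul => [|j l IH] //= /andP [jl ul]; have [IH1 IH2] := IH ul; rewrite IH1 IH2 inE.
case: (eqVneq i j) => [->|ij] /=; first by rewrite (negPf jl) swap_l // swap_r.
have ji : j != i by rewrite eq_sym.
by case: (i \in l); rewrite !swap_out // ?(pre_dis z) // ?du ?dv.
Qed.

Lemma pr_swap_out (u v : T -> word) (l : seq T) x : (forall i j, dis (u i) (v j)) ->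
  (forall i, i \in l -> ~~ pre (u i) x) -> (forall i, i \in l -> ~~ pre (v i) x) ->
  fw (pr (fun r => swap (u r) (v r)) l) x = x.
Proof.
move=> duv; elim: l => //= j l IH hu hv; rewrite IH.
- by apply: swap_out; rewrite ?duv ?hu ?hv ?mem_head.
- by move=> i il; apply: hu; rewrite inE il orbT.
- by move=> i il; apply: hv; rewrite inE il orbT.
Qed.

(** Both sides exchange [t r] with [t z r] for each letter [r] other than [z], and [c] with
    [t z z]. *)
Lemma swap_tail_split c t : dis c t ->
  swap c (rcons t z) * swap c t * swap c (rcons t z) =
  pr (fun r => swap (rcons t r) (rcons (rcons t z) r)) [seq r <- enum T | r != z] *
  swap c (rcons (rcons t z) z).
Proof.
move=> ct; set l := [seq r <- enum T | r != z].
have dci i : dis c (rcons t i) by rewrite -cats1; apply: (dis_catr z).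
have dcj i j : dis c (rcons (rcons t i) j) by rewrite -cats1; apply: (dis_catr z).
have lE r : (r \in l) = (r != z) by rewrite mem_filter mem_enum andbT.
pose u r : word := if r == z then c else rcons t r.
pose v r : word := rcons (rcons t z) r.
have du i j : i != j -> dis (u i) (u j).
  rewrite /u; case: (eqVneq i z) => [->|iz]; case: (eqVneq j z) => [_|jz] ij //.
    by rewrite dis_sym.
  exact: dis_rcons.
have dv i j : i != j -> dis (v i) (v j) by apply: dis_rcons.
have duv i j : dis (u i) (v j).
  rewrite /u /v; case: (eqVneq i z) => [_|iz] //.
  by apply: (dis_rconsr z); apply: (dis_rcons z).
have -> : pr (fun r => swap (rcons t r) (rcons (rcons t z) r)) l = pr (fun r => swap (u r) (v r)) l.
  have : {subset l <= l} by [].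
  elim: {1 3 4}l => //= r l' IH sl; rewrite IH; last by move=> i il; apply: sl; rewrite inE il orbT.
  by have := sl r (mem_head _ _); rewrite lE /u => /negPf ->.
have -> : swap c (rcons (rcons t z) z) = pr (fun r => swap (u r) (v r)) [:: z].
  by rewrite /= mulg1 /u eqxx.
rewrite -pr_cat; set F := fun r => _.
have ul : uniq (l ++ [:: z]).
  by rewrite cats1 rcons_uniq lE eqxx filter_uniq ?enum_uniq.
have al r : r \in l ++ [:: z] by rewrite mem_cat lE inE orNb.
have uz : u z = c by rewrite /u eqxx.
have ur r : r != z -> u r = rcons t r by rewrite /u => /negPf ->.
have aE w j (y' : X) : app w (scons j y') = app (rcons w j) y' by rewrite -cats1 app_cat.
have eta (y : X) : y = scons (y 0%N) (fun k => y k.+1) by apply: funext => [[|k]].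
have evu r y : fw (pr F (l ++ [:: z])) (app (u r) y) = app (v r) y.
  by have [-> _] := pr_swap_in r y ul duv du dv; rewrite al.
have evv r y : fw (pr F (l ++ [:: z])) (app (v r) y) = app (u r) y.
  by have [_ ->] := pr_swap_in r y ul duv du dv; rewrite al.
have dct x : pre t x -> ~~ pre c x by move=> /(preE z) ->; rewrite (pre_dis z).
have ntz r y : r != z -> fw (swap c (rcons t z)) (app (rcons t r) y) = app (rcons t r) y.
  move=> rz; apply: swap_out => //; first by rewrite (pre_dis z).
  by rewrite (pre_dis z) // dis_rcons // eq_sym.
apply: bijP => x; rewrite !fwM.
case: (boolP (pre c x)) => [/(preE z) ->|cx].
  rewrite -[in RHS]uz evu swap_l // -aE swap_r // swap_l //.
  by rewrite !aE uz.
case: (boolP (pre t x)) => [/(preE z) ->|tx]; last first.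
  have tx' w : ~~ pre (t ++ w) x by apply: contraNN tx; apply: (pre_cat z).
  have t1 : ~~ pre (rcons t z) x by rewrite -cats1; apply: tx'.
  rewrite !(swap_out z (dci z) cx t1) (swap_out z ct cx tx) (swap_out z (dci z) cx t1).
  rewrite pr_swap_out // => r rl.
    by rewrite /u; case: eqP => // _; rewrite -cats1.
  by rewrite /v -!cats1 -catA.
set y := sdrop _ _; rewrite (eta y) aE; set r := y 0%N; set y' := (fun k => y k.+1).
case: (eqVneq r z) => [->|rz]; last first.
  by rewrite ntz // -[in RHS](ur _ rz) evu -aE swap_r // swap_l // aE.
rewrite swap_r // swap_l // (eta y') !aE; set r' := y' 0%N; set y2 := (fun k => y' k.+1).
rewrite -/(v r') evv; case: (eqVneq r' z) => [->|rz']; first by rewrite swap_r // uz.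
by rewrite ntz // ur.
Qed.

End ChildWords.

(** * The relation schemes of the Roever-Nekrashevych group *)

Section RoverNekrashevych.
Local Open Scope group_scope.
Variables (T : finType) (z : T).
Local Notation X := (nat -> T).
Local Notation word := (seq T).
Local Notation swap := (@swap T z).
Local Notation lab := (@lab T z).
Hypothesis T8 : (8 <= #|T|)%N.
Variables (G : bij X -> Prop) (B : seq (bij X)) (nB : nat).
Hypothesis fG : fpres_by G B nB.
Hypothesis Gss : forall g i, G g -> exists j h, G h /\
  forall y, fw g (scons i y) = scons j (fw h y).
Implicit Types (a b c t u v : word) (us : seq word) (g h : bij X).

Local Notation obj_val f := (@obj_val T z T8 B _ f).
Local Notation base := (@base T z B).
Local Notation pattern := (pattern T).

Definition swap_pattern i j : pattern := (None, [:: (i, [::]); (j, [::])]).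
Definition lab_pattern h i : pattern := (Some h, [:: (i, [::])]).
Definition Eswap (Q : groupType) (f : bij X -> Q) a b := obj_val f (None, [:: a; b]).
Definition Elab (Q : groupType) (f : bij X -> Q) h a := obj_val f (Some h, [:: a]).

Lemma inst_sP us i j : inst_pattern us (swap_pattern i j) = (None, [:: nth [::] us i; nth [::] us j]).
Proof. by rewrite /inst_pattern /= !cats0. Qed.

Lemma inst_lP us h i : inst_pattern us (lab_pattern h i) = (Some h, [:: nth [::] us i]).
Proof. by rewrite /inst_pattern /= !cats0. Qed.

Lemma admS a b : a != [::] -> b != [::] -> dis a b -> admissible B (None, [:: a; b]).
Proof. exact: adm_swap. Qed.

Lemma admL h a : h \in B -> a != [::] -> admissible B (Some h, [:: a]).
Proof. by move=> hB a0; rewrite /admissible /= hB a0. Qed.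

Lemma sites1 us : sites 1%N us -> exists2 a, us = [:: a] & a != [::].
Proof. by case: us => [|a [|]] // /and3P [_ /= /andP [a0 _] _]; exists a. Qed.

Lemma sites2 us : sites 2%N us -> exists a b, [/\ us = [:: a; b], a != [::], b != [::] & dis a b].
Proof.
case: us => [|a [|b [|]]] // /and3P [_ /= /and3P [a0 b0 _] /andP [/andP [ab _] _]].
by exists a, b.
Qed.

Lemma sites3 us : sites 3%N us -> exists a b c, [/\ us = [:: a; b; c],
  [/\ a != [::], b != [::] & c != [::]] & [/\ dis a b, dis a c & dis b c]].
Proof.
case: us => [|a [|b [|c [|]]]] // /and3P [_ /= /and4P [a0 b0 c0 _]].
by case/and3P=> /and3P [ab ac _] /andP [bc _] _; exists a, b, c.
Qed.

Lemma sites4 us : sites 4%N us -> exists a b c d, [/\ us = [:: a; b; c; d],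
  [/\ a != [::], b != [::], c != [::] & d != [::]],
  [/\ dis a b, dis a c & dis a d] & [/\ dis b c, dis b d & dis c d]].
Proof.
case: us => [|a [|b [|c [|d [|]]]]] // /and3P [_ /= /and5P [a0 b0 c0 d0 _]].
case/and4P=> /and4P [ab ac ad _] /and3P [bc bd _] /andP [cd _] _.
by exists a, b, c, d.
Qed.

Lemma ev_swpC : ev base (fun Q f => forall a b, a != [::] -> b != [::] -> dis a b ->
  Eswap f a b = Eswap f b a).
Proof.
have [||||n hn] := @ev_schema T z T8 B 2 [:: swap_pattern 0 1] [:: swap_pattern 1 0] => //.
- move=> us /sites2 [a [b [-> a0 b0 ab]]]; rewrite /= !inst_sP /= !admS //.
  by rewrite dis_sym.
- move=> us /sites2 [a [b [-> a0 b0 ab]]]; rewrite /= !cats0 swap_sym //.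
exists n => Q f /hn h a b a0 b0 ab; have := h [:: a; b].
by rewrite /= !inst_sP /= !mulg1; apply; apply/and3P; split; rewrite /= ?a0 ?b0 ?ab.
Qed.

Lemma ev_swp2 : ev base (fun Q f => forall a b, a != [::] -> b != [::] -> dis a b ->
  Eswap f a b * Eswap f a b = 1).
Proof.
have [||||n hn] := @ev_schema T z T8 B 2 [:: swap_pattern 0 1; swap_pattern 0 1] [::] => //.
- by move=> us /sites2 [a [b [-> a0 b0 ab]]]; rewrite /= !inst_sP /= !admS.
- by move=> us /sites2 [a [b [-> a0 b0 ab]]]; rewrite /= !cats0 mulg1 swap2.
exists n => Q f /hn h a b a0 b0 ab; have := h [:: a; b].
by rewrite /= !inst_sP /= !mulg1; apply; apply/and3P; split; rewrite /= ?a0 ?b0 ?ab.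
Qed.

Lemma ev_swp3 : ev base (fun Q f => forall a b c, a != [::] -> b != [::] -> c != [::] ->
  dis a b -> dis a c -> dis b c -> Eswap f a b * Eswap f b c * Eswap f a b = Eswap f a c).
Proof.
have [||||n hn] := @ev_schema T z T8 B 3 [:: swap_pattern 0 1; swap_pattern 1 2; swap_pattern 0 1] [:: swap_pattern 0 2] => //.
- by move=> us /sites3 [a [b [c [-> [a0 b0 c0] [ab ac bc]]]]]; rewrite /= !inst_sP /= !admS.
- move=> us /sites3 [a [b [c [-> [a0 b0 c0] [ab ac bc]]]]]; rewrite /= !cats0 !mulg1.
  rewrite mulgA -{2}[swap a b]swapV; apply: conj_swap => // y; first exact: swap_r.
  by rewrite swap_out // (pre_dis z).
exists n => Q f /hn h a b c a0 b0 c0 ab ac bc; have := h [:: a; b; c].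
by rewrite /= !inst_sP /= !mulg1 mulgA; apply; apply/and3P; split; rewrite /= ?a0 ?b0 ?c0 ?ab ?ac ?bc.
Qed.

Lemma ev_swp4 : ev base (fun Q f => forall a b c d : word,
  a != [::] -> b != [::] -> c != [::] -> d != [::] ->
  dis a b -> dis c d -> dis a c -> dis a d -> dis b c -> dis b d ->
  commute (Eswap f a b) (Eswap f c d)).
Proof.
have [||||n hn] := @ev_schema T z T8 B 4 [:: swap_pattern 0 1; swap_pattern 2 3] [:: swap_pattern 2 3; swap_pattern 0 1] => //.
- move=> us /sites4 [a [b [c [d [-> [a0 b0 c0 d0] [ab ac ad] [bc bd cd]]]]]].
  by rewrite /= !inst_sP /= !admS.
- move=> us /sites4 [a [b [c [d [-> [a0 b0 c0 d0] [ab ac ad] [bc bd cd]]]]]].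
  rewrite /= !cats0 !mulg1; apply: (mulIg (swap a b)^-1); rewrite mulgK.
  by apply: conj_swap => // y; rewrite swap_out // (pre_dis z).
exists n => Q f /hn h a b c d a0 b0 c0 d0 ab cd ac ad bc bd; have := h [:: a; b; c; d].
rewrite /= !inst_sP /= !mulg1; apply; apply/and3P; split; rewrite /= ?a0 ?b0 ?c0 ?d0 //.
by rewrite ab ac ad bc bd cd.
Qed.

Lemma ev_lab_swp : ev base (fun Q f => forall h, h \in B -> forall a b,
  a != [::] -> b != [::] -> dis a b -> Eswap f a b * Elab f h a * Eswap f a b = Elab f h b).
Proof.
apply: ev_all => h hB.
have [||||n hn] := @ev_schema T z T8 B 2 [:: swap_pattern 0 1; lab_pattern h 0; swap_pattern 0 1] [:: lab_pattern h 1] => //.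
- by move=> us /sites2 [a [b [-> a0 b0 ab]]]; rewrite /= !inst_sP !inst_lP /= !admS ?admL.
- move=> us /sites2 [a [b [-> a0 b0 ab]]]; rewrite /= !cats0 !mulg1.
  by rewrite mulgA -{2}[swap a b]swapV; apply: conj_lab => y; apply: swap_l.
exists n => Q f /hn {}hn a b a0 b0 ab; have := hn [:: a; b].
by rewrite /= !inst_sP !inst_lP /= !mulg1 mulgA; apply; apply/and3P; split; rewrite /= ?a0 ?b0 ?ab.
Qed.

Lemma ev_lab_out : ev base (fun Q f => forall h, h \in B -> forall a b c,
  a != [::] -> b != [::] -> c != [::] -> dis a b -> dis a c -> dis b c ->
  commute (Eswap f a b) (Elab f h c)).
Proof.
apply: ev_all => h hB.
have [||||n hn] := @ev_schema T z T8 B 3 [:: swap_pattern 0 1; lab_pattern h 2] [:: lab_pattern h 2; swap_pattern 0 1] => //.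
- move=> us /sites3 [a [b [c [-> [a0 b0 c0] [ab ac bc]]]]].
  by rewrite /= !inst_sP !inst_lP /= !admS ?admL.
- move=> us /sites3 [a [b [c [-> [a0 b0 c0] [ab ac bc]]]]]; rewrite /= !cats0 !mulg1.
  apply: (mulIg (swap a b)^-1); rewrite mulgK.
  by apply: conj_lab => y; rewrite swap_out // (pre_dis z).
exists n => Q f /hn {}hn a b c a0 b0 c0 ab ac bc; have := hn [:: a; b; c].
rewrite /= !inst_sP !inst_lP /= !mulg1; apply; apply/and3P; split; rewrite /= ?a0 ?b0 ?c0 //.
by rewrite ab ac bc.
Qed.

Lemma ev_lab_lab : ev base (fun Q f => forall h, h \in B -> forall k, k \in B -> forall a b,
  a != [::] -> b != [::] -> dis a b -> commute (Elab f h a) (Elab f k b)).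
Proof.
apply: ev_all => h hB; apply: ev_all => k kB.
have [||||n hn] := @ev_schema T z T8 B 2 [:: lab_pattern h 0; lab_pattern k 1] [:: lab_pattern k 1; lab_pattern h 0] => //.
- by move=> us /sites2 [a [b [-> a0 b0 ab]]]; rewrite /= !inst_lP /= !admL.
- move=> us /sites2 [a [b [-> a0 b0 ab]]]; rewrite /= !cats0 !mulg1.
  apply: (mulIg (lab a h)^-1); rewrite mulgK.
  by apply: conj_lab => y; rewrite lab_out // (pre_dis z).
exists n => Q f /hn {}hn a b a0 b0 ab; have := hn [:: a; b].
by rewrite /= !inst_lP /= !mulg1; apply; apply/and3P; split; rewrite /= ?a0 ?b0 ?ab.
Qed.

Fixpoint words_upto n : seq (seq (bij X)) :=
  if n is n'.+1 then [::] :: [seq h :: w | h <- B, w <- words_upto n'] else [:: [::]].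

Lemma wleP n w : inw B w -> (size w <= n)%N -> w \in words_upto n.
Proof.
elim: n w => [|n IH] [|h w] //= /andP [hB Bw] short_word; rewrite inE /=.
by apply/allpairsP; exists (h, w); split=> //; apply: IH.
Qed.

Lemma prEl (Q : groupType) (f : bij X -> Q) a w :
  pr (obj_val f \o inst_pattern [:: a]) [seq lab_pattern h 0 | h <- w] = pr (fun h => Elab f h a) w.
Proof. by rewrite pr_map; apply: eq_pr => h /=; rewrite inst_lP. Qed.

(** One scheme for each relation of length at most [nB] between elements of [B], valid at all
    addresses at once. *)
Lemma ev_lab_rels : ev base (fun Q f => forall a, a != [::] -> rels (fun h => Elab f h a) B nB).
Proof.
have e : ev base (fun Q f => forall w, w \in words_upto nB -> forall w', w' \in words_upto nB ->
    [&& inw B w, inw B w' & pr id w == pr id w'] -> forall a, a != [::] ->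
    pr (fun h => Elab f h a) w = pr (fun h => Elab f h a) w').
  apply: ev_all => w _; apply: ev_all => w' _; apply: ev_imp => /and3P [Bw Bw' /eqP eww].
  have [||||n hn] := @ev_schema T z T8 B 1 [seq lab_pattern h 0 | h <- w] [seq lab_pattern h 0 | h <- w'] => //.
  - by rewrite all_cat; apply/andP; split; apply/allP=> _ /mapP [h _ ->].
  - move=> us /sites1 [a -> a0]; rewrite all_cat; apply/andP.
    by split; apply/allP=> _ /mapP [h hw ->]; rewrite inst_lP admL //;
      [apply: (allP Bw)|apply: (allP Bw')].
  - move=> us /sites1 [a -> a0]; rewrite !pr_map.
    have el_lab (v : seq (bij X)) : pr ((obj_elt z \o inst_pattern [:: a]) \o lab_pattern^~ 0) v = lab a (pr id v).
      by rewrite -pr_lab; apply: eq_pr => h /=; rewrite cats0.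
    by rewrite !el_lab eww.
  exists n => Q f /hn h a a0; have := h [:: a]; rewrite !prEl; apply.
  by apply/and3P; split; rewrite /= ?a0.
apply: ev_mono e => Q f h a a0 w w' Bw Bw' short_word sw' eww.
by apply: h => //; [apply: wleP|apply: wleP|rewrite Bw Bw' eww eqxx].
Qed.

Definition children (Q : groupType) (f : bij X -> Q) a p :=
  (exists i j, i != j /\ p = Eswap f (rcons a i) (rcons a j)) \/
  (exists i h, h \in B /\ p = Elab f h (rcons a i)).

(** The sections of a generator of [G] are words in the generators, so one scheme per generator
    suffices. *)
Lemma ev_lab_split : ev base (fun Q f => forall h, h \in B -> forall a, a != [::] ->
  sgen (children f a) (Elab f h a)).
Proof.
apply: ev_all => h hB; have Gh := fpres_gen fG hB.
have [ts [F [dts GF eF]]] := lab_split z Gss Gh.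
have /choice [obj_word hW] : forall i, exists w, inw B w /\ pr id w = F i.
  by move=> i; have [w Bw e] := fpres_word fG (GF i); exists w.
pose Pt : seq pattern := [seq (None, [:: (0%N, [:: t.1]); (0%N, [:: t.2])]) | t : T * T <- ts].
pose Pl : seq pattern := flatten [seq [seq (Some k, [:: (0%N, [:: i])]) | k <- obj_word i] | i <- enum T].
have Pform p : p \in Pt ++ Pl ->
    (exists i j, i != j /\ p = (None, [:: (0%N, [:: i]); (0%N, [:: j])])) \/
    (exists i k, k \in B /\ p = (Some k, [:: (0%N, [:: i])])).
  rewrite mem_cat => /orP [/mapP [t tts ->]|/flattenP [_ /mapP [i _ ->]] /mapP [k kW ->]].
    by left; exists t.1, t.2; split=> //; apply: (allP dts).
  by right; exists i, k; split=> //; apply: (allP (proj1 (hW i))).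
have [||||n hn] := @ev_schema T z T8 B 1 [:: lab_pattern h 0] (Pt ++ Pl) => //.
- by apply/andP; split=> //; apply/allP=> p /Pform [[i [j [_ ->]]]|[i [k [_ ->]]]].
- move=> us /sites1 [a -> a0]; apply/andP; split; first by rewrite inst_lP admL.
  apply/allP=> p /Pform [[i [j [ij ->]]]|[i [k [kB ->]]]]; rewrite /inst_pattern /= !cats1.
    by apply: admS; rewrite ?rcons_nil // (dis_rcons z).
  by apply: admL; rewrite ?rcons_nil.
- move=> us /sites1 [a -> a0]; rewrite pr1 pr_cat /= cats0 eF; congr (_ * _).
    by rewrite /Pt pr_map; apply: eq_pr => t /=; rewrite !cats1.
  rewrite /Pl; elim: (enum T) => //= i l IH; rewrite pr_cat IH; congr (_ * _).
  by rewrite -(proj2 (hW i)) -pr_lab pr_map; apply: eq_pr => k /=; rewrite cats1.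
exists n => Q f /hn {}hn a a0; have := hn [:: a]; rewrite pr1 /= inst_lP /= -/(Elab f h a) => ->; last first.
  by apply/and3P; split; rewrite /= ?a0.
have : {subset Pt ++ Pl <= Pt ++ Pl} by [].
elim: {1 3}(Pt ++ Pl) => [|p l IH] sl /=; first exact: sgen1.
apply: sgenM; last by apply: IH => q ql; apply: sl; rewrite inE ql orbT.
have /Pform [[i [j [ij ->]]]|[i [k [kB ->]]]] := sl p (mem_head _ _); rewrite /inst_pattern /= !cats1.
  by left; exists i, j.
by right; exists i, k.
Qed.

Lemma ev_swp_split : ev base (fun Q f => forall c t, c != [::] -> t != [::] -> dis c t ->
  Eswap f c (rcons t z) * Eswap f c t * Eswap f c (rcons t z) =
  pr (fun r => Eswap f (rcons t r) (rcons (rcons t z) r)) [seq r <- enum T | r != z] *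
  Eswap f c (rcons (rcons t z) z)).
Proof.
pose p1 : pattern := (None, [:: (0%N, [::]); (1%N, [:: z])]).
pose p2 r : pattern := (None, [:: (1%N, [:: r]); (1%N, [:: z; r])]).
pose p3 : pattern := (None, [:: (0%N, [::]); (1%N, [:: z; z])]).
set L := [seq r <- enum T | r != z].
have i1 c t : inst_pattern [:: c; t] p1 = (None, [:: c; rcons t z]) by rewrite /inst_pattern /= cats0 cats1.
have i2 c t r : inst_pattern [:: c; t] (p2 r) = (None, [:: rcons t r; rcons (rcons t z) r]).
  by rewrite /inst_pattern /= -!cats1 -catA.
have i3 c t : inst_pattern [:: c; t] p3 = (None, [:: c; rcons (rcons t z) z]).
  by rewrite /inst_pattern /= cats0 -!cats1 -catA.
have d1 c t i : dis c t -> dis c (rcons t i) by move=> h; apply: (dis_rconsr z).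
have [||||n hn] := @ev_schema T z T8 B 2 [:: p1; swap_pattern 0 1; p1] (rcons (map p2 L) p3) => //.
- by rewrite /= all_rcons /=; apply/allP=> _ /mapP [r _ ->].
- move=> us /sites2 [c [t [-> c0 t0 ct]]]; rewrite all_cat all_rcons; apply/and3P; split.
  + by rewrite /= !i1 inst_sP /= !admS ?rcons_nil ?d1.
  + by rewrite i3 admS ?rcons_nil ?d1.
  apply/allP=> _ /mapP [r rL ->]; rewrite i2 admS ?rcons_nil //.
  by apply: d1; apply: (dis_rcons z); move: rL; rewrite mem_filter => /andP [].
- move=> us /sites2 [c [t [-> c0 t0 ct]]]; rewrite pr_rcons /= !cats0 !cats1 mulg1 mulgA.
  rewrite -[t ++ [:: z; z]]/(t ++ ([:: z] ++ [:: z])) catA !cats1 (swap_tail_split z ct); congr (_ * _); rewrite pr_map; apply: eq_pr => r.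
  by rewrite /= -!cats1 -catA.
exists n => Q f /hn h c t c0 t0 ct; have := h [:: c; t].
rewrite pr_rcons /= i1 inst_sP i3 /= mulg1 mulgA pr_map => ->.
  by congr (_ * _); apply: eq_pr => r /=; rewrite i2.
by apply/and3P; split; rewrite /= ?c0 ?t0 ?ct.
Qed.

End RoverNekrashevych.

(** * Finite presentation of the Roever-Nekrashevych group *)

Section RNPresentation.
Local Open Scope group_scope.
Variables (T : finType) (z : T).
Local Notation X := (nat -> T).
Local Notation word := (seq T).
Local Notation swap := (@swap T z).
Local Notation lab := (@lab T z).
Hypothesis T8 : (8 <= #|T|)%N.
Variables (G : bij X -> Prop) (B : seq (bij X)) (nB : nat).
Hypothesis fG : fpres_by G B nB.
Hypothesis Gss : forall g i, G g -> exists j h, G h /\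
  forall y, fw g (scons i y) = scons j (fw h y).
Implicit Types (a b c t u v : word) (us : seq word) (g h : bij X).

Local Notation base := (@base T z B).
Local Notation Es f := (@Eswap T z T8 B _ f).
Local Notation El f := (@Elab T z T8 B _ f).
Local Notation obj_val f := (@obj_val T z T8 B _ f).

Record rn_good (Q : groupType) (f : bij X -> Q) : Prop := {
  rn_okf : short_rels z B f;
  rn_swpC : forall a b, a != [::] -> b != [::] -> dis a b -> Es f a b = Es f b a;
  rn_swp2 : forall a b, a != [::] -> b != [::] -> dis a b -> Es f a b * Es f a b = 1;
  rn_swp3 : forall a b c, a != [::] -> b != [::] -> c != [::] ->
    dis a b -> dis a c -> dis b c -> Es f a b * Es f b c * Es f a b = Es f a c;
  rn_swp4 : forall a b c d : word, a != [::] -> b != [::] -> c != [::] -> d != [::] ->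
    dis a b -> dis c d -> dis a c -> dis a d -> dis b c -> dis b d ->
    commute (Es f a b) (Es f c d);
  rn_lab_swp : forall h, h \in B -> forall a b,
    a != [::] -> b != [::] -> dis a b -> Es f a b * El f h a * Es f a b = El f h b;
  rn_lab_out : forall h, h \in B -> forall a b c,
    a != [::] -> b != [::] -> c != [::] -> dis a b -> dis a c -> dis b c ->
    commute (Es f a b) (El f h c);
  rn_lab_lab : forall h, h \in B -> forall k, k \in B -> forall a b,
    a != [::] -> b != [::] -> dis a b -> commute (El f h a) (El f k b);
  rn_lab_rels : forall a, a != [::] -> rels (fun h => El f h a) B nB;
  rn_lab_split : forall h, h \in B -> forall a, a != [::] ->
    sgen (@children T z T8 B _ f a) (El f h a);
  rn_swp_split : forall c t, c != [::] -> t != [::] -> dis c t ->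
    Es f c (rcons t z) * Es f c t * Es f c (rcons t z) =
    pr (fun r => Es f (rcons t r) (rcons (rcons t z) r)) [seq r <- enum T | r != z] *
    Es f c (rcons (rcons t z) z) }.

Lemma ev_rn_good : ev base rn_good.
Proof.
have := ev_and (ev_okf z B) (ev_and (@ev_swpC T z T8 B) (ev_and (@ev_swp2 T z T8 B)
  (ev_and (@ev_swp3 T z T8 B) (ev_and (@ev_swp4 T z T8 B) (ev_and (@ev_lab_swp T z T8 B)
  (ev_and (@ev_lab_out T z T8 B) (ev_and (@ev_lab_lab T z T8 B) (ev_and (@ev_lab_rels T z T8 B nB)
  (ev_and (ev_lab_split z T8 fG Gss) (@ev_swp_split T z T8 B)))))))))).
by apply: ev_mono => Q f [? [? [? [? [? [? [? [? [? [? ?]]]]]]]]]]; split.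
Qed.

Section Lift.
Variables (P : groupType) (act : P -> bij X) (f : bij X -> P).
Hypothesis actM : {morph act : p q / p * q}.
Hypothesis actf : forall h, act (f h) = h.
Hypothesis gf : rn_good f.

Let G1 : G 1. Proof. exact: (fpres_1 fG). Qed.
Let GM g h : G g -> G h -> G (g * h). Proof. exact: (fpres_M fG). Qed.
Let GV g : G g -> G g^-1. Proof. exact: (fpres_V fG). Qed.

Let actpr (w : seq (bij X)) : act (pr f w) = pr id w.
Proof.
have a1 : act 1 = 1 by apply: (mulgI (act 1)); rewrite -actM !mulg1.
by elim: w => [|h w IH] //=; rewrite actM actf IH.
Qed.

Let actE x : admissible B x -> act (obj_val f x) = obj_elt z x.
Proof. by move=> ax; rewrite actpr pr_W. Qed.

Let ok2 a b := [&& a != [::], b != [::] & dis a b].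
Let swp a b : P := if ok2 a b then Es f a b else 1.

Let swpE a b : a != [::] -> b != [::] -> dis a b -> swp a b = Es f a b.
Proof. by move=> a0 b0 ab; rewrite /swp /ok2 a0 b0 ab. Qed.

Let swpC a b : swp a b = swp b a.
Proof.
rewrite /swp /ok2 [dis b a]dis_sym andbCA; case: ifP => // /and3P [b0 a0 ab].
exact: (rn_swpC gf).
Qed.

(** At each address the relations of [G] extend the labels to a homomorphism [phi a] on [G], which
    provides the data for [rep_faithful]. It remains to represent every generator by a pair of
    partitions. *)
Lemma rn_trivial w : inw base w -> pr id w = 1 -> pr f w = 1.
Proof.
have /choice [phi hphi] : forall a, exists phi : bij X -> P, a != [::] ->
    (forall g h, G g -> G h -> phi (g * h) = phi g * phi h) /\
    (forall w, inw B w -> phi (pr id w) = pr (fun h => El f h a) w).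
  move=> a; case: (boolP (a != [::])) => [a0|_]; last by exists (fun=> 1).
  by have [phi h] := fpres_hom fG (rn_lab_rels gf a0); exists phi.
have GW g (R : bij X -> Prop) : R 1 -> (forall h g, h \in B -> G g -> R g -> R (h * g)) -> G g -> R g.
  move=> R1 RM /(fpres_word fG) [v Bv <-]; elim: v Bv => //= h v IH /andP [hB Bv].
  by apply: RM => //; [exact: (fpres_pr fG)|exact: IH].
have phiM a g h : a != [::] -> G g -> G h -> phi a (g * h) = phi a g * phi a h.
  by move=> a0; apply: (proj1 (hphi a a0)).
have phiB a h : a != [::] -> h \in B -> phi a h = El f h a.
  move=> a0 hB; have := proj2 (hphi a a0) [:: h]; rewrite /= hB !mulg1; exact.
have phi1 a : a != [::] -> phi a 1 = 1.
  by move=> a0; apply: (mulgI (phi a 1)); rewrite -phiM // !mulg1.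
have swp2 a b : a != [::] -> b != [::] -> dis a b -> swp a b * swp a b = 1.
  by move=> a0 b0 ab; rewrite swpE //; apply: (rn_swp2 gf).
have swp3 a b c : a != [::] -> b != [::] -> c != [::] ->
    dis a b -> dis a c -> dis b c -> swp a b * swp b c * swp a b = swp a c.
  by move=> a0 b0 c0 ab ac bc; rewrite !swpE //; apply: (rn_swp3 gf).
have swp4 a b c (d : word) : a != [::] -> b != [::] -> c != [::] -> d != [::] ->
    dis a b -> dis c d -> dis a c -> dis a d -> dis b c -> dis b d -> commute (swp a b) (swp c d).
  by move=> *; rewrite !swpE //; apply: (rn_swp4 gf).
have phi_swp a b g : a != [::] -> b != [::] -> G g -> dis a b ->
    swp a b * phi a g * swp a b = phi b g.
  move=> a0 b0 Gg ab; elim/GW: g / Gg => [|h g hB Gg IH].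
    by rewrite !phi1 // mulg1 swp2.
  have Gh := fpres_gen fG hB; rewrite !phiM // -IH (phiB a) // (phiB b) // -(rn_lab_swp gf hB a0 b0 ab) -swpE //.
  by rewrite -!mulgA (mulgA (swp a b) (swp a b)) swp2 // mul1g.
have phi_out a b c g : a != [::] -> b != [::] -> c != [::] -> G g ->
    dis a b -> dis a c -> dis b c -> commute (swp a b) (phi c g).
  move=> a0 b0 c0 Gg ab ac bc; elim/GW: g / Gg => [|h g hB Gg IH].
    by rewrite phi1 //; apply: commute1.
  have Gh := fpres_gen fG hB; rewrite phiM // phiB //; apply: commuteM IH.
  by rewrite swpE //; apply: (rn_lab_out gf).
have phi_phi a b g h : a != [::] -> b != [::] -> G g -> G h -> dis a b ->
    commute (phi a g) (phi b h).
  move=> a0 b0 Gg Gh ab; elim/GW: h / Gh => [|h h' hB Gh IH].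
    by rewrite phi1 //; apply: commute1.
  have Gh' := fpres_gen fG hB; rewrite phiM // (phiB b) //; apply: commuteM IH.
  elim/GW: g / Gg => [|k g kB Gg IH]; first by rewrite phi1 //; apply/commute_sym/commute1.
  have Gk := fpres_gen fG kB; rewrite phiM // phiB //; apply/commute_sym/commuteM; last exact: commute_sym.
  by apply/commute_sym/(rn_lab_lab gf).
have act_swp a b : a != [::] -> b != [::] -> dis a b -> act (swp a b) = swap a b.
  by move=> a0 b0 ab; rewrite swpE // actE // admS.
have act_phi a g : a != [::] -> G g -> act (phi a g) = lab a g.
  move=> a0 Gg; elim/GW: g / Gg => [|h g hB Gg IH].
    rewrite phi1 // -(pr_lab z a [::]); apply: (mulgI (act 1)); rewrite -actM !mulg1 //.
  have Gh := fpres_gen fG hB; by rewrite phiM // actM IH phiB // actE ?admL // labM.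
have phi_split a g : a != [::] -> G g ->
    sgen (fun p => (exists i j, i != j /\ p = swp (rcons a i) (rcons a j)) \/
                   (exists i h, G h /\ p = phi (rcons a i) h)) (phi a g).
  move=> a0 Gg; elim/GW: g / Gg => [|h g hB Gg IH]; first by rewrite phi1 //; exact: sgen1.
  have Gh := fpres_gen fG hB; rewrite phiM //; apply: sgen_M IH; rewrite phiB //.
  apply: sgen_sub (rn_lab_split gf hB a0) => p [[i [j [ij ->]]]|[i [k [kB ->]]]]; apply: sgen_in.
    by left; exists i, j; rewrite swpE ?rcons_nil // (dis_rcons z).
  by right; exists i, k; rewrite phiB ?rcons_nil //; split=> //; apply: (fpres_gen fG).
have swp_split c t : c != [::] -> t != [::] -> dis c t ->
    swp c (rcons t z) * swp c t * swp c (rcons t z) =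
    pr (fun r => swp (rcons t r) (rcons (rcons t z) r)) [seq r <- enum T | r != z] *
    swp c (rcons (rcons t z) z).
  move=> c0 t0 ct; rewrite !swpE ?rcons_nil // ?(dis_rconsr z) ?(dis_rconsr z) //.
  rewrite (rn_swp_split gf c0 t0 ct); congr (_ * _).
  have : all (fun r => r != z) [seq r <- enum T | r != z] by apply: filter_all.
  elim: [seq _ <- _ | _] => //= r l IH /andP [rz al]; rewrite IH //; congr (_ * _).
  by rewrite swpE ?rcons_nil //; apply: (dis_rconsr z); apply: (dis_rcons z).
have T2 : (1 < #|T|)%N by apply: leq_trans T8.
have RM := rep_M G1 GM GV actM swpC swp2 swp3 swp4 phiM phi_swp phi_out phi_phi act_swp
  act_phi phi_split swp_split.
have RF := rep_faithful G1 GM GV actM swpC swp2 swp3 swp4 phiM phi_swp phi_out phi_phi act_swp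
  act_phi phi_split swp_split T2 Gss.
have RW := @rep_W T z G P swp phi.
have c0 i : [:: i] \in comb z 0.
  rewrite /comb tl0 inE; case: (eqVneq i z) => [->|iz]; first by rewrite eqxx.
  by rewrite /= map_f ?orbT // mem_filter iz mem_enum.
have c1 i : i != z -> [:: i] \in comb z 1.
  by move=> iz; rewrite inE /= mem_cat (map_f (fun r => [:: r])) ?orbT // mem_filter iz mem_enum.
have c2 i : [:: z; i] \in comb z 1.
  rewrite inE tlS tl0 /=; case: (eqVneq i z) => [->|iz]; first by rewrite eqxx.
  by rewrite mem_cat tl0 (map_f (fun r => [:: z; r])) ?orbT // mem_filter iz mem_enum.
have Rl i j : i != j -> represented z G swp phi (swp [:: i] [:: j]).
  by move=> ij; apply: (RW 0%N); apply: W_swp => //; apply: contraNneq ij => -[->].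
have Sf a b : short_word a -> short_word b -> dis a b -> swp a b = f (swap a b).
  move=> sa sb ab; rewrite swpE ?sw0 // /Eswap E_short //; exact: sw_short.
(* The exchanges with a two-letter word beginning with [z] lie at level 1; the others are conjugate
   to these by the exchange of [z] with another letter. *)
have R21 i j k : i != k -> represented z G swp phi (swp [:: i; j] [:: k]).
  move=> ik; have d1 : dis [:: i; j] [:: k] by apply: dis_letter.
  have R1 l : l != z -> represented z G swp phi (swp [:: z; j] [:: l]).
    by move=> lz; apply: (RW 1%N); apply: W_swp; rewrite ?c2 ?c1 // eqseq_cons andbF.
  case: (eqVneq i z) => [ei|iz]; first by rewrite ei; apply: R1; rewrite -ei eq_sym.
  have zi : z != i by rewrite eq_sym.
  have dzi : dis [:: z] [:: i] by apply: dis_letter.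
  have mz v : move_word [:: z] [:: i] (z :: v) = i :: v by rewrite -[z :: v]/([:: z] ++ v) mv_l.
  have gz v : movable [:: z] [:: i] (z :: v) by rewrite -[z :: v]/([:: z] ++ v) /movable (prefix_prefix [:: z]).
  have Rz : represented z G swp phi (f (swap [:: z] [:: i])) by rewrite -Sf //; apply: Rl.
  have conj l l' : l' != z -> l != i -> move_word [:: z] [:: i] [:: l'] = [:: l] -> movable [:: z] [:: i] [:: l'] ->
      represented z G swp phi (swp [:: i; j] [:: l]).
    move=> l'z li ml gl; have dl : dis [:: z; j] [:: l'] by apply: dis_letter; rewrite eq_sym.
    have il : i != l by rewrite eq_sym.
    have dl' : dis [:: i; j] [:: l] by apply: dis_letter.
    have ax : admissible B (None, [:: [:: z; j]; [:: l']]) by apply: admS.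
    have := swap_conj T8 (rn_okf gf) ax (isT : short_word [:: z]) (isT : short_word [:: i]) dzi.
    rewrite /= gz gl => /(_ isT); rewrite /move_obj /= mz ml -/(Es f _ _) -/(Es f _ _) -!swpE // => <-.
    by apply: (RM _ _ (RM _ _ Rz (R1 _ l'z)) Rz).
  case: (eqVneq k z) => [->|kz]; last first.
    have [dz dk] : dis [:: z] [:: k] /\ dis [:: i] [:: k].
      by split; apply: dis_letter => //; rewrite eq_sym.
    by apply: (conj k k); rewrite // ?(eq_sym k i) // ?mv_out //; apply: gp_out.
  by apply: (conj z i); rewrite // ?(mvr z) //; apply: gp_r.
(* Objects with one-letter addresses lie at level 0, and every other object is conjugated to a
   smaller one by an exchange already represented. *)
have RE x : admissible B x -> represented z G swp phi (obj_val f x).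
  have [m] := ubnP (obj_size x); elim: m x => // m IH x lt ax; have [sh nx px] := admP ax.
  case: (boolP (all (fun u => size u <= 1)%N x.2)) => [a1|].
    have one u : u \in x.2 -> exists i, u = [:: i].
      move=> ux; have := allP a1 _ ux; have := allP nx _ ux.
      by case: u {ux} => [|i [|]] // _ _; exists i.
    case: x sh one px {lt ax nx a1} => [[h|] [|u [|v [|]]]] //= hB one.
      have [i ->] := one u (mem_head _ _) => _; rewrite -/(El f h [:: i]) -phiB //.
      by apply: (RW 0%N); apply: sgen_in; right; exists [:: i], h; split=> //; exact: (fpres_gen fG).
    have [i ->] := one u (mem_head _ _); have [|j ->] := one v; first by rewrite !inE eqxx orbT.
    rewrite !andbT => ij; rewrite -/(Es f _ _) -swpE //; apply: Rl.
    by apply: contraTneq ij => ->; rewrite /dis prefix_refl.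
  rewrite -has_predC => /hasP [u ux /=]; rewrite -ltnNge => u2.
  have [c [cx _]] := @fresh_redm T z T8 B x [::] ax isT.
  have r : reducible_by z x (take 2 u) c.
    by split=> //; [rewrite size_takel|exists u => //; apply: prefix_take2].
  have sg : short_word (take 2 u) by rewrite /short_word size_takel.
  have dg := redm_head ax r.
  have := swap_conj T8 (rn_okf gf) ax sg (isT : short_word [:: c]) dg (redm_all ax r) => e.
  have Rs : represented z G swp phi (f (swap (take 2 u) [:: c])).
    rewrite -Sf //; have := notin_hds cx ux.
    case: (u) u2 => [|i [|j u']] //= _; rewrite take0 => ci.
    by apply: R21; rewrite eq_sym.
  have S2 : f (swap (take 2 u) [:: c]) * f (swap (take 2 u) [:: c]) = 1.
    by rewrite -Sf // swp2 //; apply: sw0.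
  have -> : obj_val f x = f (swap (take 2 u) [:: c]) * obj_val f (move_obj (take 2 u) [:: c] x) *
      f (swap (take 2 u) [:: c]).
    by rewrite -e !mulgA S2 mul1g -mulgA S2 mulg1.
  apply: (RM _ _ (RM _ _ Rs _) Rs); apply: IH; last exact: redm_adm ax r.
  exact: leq_trans (redm_sz ax r) lt.
move=> Bw ew; apply: RF; last by rewrite actpr.
elim: w Bw {ew} => [_|h w IH /= /andP [hb /IH Rw]]; first by apply: (RW 0%N); exact: sgen1.
apply: RM Rw; have [x [ax sx ->]] := baseP hb.
by have := RE x ax; rewrite E_short.
Qed.

End Lift.
Definition rn g := exists2 w, inw base w & pr id w = g.

(** As for GL_n(Z), the generators are paired with their images in [Q] and the product group acts
    through its first component. *)
Lemma rn_fpres : exists n, fpres_by rn base n.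
Proof.
have [n hn] := ev_rn_good; exists n; split=> [b|g|Q f r w Bw ew] //.
  by apply: base_V => k; case: fG => h _ _; apply: h.
pose f' h : (bij X * Q)%type := (h, f h).
have prf' (v : seq (bij X)) : pr f' v = (pr id v, pr f v) by elim: v => //= h v ->.
have r' : rels f' base n.
  by move=> v v' Bv Bv' sv sv' e; rewrite !prf' e; congr pair; apply: r.
have := @rn_trivial _ fst f' (fun _ _ => erefl) (fun _ => erefl) (hn _ _ r') w Bw ew.
by rewrite prf' => -[].
Qed.

End RNPresentation.

(** * Simplicity *)

Section Simplicity.
Local Open Scope group_scope.
Variables (T : finType) (z : T).
Local Notation X := (nat -> T).
Local Notation word := (seq T).
Local Notation swap := (@swap T z).
Local Notation lab := (@lab T z).
Hypothesis T8 : (8 <= #|T|)%N.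
Hypothesis Teven : ~~ odd #|T|.
Variables (G : bij X -> Prop) (B : seq (bij X)) (nB : nat).
Hypothesis fG : fpres_by G B nB.
Hypothesis Gss : forall g i, G g -> exists j h, G h /\
  forall y, fw g (scons i y) = scons j (fw h y).
Implicit Types (a b c t u v : word) (us : seq word) (g h k : bij X) (x y : X).

Local Notation base := (@base T z B).
Local Notation rn := (rn z B).

Let rn_by : exists n, fpres_by rn base n. Proof. exact: (rn_fpres z T8 fG Gss). Qed.

Lemma rn1 : rn 1. Proof. by have [n f] := rn_by; exact: (fpres_1 f). Qed.
Lemma rnM g h : rn g -> rn h -> rn (g * h). Proof. by have [n f] := rn_by; exact: (fpres_M f). Qed.
Lemma rnV g : rn g -> rn g^-1. Proof. by have [n f] := rn_by; exact: (fpres_V f). Qed.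

Lemma rn_el s : admissible B s -> rn (obj_elt z s).
Proof. by move=> ax; exists (obj_word z T8 B s); [apply: W_base|apply: pr_W]. Qed.

Lemma rn_swap a b : a != [::] -> b != [::] -> dis a b -> rn (swap a b).
Proof. by move=> a0 b0 ab; apply: (rn_el (admS B a0 b0 ab)). Qed.

Lemma rn_lab a g : a != [::] -> G g -> rn (lab a g).
Proof.
move=> a0 /(fpres_word fG) [w Bw <-]; rewrite -pr_lab.
elim: w Bw => [_|h w IH /andP [hB Bw]]; first exact: rn1.
by apply: rnM (IH Bw); apply: (rn_el (admL hB a0)).
Qed.

Lemma rn_ind (R : bij X -> Prop) : R 1 ->
  (forall a b g, a != [::] -> b != [::] -> dis a b -> R g -> R (swap a b * g)) ->
  (forall a h g, a != [::] -> h \in B -> R g -> R (lab a h * g)) ->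
  forall g, rn g -> R g.
Proof.
move=> R1 Rs Rl g [w Bw <-]; elim: w Bw => [//|h w IH] /= /andP [hb /IH Rw].
have [s [ax _ ->]] := baseP hb; have [sh nx px] := admP ax.
case: s sh nx px {ax} => [[k|] [|u [|v [|]]]] //= kB; rewrite !andbT.
  by move=> u0 _; apply: Rl.
by move=> /andP [u0 v0] uv; apply: Rs.
Qed.

Definition linear g u := exists v h, G h /\ forall y, fw g (app u y) = app v (fw h y).

Lemma G_word g w : G g -> exists w' h, [/\ size w' = size w, G h &
  forall y, fw g (app w y) = app w' (fw h y)].
Proof.
elim: w g => [|i w IH] g Gg; first by exists [::], g.
have [j [h [Gh e]]] := Gss i Gg; have [w' [k [short_word Gk e']]] := IH h Gh.
by exists (j :: w'), k; rewrite /= short_word; split=> // y; rewrite e e'.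
Qed.

Lemma linear_ext g u v h w : G h -> (forall y, fw g (app u y) = app v (fw h y)) ->
  exists w' k, [/\ size w' = size w, G k & forall y, fw g (app (u ++ w) y) = app (v ++ w') (fw k y)].
Proof.
move=> Gh e; have [w' [k [short_word Gk e']]] := G_word w Gh; exists w', k; split=> // y.
by rewrite !app_cat e e'.
Qed.

Lemma mkseq_pre x n : pre (mkseq x n) x.
Proof. by rewrite /pre size_mkseq. Qed.

Lemma mkseqD x n m : mkseq x (n + m) = mkseq x n ++ mkseq (sdrop n x) m.
Proof. by rewrite /mkseq iotaD map_cat add0n -[X in iota X m]addn0 iotaDl -map_comp. Qed.

(** For each further generator the prefix of [x] is prolonged until the image prefix is long enough
    to extend the addresses of the generator or to be disjoint from them. *)
Lemma local_linear g x : rn g -> exists n, linear g (mkseq x n).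
Proof.
have G1 : G 1 := fpres_1 fG; have GM := fpres_M fG.
move=> Rg; elim/rn_ind: g / Rg x => [|a b g a0 b0 ab IH|a h g a0 hB IH] x.
- by exists 0%N, [::], 1.
- have [n [v [h [Gh e]]]] := IH x.
  pose m := maxn (size a) (size b).
  have [w' [k [short_word Gk e']]] := linear_ext (mkseq (sdrop n x) m) Gh e.
  exists (n + m)%N; rewrite mkseqD.
  have vm : (m <= size (v ++ w'))%N by rewrite size_cat short_word size_mkseq leq_addl.
  case: (boolP (prefix a (v ++ w'))) => [/prefixP [r er]|na].
    by exists (b ++ r), k; split=> // y; rewrite fwM e' er !app_cat swap_l.
  case: (boolP (prefix b (v ++ w'))) => [/prefixP [r er]|nb].
    by exists (a ++ r), k; split=> // y; rewrite fwM e' er !app_cat swap_r.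
  exists (v ++ w'), k; split=> // y; rewrite fwM e' swap_out //.
    by apply: contraNN na => /(pre_prefix z); apply; rewrite (leq_trans _ vm) ?leq_maxl.
  by apply: contraNN nb => /(pre_prefix z); apply; rewrite (leq_trans _ vm) ?leq_maxr.
- have [n [v [h' [Gh e]]]] := IH x.
  have [w' [k [short_word Gk e']]] := linear_ext (mkseq (sdrop n x) (size a)) Gh e.
  exists (n + size a)%N; rewrite mkseqD.
  case: (boolP (prefix a (v ++ w'))) => [/prefixP [r er]|na].
    have [r' [k' [sr Gk' er']]] := G_word r (fpres_gen fG hB).
    exists (a ++ r'), (k' * k); split; first exact: GM.
    by move=> y; rewrite fwM e' er !app_cat lab_in er' fwM.
  exists (v ++ w'), k; split=> // y; rewrite fwM e' lab_out //.
  by apply: contraNN na => /(pre_prefix z); apply; rewrite size_cat short_word size_mkseq leq_addl.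
Qed.

(** Around a point whose coordinate [i] is changed, a cone reaching beyond [i] is carried to another
    prefix, and the two prefixes differ at [i]. *)
Lemma moved_cone g : rn g -> g <> 1 -> exists u v h, [/\ u != [::], v != [::], dis u v, G h &
  forall y, fw g (app u y) = app v (fw h y)].
Proof.
move=> Rg ng; have [x nx] : exists x, fw g x <> x.
  by apply: contrapT => h; apply: ng; apply: bijP => x; apply: contrapT => nx; apply: h; exists x.
have [i ni] : exists i, fw g x i <> x i.
  by apply: contrapT => h; apply: nx; apply: funext => i; apply: contrapT => ni; apply: h; exists i.
have [n [v [h [Gh e]]]] := local_linear x Rg.
have [w' [k [short_word Gk e']]] := linear_ext (mkseq (sdrop n x) i.+1) Gh e.
rewrite -mkseqD in e'; exists (mkseq x (n + i.+1)), (v ++ w'), k.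
have s1 : (i < size (mkseq x (n + i.+1)))%N by rewrite size_mkseq; lia.
have s2 : (i < size (v ++ w'))%N by rewrite size_cat short_word size_mkseq; lia.
split=> //; [by case: (mkseq _ _) s1|by case: (v ++ w') s2|].
have ex : x = app (mkseq x (n + i.+1)) (sdrop (n + i.+1) x).
  by have := preE z (mkseq_pre x (n + i.+1)); rewrite size_mkseq.
apply/negbNE/negP => nd; apply: ni.
have nth_eq : nth z (mkseq x (n + i.+1)) i = nth z (v ++ w') i.
  move: nd; rewrite /dis negb_and !negbK => /orP [] /prefixP [r er].
    by rewrite er nth_cat s1.
  by rewrite er [LHS]nth_cat s2.
by rewrite {1}ex e' (app_nth z) // s2 -nth_eq nth_mkseq //; lia.
Qed.

Definition supp u g := forall x, ~~ pre u x -> fw g x = x.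

Lemma supp_pre u g x : supp u g -> pre u (fw g x) = pre u x.
Proof.
move=> sg; case: (boolP (pre u x)) => px; last by rewrite sg // (negPf px).
apply: contraT => npx; have := sg _ npx => /(@fwI _ g) e.
by rewrite e px in npx.
Qed.

Lemma supp_commute u v g h : dis u v -> supp u g -> supp v h -> commute g h.
Proof.
move=> uv sg sh; apply: bijP => x; rewrite !fwM.
have ex y : pre u y -> ~~ pre v y by move=> /(preE z) ->; rewrite (pre_dis z) // dis_sym.
case: (boolP (pre u x)) => px; last by rewrite (sg x) // (sg (fw h x)) //;
  case: (boolP (pre v x)) => pv; [apply: contraTN pv => /ex; rewrite (supp_pre _ sh)|rewrite sh].
by rewrite (sh x) ?ex // (sh (fw g x)) // ex // (supp_pre _ sg).
Qed.

Lemma supp_conj u v g h k : supp u h -> (forall y, fw g (app u y) = app v (fw k y)) ->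
  supp v (g * h * g^-1).
Proof.
move=> sh e x px; rewrite !fwM sh; first by rewrite -fwM mulgV.
apply: contraNN px => /(preE z) ey; have -> : x = fw g (fw g^-1 x) by rewrite -fwM mulgV.
by rewrite ey e (pre_app0 z).
Qed.

Lemma supp_swap u a b : dis (u ++ a) (u ++ b) -> supp u (swap (u ++ a) (u ++ b)).
Proof.
move=> ab x px; apply: swap_out => //; apply: contraNN px; apply: (pre_cat z).
Qed.

Lemma supp_lab u g : supp u (lab u g).
Proof. by move=> x px; apply: lab_out. Qed.

(** To be applied to the elements of [G] whose copy in a cone lies in a given normal subgroup: the
    listed closure properties are those that such a set has. *)
Hypothesis perf : forall K : bij X -> Prop, K 1 ->
  (forall g h, G g -> G h -> K g -> K h -> K (g * h)) ->
  (forall g, G g -> K g -> K g^-1) ->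
  (forall g h, G g -> G h -> K (g^-1 * h * g * h^-1)) ->
  (forall g (s : T -> T) (F : T -> bij X), G g -> (forall i, G (F i)) ->
    (forall i y, fw g (scons i y) = scons (s i) (fw (F i) y)) ->
    K (pr F (enum T)) -> K g) ->
  forall g, G g -> K g.

Section Normal.
Variable N : bij X -> Prop.
Hypothesis NR : forall g, N g -> rn g.
Hypothesis N1 : N 1.
Hypothesis NM : forall g h, N g -> N h -> N (g * h).
Hypothesis NV : forall g, N g -> N g^-1.
Hypothesis NJ : forall g h, rn g -> N h -> N (g * h * g^-1).
Variable g0 : bij X.
Hypothesis Ng0 : N g0.
Hypothesis ng0 : g0 <> 1.

Definition comm_in u := forall g h, rn g -> rn h -> supp u g -> supp u h ->
  N (g^-1 * h * g * h^-1).

(* If [g0] in [N] moves the cone [u] off itself and [g], [h] live in [u], then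
   [h] commutes with [g0 g g0^-1], so the commutator of [g] and [h] is a product of conjugates of
   [g0]. *)
Lemma comm_cone : exists2 u, u != [::] & comm_in u.
Proof.
have [u [v [k [u0 v0 uv Gk e]]]] := moved_cone (NR Ng0) ng0.
exists u => // g h Rg Rh sg sh.
set c := g0 * g * g0^-1.
have sc : supp v c := supp_conj sg e.
have cC f : supp u f -> commute c f.
  by move=> sf; apply/commute_sym/(supp_commute uv).
have Nu : N (c * g^-1).
  rewrite /c -!mulgA; apply: NM => //; rewrite mulgA; exact: NJ Rg (NV Ng0).
have -> : g^-1 * h * g * h^-1 = (c * g^-1) * (h * (c * g^-1)^-1 * h^-1).
  have cw : commute c (g^-1 * h * g).
    by apply: commuteM (cC g sg); apply: commuteM (cC h sh); apply/commuteV/cC.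
  have e1 : c * (g^-1 * h * g) * c^-1 = g^-1 * h * g by rewrite cw mulgK.
  have -> : g^-1 * h * g * h^-1 = c * (g^-1 * h * g) * c^-1 * h^-1 by rewrite e1.
  by rewrite [(c * g^-1)^-1]invgM invgK !mulgA.
by apply: (NM Nu); apply: NJ (NV Nu).
Qed.

Lemma letter_notin (l : seq T) : (size l < 8)%N -> exists c : T, c \notin l.
Proof. by move=> sl; apply: fresh; apply: leq_trans T8. Qed.

Lemma supp_move u v g h : carries h u v -> supp v g -> supp u (h^-1 * g * h).
Proof.
move=> c sg; rewrite -{2}[h]invgK; apply: (supp_conj sg (k := 1)) => y.
exact: carriesV c y.
Qed.

Lemma comm_in_carries u v h : rn h -> carries h u v -> comm_in u -> comm_in v.
Proof.
move=> Rh c cu f k Rf Rk sf sk.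
have Rc g : rn g -> rn (h^-1 * g * h) by move=> Rg; exact: rnM (rnM (rnV Rh) Rg) Rh.
have := NJ Rh (cu _ _ (Rc _ Rf) (Rc _ Rk) (supp_move c sf) (supp_move c sk)).
by rewrite !invgM !invgK !mulgA !(mulgK h) mulgV mul1g.
Qed.

Lemma head_dis u v : u != [::] -> v != [::] -> head z u != head z v -> dis u v.
Proof. by case: u v => [|i u] [|j v] // _ _; apply: dis_letter. Qed.

(** Since [u] and the known cone [v] may be comparable, two exchanges through a fresh letter carry
    [v] to [u]. *)
Lemma comm_all u : u != [::] -> comm_in u.
Proof.
have [v v0 cv] := comm_cone; move=> u0.
have [c] := @letter_notin [:: head z u; head z v] isT.
rewrite !inE negb_or => /andP [cu cv'].
have vc : dis v [:: c] by apply: head_dis => //; rewrite eq_sym.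
have cu' : dis [:: c] u by apply: head_dis.
apply: (@comm_in_carries [:: c] u (swap [:: c] u)); [exact: rn_swap|by move=> y; apply: swap_l|].
apply: comm_in_carries cv; [exact: (rn_swap v0 _ vc)|by move=> y; apply: swap_l].
Qed.

Definition eqN g h := [/\ rn g, rn h & N (g * h^-1)].

Lemma eqN_refl g : rn g -> eqN g g.
Proof. by move=> Rg; split; rewrite ?mulgV. Qed.

Lemma eqN_sym g h : eqN g h -> eqN h g.
Proof. by case=> Rg Rh n; split=> //; rewrite -[h * g^-1]invgK invgM invgK; apply: NV. Qed.

Lemma eqN_trans g h k : eqN g h -> eqN h k -> eqN g k.
Proof.
case=> Rg Rh n [_ Rk n']; split=> //.
by have := NM n n'; rewrite mulgA mulgKV.
Qed.

Lemma eqN_M g g' h h' : eqN g g' -> eqN h h' -> eqN (g * h) (g' * h').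
Proof.
case=> Rg Rg' n [Rh Rh' n']; split; try exact: rnM.
have := NM (NJ Rg n') n; rewrite invgM !mulgA mulgKV.
by rewrite -!mulgA.
Qed.

Lemma eqN_N g h : eqN g h -> N g -> N h.
Proof.
by move=> /eqN_sym [_ _ n] Ng; have := NM n Ng; rewrite mulgKV.
Qed.

Lemma eqN1 g : N g -> eqN g 1.
Proof. by move=> Ng; split; [exact: NR|exact: rn1|rewrite invg1 mulg1]. Qed.

(** The exchange of [a] and [b] is the conjugate of that of [b] and [c] by that of [a] and [c]. The
    quotient is therefore a commutator of elements supported in the cone [l]. *)
Lemma swap_cycle l a b c : dis a b -> dis a c -> dis b c ->
  eqN (swap (l :: a) (l :: b)) (swap (l :: b) (l :: c)).
Proof.
move=> ab ac bc; have L0 := (@comm_all [:: l] isT).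
have dl u v : dis u v -> dis (l :: u) (l :: v).
  by move=> uv; rewrite -[l :: u]/([:: l] ++ u) -[l :: v]/([:: l] ++ v) (dis_cat2l z).
have Rs u v : dis u v -> rn (swap (l :: u) (l :: v)) by move=> uv; apply: rn_swap => //; apply: dl.
have ss u v : dis u v -> supp [:: l] (swap (l :: u) (l :: v)).
  by move=> uv; apply: (@supp_swap [:: l] u v); apply: dl.
split; try exact: Rs.
have := L0 _ _ (Rs _ _ ac) (Rs _ _ bc) (ss _ _ ac) (ss _ _ bc).
rewrite swapV => H; rewrite (_ : swap (l :: a) (l :: b) = swap (l :: a) (l :: c) *
  swap (l :: b) (l :: c) * swap (l :: a) (l :: c)) //.
rewrite -{2}[swap (l :: a) (l :: c)]swapV (swap_sym z (l :: b)); apply/esym/conj_swap.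
- by apply: dl; rewrite dis_sym.
- exact: dl.
- by move=> y; apply: swap_r; apply: dl.
- by move=> y; rewrite swap_out ?(pre_dis z) //; apply: dl => //; rewrite dis_sym.
Qed.

Lemma swap_tail_prod u v : dis u v ->
  swap u v = pr (fun r => swap (rcons u r) (rcons v r)) (enum T).
Proof.
move=> uv; have d i j : dis (rcons u i) (rcons v j).
  by rewrite -!cats1; apply: (dis_catl z); apply: (dis_catr z).
have ev w x : app w x = app (rcons w (x 0%N)) (fun n : nat => x n.+1).
  by rewrite -cats1 app_cat; congr app; apply: funext => [[|k]].
apply: bijP => x; case: (boolP (pre u x)) => [/(preE z) ->|pu].
  rewrite swap_l // (ev u) (ev v).
  have [-> _] := pr_swap_in z (x (size u + 0)%N) (fun n : nat => sdrop (size u) x n.+1) (enum_uniq T) d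
    (fun i j => @dis_rcons T z u i j) (fun i j => @dis_rcons T z v i j).
  by rewrite mem_enum.
case: (boolP (pre v x)) => [/(preE z) ->|pv].
  rewrite swap_r // (ev u) (ev v).
  have [_ ->] := pr_swap_in z (x (size v + 0)%N) (fun n : nat => sdrop (size v) x n.+1) (enum_uniq T) d
    (fun i j => @dis_rcons T z u i j) (fun i j => @dis_rcons T z v i j).
  by rewrite mem_enum.
rewrite swap_out // pr_swap_out // => i _; rewrite -cats1.
  by apply: contraNN pu; apply: (pre_cat z).
by apply: contraNN pv; apply: (pre_cat z).
Qed.

(* An exchange of two cones is the product of the [#|T|] exchanges of their
   children, all congruent to it modulo [N]; as [#|T|] is even it is in [N]. *)
Lemma N_swap_letter (l a b c : T) : a != b -> a != c -> b != c -> N (swap [:: l; a] [:: l; b]).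
Proof.
move=> ab ac bc.
have [dab dac dbc] : [/\ dis [:: a] [:: b], dis [:: a] [:: c] & dis [:: b] [:: c]].
  by split; apply: dis_letter.
have d i : [/\ dis [:: a; i] [:: b], dis [:: a; i] [:: c], dis [:: a; i] [:: b; i] &
    dis [:: b; i] [:: c]] by split; apply: dis_letter.
set s := swap _ _.
(* The chain of exchanges passes through [c], because [a] is comparable with its child
   [[:: a; i]]. *)
have es i : eqN (swap [:: l; a; i] [:: l; b; i]) s.
  have [d1 d2 d3 d4] := d i; apply: eqN_sym.
  have [dba dca dcb] : [/\ dis [:: b] [:: a], dis [:: c] [:: a] & dis [:: c] [:: b]].
    by rewrite ![dis _ [:: a]]dis_sym [dis [:: c] _]dis_sym.
  apply: (eqN_trans (swap_cycle l dab dac dbc)).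
  have d1' : dis [:: b] [:: a; i] by rewrite dis_sym.
  have d2' : dis [:: c] [:: a; i] by rewrite dis_sym.
  have d4' : dis [:: c] [:: b; i] by rewrite dis_sym.
  apply: (eqN_trans (swap_cycle l dbc d1' d2')).
  exact: (swap_cycle l d2' d4' d3).
have Rs : rn s by apply: rn_swap => //; apply: (dis_rcons z [:: l]).
have e : s = pr (fun r => swap [:: l; a; r] [:: l; b; r]) (enum T).
  by rewrite /s swap_tail_prod //; apply: (dis_rcons z [:: l]).
have eP (r : seq T) : eqN (pr (fun r => swap [:: l; a; r] [:: l; b; r]) r) (s ^+ size r).
  elim: r => [|i r IH]; first exact: eqN_refl rn1.
  by rewrite pr_cons expgS; apply: eqN_M.
have sK : s ^+ size (enum T) = 1.
  rewrite -cardT -(odd_double_half #|T|) (negPf Teven) add0n -mul2n expgnA.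
  by rewrite expg2 swap2 expg1n.
by have := eP (enum T); rewrite -e sK => /eqN_sym h; apply: eqN_N h N1.
Qed.

(** The exchange is conjugate to one of two children of a letter [l] that begins neither [a] nor
    [b]. *)
Lemma N_swap a b : a != [::] -> b != [::] -> dis a b -> N (swap a b).
Proof.
move=> a0 b0 ab; have [l] := @letter_notin [:: head z a; head z b] isT.
rewrite !inE negb_or => /andP [la lb].
have [i [j [k [ij ik jk]]]] : exists i j k : T, [/\ i != j, i != k & j != k].
  have [i _] := @letter_notin [::] isT; have [j] := @letter_notin [:: i] isT.
  have [k] := @letter_notin [:: i; j] isT.
  rewrite !inE negb_or => /andP [ki kj] ji; exists i, j, k.
  by split; rewrite eq_sym.
have dal w : dis a (l :: w) by apply: head_dis => //; rewrite eq_sym.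
have dbl w : dis b (l :: w) by apply: head_dis => //; rewrite eq_sym.
have dij : dis [:: l; i] [:: l; j] by apply: (dis_rcons z [:: l]).
pose h := swap a [:: l; i] * swap b [:: l; j].
have Rh : rn h by apply: rnM; apply: rn_swap.
have ca : carries h [:: l; i] a.
  move=> y; rewrite fwM (@swap_out _ z b) ?(pre_dis z) //; last by rewrite dis_sym.
  exact: swap_r.
have cb : carries h [:: l; j] b.
  move=> y; rewrite fwM swap_r // swap_out // (pre_dis z) //.
  by rewrite dis_sym.
rewrite -(conj_swap z dij ab ca cb); apply: NJ => //; exact: N_swap_letter ij ik jk.
Qed.

Lemma eqN_lab u v g : u != [::] -> v != [::] -> G g -> eqN (lab u g) (lab v g).
Proof.
have dist a b : a != [::] -> b != [::] -> dis a b -> G g -> eqN (lab a g) (lab b g).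
  move=> a0 b0 ab Gg; have Ns := N_swap a0 b0 ab.
  rewrite -(@conj_lab _ z (swap a b) a b g); last by move=> y; apply: swap_l.
  rewrite -{1}[lab a g]mul1g -[1 * lab a g]mulg1 swapV.
  have e := eqN_sym (eqN1 Ns).
  exact: (eqN_M (eqN_M e (eqN_refl (rn_lab a0 Gg))) e).
move=> u0 v0 Gg; have [c] := @letter_notin [:: head z u; head z v] isT.
rewrite !inE negb_or => /andP [cu cv].
apply: (@eqN_trans _ (lab [:: c] g)); apply: dist => //; apply: head_dis => //.
by rewrite eq_sym.
Qed.

Lemma lab1 u : lab u 1 = 1.
Proof.
apply: bijP => y; case: (boolP (pre u y)) => [/(preE z) ->|pu]; last exact: lab_out.
by rewrite lab_in.
Qed.

Lemma labV u g : lab u g^-1 = (lab u g)^-1.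
Proof. by apply: (mulgI (lab u g)); rewrite -[LHS]labM !mulgV lab1. Qed.

(** A copy of [g] is a product of exchanges and of copies of its sections in the children. Modulo
    [N] the latter may all be moved to the cone [u], which gives the last closure property in
    [perf]. *)
Lemma N_lab u g : u != [::] -> G g -> N (lab u g).
Proof.
move=> u0 Gg; apply: (perf (K := fun g => N (lab u g))) Gg => [|g' h _ _|g' _|g' h Gg' Gh|g' s F Gg' GF e].
- rewrite lab1 //.
- by rewrite labM; apply: NM.
- by rewrite labV; apply: NV.
- have -> : lab u (g'^-1 * h * g' * h^-1) = (lab u g')^-1 * lab u h * lab u g' * (lab u h)^-1.
    by rewrite !labM !labV.
  by apply: (comm_all u0); [exact: rn_lab|exact: rn_lab|exact: supp_lab|exact: supp_lab].
move=> NF; have [ts dts ->] := lab_sections z e; apply: NM.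
  elim: ts dts => //= t ts IH /andP [dt /IH]; apply: NM.
  by apply: N_swap; rewrite -?cats1 ?cats1; [case: (u)|case: (u)|apply: dis_rcons].
have e1 (r : seq T) : eqN (pr (fun j => lab (rcons u j) (F j)) r) (lab u (pr F r)).
  elim: r => [|j r IH]; first by rewrite lab1; apply: eqN_refl rn1.
  by rewrite !pr_cons labM; apply: eqN_M IH; apply: eqN_lab => //; case: (u).
exact: eqN_N (eqN_sym (e1 _)) NF.
Qed.

Lemma N_rn g : rn g -> N g.
Proof.
elim/rn_ind => // [a b h a0 b0 ab|a b h a0 hB]; apply: NM; first exact: N_swap.
by apply: N_lab => //; apply: (fpres_gen fG).
Qed.

End Normal.

Lemma rn_simple (N : bij X -> Prop) : (forall g, N g -> rn g) -> N 1 ->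
    (forall g h, N g -> N h -> N (g * h)) -> (forall g, N g -> N g^-1) ->
    (forall g h, rn g -> N h -> N (g * h * g^-1)) ->
  (forall g, N g -> g = 1) \/ (forall g, rn g -> N g).
Proof.
move=> NR N1 NM NV NJ; case: (pselect (exists2 g, N g & g <> 1)) => [[g Ng g1]|h].
  by right; apply: N_rn Ng g1.
by left=> g Ng; apply: contrapT => g1; apply: h; exists g.
Qed.

Lemma rn_nontrivial : exists2 g, rn g & g <> 1.
Proof.
have [i _] := @letter_notin [::] isT; have [j] := @letter_notin [:: i] isT.
rewrite inE => ji; have d : dis [:: j] [:: i] by apply: dis_letter.
exists (swap [:: j] [:: i]); first exact: rn_swap.
move=> /(congr1 (fun g => fw g (app [:: j] (fun=> z)) 0%N)).
by rewrite swap_l //= => /eqP; rewrite eq_sym (negPf ji).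
Qed.

End Simplicity.

(** * Automaton groups *)

Section Automaton.
Local Open Scope group_scope.
Variables (Q : groupType) (H : Q -> Prop) (T : finType) (z : T).
Local Notation X := (nat -> T).
Variables (sg : Q -> T -> T) (st : Q -> T -> Q).
Hypothesis H1 : H 1.
Hypothesis HM : forall g h, H g -> H h -> H (g * h).
Hypothesis HV : forall g, H g -> H g^-1.
Hypothesis stH : forall g t, H g -> H (st g t).
Hypothesis sg1 : forall t, sg 1 t = t.
Hypothesis sgM : forall g h t, H g -> H h -> sg (g * h) t = sg g (sg h t).
Hypothesis stM : forall g h t, H g -> H h -> st (g * h) t = st g (sg h t) * st h t.

(** The Mealy machine with states in [Q], output [sg] and transition [st]. *)
Fixpoint run g (x : X) (k : nat) : T :=
  match k with 0 => sg g (x 0%N) | k.+1 => run (st g (x 0%N)) (fun j => x j.+1) k end.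

Lemma st1 t : st 1 t = 1.
Proof. by apply: (mulgI (st 1 t)); rewrite mulg1 -{3}[1]mulg1 stM // sg1. Qed.

Lemma run1 x k : run 1 x k = x k.
Proof. by elim: k x => [|k IH] x /=; rewrite ?sg1 // st1 IH. Qed.

Lemma runM g h x k : H g -> H h -> run (g * h) x k = run g (run h x) k.
Proof.
elim: k g h x => [|k IH] g h x Hg Hh /=; first by rewrite sgM.
by rewrite stM // IH //; apply: stH.
Qed.

Lemma run_bij g : exists f : bij X, H g -> fw f = run g.
Proof.
case: (pselect (H g)) => Hg; last by exists 1.
have K a b : H a -> H b -> a * b = 1 -> cancel (run b) (run a).
  by move=> Ha Hb ab x; apply: funext => k; rewrite -runM // ab run1.
have [f ef] := exists_bij (K _ _ (HV Hg) Hg (mulVg g)) (K _ _ Hg (HV Hg) (mulgV g)).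
by exists f => _; apply: funext.
Qed.

Definition autom g : bij X := projT1 (cid (run_bij g)).

Lemma automE g : H g -> fw (autom g) = run g.
Proof. exact: (projT2 (cid (run_bij g))). Qed.

Lemma automM g h : H g -> H h -> autom (g * h) = autom g * autom h.
Proof.
move=> Hg Hh; apply: bijP => x; rewrite fwM !automE //; last exact: HM.
by apply: funext => k; apply: runM.
Qed.

Lemma autom1 : autom 1 = 1.
Proof. by apply: (mulgI (autom 1)); rewrite -automM // !mulg1. Qed.

Lemma automV g : H g -> autom g^-1 = (autom g)^-1.
Proof. by move=> Hg; apply/esym/mulg1_eq; rewrite -automM ?mulgV ?autom1 //; apply: HV. Qed.

Lemma autom_section g i y : H g -> fw (autom g) (scons i y) = scons (sg g i) (fw (autom (st g i)) y).
Proof.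
move=> Hg; rewrite !automE //; last exact: stH.
by apply: funext => [[|k]].
Qed.

(** The elements acting trivially form a set that fixes all letters and is closed under sections;
    the hypothesis says that such a set contains at most 1. *)
Hypothesis faithful : forall P : Q -> Prop, (forall g, P g -> H g) ->
  (forall g t, P g -> sg g t = t /\ P (st g t)) -> forall g, P g -> g = 1.

Lemma autom_inj g h : H g -> H h -> autom g = autom h -> g = h.
Proof.
move=> Hg Hh e; apply: (mulIg h^-1); rewrite mulgV.
apply: (faithful (P := fun g => H g /\ autom g = 1)) => [k []//|k t [Hk pk]|].
  have sec y : scons (sg k t) (fw (autom (st k t)) y) = scons t y by rewrite -autom_section // pk.
  split; first exact: (congr1 (fun f => f 0%N) (sec (fun=> z))).
  split; first exact: stH.
  apply: bijP => y; apply: funext => j; exact: (congr1 (fun f => f j.+1) (sec y)).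
by split; [apply: HM => //; apply: HV|rewrite automM ?automV ?e ?mulgV //; apply: HV].
Qed.

Definition image f := exists2 g, H g & autom g = f.

Lemma image_fpres : fpres H -> fpres image.
Proof. exact: fpres_inj automM autom_inj. Qed.

Lemma image_sections f i : image f -> exists j h, image h /\
  forall y, fw f (scons i y) = scons j (fw h y).
Proof.
move=> [g Hg <-]; exists (sg g i), (autom (st g i)); split; last by move=> y; apply: autom_section.
by exists (st g i) => //; apply: stH.
Qed.

Hypothesis ab : forall K : Q -> Prop, K 1 ->
  (forall g h, H g -> H h -> K g -> K h -> K (g * h)) ->
  (forall g, H g -> K g -> K g^-1) ->
  (forall g h, H g -> H h -> K (g^-1 * h * g * h^-1)) ->
  (forall g, H g -> K (pr (st g) (enum T)) -> K g) ->
  forall g, H g -> K g.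

Lemma image_perfect (K : bij X -> Prop) : K 1 ->
  (forall g h, image g -> image h -> K g -> K h -> K (g * h)) ->
  (forall g, image g -> K g -> K g^-1) ->
  (forall g h, image g -> image h -> K (g^-1 * h * g * h^-1)) ->
  (forall g (s : T -> T) (F : T -> bij X), image g -> (forall i, image (F i)) ->
    (forall i y, fw g (scons i y) = scons (s i) (fw (F i) y)) ->
    K (pr F (enum T)) -> K g) ->
  forall g, image g -> K g.
Proof.
move=> K1 KM KV KJ KS _ [g Hg <-]; have im h : H h -> image (autom h) by exists h.
apply: (ab (K := fun g => K (autom g))) Hg => [|a b Ha Hb|a Ha|a b Ha Hb|a Ha].
- by rewrite autom1.
- by rewrite automM //; apply: KM; apply: im.
- by rewrite automV //; apply: KV; apply: im.
- have Va := HV Ha; have Vb := HV Hb.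
  by rewrite !automM ?automV //; [apply: KJ; apply: im|do ?apply: HM..].
rewrite (pr_hom (enum T) H1 HM automM) => [Kp|i]; last exact: stH.
by apply: (KS _ (sg a) (autom \o st a)) => // [|i|i y]; [apply: im|apply/im/stH|apply: autom_section].
Qed.

End Automaton.

(** * The affine group acting on p-adic digits *)

Section Digits.
Import GRing.Theory Num.Theory.
Local Open Scope ring_scope.
Variables (n m p : nat).
Hypothesis m0 : (0 < m)%N.
Hypothesis pp : prime p.
Hypothesis pm : coprime p m.
Local Notation V := 'cV[rat]_n.+1.
Local Notation ZQ := (map_mx (intr : int -> rat)).
Local Notation C := ('cV['I_p]_n.+1).

(** The vectors with entries in Z[1/m]. *)
Definition mint (v : V) := exists s (w : 'cV[int]_n.+1), m%:R ^+ s *: v = ZQ w.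

Let mQ : (m%:R : rat) != 0. Proof. by rewrite pnatr_eq0 -lt0n. Qed.
Let pQ : (p%:R : rat) != 0. Proof. by rewrite pnatr_eq0 -lt0n prime_gt0. Qed.

Lemma mintZ (z : int) v : mint v -> mint (z%:~R *: v).
Proof.
by move=> [s [w e]]; exists s, (z *: w); rewrite scalerA mulrC -scalerA e; apply/colP => i; rewrite !mxE rmorphM.
Qed.

Lemma mint0 : mint 0.
Proof. by exists 0%N, 0; rewrite scaler0 map_mx0. Qed.

Lemma mintD u v : mint u -> mint v -> mint (u + v).
Proof.
move=> [s [w e]] [t [x f]]; exists (s + t)%N, ((m%:Z ^+ t) *: w + (m%:Z ^+ s) *: x).
rewrite scalerDr exprD -[X in _ + X]scalerA f mulrC -scalerA e.
by apply/colP => i; rewrite !mxE !rmorphD !rmorphM !rmorphXn.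
Qed.

Lemma mint_mul (A : 'M[rat]_n.+1) v s : iZ (m%:R ^+ s *: A) -> mint v -> mint (A *m v).
Proof.
move=> [B eB] [t [w e]]; exists (s + t)%N, (B *m w).
by rewrite exprD -scalerA scalemxAr e scalemxAl eB -map_mxM.
Qed.

Definition emb (c : C) : V := \col_i (c i 0%R : nat)%:R.

Lemma mint_emb c : mint (emb c).
Proof. by exists 0%N, (\col_i (c i 0%R : nat)%:Z); rewrite scale1r; apply/colP => i; rewrite !mxE. Qed.

(** A power of [m] makes [v] integral, and it can be cancelled from the divisibility because it is
    prime to [p]. *)
Lemma clear_dvd (v : V) (w : 'cV[int]_n.+1) k : mint v -> ZQ w = p%:R ^+ k *: v ->
  forall i, ((p ^ k)%N %| `|w i 0%R|)%N.
Proof.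
move=> [s [x e]] ew i; have := congr1 (fun u : V => (m%:R ^+ s *: u) i 0) ew.
rewrite scalerA mulrC -scalerA e !mxE => /eqP.
rewrite -!natrX !pmulrn -!intrM eqr_int => /eqP /(congr1 absz).
rewrite !abszM !absz_nat => ed; have : ((p ^ k) %| m ^ s * `|w i 0%R|)%N by rewrite ed dvdn_mulr.
by rewrite Gauss_dvdr // coprimeXl // coprimeXr.
Qed.

(** As [m] is invertible modulo [p], the residue of [w / m^s] is that of [u w], with [u] an inverse
    of [m^s] modulo [p]. *)
Lemma vdig_ex v : exists cv : C * V, mint v -> mint cv.2 /\ v = emb cv.1 + p%:R *: cv.2.
Proof.
have p0 := prime_gt0 pp.
case: (pselect (mint v)) => [[s [w e]]|nv]; last by exists (const_mx (Ordinal p0), 0).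
have [u hu] : exists u : nat, (u * m ^ s = 1 %[mod p])%N.
  have cp : coprime (m ^ s) p by rewrite coprime_sym coprimeXr.
  have ms0 : (0 < m ^ s)%N by rewrite expn_gt0 m0.
  have [a b eab _] := egcdnP p ms0.
  by move: cp => /eqP cp; rewrite cp in eab; exists a; rewrite eab modnMDl.
pose d (i : 'I_n.+1) : nat := `|((u%:Z * w i 0%R) %% p%:Z)%Z|%N.
have pz : p%:Z != 0 by rewrite -lt0n.
have dE i : (d i)%:Z = ((u%:Z * w i 0%R) %% p%:Z)%Z by rewrite gez0_abs // modz_ge0.
have dp i : (d i < p)%N by rewrite -ltz_nat dE ltz_pmod.
have dv i : (p%:Z %| w i 0%R - m%:Z ^+ s * (d i)%:Z)%Z.
  rewrite dE (_ : _ - _ = w i 0%R * (1 - m%:Z ^+ s * u%:Z) +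
    m%:Z ^+ s * ((u%:Z * w i 0%R %/ p%:Z)%Z * p%:Z)); last first.
    move: (divz_eq (u%:Z * w i 0%R) p%:Z); set q := (_ %/ _)%Z; set r := (_ %% _)%Z => h.
    have -> : r = u%:Z * w i 0%R - q * p%:Z by rewrite h [q * _ + _]addrC addrK.
    ring.
  rewrite rpredD ?dvdz_mull //.
  rewrite -opprB rpredN -eqz_mod_dvd.
  have -> : m%:Z ^+ s * u%:Z = (u * m ^ s)%N%:Z.
    by rewrite PoszM mulrC -[Posz (m ^ s)]natz natrX natz.
  by rewrite -[X in _ == (X %% _)%Z]/(Posz 1) !modz_nat hu.
exists (\col_i Ordinal (dp i), \col_i (((w i 0%R - m%:Z ^+ s * (d i)%:Z) %/ p%:Z)%Z%:~R / m%:R ^+ s)).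
move=> _; split=> /=.
  exists s, (\col_i ((w i 0%R - m%:Z ^+ s * (d i)%:Z) %/ p%:Z)%Z).
  by apply/colP => i; rewrite !mxE mulrC divfK // expf_neq0.
apply/colP => i; rewrite !mxE /=; apply: (mulfI (expf_neq0 s mQ)).
have := congr1 (fun u : V => u i 0) e; rewrite !mxE => ->.
rewrite mulrDr [p%:R * _]mulrA [X in _ = _ + X]mulrCA mulfV ?expf_neq0 // mulr1.
rewrite -[p%:R]/(p%:Z%:~R) -intrM mulrC [(p%:Z * _)%R]mulrC divzK // rmorphB rmorphM rmorphXn /=.
by rewrite mulrC addrC subrK.
Qed.

Definition vdig v := projT1 (cid (vdig_ex v)).
Definition dig v := (vdig v).1.
Definition quo v := (vdig v).2.

Lemma quoP v : mint v -> mint (quo v). Proof. by case/(projT2 (cid (vdig_ex v))). Qed.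
Lemma vdigE v : mint v -> v = emb (dig v) + p%:R *: quo v.
Proof. by case/(projT2 (cid (vdig_ex v))). Qed.

Lemma vdig_uniq v c q : mint q -> v = emb c + p%:R *: q -> dig v = c /\ quo v = q.
Proof.
move=> mq ev; have mv : mint v by rewrite ev; apply: mintD (mint_emb c) (mintZ p mq).
have e := vdigE mv; rewrite {1}ev in e.
have mqq : mint (quo v - q) by apply: mintD (quoP mv) _; rewrite -scaleN1r; apply: (mintZ (-1)).
have ed : emb c - emb (dig v) = p%:R *: (quo v - q).
  by apply: (addrI (emb (dig v))); rewrite addrC subrK scalerBr addrA -e addrK.
have ecd : dig v = c.
  apply/matrixP => i j; rewrite (ord1 j); apply/val_inj/eqP.
  have := @clear_dvd _ (\col_i ((c i 0%R : nat)%:Z - (dig v i 0%R : nat)%:Z)) 1 mqq _ i.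
  rewrite expr1 -ed expn1 => /(_ _)/wrap [|]; first by apply/colP => k; rewrite !mxE rmorphB.
  rewrite !mxE => dv.
  have := ltn_ord (c i 0); have := ltn_ord (dig v i 0).
  set a := (c i 0%R : nat) in dv *; set b := (dig v i 0%R : nat) in dv * => lb la.
  have lt : (`|a%:Z - b%:Z|%N < p)%N by lia.
  case: (posnP `|a%:Z - b%:Z|%N) => [|a0]; first by move=> ?; have : b = a by [lia]; move/eqP.
  by have := gtnNdvd a0 lt; rewrite dv.
split=> //; move: ed; rewrite ecd subrr => /esym/eqP.
by rewrite scaler_eq0 (negPf pQ) subr_eq0 => /eqP.
Qed.

End Digits.

(** * The self-similar action of the affine group *)

Section DigitAutomaton.
Import GRing.Theory Num.Theory.
Local Open Scope ring_scope.
Variables (n m p : nat).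
Hypothesis m0 : (0 < m)%N.
Hypothesis pp : prime p.
Hypothesis pm : coprime p m.
Local Notation GLQ := (ugroup 'M[rat]_n.+1).
Local Notation V := 'cV[rat]_n.+1.
Local Notation C := ('cV['I_p]_n.+1).
Local Notation T := (C * bool)%type.
Local Notation H := (@affm n m).
Local Notation mint := (@mint n m).
Local Notation dig := (@dig n m p m0 pp pm).
Local Notation quo := (@quo n m p m0 pp pm).
Local Notation emb := (@emb n p).

Lemma affm1 : H 1%g. Proof. by have [B [k fB]] := affm_fpres n m0; apply: (fpres_1 fB). Qed.
Lemma affmM g h : H g -> H h -> H (g * h)%g.
Proof. by have [B [k fB]] := affm_fpres n m0; apply: (fpres_M fB). Qed.
Lemma affmV g : H g -> H g^-1%g.
Proof. by have [B [k fB]] := affm_fpres n m0; apply: (fpres_V fB). Qed.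

Lemma GLm_mint a v : GLm m a -> mint v -> mint (uval a *m v).
Proof. by move=> [s [ia _]]; apply: mint_mul ia. Qed.

Lemma lin_affm a : GLm m a -> H (lin a).
Proof. by move=> Ga; split=> //; apply: mint0. Qed.

Lemma tr_affm v : mint v -> H (tr v).
Proof. by move=> mv; split=> //; have [] := affm1. Qed.

Lemma dual_unit (a : GLQ) : (uval a^-1%g)^T \is a GRing.unit.
Proof. by change ((uval a^-1%g)^T \in unitmx); rewrite unitmx_tr; apply: uvalP. Qed.

Definition dual a := UGroup (dual_unit a).

Lemma dualM a b : dual (a * b)%g = (dual a * dual b)%g.
Proof. by apply: val_inj => /=; rewrite invrM ?uvalP //; apply: trmx_mul. Qed.

Lemma dual1 : dual 1%g = 1%g.
Proof. by apply: val_inj => /=; rewrite invr1 trmx1. Qed.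

Lemma dualV a : (dual a)^-1%g = dual a^-1%g.
Proof. by apply: mulg1_eq; rewrite -dualM mulgV dual1. Qed.

Lemma dual_sym a : (uval a)^T = uval a -> dual a = a^-1%g.
Proof.
move=> sa; apply: (mulgI a); rewrite mulgV; apply: val_inj.
rewrite -[LHS]/(uval a *m (uval a^-1%g)^T) -{1}sa -trmx_mul.
by rewrite -[_ *m _]/(uval (a^-1 * a)%g) mulVg trmx1.
Qed.

Lemma GLm_dual a : GLm m a -> GLm m (dual a).
Proof.
have tZ A : iZ A -> iZ A^T by move=> [B ->]; exists B^T; rewrite map_trmx.
move=> [s [ia iaV]]; exists s; rewrite dualV /=; split.
  by rewrite -linearZ; apply: tZ.
by rewrite invrK -linearZ; apply: tZ.
Qed.

Definition afval (g : aff n) (c : C) : V := uval (lpart g) *m emb c + tpart g.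

Lemma mint_afval g c : H g -> mint (afval g c).
Proof. by move=> [Gg mg]; apply: mintD => //; apply: GLm_mint Gg (mint_emb _ _). Qed.

(* The letters [(c, true)] are digits, changed by the affine map with the carry
   as new translation; [(c, false)] is fixed with the inverse transpose as
   section. *)
Definition dsg (g : aff n) (t : T) : T := if t.2 then (dig (afval g t.1), true) else t.

Definition dst (g : aff n) (t : T) : aff n :=
  if t.2 then Aff (lpart g) (quo (afval g t.1)) else lin (dual (lpart g)).

Lemma dstH g t : H g -> H (dst g t).
Proof.
move=> Hg; case: t => c [] /=; have [Gg mg] := Hg.
  by split=> //; apply: quoP; apply: mint_afval.
exact: lin_affm (GLm_dual Gg).
Qed.

Lemma dsg1 t : dsg 1%g t = t.
Proof.
case: t => c [] //; rewrite /dsg /= /afval /= mul1mx addr0.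
by have [-> _] := @vdig_uniq n m p m0 pp pm (emb c) c 0 (mint0 _ _) (etrans (esym (addr0 _)) (congr1 _ (esym (scaler0 _ _)))).
Qed.

(** The carries of [h] and [g] combine exactly as the translation part of the product of the two
    sections, which is why sections compose. *)
Lemma afvalM g h c : H g -> H h ->
  afval (g * h)%g c = emb (dig (afval g (dig (afval h c)))) +
    p%:R *: (uval (lpart g) *m quo (afval h c) + quo (afval g (dig (afval h c)))).
Proof.
move=> Hg Hh; have eh := vdigE m0 pp pm (mint_afval c Hh).
have eg := vdigE m0 pp pm (mint_afval (dig (afval h c)) Hg).
have -> : afval (g * h)%g c = uval (lpart g) *m afval h c + tpart g.
  by rewrite /afval /= mulmxDr mulmxA addrA.
rewrite {1}eh mulmxDr addrAC -/(afval g (dig (afval h c))) {1}eg.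
by rewrite -scalemxAr scalerDr -addrA [_ + p%:R *: (_ *m _)]addrC.
Qed.

Lemma mint_quoM g h c : H g -> H h ->
  mint (uval (lpart g) *m quo (afval h c) + quo (afval g (dig (afval h c)))).
Proof.
move=> Hg Hh; apply: mintD; last by apply: quoP; apply: mint_afval.
by apply: GLm_mint (proj1 Hg) _; apply: quoP; apply: mint_afval.
Qed.

Lemma dsgM g h t : H g -> H h -> dsg (g * h)%g t = dsg g (dsg h t).
Proof.
move=> Hg Hh; case: t => c [] //; rewrite /dsg /=.
by have [-> _] := vdig_uniq m0 pp pm (mint_quoM c Hg Hh) (afvalM c Hg Hh).
Qed.

Lemma dstM g h t : H g -> H h -> dst (g * h)%g t = (dst g (dsg h t) * dst h t)%g.
Proof.
move=> Hg Hh; case: t => c []; rewrite /dst /dsg /=; last by rewrite dualM linM.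
by have [_ ->] := vdig_uniq m0 pp pm (mint_quoM c Hg Hh) (afvalM c Hg Hh).
Qed.

(* [p] is not invertible in [Z[1/m]]. *)
Lemma div_all (v : V) : (forall k, exists2 u, mint u & v = p%:R ^+ k *: u) -> v = 0.
Proof.
move=> dv; have [u [s [w e]] ev] := dv 0%N; rewrite expr0 scale1r in ev; subst u.
apply/colP => i; rewrite mxE; suff wi : w i 0 = 0.
  have := congr1 (fun u : V => u i 0) e; rewrite !mxE wi => /eqP.
  by rewrite mulf_eq0 expf_eq0 pnatr_eq0 -[m == 0%N]negbK -lt0n m0 andbF => /eqP.
have [u mu eu] := dv `|w i 0%R|%N.
have ew : map_mx intr w = p%:R ^+ `|w i 0%R|%N *: (m%:R ^+ s *: u).
  by rewrite -e eu !scalerA mulrC.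
have mu' : mint (m%:R ^+ s *: u).
  by rewrite -natrX -[_%:R]/(((m ^ s)%N%:Z)%:~R); apply: mintZ.
have := clear_dvd pm mu' ew i; have := ltn_expl `|w i 0%R|%N (prime_gt1 pp).
case: (posnP `|w i 0%R|%N) => [/eqP|w0 lt]; first by rewrite absz_eq0 => /eqP.
by move=> /(dvdn_leq w0); rewrite leqNgt lt.
Qed.

(** Fixing the digit 0 at every stage makes the translation part divisible by all powers of [p],
    hence 0, for each member of [P]. With the translations of the section gone too, reading the
    digit vector [e_j] shows column [j] of the linear part. *)
Lemma dig_faithful (P : aff n -> Prop) : (forall g, P g -> H g) ->
  (forall g t, P g -> dsg g t = t /\ P (dst g t)) -> forall g, P g -> g = 1%g.
Proof.
move=> PH Ps; have fixd g c : P g -> dig (afval g c) = c /\ P (Aff (lpart g) (quo (afval g c))).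
  by move=> Pg; have [[e] Q] := Ps g (c, true) Pg.
have t0 g : P g -> tpart g = 0.
  pose o : C := const_mx (Ordinal (prime_gt0 pp)).
  have eo : emb o = 0 by apply/colP => i; rewrite !mxE.
  move=> Pg; apply: div_all => k; elim: k g Pg => [|k IH] g Pg.
    by exists (tpart g); [case: (PH g Pg)|rewrite scale1r].
  have [e /IH [u mu /= eu]] := fixd g o Pg; exists u => //.
  have := vdigE m0 pp pm (mint_afval o (PH g Pg)); rewrite e eo add0r eu scalerA -exprS => <-.
  by rewrite /afval eo mulmx0 add0r.
move=> g Pg; have tg := t0 g Pg.
suff e : uval (lpart g) = 1 by case: g tg e {Pg} => a b /= -> e; congr Aff; apply: val_inj.
apply/matrixP => i j.
pose c : C := \col_k (if k == j then Ordinal (prime_gt1 pp) else Ordinal (prime_gt0 pp)).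
have ec : emb c = delta_mx j 0 by apply/colP => k; rewrite !mxE eqxx andbT; case: ifP.
have [e Pq] := fixd g c Pg; have := vdigE m0 pp pm (mint_afval c (PH g Pg)).
rewrite (t0 _ Pq : quo _ = 0) scaler0 addr0 e /afval tg addr0 ec -colE.
by move/colP/(_ i); rewrite !mxE eqxx andbT.
Qed.

End DigitAutomaton.

(** * The affine group modulo commutators and sections *)

Section ModuloNormal.
Local Open Scope group_scope.
Variables (Q : groupType) (H K : Q -> Prop).
Hypothesis H1 : H 1.
Hypothesis HM : forall g h, H g -> H h -> H (g * h).
Hypothesis HV : forall g, H g -> H g^-1.
Hypothesis K1 : K 1.
Hypothesis KM : forall g h, H g -> H h -> K g -> K h -> K (g * h).
Hypothesis KJ : forall g h, H g -> H h -> K (g^-1 * h * g * h^-1).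

Lemma normal_conj g h : H g -> H h -> K h -> K (g * h * g^-1).
Proof.
move=> Hg Hh Kh; have Vg := HV Hg; have Vh := HV Hh; have := KJ Vg Hh; rewrite invgK => k.
by rewrite -[_ * _](mulgKV h); apply: KM => //; do ?apply: HM.
Qed.

Definition eqK g h := [/\ H g, H h & K (g * h^-1)].

Lemma eqK_refl g : H g -> eqK g g.
Proof. by move=> Hg; split; rewrite ?mulgV. Qed.

Lemma eqK_M g g' h h' : eqK g g' -> eqK h h' -> eqK (g * h) (g' * h').
Proof.
case=> Hg Hg' n [Hh Hh' n']; split; try exact: HM.
have Vg := HV Hg; have Vg' := HV Hg'; have Vh' := HV Hh'.
have Hhh : H (h * h'^-1) by apply: HM.
have Hc := HM (HM Hg Hhh) Vg.
have := KM Hc (HM Hg Vg') (normal_conj Hg Hhh n') n.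
rewrite invgM !mulgA mulgKV.
by rewrite -!mulgA.
Qed.

Lemma pr_eqK (A : Type) (b : A -> bool) (f : A -> Q) d r : H d ->
  (forall i, eqK (f i) (if b i then d else d^-1)) ->
  eqK (pr f r) (d ^+ count b r * d ^- count (predC b) r).
Proof.
move=> Hd e; elim: r => [|i r IH] /=; first by rewrite invg1 mulg1; apply: eqK_refl.
have := eqK_M (e i) IH; case: (b i) => /=; first by rewrite add1n expgS add0n mulgA.
rewrite add0n add1n expgSr invgM !mulgA (_ : d^-1 * _ = d ^+ count b r * d^-1) //.
by apply: commuteX; apply/commute_sym/commuteV.
Qed.

End ModuloNormal.

Section Perfect.
Import GRing.Theory Num.Theory.
Local Open Scope ring_scope.
Variables (n m p : nat).
Hypothesis n2 : (1 < n)%N.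
Hypothesis m0 : (0 < m)%N.
Hypothesis pp : prime p.
Hypothesis pm : coprime p m.
Local Notation GLQ := (ugroup 'M[rat]_n.+1).
Local Notation V := 'cV[rat]_n.+1.
Local Notation C := ('cV['I_p]_n.+1).
Local Notation T := (C * bool)%type.
Local Notation H := (@affm n m).
Local Notation mint := (@mint n m).
Local Notation dst := (@dst n m p m0 pp pm).
Variable K : aff n -> Prop.
Hypothesis K1 : K 1%g.
Hypothesis KM : forall g h, H g -> H h -> K g -> K h -> K (g * h)%g.
Hypothesis KV : forall g, H g -> K g -> K (g^-1)%g.
Hypothesis KJ : forall g h, H g -> H h -> K (g^-1 * h * g * h^-1)%g.
Hypothesis KS : forall g, H g -> K (pr (dst g) (enum {: T})) -> K g.

Let HM (g h : aff n) : H g -> H h -> H (g * h)%g. Proof. exact: affmM. Qed.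
Let HV g : H g -> H g^-1%g. Proof. exact: affmV. Qed.

Lemma GLm_GLZQ (a : GLQ) : GLZQ a -> GLm m a.
Proof. by move=> /GLZQP [ia iV]; exists 0%N; rewrite !scale1r. Qed.

Lemma GLm_M (a b : GLQ) : GLm m a -> GLm m b -> GLm m (a * b)%g.
Proof. by move=> Ga Gb; have [] := HM (lin_affm Ga) (lin_affm Gb). Qed.

Lemma GLm_V (a : GLQ) : GLm m a -> GLm m a^-1%g.
Proof. by move=> Ga; have [] := HV (lin_affm Ga). Qed.

Lemma trN (v : V) : tr (- v) = (tr v)^-1%g.
Proof. by apply/esym/mulg1_eq; rewrite -trD subrr. Qed.

Lemma K_tr_sub (a : GLQ) v : GLm m a -> mint v -> K (tr (uval a *m v - v)).
Proof.
move=> Ga mv; have := KJ (lin_affm (GLm_V Ga)) (tr_affm m0 mv).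
by rewrite linV invgK lin_tr -[(tr _ * lin a * _)%g]mulgA mulgV mulg1 -trN -trD.
Qed.

Lemma mint_delta (i j : 'I_n.+1) v : mint v -> mint (delta_mx i j *m v).
Proof.
move=> mv; apply: (@mint_mul n m _ _ 0) mv; rewrite expr0 scale1r.
by exists (delta_mx i j); rewrite map_delta_mx.
Qed.

Lemma other_index (i j : 'I_n.+1) : exists k, (k != i) && (k != j).
Proof.
apply/existsP; rewrite -[[exists _, _]]negbK negb_exists; apply/negP => /forallP h.
have := card_ord n.+1; rewrite -cardsT => e.
have : ([set: 'I_n.+1] \subset [set i; j]).
  by apply/subsetP => k _; have := h k; rewrite negb_and !negbK !inE.
move/subset_leq_card; rewrite e cards2; case: (i != j) => //= h3.
  by have := leq_trans n2 h3.
by have := leq_trans n2 (ltnW h3).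
Qed.

Lemma GLZQ_toQ (a : ugroup 'M[int]_n.+1) : GLZQ (toQ a). Proof. by exists a. Qed.

(** The component of [v] along a basis vector has the form [a w - w] with [a] a transvection, so its
    translation is a commutator. *)
Lemma K_tr v : mint v -> K (tr v).
Proof.
move=> mv; rewrite -[v]mul1mx mx1_sum_delta mulmx_suml.
suff : mint (\sum_i delta_mx i i *m v) /\ K (tr (\sum_i delta_mx i i *m v)) by case.
elim/big_ind: _ => [|x y [mx kx] [my ky]|i _].
- by split; [exact: mint0|exact: K1].
- by rewrite trD; split; [apply: mintD|apply: KM => //; apply: tr_affm].
split; first exact: mint_delta.
have [j /andP [ji _]] := other_index i i.
have := K_tr_sub (GLm_GLZQ (GLZQ_toQ (trv j i))) (mint_delta j i mv).
rewrite /= /trv_mx (negPf ji) map_mxD map_mx1 map_delta_mx mulmxDl mul1mx addrC addKr.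
by rewrite mulmxA mul_delta_mx.
Qed.

Lemma toQ1 : toQ (1%g : ugroup 'M[int]_n.+1) = 1%g.
Proof. by apply: val_inj; rewrite /= rmorph1. Qed.

Lemma toQV (a : ugroup 'M[int]_n.+1) : toQ a^-1%g = (toQ a)^-1%g.
Proof. by apply/esym/mulg1_eq; rewrite -toQM mulgV toQ1. Qed.

(** The Steinberg relation with a third index [k]; here the size has to be at least 3. *)
Lemma K_trv (i j : 'I_n.+1) : i != j -> K (lin (toQ (trv i j))).
Proof.
move=> ij; have [k /andP [ki kj]] := other_index i j.
have ik : i != k by rewrite eq_sym.
have e := er_steinberg (elem_rels_matrix n) ik kj ij.
have -> : trv i j = ((trv k j)^-1 * (trv i k)^-1 * trv k j * (trv i k))%g.
  by rewrite -!mulgA e !mulgA mulgKV mulVg mul1g.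
have L (b : ugroup 'M[int]_n.+1) : H (lin (toQ b)) by apply/lin_affm/GLm_GLZQ/GLZQ_toQ.
have lV (b : ugroup 'M[int]_n.+1) : lin (toQ b^-1)%g = (lin (toQ b))^-1%g.
  by rewrite -linV; congr lin; apply: toQV.
have := KJ (L (trv k j)) (HV (L (trv i k))).
by rewrite -!lV invgK -!linM -!toQM.
Qed.

Lemma count_signs : count snd (enum {: T}) = count (predC snd) (enum {: T}).
Proof.
pose f (t : T) : T := (t.1, ~~ t.2).
have fK : involutive f by move=> [c b]; rewrite /f /= negbK.
have pe : perm_eq (map f (enum {: T})) (enum {: T}).
  apply: uniq_perm; rewrite ?(map_inj_uniq (inv_inj fK)) ?enum_uniq // => t.
  by rewrite mem_enum -[t]fK map_f ?mem_enum.
have ef : snd =1 preim f (predC snd) by move=> t; rewrite /= negbK.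
by rewrite (eq_count ef) -count_map; apply: (seq.permP pe).
Qed.

(* For symmetric [a] the inverse transpose is [a^-1], so the sections at the two
   kinds of letters cancel modulo translations and commutators. *)
Lemma K_sym (a : GLQ) : GLm m a -> (uval a)^T = uval a -> K (lin a).
Proof.
move=> Ga sa; have Ha := lin_affm Ga; apply: (KS Ha).
have sec t : eqK H K (dst (lin a) t) (if t.2 then lin a else (lin a)^-1%g).
  case: t => c [] /=; last first.
    by rewrite /dst /= dual_sym // linV; apply: eqK_refl => //; apply: HV.
  have Hs := dstH m0 pp pm (c, true) Ha; rewrite /dst /= in Hs *.
  set q := quo _ _ _ _ in Hs *; split=> //.
  have mq : mint q by case: Hs.
  by rewrite -tr_lin -mulgA mulgV mulg1; apply: K_tr.
have [h1 h2] := pr_eqK (affm1 n m0) HM HV K1 KM KJ (enum {: T}) Ha sec.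
by rewrite -count_signs mulgV invg1 mulg1.
Qed.

Lemma K_lin_M (a b : GLQ) : GLm m a -> GLm m b -> K (lin a) -> K (lin b) -> K (lin (a * b)%g).
Proof. by move=> Ga Gb; rewrite linM; apply: KM; apply: lin_affm. Qed.

Lemma K_lin_V (a : GLQ) : GLm m a -> K (lin a) -> K (lin a^-1%g).
Proof. by move=> Ga; rewrite linV; apply: KV; apply: lin_affm. Qed.

(** Among the elementary generators the transvections are commutators, while sign changes and
    exchanges are symmetric matrices. *)
Lemma K_GLZQ (a : GLQ) : GLZQ a -> K (lin a).
Proof.
move=> [b _ <-]; have Gb c : GLm m (toQ c) := GLm_GLZQ (GLZQ_toQ c).
have Ke c : elem (@trv n) (@flip n) (@exch n) n.+1 c -> K (lin (toQ c)).
  case=> [i j ij _ _|i _|i j _ _]; first exact: K_trv.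
    by apply: K_sym => //=; rewrite map_diag_mx tr_diag_mx.
  by apply: K_sym => //=; rewrite map_trmx tr_tperm_mx.
elim: (gl_gen b) => [|c d /Ke Kc _ Kd|c d /Ke Kc _ Kd].
- by rewrite toQ1.
- by rewrite toQM; apply: K_lin_M.
rewrite toQM toQV.
by apply: K_lin_M => //; [apply: GLm_V|apply: K_lin_V].
Qed.

(** The diagonal factor of the Smith normal form is symmetric, and it is invertible over Z[1/m]
    because it equals [L^-1 * c * R^-1]. *)
Lemma K_posm (c : GLQ) : posm m c -> K (lin c).
Proof.
move=> pc; have Gc : GLm m c by apply/(fracs_posm m0); exists 0%N; rewrite mulg1.
have [L [R [d [GL GR e]]]] := posm_smith pc.
have ud : diag_mx (\row_i (d i)%:~R) = uval (L^-1 * c * R^-1)%g :> 'M[rat]_n.+1.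
  rewrite !uvalM e !mulrA mulVr ?uvalP // mul1r.
  by rewrite -mulrA mulrV ?uvalP // mulr1.
have -> : c = (L * (L^-1 * c * R^-1) * R)%g by rewrite !mulgA mulgV mul1g mulgKV.
have [GL' GR'] := (GLm_GLZQ GL, GLm_GLZQ GR).
have GD : GLm m (L^-1 * c * R^-1)%g by apply: GLm_M (GLm_M (GLm_V _) _) (GLm_V _).
apply: K_lin_M => //; [exact: GLm_M| |exact: K_GLZQ].
by apply: K_lin_M => //; [exact: K_GLZQ|apply: K_sym => //; rewrite -ud tr_diag_mx].
Qed.

(** The linear part is a fraction of an integral matrix by a scalar power of [m], and both lie in
    [posm m]. *)
Lemma K_all g : H g -> K g.
Proof.
move=> Hg; have [Ga mb] := Hg; case: g Hg Ga mb => a b Hg /= Ga mb.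
rewrite -tr_lin; apply: KM; [exact: tr_affm|exact: lin_affm|exact: K_tr|].
have [s pa] := proj2 (fracs_posm m0 a) Ga.
have ps : posm m (scal n m0 ^+ s)%g.
  elim: s {pa} => [|s IH]; last by rewrite expgS; apply: posm_M (posm_scal n m0) IH.
  by apply: posm_unit; rewrite expg0; apply/GLZQP; rewrite invg1; split; apply: iZ1.
have Gp c : posm m c -> GLm m c by move=> pc; apply/(fracs_posm m0); exists 0%N; rewrite mulg1.
rewrite -[a](mulgK (scal n m0 ^+ s)%g); apply: K_lin_M; [exact: Gp|exact/GLm_V/Gp|exact: K_posm|].
by apply: K_lin_V; [exact: Gp|exact: K_posm].
Qed.

End Perfect.

(** * The embedding *)

Section ClearDenominators.
Import GRing.Theory Num.Theory.
Local Open Scope ring_scope.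
Variable n : nat.
Local Notation GLQ := (ugroup 'M[rat]_n.+1).

Lemma clear_mx (A : 'M[rat]_n.+1) : exists2 m, (0 < m)%N & iZ (m%:R *: A).
Proof.
pose d (q : 'I_n.+1 * 'I_n.+1) := `|denq (A q.1 q.2)|%N.
exists (\prod_q d q)%N; first by rewrite prodn_gt0 // => q; rewrite absz_gt0 denq_eq0.
exists (\matrix_(i, j) ((\prod_(q | q != (i, j)) d q)%N%:Z * numq (A i j))).
apply/matrixP => i j; rewrite !mxE (bigD1 (i, j)) //= intrM numqE natrM.
have -> : (d (i, j))%:R = (denq (A i j))%:~R :> rat by rewrite pmulrn absz_denq.
ring.
Qed.

Lemma clear_seq (us : seq GLQ) : exists2 m, (0 < m)%N & {in us, forall u, GLm m u}.
Proof.
suff [m m0 h] : exists2 m, (0 < m)%N &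
    {in us, forall u, iZ (m%:R *: uval u) /\ iZ (m%:R *: uval u^-1%g)}.
  by exists m => // u /h; exists 1%N; rewrite expr1.
elim: us => [|u us [m m0 IH]]; first by exists 1%N.
have [[k k0 ik] [l l0 il]] := (clear_mx (uval u), clear_mx (uval u^-1%g)).
exists (k * l * m)%N => [|v]; first by rewrite !muln_gt0 k0 l0.
rewrite inE => /orP [/eqP ->|/IH [i1 i2]].
  split; [rewrite (_ : (k * l * m = l * m * k)%N); last lia|
    rewrite (_ : (k * l * m = k * m * l)%N); last lia];
    by rewrite natrM -scalerA; apply: iZZn.
by rewrite natrM -!scalerA; split; apply: iZZn.
Qed.

End ClearDenominators.

Section Corner.
Import GRing.Theory.
Local Open Scope ring_scope.
Variable n : nat.

(** Two more rows bring the size to at least 3. *)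
Definition corner (A : 'M[rat]_n.+1) : 'M[rat]_((n + 2).+1) := block_mx A 0 0 1%:M.

Lemma cornerM A B : corner (A *m B) = corner A *m corner B.
Proof.
apply: etrans (esym (mulmx_block A 0 0 1%:M B 0 0 1%:M)).
by rewrite !mulmx0 !mul0mx !addr0 add0r mulmx1.
Qed.

Lemma corner1 : corner 1%:M = 1%:M.
Proof. by apply: esym; apply: (@scalar_mx_block rat n.+1 2). Qed.

Lemma corner_inj : injective corner.
Proof.
move=> A B e; have : block_mx A 0 0 1%:M = block_mx B 0 0 (1%:M : 'M_2) := e.
by case/eq_block_mx.
Qed.

Lemma corner_unit A : A \in unitmx -> corner A \is a GRing.unit.
Proof.
move=> uA; apply/unitrP; exists (corner (invmx A)).
by rewrite -[_ * _]cornerM mulVmx // -[corner A * _]cornerM mulmxV // corner1.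
Qed.

End Corner.

Section SimpleCarrier.
Local Open Scope group_scope.

Lemma rn_fp_simple (T : finType) (z : T) (G : bij (nat -> T) -> Prop) B nB :
    (8 <= #|T|)%N -> ~~ odd #|T| -> fpres_by G B nB ->
    (forall g i, G g -> exists j h, G h /\ forall y, fw g (scons i y) = scons j (fw h y)) ->
    (forall K : bij (nat -> T) -> Prop, K 1 ->
      (forall g h, G g -> G h -> K g -> K h -> K (g * h)) ->
      (forall g, G g -> K g -> K g^-1) ->
      (forall g h, G g -> G h -> K (g^-1 * h * g * h^-1)) ->
      (forall g (s : T -> T) (F : T -> bij (nat -> T)), G g -> (forall i, G (F i)) ->
        (forall i y, fw g (scons i y) = scons (s i) (fw (F i) y)) ->
        K (pr F (enum T)) -> K g) ->
      forall g, G g -> K g) ->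
  exists fR : fpres (rn z B), is_simple_group (sub_mul fR) (sub_inv fR) (sub_one fR).
Proof.
move=> T8 Te fG Gss perf; have [k fk] := rn_fpres z T8 fG Gss.
have fR : fpres (rn z B) by exists (base z B), k.
exists fR; split.
  have [g Rg g1] := rn_nontrivial z T8 B.
  by exists (exist _ g Rg) => /(congr1 sval).
move=> N [N1 NM NV NJ]; pose N' g := exists2 x, N x & sval x = g.
have [] := @rn_simple T z T8 Te G B nB fG Gss perf N'.
- by move=> _ [x _ <-]; apply: svalP.
- by exists (sub_one fR).
- by move=> _ _ [x Nx <-] [y Ny <-]; exists (sub_mul fR x y) => //; apply: NM.
- by move=> _ [x Nx <-]; exists (sub_inv fR x) => //; apply: NV.
- move=> g _ Rg [x Nx <-]; pose y : sub_carrier (rn z B) := exist _ g Rg.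
  by exists (sub_mul fR (sub_mul fR y x) (sub_inv fR y)) => //; apply: NJ.
- by move=> h; left=> x Nx; apply: sub_inj; apply: h; exists x.
by move=> h; right=> x; have [y Ny /sub_inj <-] := h _ (svalP x).
Qed.

End SimpleCarrier.

Section Embedding.
Import GRing.Theory.
Local Open Scope ring_scope.

(** The finitely many generators and their inverses determine [m]; products and inverses introduce
    no other denominators. *)
Lemma gen_subgroup_GLm n (S : seq 'M[rat]_n.+1) : all (fun A => A \in unitmx) S ->
  exists2 m, (0 < m)%N & forall A, gen_subgroup S A ->
    exists2 u : ugroup 'M[rat]_((n + 2).+1), GLm m u & uval u = corner A.
Proof.
move=> /allP uS; pose us := pmap (fun A => insub (corner A) : option (ugroup 'M[rat]_((n + 2).+1))) S.
have [m m0 hm] := clear_seq us; exists m => // A; elim=> {A} [|A AS|A B _ [u Gu eu] _ [v Gv ev]|A _ [u Gu eu]].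
- by exists 1%g; [have [] := affm1 (n + 2) m0|rewrite corner1].
- exists (UGroup (corner_unit (uS A AS))) => //; apply: hm.
  rewrite mem_pmap; apply/mapP; exists A => //.
  by rewrite insubT; [exact: corner_unit (uS A AS)|move=> h; congr Some; apply: val_inj].
- by exists (u * v)%g; [apply: GLm_M|rewrite cornerM -eu -ev].
(* [invmx] is an inverse only on invertible matrices; [A] is one because it has the determinant of
   its corner. *)
have uA : A \in unitmx.
  have dA : \det (corner A) = \det A.
    by apply: etrans (det_ublock A 0 1%:M) _; rewrite det1 mulr1.
  rewrite unitmxE -dA -eu -unitmxE; exact: uvalP.
exists u^-1%g; first exact: GLm_V.
apply: (mulrI (uvalP u)); rewrite /= mulrV ?uvalP // eu -[_ * _]cornerM mulmxV //.
by rewrite corner1.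
Qed.

Lemma embeds_corner n m (H : 'M[rat]_n.+1 -> Prop) : (0 < m)%N ->
    (forall A, H A -> exists2 u : ugroup 'M[rat]_((n + 2).+1), GLm m u & uval u = corner A) ->
    (forall A B, H A -> H B -> H (A *m B)) ->
  embeds_in_fp_simple H.
Proof.
move=> m0 hH HM; pose N := (n + 2)%N; have n2 : (1 < N)%N by rewrite /N addn2.
(* A prime larger than the positive number [m] does not divide it. *)
have [p pm pp] := prime_above m.
have cpm : coprime p m by rewrite prime_coprime // gtnNdvd.
pose T : finType := ('cV['I_p]_N.+1 * bool)%type.
pose z : T := (const_mx (Ordinal (prime_gt0 pp)), true).
have cT : #|T| = (p ^ N.+1 * 2)%N by rewrite card_prod card_mx card_ord card_bool muln1.
(* The size is at least 3 and [p] at least 2, so there are at least 16 letters. *)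
have T8 : (8 <= #|T|)%N.
  rewrite cT /N addn2 (@leq_trans (2 ^ 3 * 2)%N) // leq_mul2r.
  by rewrite orbC (@leq_trans (2 ^ n.+3)%N) ?leq_exp2l ?leq_exp2r ?prime_gt1.
have Te : ~~ odd #|T| by rewrite cT oddM andbF.
pose Ha := @affm N m.
have a1 : Ha 1%g := affm1 N m0.
have aM := @affmM N m m0; have aV := @affmV N m m0.
have tH := @dstH N m p m0 pp cpm.
have s1 := @dsg1 N m p m0 pp cpm.
have sM := @dsgM N m p m0 pp cpm.
have tM := @dstM N m p m0 pp cpm.
have fa := @dig_faithful N m p m0 pp cpm.
have ab K K1 KM KV KJ KS g := @K_all N m p n2 m0 pp cpm K K1 KM KV KJ KS g.
pose ph := autom a1 aV tH s1 sM tM.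
have phM g h : Ha g -> Ha h -> ph (g * h)%g = (ph g * ph h)%g.
  exact: (automM a1 aM aV tH s1 sM tM).
have phI g h : Ha g -> Ha h -> ph g = ph h -> g = h by apply: (autom_inj z aM fa).
pose G := image a1 aV tH s1 sM tM.
have [B [nB fG]] : fpres G := image_fpres z a1 aM aV tH s1 sM tM fa (affm_fpres N m0).
have Gss g i : G g -> exists j h, G h /\ forall y, fw g (scons i y) = scons j (fw h y).
  exact: image_sections.
have perf := image_perfect (H1 := a1) aM (HV := aV) (stH := tH) (sg1 := s1) (sgM := sM)
  (stM := tM) ab.
have [fR simpleR] := rn_fp_simple z T8 Te fG Gss perf.
exists (sub_carrier (rn z B)), (sub_mul fR), (sub_inv fR), (sub_one fR); split=> //.
- exact: sub_is_group.
- exact: sub_finitely_presented.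
(* The affine group is placed inside one cone, as the addresses of the generators are non-empty. *)
have gen u : GLm m u -> rn z B (lab z [:: z] (ph (lin u))).
  by move=> Gu; apply: (rn_lab z T8 fG Gss) => //; exists (lin u) => //; apply: lin_affm.
(* Outside [H], where nothing is required, the value is the neutral element. *)
have /choice [f hf] : forall A, exists x : sub_carrier (rn z B), H A ->
    exists u, [/\ GLm m u, uval u = corner A & sval x = lab z [:: z] (ph (lin u))].
  move=> A; case: (pselect (H A)) => [/hH [u Gu eu]|nA]; last by exists (sub_one fR).
  by exists (exist _ _ (gen u Gu)) => _; exists u.
exists f; split=> A B' HA HB.
  have [u [Gu eu fu]] := hf A HA; have [v [Gv ev fv]] := hf B' HB.
  have [w [Gw ew fw]] := hf _ (HM _ _ HA HB).
  apply: sub_inj; rewrite fw /= fu fv -labM -phM; try exact: lin_affm.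
  rewrite -linM; congr (lab z _ (ph (lin _))).
  by apply: val_inj; rewrite /= ew eu ev cornerM.
have [u [Gu eu fu]] := hf A HA; have [v [Gv ev fv]] := hf B' HB.
move=> /(congr1 sval); rewrite fu fv => /lab_inj /phI e.
by apply: corner_inj; rewrite -eu -ev; case: (e (lin_affm Gu) (lin_affm Gv)) => ->.
Qed.

End Embedding.

Local Open Scope ring_scope.

Theorem theorem1p2 (n : nat) (hn : (1 <= n)%N) (S : seq 'M[rat]_n)
  (hS : all (fun A => A \in unitmx) S) :
  embeds_in_fp_simple (gen_subgroup S).
Proof.
case: n hn S hS => // n _ S hS; have [m m0 hm] := gen_subgroup_GLm hS.
by apply: embeds_corner m0 hm _ => A B; apply: gs_mul.
Qed.
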